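(* Let $N$ be a squarefree positive integer with $\gcd(N,6)=1$, and let $d$ be a positive divisor of $N$. Then $$\frac{\eta^N((N/d)z)}{\eta(dz)}=\chi_{N/d}(0)+\left(\frac{N/d}{d}\right)C(d,N)\cdot\frac dN\cdot\frac{1-N}{B_{(N-1)/2,\chi_N}}\sum_{n\ge1}\sigma_{(N-3)/2}(\chi_{N/d},\chi_d;n)q^n+C_1(z)$$ for some $C_1(z)\in S_{(N-1)/2}(\Gamma_0(N),\chi_N)$, where $C(d,N):=\frac{i^{(1-Nd)/2}}{A(d,N)}$, and moreover $C(d,N)=\left(\frac{-8}{N}\right)\left(\frac8d\right)\left(\frac{-4}{d}\right)^{(N-1)/2}$.
   Context: $q=e^{2\pi iz}$, $\eta(z)=q^{1/24}\prod_{n\ge1}(1-q^n)$. For an odd squarefree positive integer $a$ and $b\in\mathbb{Z}$, $\chi_a(b)$ is the Kronecker symbol $\left(\frac{(-1)^{(a-1)/2}a}{b}\right)$ (so $\chi_1(0)=1$ and $\chi_a(0)=0$ for $a>1$). $\left(\frac{N/d}{d}\right)$, $\left(\frac{-8}{N}\right)$, $\left(\frac8d\right)$, $\left(\frac{-4}{d}\right)$ are Kronecker symbols. $S_k(\Gamma_0(N),\chi_N)$ is the space of cusp forms of weight $k$ on $\Gamma_0(N)$ with character $\chi_N$. $\sigma_{k-1}(\chi_{N/d},\chi_d;n)=\sum_{1\le t\mid n}\chi_{N/d}(n/t)\chi_d(t)t^{k-1}$. $B_{k,\chi_N}$ is defined by $\sum_{k\ge0}B_{k,\chi_N}t^k/k!=\sum_{a=1}^N\chi_N(a)te^{at}/(e^{Nt}-1)$.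 $\epsilon_c=1$ if $c\equiv1\pmod4$, $\epsilon_c=i$ if $c\equiv3\pmod4$, and $A(d,N)=(-1)^{(d+1)(N/d-1)/4}\epsilon_{N/d}$. *)

(* Defs.v *)
From HB Require Import structures.
From mathcomp Require Import all_boot all_order all_algebra.
From mathcomp Require Import all_classical all_reals all_analysis.
From mathcomp Require Import complex.

Set Implicit Arguments.
Unset Strict Implicit.
Unset Printing Implicit Defensive.

Import Order.TTheory GRing.Theory Num.Theory.
Import numFieldNormedType.Exports.

Local Open Scope classical_set_scope.
Local Open Scope ring_scope.

Definition squarefree (n : nat) : Prop :=
  forall m : nat, (m ^ 2 %| n)%N -> m = 1%N.

Definition legendre (a : int) (p : nat) : int :=
  if (p%:Z %| a)%Z then 0
  else if [exists x : 'I_p, (x%:Z ^+ 2 == a %[mod p%:Z])%Z] then 1 else -1.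

Definition kronecker_prime (a : int) (p : nat) : int :=
  if p == 2%N then
    if (2 %| a)%Z then 0
    else if ((a %% 8)%Z == 1) || ((a %% 8)%Z == 7) then 1 else -1
  else legendre a p.

(* The factor for n < 0 is the symbol at the unit: (a / -1) = -1 iff a < 0. *)
Definition kronecker (a n : int) : int :=
  if n == 0 then (`|a|%N == 1%N)%:Z
  else (if (n < 0) && (a < 0) then -1 else 1) *
       \prod_(p <- primes `|n|%N) kronecker_prime a p ^+ logn p `|n|%N.

Definition chi (a : nat) (b : int) : int :=
  kronecker ((-1) ^+ (a.-1)./2 * a%:Z) b.

Section FormalPowerSeries.
Variable F : fieldType.
Implicit Types f g : nat -> F.

Definition fps_mul f g : nat -> F :=
  fun n => \sum_(i < n.+1) f i * g (n - i)%N.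

Fixpoint fps_div_seq f g (n : nat) : seq F :=
  if n is m.+1 then
    let s := fps_div_seq f g m in
    rcons s ((f m - \sum_(i < m) s`_i * g (m - i)%N) / g 0%N)
  else [::].

Definition fps_div f g : nat -> F := fun n => (fps_div_seq f g n.+1)`_n.

Lemma size_fps_div_seq f g n : size (fps_div_seq f g n) = n.
Proof. by elim: n => //= n IHn; rewrite size_rcons IHn. Qed.

Lemma nth_fps_div_seq f g n i :
  (i < n)%N -> (fps_div_seq f g n)`_i = fps_div f g i.
Proof.
elim: n => // n IHn; rewrite ltnS leq_eqVlt => /predU1P[->//|lt_in].
by rewrite /= nth_rcons size_fps_div_seq lt_in IHn.
Qed.

Lemma fps_divK f g : g 0%N != 0 -> fps_mul (fps_div f g) g =1 f.
Proof.
move=> g0 n; rewrite /fps_mul big_ord_recr /= subnn.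
rewrite {2}/fps_div /= nth_rcons size_fps_div_seq ltnn eqxx divfK //.
rewrite (eq_bigr (fun i : 'I_n => (fps_div_seq f g n)`_i * g (n - i)%N)).
  by rewrite addrC subrK.
by move=> i _; rewrite nth_fps_div_seq.
Qed.

End FormalPowerSeries.

(* The n-th generalized Bernoulli number: n! times the coefficient of t^n in
   (sum_(a = 1..N) psi a * e^(at)) / ((e^(Nt) - 1) / t). *)
Definition gen_bernoulli (F : numFieldType) (N : nat) (psi : int -> int)
    (n : nat) : F :=
  n`!%:R * fps_div (fun m => \sum_(1 <= a < N.+1)
                       (psi a%:Z)%:~R * a%:R ^+ m / m`!%:R)
                   (fun m => N%:R ^+ m.+1 / (m.+1)`!%:R) n.

(* The generating-function identity
   (sum_n B_n t^n / n!) * (e^(Nt) - 1) = sum_(a = 1..N) psi a * t * e^(at). *)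
Lemma gen_bernoulliE (F : numFieldType) (N : nat) (psi : int -> int) :
  (0 < N)%N ->
  fps_mul (fun n => gen_bernoulli F N psi n / n`!%:R)
          (fun n => N%:R ^+ n / n`!%:R - (n == 0%N)%:R)
  =1 (fun n => \sum_(1 <= a < N.+1)
        (psi a%:Z)%:~R * (if n is m.+1 then a%:R ^+ m / m`!%:R else 0)).
Proof.
move=> N0 [|n]; rewrite /fps_mul.
  rewrite big_ord1 /= subnn expr0 fact0 !divr1 subrr mulr0.
  by rewrite big1 // => a _; rewrite mulr0.
have fn0 m : m`!%:R != 0 :> F by rewrite pnatr_eq0 -lt0n fact_gt0.
rewrite big_ord_recr /= subnn expr0 fact0 !divr1 subrr mulr0 addr0.
transitivity (fps_mul (fps_div (fun m => \sum_(1 <= a < N.+1)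
      (psi a%:Z)%:~R * a%:R ^+ m / m`!%:R)
    (fun m => N%:R ^+ m.+1 / (m.+1)`!%:R)) (fun m => N%:R ^+ m.+1 / (m.+1)`!%:R) n : F).
  apply: eq_bigr => i _; congr (_ * _).
    by rewrite /gen_bernoulli mulrC mulKf.
  by rewrite subSn ?subr0 // -ltnS.
rewrite fps_divK; first by apply: eq_bigr => a _; rewrite mulrA.
by rewrite expr1 divr1 pnatr_eq0 -lt0n.
Qed.

Section ComplexAnalysis.
Variable R : realType.
Local Notation C := R[i].

Definition expC (z : C) : C :=
  (expR (complex.Re z))%:C%C *
  (cos (complex.Im z) +i* sin (complex.Im z))%C.

Definition two_pi_i : C := 2 * pi%:C%C * 'i%C.

Definition qexp (z : C) : C := expC (two_pi_i * z).

(* C carries its topology, as a normed module over itself, under the name C^o. *)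
Definition dedekind_eta (z : C) : C :=
  expC (two_pi_i * z / 24) *
  limn (fun m => \prod_(1 <= n < m.+1) (1 - qexp z ^+ n) : C^o).

Definition sigma (s : int) (phi psi : int -> int) (n : nat) : C :=
  \sum_(t <- divisors n)
    (phi (n %/ t)%N%:Z * psi t%:Z)%:~R * t%:R ^ s.

Definition eisenstein_sum (s : int) (phi psi : int -> int) (z : C) : C :=
  limn (fun m => \sum_(1 <= n < m.+1) sigma s phi psi n * qexp z ^+ n : C^o).

Definition SL2Z : set 'M[int]_2 := [set g | \det g = 1].

Definition Gamma0 (N : nat) : set 'M[int]_2 :=
  [set g | SL2Z g /\ (N%:Z %| (g 1 0)%R)%Z].

Definition autom_factor (g : 'M[int]_2) (z : C) : C :=
  (g 1 0)%:~R * z + (g 1 1)%:~R.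

Definition moebius (g : 'M[int]_2) (z : C) : C :=
  ((g 0 0)%:~R * z + (g 0 1)%:~R) / autom_factor g z.

Definition slash (k : nat) (f : C -> C) (g : 'M[int]_2) (z : C) : C :=
  autom_factor g z ^- k * f (moebius g z).

(* S_k(Gamma0(N), psi). Only the values of f on the upper half-plane matter;
   vanishing at the cusps says that every f|_k g with g in SL_2(Z) tends to 0
   as Im z tends to infinity, uniformly in Re z. *)
Definition cusp_form (k N : nat) (psi : int -> int) (f : C -> C) : Prop :=
  [/\ forall z : C, 0 < complex.Im z -> derivable (f : C^o -> C^o) z 1,
      forall g, Gamma0 N g -> forall z : C, 0 < complex.Im z ->
        f (moebius g z) = (psi (g 1 1))%:~R * autom_factor g z ^+ k * f z
    & forall g, SL2Z g -> forall e : R, 0 < e ->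
        exists A : R, forall z : C, 0 < complex.Im z -> A <= complex.Im z ->
          `|slash k f g z| <= e%:C%C].

Definition epsilon (c : nat) : C :=
  if (c %% 4 == 1)%N then 1 else if (c %% 4 == 3)%N then 'i%C else 0.

Definition A_coef (d N : nat) : C :=
  (-1) ^+ ((d + 1) * (N %/ d - 1) %/ 4)%N * epsilon (N %/ d)%N.

Definition C_coef (d N : nat) : C :=
  'i%C ^ ((1 - (N * d)%N%:Z) %/ 2)%Z / A_coef d N.

End ComplexAnalysis.

(* Main.v *)
(** Up to a constant, eta(Dz)^N / eta(dz) with N = dD is the inverse of a
    product of Klein forms.  Their behaviour under SL2(Z) gives the
    transformation of the quotient under Gamma0(N) and its limit at every cusp,
    both in terms of the symbol [jac a n], a product of signs of residues as in
    Gauss' lemma; the limit is nonzero only at the cusps a/c with d | c.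

    The Eisenstein series of weight k = (N-1)/2 attached to the function
    w(m, n) = [d | m] (dm / D)(n / d) on (Z/N)^2 has the same automorphy, and
    its limit at a/c is the limit of the quotient times a constant independent
    of the cusp, because the character sums reduce to the single L-value
    L(k, chi_N).  A multiple of it therefore cancels the quotient at all cusps.
    Lipschitz' formula turns the series into its q-expansion, the same formula
    summed over residues expresses L(k, chi_N) through B_{k, chi_N}, and the
    signs of the quadratic Gauss sums produce C(d, N). *)

Require Import Defs.
From HB Require Import structures.
From mathcomp Require Import all_boot all_order all_algebra.
From mathcomp Require Import all_classical all_reals all_analysis.
From mathcomp Require Import complex.
From mathcomp Require Import ring lra zify.

Set Implicit Arguments.
Unset Strict Implicit.
Unset Printing Implicit Defensive.

Import Order.TTheory GRing.Theory Num.Theory.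
Import numFieldNormedType.Exports.
Local Open Scope ring_scope.

(** * Symmetric residues and the Gauss-lemma symbol *)

(** Nothing is taken from a general theory of modular forms: the cusp conditions are checked on the
    difference itself, at every matrix of SL2(Z), for explicit series and products. What shapes this
    is the smallest level N = 5, of weight k = 2, where the Eisenstein series does not converge
    absolutely. The sum of w over (Z/N)^2 is 0, so the terms of an N by N block cancel to first
    order and the sum over blocks is absolutely convergent; the inversion z -> -1/z then costs one
    exchange of limits and leaves no correction term. The Klein forms meet the same difficulty in a
    product over a lattice; there exponential convergence factors are inserted, and the Gaussian
    they leave is determined by quasi-periodicity. The symbol of Gauss' lemma is primitive here
    because half systems of residues are what both the Klein products and the sine products for
    Gauss sums run over; reciprocity only serves to compare it with the Kronecker symbol.
    Divisibility of 1^2 + ... + ((n-1)/2)^2 by n, for n prime to 6, makes all quadratic phases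
    cancel. *)

Definition sres (n : nat) (t : int) : int :=
  if ((t %% n)%Z <= (n./2)%:Z) then (t %% n)%Z else (t %% n)%Z - n%:Z.

(** Gauss' lemma taken as a definition: this is the form in which the Jacobi symbol comes out of any
    product of an odd n-periodic function over a half system ([prod_half_odd]). For odd n it
    vanishes when a and n share a factor, since then some residue is 0. *)
Definition jac (a : int) (n : nat) : int :=
  \prod_(r < n./2) sgz (sres n (a * r.+1%:Z)).

Lemma dvdz_sres n t : (n%:Z %| t - sres n t)%Z.
Proof.
have := divz_eq t n%:Z; rewrite /sres => e.
by case: ifP => _; apply/dvdzP; [exists (t %/ n)%Z | exists ((t %/ n)%Z + 1)]; lia.
Qed.

Lemma sres_bound n t : odd n -> (`|sres n t|%N <= n./2)%N.
Proof.
move=> on; rewrite /sres.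
have h1 := @modz_ge0 t n%:Z; have h2 := @ltz_pmod t n%:Z.
by case: ifP => h3; lia.
Qed.

Lemma sres_uniq n t x : odd n -> (`|x|%N <= n./2)%N -> (n%:Z %| t - x)%Z -> sres n t = x.
Proof.
move=> on hx hd; have hs := sres_bound t on.
have : (n%:Z %| sres n t - x)%Z.
  have -> : sres n t - x = (t - x) - (t - sres n t) by ring.
  by apply: rpredB => //; apply: dvdz_sres.
case/dvdzP => q e.
have : q = 0.
  have : (`|(q * n%:Z)%R|%N < n)%N by rewrite -e; lia.
  rewrite abszM /= => h; case: q e h => [[|q]|q] //= _ h.
    by nia.
  by nia.
by move=> q0; move: e; rewrite q0 mul0r; lia.
Qed.

Lemma eq_sres n t u : odd n -> (n%:Z %| t - u)%Z -> sres n t = sres n u.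
Proof.
move=> on h; apply: sres_uniq => //; first exact: sres_bound.
have -> : t - sres n u = (t - u) + (u - sres n u) by ring.
by apply: rpredD => //; apply: dvdz_sres.
Qed.

Lemma sresN n t : odd n -> sres n (- t) = - sres n t.
Proof.
move=> on; apply: sres_uniq => //; first by rewrite abszN; apply: sres_bound.
by rewrite -opprD rpredN; apply: dvdz_sres.
Qed.

Lemma sres_small n (x : int) : odd n -> (`|x|%N <= n./2)%N -> sres n x = x.
Proof. by move=> on h; apply: sres_uniq => //; rewrite subrr dvdz0. Qed.

Lemma sres_eq0 n t : odd n -> (sres n t == 0) = (n%:Z %| t)%Z.
Proof.
move=> on; apply/eqP/idP => [h|h].
  by have := dvdz_sres n t; rewrite h subr0.
by apply: sres_uniq => //; rewrite subr0.
Qed.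

Lemma coprime_sres_neq0 n (a : int) (r : nat) : odd n -> coprimez a n%:Z ->
  (r < n./2)%N -> sres n (a * r.+1%:Z) != 0.
Proof.
move=> on ca hr; rewrite sres_eq0 // Gauss_dvdzr; last by rewrite coprimez_sym.
by rewrite dvdzE /= gtnNdvd //; lia.
Qed.

Section HalfSystem.
Variables (n : nat) (on : odd n) (a : int) (ca : coprimez a n%:Z).

Lemma sres_abs_inj (r s : 'I_(n./2)) :
  `|sres n (a * r.+1%:Z)|%N = `|sres n (a * s.+1%:Z)|%N -> r = s.
Proof.
move=> h.
have [e|e] : sres n (a * r.+1%:Z) = sres n (a * s.+1%:Z) \/
         sres n (a * r.+1%:Z) = - sres n (a * s.+1%:Z) by lia.
  have : (n%:Z %| a * (r.+1%:Z - s.+1%:Z))%Z.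
    have -> : a * (r.+1%:Z - s.+1%:Z) =
      (a * r.+1%:Z - sres n (a * r.+1%:Z)) - (a * s.+1%:Z - sres n (a * s.+1%:Z)).
      by rewrite e; ring.
    by apply: rpredB; apply: dvdz_sres.
  rewrite Gauss_dvdzr; last by rewrite coprimez_sym.
  move=> hd; apply/val_inj => /=; have := ltn_ord r; have := ltn_ord s.
  have /eqP : sres n (r.+1%:Z - s.+1%:Z) == 0 by rewrite sres_eq0.
  by move=> + hs hr; rewrite sres_small //; lia.
have : (n%:Z %| a * (r.+1%:Z + s.+1%:Z))%Z.
  have -> : a * (r.+1%:Z + s.+1%:Z) =
    (a * r.+1%:Z - sres n (a * r.+1%:Z)) + (a * s.+1%:Z - sres n (a * s.+1%:Z)).
    by rewrite e; ring.
  by apply: rpredD; apply: dvdz_sres.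
rewrite Gauss_dvdzr; last by rewrite coprimez_sym.
rewrite dvdzE /= => /dvdn_leq; have := ltn_ord r; have := ltn_ord s; lia.
Qed.

Lemma sres_perm_subproof (r : 'I_(n./2)) : (`|sres n (a * r.+1%:Z)|%N.-1 < n./2)%N.
Proof.
have := sres_bound (a * r.+1%:Z) on; have := coprime_sres_neq0 on ca (ltn_ord r); lia.
Qed.

(** Two absolute residues agree only if n divides a(r - s) or a(r + s); as [a] is a unit, they
    permute 1, ..., n/2. *)
Lemma big_half_perm (T : Type) (idx : T) (op : Monoid.com_law idx) (F : nat -> T) :
  \big[op/idx]_(r < n./2) F `|sres n (a * r.+1%:Z)|%N = \big[op/idx]_(r < n./2) F r.+1.
Proof.
pose h r := Ordinal (sres_perm_subproof r).
have hi : injective h.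
  move=> r s /(congr1 val) /= e; apply: sres_abs_inj.
  by have := coprime_sres_neq0 on ca (ltn_ord r); have := coprime_sres_neq0 on ca (ltn_ord s); lia.
rewrite [RHS](reindex_inj hi) /=; apply: eq_bigr => r _; congr F.
by have := coprime_sres_neq0 on ca (ltn_ord r); lia.
Qed.

(** Each factor is the sign of the residue times F at its absolute value: the signs collect into the
    symbol and the absolute values permute the half system. It is applied to sines, to powers of a
    root of unity, to elements of a prime field and to Klein forms. *)
Lemma prod_half_odd (A : comPzRingType) (F : int -> A) :
  (forall t, F (- t) = - F t) -> (forall t u, (n%:Z %| t - u)%Z -> F t = F u) ->
  \prod_(r < n./2) F (a * r.+1%:Z) = (jac a n)%:~R * \prod_(r < n./2) F r.+1%:Z.
Proof.
move=> FN Fp; rewrite -(big_half_perm _ (fun r => F r%:Z)) /jac rmorph_prod -big_split /=.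
apply: eq_bigr => r _; rewrite (Fp _ _ (dvdz_sres n (a * r.+1%:Z))).
have := coprime_sres_neq0 on ca (ltn_ord r).
case: (sres n _) => [[|m]|m] //= _; first by rewrite gtr0_sgz // mul1r.
by rewrite NegzE FN sgzN gtr0_sgz // mulN1r.
Qed.

End HalfSystem.

(** With g = gcd(a, n) > 1, hence g > 2, the number n/g lies in the half system and its multiple by
    [a] has residue 0. *)
Lemma jac_eq0 a n : odd n -> ~~ coprimez a n%:Z -> jac a n = 0.
Proof.
move=> on; rewrite coprimezE /coprime => nc.
set g := gcdn `|a| `|n%:Z| in nc *.
have g0 : (0 < g)%N by rewrite gcdn_gt0 orbC; lia.
have gn : (g %| n)%N by rewrite /g dvdn_gcdr.
have ga : (g %| `|a|)%N by rewrite /g dvdn_gcdl.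
case/dvdnP: gn => q nE; case/dvdnP: ga => b aE.
have g2 : (2 < g)%N by move: on; rewrite nE oddM; case: g g0 nc {nE aE} => [|[|[|]]] // _ _; rewrite andbF.
have q0 : (0 < q)%N by move: on; rewrite nE oddM; case: q {nE}.
have hq : (q.-1 < n./2)%N by rewrite nE; nia.
rewrite /jac (bigD1 (Ordinal hq)) //=; apply/eqP; rewrite mulf_eq0; apply/orP; left.
rewrite sgz_eq0 sres_eq0 // prednK // dvdzE abszM aE /= nE -mulnA [(g * q)%N]mulnC.
exact: dvdn_mull.
Qed.

Lemma eq_jac a b n : odd n -> (n%:Z %| a - b)%Z -> jac a n = jac b n.
Proof.
move=> on h; apply: eq_bigr => r _; congr sgz; apply: eq_sres => //.
by rewrite -mulrBl dvdz_mulr.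
Qed.

Lemma jac1n n : odd n -> jac 1 n = 1.
Proof.
move=> on; apply: big1 => r _; rewrite mul1r sres_small //.
by have := ltn_ord r; rewrite /=; lia.
Qed.

Lemma jaca1 a : jac a 1 = 1.
Proof. by rewrite /jac big_ord0. Qed.

(** For b a unit, the half system is replaced by the absolute residues of the multiples of b; the
    signs lost on the way make up [jac b n]. *)
Lemma jacM a b n : odd n -> jac (a * b) n = jac a n * jac b n.
Proof.
move=> on; have [cb|ncb] := boolP (coprimez b n%:Z); last first.
  by rewrite [jac b n]jac_eq0 // mulr0 jac_eq0 // coprimezMl negb_and ncb orbT.
rewrite {1 2}/jac -(big_half_perm on cb _ (fun r => sgz (sres n (a * r%:Z)))) /jac -big_split /=.
apply: eq_bigr => r _; have nz := coprime_sres_neq0 on cb (ltn_ord r).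
rewrite -mulrA; set y := b * _ in nz *.
have -> : sres n (a * y) = sres n (a * sres n y).
  by apply: eq_sres => //; rewrite -mulrBr dvdz_mull // dvdz_sres.
case: (sres n y) nz => [[|m]|m] // _; rewrite ?mulr1 //=.
by rewrite NegzE mulrN sresN // sgzN mulrN1.
Qed.

Lemma jacN1 n : odd n -> jac (-1) n = (-1) ^+ n./2.
Proof.
move=> on; rewrite /jac (eq_bigr (fun=> -1)) ?prodr_const ?card_ord // => r _.
by rewrite mulN1r sres_small // abszN /=; have := ltn_ord r; lia.
Qed.

Lemma jac_sqr a n : odd n -> coprimez a n%:Z -> jac a n ^+ 2 = 1.
Proof.
move=> on ca; rewrite /jac -prodrXl big1 // => r _.
have := coprime_sres_neq0 on ca (ltn_ord r).
by case: (sres n _) => [[|m]|m].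
Qed.

Lemma jac_cases a n : odd n -> coprimez a n%:Z -> jac a n = 1 \/ jac a n = -1.
Proof.
by move=> on ca; have /eqP := jac_sqr on ca; rewrite sqrf_eq1 => /orP[] /eqP; [left|right].
Qed.

(** The residue of 2r is negative exactly for r > n/4, which happens [uphalf n./2] times. *)
Lemma jac2 n : odd n -> jac 2 n = (-1) ^+ uphalf n./2.
Proof.
move=> on; set m := n./2.
have -> : jac 2 n = \prod_(r < m) (if (r < m./2)%N then 1 else -1).
  apply: eq_bigr => r _; case: ifP => h.
    by rewrite sres_small //=; move: h; rewrite -/m; lia.
  rewrite (@sres_uniq _ _ (2 * r.+1%:Z - n%:Z)) //.
  - by have := ltn_ord r; rewrite -/m => hr; rewrite ltr0_sgz //; lia.
  - by have := ltn_ord r; rewrite -/m => hr; lia.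
  - by apply/dvdzP; exists 1; ring.
have hm : m = (m./2 + uphalf m)%N by lia.
rewrite -(big_mkord xpredT (fun r : nat => if (r < m./2)%N then 1 else -1)).
rewrite (@big_cat_nat _ _ _ m./2) //=; last by lia.
rewrite big_nat big1 ?mul1r; last by move=> i /andP[_ ->].
rewrite big_nat (eq_bigr (fun=> -1)); last by move=> i /andP[+ _]; rewrite leqNgt => /negbTE->.
by rewrite -big_nat big_const_nat iter_mulr_1; congr (_ ^+ _); lia.
Qed.

(** * Sums of periodic functions *)

(** A map from n points that is injective modulo n meets every residue class exactly once. *)
Lemma periodic_big_reindex (V : Type) (idx : V) (op : Monoid.com_law idx) (n : nat)
    (T : finType) (h : T -> int) (f : int -> V) :
  (0 < n)%N -> #|T| = n -> (forall t u, (n%:Z %| h t - h u)%Z -> t = u) ->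
  (forall t u, (n%:Z %| t - u)%Z -> f t = f u) ->
  \big[op/idx]_t f (h t) = \big[op/idx]_(x < n) f x%:Z.
Proof.
move=> n0 cT hi fp.
have lt t : (`|(h t %% n)%Z| < n)%N.
  by have := @modz_ge0 (h t) n%:Z; have := @ltz_pmod (h t) n%:Z; lia.
have abs_mod t : (`|(h t %% n)%Z|%N)%:Z = (h t %% n)%Z.
  by have := @modz_ge0 (h t) n%:Z; lia.
pose g t := Ordinal (lt t).
have gi : injective g.
  move=> t u /(congr1 val) /= e; apply: hi.
  by rewrite -eqz_mod_dvd -(abs_mod t) -(abs_mod u) e.
have gb : bijective g by apply: inj_card_bij => //; rewrite cT card_ord.
rewrite [RHS](reindex g) /=; last by apply: onW_bij.
apply: eq_bigr => t _; apply: fp; rewrite abs_mod -eqz_mod_dvd modz_mod //.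
Qed.

Lemma periodic_sum_reindex (V : nmodType) (n : nat) (T : finType) (h : T -> int) (f : int -> V) :
  (0 < n)%N -> #|T| = n -> (forall t u, (n%:Z %| h t - h u)%Z -> t = u) ->
  (forall t u, (n%:Z %| t - u)%Z -> f t = f u) ->
  \sum_t f (h t) = \sum_(x < n) f x%:Z.
Proof. exact: periodic_big_reindex. Qed.

Lemma periodic_sum_unit (V : nmodType) (n : nat) (a c : int) (f : int -> V) :
  (0 < n)%N -> coprimez a n%:Z -> (forall t u, (n%:Z %| t - u)%Z -> f t = f u) ->
  \sum_(x < n) f (a * x%:Z + c) = \sum_(x < n) f x%:Z.
Proof.
move=> n0 ca fp; apply: (periodic_sum_reindex (h := fun x : 'I_n => a * x%:Z + c)) => //.
  by rewrite card_ord.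
move=> t u; have -> : a * t%:Z + c - (a * u%:Z + c) = a * (t%:Z - u%:Z) by ring.
rewrite Gauss_dvdzr; last by rewrite coprimez_sym.
rewrite -eqz_mod_dvd !modz_nat => /eqP [].
by rewrite !modn_small // => e; apply: val_inj.
Qed.

Lemma periodic_sum_crt (V : nmodType) (n1 n2 : nat) (f : int -> V) :
  (0 < n1)%N -> (0 < n2)%N -> coprime n1 n2 ->
  (forall t u, ((n1 * n2)%N%:Z %| t - u)%Z -> f t = f u) ->
  \sum_(x < n1 * n2) f x%:Z =
  \sum_(x < n1) \sum_(y < n2) f (n2%:Z * x%:Z + n1%:Z * y%:Z).
Proof.
move=> n10 n20 cn fp; rewrite pair_bigA /=; symmetry.
apply: (periodic_sum_reindex (h := fun p : 'I_n1 * 'I_n2 => n2%:Z * p.1%:Z + n1%:Z * p.2%:Z)) => //.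
- by rewrite muln_gt0 n10.
- by rewrite card_prod !card_ord.
move=> [x y] [x' y'] /= h.
have e1 : (n1%:Z %| n2%:Z * (x%:Z - x'%:Z))%Z.
  have -> : n2%:Z * (x%:Z - x'%:Z) = (n2%:Z * x%:Z + n1%:Z * y%:Z - (n2%:Z * x'%:Z + n1%:Z * y'%:Z))
     + n1%:Z * (y'%:Z - y%:Z) by ring.
  by apply: rpredD; [apply: dvdz_trans h; rewrite PoszM dvdz_mulr | rewrite dvdz_mulr].
have e2 : (n2%:Z %| n1%:Z * (y%:Z - y'%:Z))%Z.
  have -> : n1%:Z * (y%:Z - y'%:Z) = (n2%:Z * x%:Z + n1%:Z * y%:Z - (n2%:Z * x'%:Z + n1%:Z * y'%:Z))
     + n2%:Z * (x'%:Z - x%:Z) by ring.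
  by apply: rpredD; [apply: dvdz_trans h; rewrite PoszM dvdz_mull | rewrite dvdz_mulr].
rewrite Gauss_dvdzr in e1; last by rewrite coprimezE.
rewrite Gauss_dvdzr in e2; last by rewrite coprimezE coprime_sym.
move: e1 e2; rewrite -!eqz_mod_dvd !modz_nat => /eqP[] ; rewrite !modn_small // => e1 /eqP[].
by rewrite ?modn_small // => e2; congr pair; apply: val_inj.
Qed.

(** * Symmetric ranges *)

(** Pairing r with -r makes the limit over m the symmetric summation over Z, and, for f of odd
    period 2m + 1, turns the range into a complete residue system. *)
Definition ssum (V : nmodType) (m : nat) (f : int -> V) : V :=
  f 0 + \sum_(r < m) (f r.+1%:Z + f (- r.+1%:Z)).

Definition sprod (A : comPzRingType) (m : nat) (f : int -> A) : A :=
  f 0 * \prod_(r < m) (f r.+1%:Z * f (- r.+1%:Z)).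

Lemma big_sym_periodic (V : Type) (idx : V) (op : Monoid.com_law idx) (m : nat) (f : int -> V) :
  (forall t u, (m.*2.+1%:Z %| t - u)%Z -> f t = f u) ->
  op (f 0) (\big[op/idx]_(r < m) op (f r.+1%:Z) (f (- r.+1%:Z))) =
  \big[op/idx]_(x < m.*2.+1) f x%:Z.
Proof.
move=> fp; rewrite big_ord_recl; congr (op _ _).
have -> : \big[op/idx]_(i < m.*2) f (lift ord0 i)%:Z = \big[op/idx]_(0 <= i < m.*2) f i.+1%:Z.
  by rewrite big_mkord.
rewrite (@big_cat_nat _ _ _ m) //=; last by lia.
rewrite big_split /= big_mkord; congr (op _ _).
rewrite [RHS](_ : _ = \big[op/idx]_(i < m) f (i + m).+1%:Z); last first.
  by rewrite -{1}[m]add0n big_addn -addnn addnK big_mkord.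
rewrite [RHS](reindex_inj rev_ord_inj) /=.
apply: eq_bigr => r _; apply: fp; apply/dvdzP; exists (-1); have := ltn_ord r; lia.
Qed.

Lemma ssum_periodic (V : nmodType) (m : nat) (f : int -> V) :
  (forall t u, (m.*2.+1%:Z %| t - u)%Z -> f t = f u) -> ssum m f = \sum_(x < m.*2.+1) f x%:Z.
Proof. exact: big_sym_periodic. Qed.

Lemma sprod_periodic (A : comPzRingType) (m : nat) (f : int -> A) :
  (forall t u, (m.*2.+1%:Z %| t - u)%Z -> f t = f u) -> sprod m f = \prod_(x < m.*2.+1) f x%:Z.
Proof. exact: big_sym_periodic. Qed.

(** * Quadratic Gauss sums *)

Section GaussSum.
Variable F : fieldType.
Implicit Types (z q : F).

(** Gaussian binomial coefficients through Pascal's rule, so that they make sense at a root of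
    unity, where the quotient of q-factorials does not. *)
Fixpoint qbin (q : F) (m j : nat) {struct m} : F :=
  if j is j'.+1 then
    (if m is m'.+1 then qbin q m' j' + q ^+ j * qbin q m' j else 0)
  else 1.

Lemma qbin0 q m : qbin q m 0 = 1. Proof. by case: m. Qed.

Lemma qbinS q m j : qbin q m.+1 j.+1 = qbin q m j + q ^+ j.+1 * qbin q m j.+1.
Proof. by []. Qed.

Lemma qbin_gt q m j : (m < j)%N -> qbin q m j = 0.
Proof.
elim: m j => [|m IH] [|j] // h; rewrite qbinS !IH ?mulr0 ?addr0 //; lia.
Qed.

Arguments qbin : simpl never.

Lemma qbin_absorb q m j : (1 - q ^+ j.+1) * qbin q m.+1 j.+1 = (1 - q ^+ m.+1) * qbin q m j.
Proof.
elim: m j => [|m IH] j.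
  rewrite qbinS; case: j => [|j]; last by rewrite !qbin_gt ?mulr0 ?addr0 ?mulr0.
  by rewrite !qbin0 qbin_gt // mulr0 addr0.
rewrite qbinS mulrDr mulrCA IH; case: j => [|j].
  by rewrite !qbin0 !mulr1 [q ^+ m.+2]exprS expr1; ring.
have hI := IH j; have hX := qbinS q m j.
rewrite [q ^+ j.+2]exprS [q ^+ m.+2]exprS.
move: hI hX; set X := qbin q m.+1 j.+1; set A := qbin q m j; set Y := qbin q m j.+1.
set Q := q ^+ j.+1; set M := q ^+ m.+1 => hI hX.
apply/eqP; rewrite -subr_eq0; apply/eqP.
transitivity (- q * (1 - M) * (X - (A + Q * Y)) + q * ((1 - Q) * X - (1 - M) * A)); first by ring.
by rewrite hI -hX !subrr !mulr0 addr0.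
Qed.

(** Gauss' alternating sum: its product form ([qalt_even]) is what determines the quadratic Gauss
    sum together with its sign. *)
Definition qalt q m : F := \sum_(j < m.+1) (-1) ^+ j * qbin q m j.

Lemma qaltSS q m : qalt q m.+2 = (1 - q ^+ m.+1) * qalt q m.
Proof.
rewrite /qalt big_ord_recl qbin0 expr0 mulr1.
under eq_bigr => i _ do rewrite lift0 qbinS mulrDr.
rewrite big_split /= [X in _ + (X + _)]big_ord_recl qbin0 expr1 mulr1 !addrA subrr add0r.
rewrite [X in _ + X]big_ord_recr /= [qbin q m.+1 m.+2]qbin_gt // !mulr0 addr0.
rewrite -big_split /= mulr_sumr; apply: eq_bigr => i _; rewrite /bump /= !add1n.
have e := qbin_absorb q m i; set X := qbin q m.+1 i.+1 in e *.
by rewrite exprS [(-1) ^+ i.+1]exprS [RHS]mulrCA -e; ring.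
Qed.

Lemma qalt_even q m : qalt q m.*2 = \prod_(i < m) (1 - q ^+ i.*2.+1).
Proof.
elim: m => [|m IH]; first by rewrite /qalt big_ord_recl !big_ord0 /= mulr1 addr0.
by rewrite doubleS qaltSS IH big_ord_recr mulrC.
Qed.

(** The coefficient [n, j+1] vanishes at a primitive n-th root of unity, so Pascal's rule gives
    [n-1, j+1] from [n-1, j]. *)
Lemma qbin_prim q n j : n.-primitive_root q -> (j < n)%N ->
  (-1) ^+ j * qbin q n.-1 j = q ^- 'C(j.+1, 2).
Proof.
move=> pq; have n0 := prim_order_gt0 pq; case: n n0 pq => // n _ pq /=.
have q0 : q != 0.
  apply/eqP => q0; have /eqP := prim_expr_order pq.
  by rewrite q0 expr0n /= eq_sym oner_eq0.
elim: j => [|j IH] hj; first by rewrite qbin0 mulr1 expr0 invr1.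
have e : qbin q n.+1 j.+1 = 0.
  have := qbin_absorb q n j; rewrite (prim_expr_order pq) subrr mul0r => /eqP.
  rewrite mulf_eq0 subr_eq0 eq_sym -(prim_order_dvd pq) gtnNdvd //= => /eqP //.
move: e; rewrite qbinS => /eqP; rewrite addr_eq0 => /eqP e.
have {}IH := IH (ltnW hj).
have -> : 'C(j.+2, 2) = ('C(j.+1, 2) + j.+1)%N by rewrite binS bin1 addnC.
rewrite exprD invfM -IH e exprS !mulrN mulrA; field.
by rewrite expf_neq0.
Qed.

Lemma prim_root_neq0 n z : n.-primitive_root z -> z != 0.
Proof.
move=> pz; apply/eqP => z0; have /eqP := prim_expr_order pz.
by rewrite z0 expr0n gtn_eqF ?(prim_order_gt0 pz) // eq_sym oner_eq0.
Qed.

Lemma prim_exprz_eq n z (t u : int) : n.-primitive_root z -> (n%:Z %| t - u)%Z -> z ^ t = z ^ u.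
Proof.
move=> pz /dvdzP[q e]; have z0 := prim_root_neq0 pz.
have -> : t = u + n%:Z * q by lia.
by rewrite expfzDr // -exprz_exp -exprnP (prim_expr_order pz) exp1rz mulr1.
Qed.

Definition gauss_sum n z (a : int) : F := \sum_(x < n) z ^ (a * x%:Z ^+ 2).

Definition sine_prod n z : F := \prod_(r < n./2) (z ^ (r.+1%:Z) - z ^ (- r.+1%:Z)).

Lemma sine_prodM n z (a : int) : odd n -> n.-primitive_root z -> coprimez a n%:Z ->
  sine_prod n (z ^ a) = (jac a n)%:~R * sine_prod n z.
Proof.
move=> on pz ca.
rewrite -(prod_half_odd on ca (F := fun t => z ^ t - z ^ (- t))); first last.
- by move=> t u h; rewrite (prim_exprz_eq pz h) (@prim_exprz_eq n z (- t) (- u)) // -opprD rpredN.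
- by move=> t; rewrite opprK opprB.
by apply: eq_bigr => r _; rewrite !exprz_exp mulrN.
Qed.

Lemma odd_half n : odd n -> n = n./2.*2.+1.
Proof. lia. Qed.

(** Gauss' method: at q = z^-2 the alternating sum of Gaussian binomials becomes the sum of z^(j^2 +
    j), a Gauss sum up to completing the square, while its product form is a product of sines. It
    holds for every primitive root, whence the dependence on the parameter in [gauss_sum_unit]. *)
Lemma gauss_sum_eval n z : odd n -> n.-primitive_root z ->
  gauss_sum n z 1 = (-1) ^+ n./2 * sine_prod n (z ^+ 2).
Proof.
move=> on pz; have z0 := prim_root_neq0 pz; set m := n./2.
have nE : n = m.*2.+1 by exact: odd_half.
have n0 : (0 < n)%N by lia.
pose q := z ^- 2.
have pq : n.-primitive_root q.
  have : n.-primitive_root (z ^+ 2) by rewrite prim_root_exp_coprime // coprime2n.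
  move=> h; rewrite /q.
  have -> : z ^- 2 = (z ^+ 2) ^+ n.-1.
    apply: (mulfI (x := z ^+ 2)); first by rewrite expf_neq0.
    by rewrite mulfV ?expf_neq0 // -exprS prednK // (prim_expr_order h).
  by rewrite prim_root_exp_coprime // coprime_sym coprimenP.
have := qalt_even q m; rewrite /qalt.
rewrite (eq_bigr (fun j : 'I_m.*2.+1 => z ^ (j%:Z ^+ 2 + j%:Z))); last first.
  move=> j _; have := @qbin_prim q n j pq; rewrite {1 2}nE /= => -> //.
  rewrite /q -exprVn invrK -exprM exprnP; congr (z ^ _).
  by have := mul_bin_diag j.+1 1; rewrite bin1 /=; lia.
move=> e.
(* Completing the square: m + 1 is the inverse of 2 modulo n = 2m + 1, and (j + m + 1)^2 = j^2 + j +
   (m + 1)^2 + n j. *)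
have -> : gauss_sum n z 1 = z ^ ((m.+1)%:Z ^+ 2) * \sum_(j < n) z ^ (j%:Z ^+ 2 + j%:Z).
  rewrite /gauss_sum -(@periodic_sum_unit _ n 1 m.+1%:Z (fun t => z ^ (1 * t ^+ 2))) //; first last.
  - move=> t u h; apply: (prim_exprz_eq pz).
    have -> : 1 * t ^+ 2 - 1 * u ^+ 2 = (t - u) * (t + u) by ring.
    exact: dvdz_mulr.
  - by rewrite coprimezE coprime1n.
  rewrite mulr_sumr; apply: eq_bigr => j _; rewrite -expfzDr //.
  apply: (prim_exprz_eq pz); apply/dvdzP; exists j%:Z.
  transitivity (j%:Z * (2 * m%:Z + 1)); [ring | congr (_ * _); lia].
rewrite [in LHS]nE e.
have -> : \prod_(i < m) (1 - q ^+ i.*2.+1) =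
   z ^ (- (m%:Z ^+ 2)) * \prod_(i < m) (z ^ (i.*2.+1%:Z) - z ^ (- i.*2.+1%:Z)).
  elim: {e} m {nE} => [|m IH]; first by rewrite !big_ord0 mulr1.
  rewrite !big_ord_recr /= IH.
  have -> : (1 - q ^+ m.*2.+1) = z ^ (- m.*2.+1%:Z) * (z ^ m.*2.+1%:Z - z ^ (- m.*2.+1%:Z)).
    rewrite mulrBr -!expfzDr // addNr expr0z; congr (1 - _).
    by rewrite /q -exprVn -exprM exprnP exprz_inv; congr (_ ^ _); lia.
  have -> : - (m.+1%:Z ^+ 2) = - (m%:Z ^+ 2) - m.*2.+1%:Z by lia.
  by rewrite expfzDr //; ring.
rewrite mulrA -expfzDr //.
have -> : z ^ (m.+1%:Z ^+ 2 - m%:Z ^+ 2) = 1.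
  have -> : m.+1%:Z ^+ 2 - m%:Z ^+ 2 = n%:Z by lia.
  by rewrite -exprnP (prim_expr_order pz).
rewrite mul1r /sine_prod -/m.
have -> : (-1) ^+ m = \prod_(r < m) (-1 : F) by rewrite prodr_const card_ord.
rewrite -big_split /=.
(* The even exponent 2(m - i) is n - (2i + 1), so reversing the order matches even with odd
   exponents and each factor changes sign. *)
rewrite (reindex_inj rev_ord_inj) /=; apply: eq_bigr => i _.
rewrite mulN1r opprB [z ^+ 2]exprnP !exprz_exp.
congr (_ - _); apply: (prim_exprz_eq pz); apply/dvdzP; [exists 1|exists (-1)]; have := ltn_ord i; lia.
Qed.

(** Changing the parameter changes the root z to another primitive root; in the product of sines
    this produces the symbol. No counting of squares is involved, so n may be any odd number. *)
Lemma gauss_sum_unit n z (a : int) : odd n -> n.-primitive_root z -> coprimez a n%:Z ->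
  gauss_sum n z a = (jac a n)%:~R * gauss_sum n z 1.
Proof.
move=> on pz ca; have z0 := prim_root_neq0 pz.
have n0 : (0 < n)%N by lia.
pose b := `|(a %% n)%Z|%N.
have bE : b%:Z = (a %% n)%Z by rewrite /b; have := @modz_ge0 a n%:Z; lia.
have ab : (n%:Z %| a - b%:Z)%Z by rewrite -eqz_mod_dvd bE modz_mod.
have cb : coprimez b%:Z n%:Z.
  by rewrite bE /coprimez gcdz_modl.
have pzb : n.-primitive_root (z ^+ b) by rewrite prim_root_exp_coprime // -coprimezE.
have -> : gauss_sum n z a = gauss_sum n (z ^+ b) 1.
  apply: eq_bigr => x _; rewrite [z ^+ b]exprnP exprz_exp mul1r.
  by apply: (prim_exprz_eq pz); rewrite -mulrBl dvdz_mulr.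
rewrite !gauss_sum_eval // (eq_jac on ab) mulrCA; congr (_ * _).
have -> : (z ^+ b) ^+ 2 = (z ^+ 2) ^ b%:Z by rewrite -exprnP -!exprM mulnC.
by rewrite sine_prodM // prim_root_exp_coprime // coprime2n.
Qed.

Lemma sine_prod_neq0 n z : odd n -> n.-primitive_root z -> sine_prod n z != 0.
Proof.
move=> on pz; have z0 := prim_root_neq0 pz; apply/prodf_neq0 => r _.
rewrite subr_eq0; apply/negP => /eqP e.
have : z ^+ (r.+1).*2 == 1.
  by rewrite -addnn exprD !exprnP {2}e -expfzDr // subrr expr0z.
rewrite -(prim_order_dvd pz) => /dvdn_leq; have := ltn_ord r; lia.
Qed.

Lemma gauss_sum_neq0 n z : odd n -> n.-primitive_root z -> gauss_sum n z 1 != 0.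
Proof.
move=> on pz; rewrite gauss_sum_eval // mulf_neq0 ?signr_eq0 // sine_prod_neq0 //.
by rewrite prim_root_exp_coprime // coprime2n.
Qed.

Lemma gauss_sum_crt n1 n2 z (a : int) : odd n1 -> odd n2 -> coprime n1 n2 ->
  (n1 * n2)%N.-primitive_root z ->
  gauss_sum (n1 * n2) z a =
  gauss_sum n1 (z ^+ n2) (a * n2%:Z) * gauss_sum n2 (z ^+ n1) (a * n1%:Z).
Proof.
move=> o1 o2 cn pz; have z0 := prim_root_neq0 pz.
rewrite /gauss_sum (periodic_sum_crt (f := fun t => z ^ (a * t ^+ 2))) //; try lia; last first.
  move=> t u h; apply: (prim_exprz_eq pz).
  have -> : a * t ^+ 2 - a * u ^+ 2 = (t - u) * (a * (t + u)) by ring.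
  exact: dvdz_mulr.
rewrite big_distrl /=; apply: eq_bigr => x _; rewrite big_distrr /=; apply: eq_bigr => y _.
rewrite !exprnP !exprz_exp -expfzDr //; apply: (prim_exprz_eq pz).
by apply/dvdzP; exists (2 * a * x%:Z * y%:Z); rewrite PoszM; ring.
Qed.

Lemma prim_root_crt n1 n2 z : (0 < n2)%N -> (n1 * n2)%N.-primitive_root z ->
  n1.-primitive_root (z ^+ n2).
Proof.
move=> n20 pz; have := dvdn_prim_root pz (dvdn_mulr n2 (dvdnn n1)).
by rewrite -[X in (X %/ _)%N]mulnC mulnK //; have := prim_order_gt0 pz; rewrite muln_gt0 => /andP[].
Qed.

Lemma jac_fourier_crt n1 n2 z : odd n1 -> odd n2 -> coprime n1 n2 ->
  (n1 * n2)%N.-primitive_root z ->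
  (forall a, jac a (n1 * n2) = jac a n1 * jac a n2) ->
  (forall t, \sum_(b < n1) (jac b%:Z n1)%:~R * (z ^+ n2) ^ (t * b%:Z) =
     (jac t n1)%:~R * gauss_sum n1 (z ^+ n2) 1) ->
  (forall t, \sum_(b < n2) (jac b%:Z n2)%:~R * (z ^+ n1) ^ (t * b%:Z) =
     (jac t n2)%:~R * gauss_sum n2 (z ^+ n1) 1) ->
  forall t, \sum_(b < n1 * n2) (jac b%:Z (n1 * n2))%:~R * z ^ (t * b%:Z) =
     (jac t (n1 * n2))%:~R * gauss_sum (n1 * n2) z 1.
Proof.
move=> o1 o2 cn pz jM f1 f2 t; have z0 := prim_root_neq0 pz.
have on : odd (n1 * n2) by rewrite oddM o1.
have p1 := prim_root_crt (odd_gt0 o2) pz.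
have p2 : n2.-primitive_root (z ^+ n1) by apply: (prim_root_crt (odd_gt0 o1)); rewrite mulnC.
have c1 : coprimez n2%:Z n1%:Z by rewrite coprimezE coprime_sym.
have c2 : coprimez n1%:Z n2%:Z by rewrite coprimezE.
rewrite gauss_sum_crt // !mul1r gauss_sum_unit // [gauss_sum n2 _ _]gauss_sum_unit //.
rewrite (periodic_sum_crt (f := fun b => (jac b (n1 * n2))%:~R * z ^ (t * b))) ?odd_gt0 //; last first.
  move=> b u h; rewrite (eq_jac on h); congr (_ * _); apply: (prim_exprz_eq pz).
  by rewrite -mulrBr dvdz_mull.
transitivity ((jac n2%:Z n1)%:~R * (jac n1%:Z n2)%:~R *
   ((\sum_(b < n1) (jac b%:Z n1)%:~R * (z ^+ n2) ^ (t * b%:Z)) *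
    (\sum_(b < n2) (jac b%:Z n2)%:~R * (z ^+ n1) ^ (t * b%:Z)))); last first.
  by rewrite f1 f2 jM rmorphM /=; ring.
rewrite [in RHS]big_distrl /= mulr_sumr; apply: eq_bigr => x _.
rewrite big_distrr /= mulr_sumr; apply: eq_bigr => y _.
rewrite jM.
rewrite (@eq_jac _ (n2%:Z * x%:Z) n1) //; last by apply/dvdzP; exists y%:Z; ring.
rewrite (@eq_jac _ (n1%:Z * y%:Z) n2) //; last by apply/dvdzP; exists x%:Z; ring.
rewrite !jacM // !exprnP !exprz_exp !rmorphM /=.
have -> : t * (n2%:Z * x%:Z + n1%:Z * y%:Z) = n2%:Z * (t * x%:Z) + n1%:Z * (t * y%:Z) by ring.
by rewrite expfzDr //; ring.
Qed.

(** * Finite sine products from the factorization of X^n - 1 *)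

Lemma prod_1_sub_prim n z : n.+1.-primitive_root z -> \prod_(i < n) (1 - z ^+ i.+1) = n.+1%:R.
Proof.
move=> pz; have := factor_Xn_sub_1 pz; rewrite big_nat_recl // expr0 => e.
have {e} : \prod_(0 <= i < n) ('X - (z ^+ i.+1)%:P) = \sum_(i < n.+1) 'X^i.
  apply: (mulfI (x := 'X - 1%:P)); first by rewrite polyXsubC_eq0.
  by rewrite e -subrX1.
move/(congr1 (fun p => p.[1])); rewrite horner_sum horner_prod big_mkord.
under eq_bigr => i _ do rewrite !hornerE.
move=> ->; under eq_bigr => i _ do rewrite hornerXn expr1n.
by rewrite sumr_const card_ord.
Qed.

(** The factorization of X^n - 1 at a^2, made symmetric. Only x^2 has to be an n-th root of unity,
    so x may be exp(pi i / n), which gives the multiplication formula of the sine. *)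
Lemma prod_sine_full m (x a : F) : x != 0 -> a != 0 -> m.*2.+1.-primitive_root (x ^+ 2) ->
  sprod m (fun j => x ^ j * a - x ^ (- j) / a) = a ^+ m.*2.+1 - a ^- m.*2.+1.
Proof.
move=> x0 a0 pz; set n := m.*2.+1 in pz *.
have := factor_Xn_sub_1 pz => /(congr1 (fun p => p.[a ^+ 2])).
rewrite horner_prod !hornerE -exprM big_mkord.
under eq_bigr => i _ do rewrite !hornerE.
have per : \prod_(i < n) (a ^+ 2 - (x ^+ 2) ^+ i) = sprod m (fun j => a ^+ 2 - (x ^+ 2) ^ j).
  rewrite sprod_periodic // => t u h.
  by rewrite (prim_exprz_eq pz h).
rewrite per /sprod /= ?oppr0 !expr0z !mul1r => e.
apply: (mulfI (x := a ^+ n)); first by rewrite expf_neq0.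
rewrite mulrBr mulfV ?expf_neq0 // -exprD addnn -mul2n -e.
have -> : a ^+ n = a * \prod_(r < m) a ^+ 2.
  by rewrite prodr_const card_ord -exprM /n exprS; congr (_ * _ ^+ _); lia.
set Q := \prod_(r < m) a ^+ 2; set T := \prod_(r < m) ((x ^ _ * a - _) * _).
set P := \prod_(r < m) ((a ^+ 2 - _) * _).
have -> : P = T * Q; last by field.
rewrite -big_split /=; apply: eq_bigr => r _.
rewrite opprK -!exprnN -!exprnP -!exprM mulnC exprM.
set y := x ^+ r.+1; have y0 : y != 0 by rewrite expf_neq0.
by field; rewrite a0 y0.
Qed.

Lemma prod_sine_half m (x : F) : x != 0 -> m.*2.+1.-primitive_root (x ^+ 2) ->
  \prod_(r < m) (- (x ^+ r.+1 - x ^- r.+1) ^+ 2) = m.*2.+1%:R.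
Proof.
move=> x0 pz; rewrite -(prod_1_sub_prim pz).
have per := @sprod_periodic _ m (fun j => if (m.*2.+1%:Z %| j)%Z then 1 else 1 - (x ^+ 2) ^ j).
have {per} := per _; rewrite big_ord_recl /sprod dvdz0 !mul1r => per.
have -> : \prod_(i < m.*2) (1 - (x ^+ 2) ^+ i.+1) = \prod_(i < m.*2)
   (if (m.*2.+1%:Z %| (lift ord0 i)%:Z)%Z then 1 else 1 - (x ^+ 2) ^ (lift ord0 i)%:Z).
  apply: eq_bigr => i _; rewrite lift0 dvdzE /= gtnNdvd //.
  by have := ltn_ord i; lia.
rewrite -per; last first.
  move=> t u h; rewrite (prim_exprz_eq pz h).
  by rewrite -[in (_ %| t)%Z](subrK u t) rpredDl.
apply: eq_bigr => r _; have hr := ltn_ord r.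
rewrite !dvdzE abszN /= !gtnNdvd //; try lia.
rewrite -!exprnN -!exprnP -!exprM mulnC exprM.
set y := x ^+ r.+1; have y0 : y != 0 by rewrite expf_neq0.
by field.
Qed.

End GaussSum.

(** Multiplicativity in the modulus is not visible on half systems. The Gauss sum with parameter [a]
    is computed directly and through the Chinese remainder theorem, and the nonzero Gauss sums
    cancel; characteristic 0 lets the identity be read in the integers. *)
Lemma jac_mulr_root (F : numFieldType) (z : F) (a : int) (n1 n2 : nat) :
  odd n1 -> odd n2 -> coprime n1 n2 -> (n1 * n2)%N.-primitive_root z ->
  jac a (n1 * n2) = jac a n1 * jac a n2.
Proof.
move=> o1 o2 cn pz; have on : odd (n1 * n2) by rewrite oddM o1.
have cE : coprimez a (n1 * n2)%N%:Z = coprimez a n1%:Z && coprimez a n2%:Z.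
  by rewrite !coprimezE /= coprimeMr.
have [ca|nca] := boolP (coprimez a (n1 * n2)%N%:Z); last first.
  rewrite jac_eq0 //; move: nca; rewrite cE negb_and => /orP[] h.
    by rewrite (@jac_eq0 a n1) ?mul0r.
  by rewrite (@jac_eq0 a n2) ?mulr0.
have /andP[ca1 ca2] : coprimez a n1%:Z && coprimez a n2%:Z by rewrite -cE.
have p1 := prim_root_crt (odd_gt0 o2) pz.
have p2 : n2.-primitive_root (z ^+ n1) by apply: (prim_root_crt (odd_gt0 o1)); rewrite mulnC.
have c1 : coprimez n2%:Z n1%:Z by rewrite coprimezE coprime_sym.
have c2 : coprimez n1%:Z n2%:Z by rewrite coprimezE.
have := gauss_sum_crt a o1 o2 cn pz.
rewrite gauss_sum_unit // gauss_sum_crt // mul1r mul1r.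
rewrite (@gauss_sum_unit _ n1 _ n2%:Z) // (@gauss_sum_unit _ n2 _ n1%:Z) //.
rewrite (@gauss_sum_unit _ n1 _ (a * _)) // ?(@gauss_sum_unit _ n2 _ (a * _)) //;
  try by rewrite coprimezMl ?ca1 ?ca2.
rewrite !jacM // !rmorphM /=.
set G1 := gauss_sum n1 _ _; set G2 := gauss_sum n2 _ _.
have G10 : G1 != 0 by apply: gauss_sum_neq0.
have G20 : G2 != 0 by apply: gauss_sum_neq0.
have nz1 : (jac n2 n1)%:~R != 0 :> F.
  by rewrite intr_eq0; have := jac_sqr o1 c1; case: eqP => [->|].
have nz2 : (jac n1 n2)%:~R != 0 :> F.
  by rewrite intr_eq0; have := jac_sqr o2 c2; case: eqP => [->|].
move=> e; apply/eqP; rewrite -(eqr_int F) rmorphM /=; apply/eqP.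
apply: (mulIf (x := (jac n2 n1)%:~R * G1 * ((jac n1 n2)%:~R * G2))); first by rewrite !mulf_neq0.
by rewrite e; ring.
Qed.

(** * Comparison with the Kronecker symbol *)

Section LegendrePrime.
Variables (p : nat) (pp : prime p) (op : odd p).

Lemma Fp_dvdz (t : int) : (p%:Z %| t)%Z = (t%:~R == 0 :> 'F_p).
Proof. by apply: dvdz_pcharf; apply: pchar_Fp. Qed.

Lemma Fp_intP (x : 'F_p) : ((x : nat)%:Z)%:~R = x.
Proof. by rewrite -pmulrn natr_Zp. Qed.

Lemma coprimez_prime (t : int) : coprimez t p%:Z = (t%:~R != 0 :> 'F_p).
Proof. by rewrite -Fp_dvdz dvdzE coprimez_sym coprimezE /= prime_coprime. Qed.

Lemma jac_euler (a : int) : coprimez a p%:Z -> (jac a p)%:~R = a%:~R ^+ p./2 :> 'F_p.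
Proof.
move=> ca; have := prod_half_odd op ca (F := fun t => t%:~R : 'F_p).
move=> /(_ (fun t => rmorphN _ t)).
under eq_bigr => r _ do rewrite rmorphM.
rewrite big_split /= prodr_const card_ord => e.
apply: (mulIf (x := \prod_(r < p./2) (r.+1%:Z)%:~R)).
  apply/prodf_neq0 => r _; rewrite -Fp_dvdz dvdzE /= gtnNdvd //.
  by have := ltn_ord r; lia.
rewrite -e // => t u h; apply/eqP; rewrite -subr_eq0 -rmorphB -Fp_dvdz //.
Qed.

Lemma jac_square (b : int) (x : 'F_p) : b%:~R = x ^+ 2 -> x != 0 -> jac b p = 1.
Proof.
move=> e x0; rewrite (@eq_jac _ ((x : nat)%:Z * (x : nat)%:Z)) //; last first.
  by rewrite Fp_dvdz rmorphB rmorphM /= !Fp_intP e subrr.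
by rewrite jacM // -expr2 jac_sqr // coprimez_prime Fp_intP.
Qed.

(** By Euler's criterion the (p - 1)/2 nonzero squares are roots of X^((p-1)/2) - 1; a nonsquare
    with symbol 1 would be one root too many. *)
Lemma jac_nonsquare (b : int) : jac b p = 1 -> exists x : 'F_p, b%:~R = x ^+ 2.
Proof.
move=> jb; have cb : coprimez b p%:Z by apply: contraPT (jb) => /(jac_eq0 op) ->.
have [|nsq] := boolP [exists x : 'F_p, b%:~R == x ^+ 2].
  by move=> /existsP[x /eqP ->]; exists x.
pose m := p./2; pose P : {poly 'F_p} := 'X^m - 1.
have m0 : (0 < m)%N by have := prime_gt1 pp; rewrite /m; lia.
have P0 : P != 0 by rewrite -size_poly_eq0 size_XnsubC.
pose rs := b%:~R :: [seq (r.+1%:R : 'F_p) ^+ 2 | r <- iota 0 m].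
have rP : all (root P) rs.
  have rt (x : 'F_p) : x ^+ m = 1 -> root P x by rewrite /root !hornerE => ->; rewrite subrr.
  rewrite /= rt /=; last by rewrite -jac_euler // jb.
  apply/allP => y /mapP[r]; rewrite mem_iota add0n => /andP[_ hr] ->; apply: rt.
  have -> : (r.+1%:R ^+ 2) = ((r.+1%:Z) * (r.+1%:Z))%:~R :> 'F_p by rewrite rmorphM.
  have cr : coprimez r.+1%:Z p%:Z.
    by rewrite coprimez_prime -Fp_dvdz dvdzE /= gtnNdvd //; rewrite /m in hr; lia.
  rewrite -jac_euler ?coprimezMl ?cr // jacM // -expr2 jac_sqr //.
have uP : uniq rs.
  rewrite /= map_inj_in_uniq ?iota_uniq ?andbT.
    apply/mapP => -[r _ e]; case/negP: nsq; apply/existsP; exists r.+1%:R; exact/eqP.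
  move=> r s; rewrite !mem_iota !add0n => /andP[_ hr] /andP[_ hs] /eqP.
  rewrite -subr_eq0 subr_sqr mulf_eq0 => /orP[].
    have -> : r.+1%:R - s.+1%:R = (r.+1%:Z - s.+1%:Z)%:~R :> 'F_p by rewrite rmorphB.
    rewrite -Fp_dvdz => hd; have /eqP : sres p (r.+1%:Z - s.+1%:Z) == 0 by rewrite sres_eq0.
    by rewrite sres_small //; rewrite /m in hr hs; lia.
  rewrite -natrD -(@Fp_dvdz (r.+1 + s.+1)%N) dvdzE /= => /dvdn_leq.
  by rewrite /m in hr hs; lia.
have := max_poly_roots P0 rP uP; rewrite size_XnsubC //= size_map size_iota; lia.
Qed.

Lemma card_sqrt (b : int) : (#|[set x : 'F_p | x ^+ 2 == b%:~R]|)%:Z = 1 + jac b p.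
Proof.
have [cb|ncb] := boolP (coprimez b p%:Z); last first.
  rewrite (jac_eq0 op ncb) addr0.
  have b0 : b%:~R = 0 :> 'F_p by move: ncb; rewrite coprimez_prime negbK => /eqP.
  rewrite (_ : [set x | _] = [set 0]) ?cards1 //.
  by apply/setP => x; rewrite !inE b0 sqrf_eq0.
have b0 : b%:~R != 0 :> 'F_p by rewrite -coprimez_prime.
have [jb|jb] := jac_cases op cb; rewrite jb.
  have [x e] := jac_nonsquare jb.
  have x0 : x != 0 by apply: contra_neq b0 => x0; rewrite e x0 expr0n.
  have xN : x != - x.
    rewrite -subr_eq0 opprK -mulr2n -mulr_natl mulf_neq0 //.
    have := Fp_dvdz 2%:Z; rewrite dvdzE /= => h; rewrite -[2%:R]/((2%:Z)%:~R) -h gtnNdvd //.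
    by have := prime_gt1 pp; lia.
  rewrite (_ : [set x | _] = [set x; - x]) ?cards2 ?xN //.
  by apply/setP => y; rewrite !inE e eqf_sqr.
rewrite (_ : [set x | _] = finset.set0) ?cards0 ?subrr //.
apply/setP => x; rewrite !inE; apply/negP => /eqP e.
have : jac b p = 1.
  by apply: (@jac_square _ x); rewrite ?e //; apply: contra_neq b0 => x0; rewrite -e x0 expr0n.
by rewrite jb.
Qed.

Lemma legendre_jac (a : int) : legendre a p = jac a p.
Proof.
rewrite /legendre; have := coprimez_prime a; rewrite -Fp_dvdz; case: ifP => h ca.
  by rewrite jac_eq0 // ca.
have sqE (x : nat) : (x%:Z ^+ 2 == a %[mod p%:Z])%Z = ((x%:R : 'F_p) ^+ 2 == a%:~R).
  by rewrite eqz_mod_dvd Fp_dvdz rmorphB rmorphXn /= subr_eq0.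
case: ifP => [/existsP[x]|].
  rewrite sqE => /eqP e; symmetry; apply: (@jac_square _ x%:R); first by [].
  by apply/negP => /eqP x0; move: ca; rewrite coprimez_prime -e x0 expr0n.
move=> nsq; have [e|->//] := jac_cases op ca.
have [x ex] := jac_nonsquare e; move/negbT/negP: nsq; case; apply/existsP.
have xp : ((x : nat) < p)%N by have := ltn_ord x; rewrite [X in (_ < X)%N -> _]Fp_cast.
by exists (Ordinal xp) => /=; rewrite sqE natr_Zp ex.
Qed.

(** Grouping x by its square turns the Gauss sum into the sum of (1 + (b/p)) z^(tb), and the sum of
    z^(tb) alone vanishes unless p divides t. *)
Lemma jac_fourier_prime (F : fieldType) (z : F) : p.-primitive_root z ->
  forall t, \sum_(b < p) (jac b%:Z p)%:~R * z ^ (t * b%:Z) = (jac t p)%:~R * gauss_sum p z 1.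
Proof.
move=> pz t; have z0 := prim_root_neq0 pz; have p0 := prime_gt0 pp.
have per (f : int -> F) : (forall t u, (p%:Z %| t - u)%Z -> f t = f u) ->
    \sum_(x : 'F_p) f (x : nat)%:Z = \sum_(x < p) f x%:Z.
  move=> fp; apply: (periodic_sum_reindex (h := fun x : 'F_p => (x : nat)%:Z)) => //.
    by rewrite card_Fp.
  move=> x y; rewrite Fp_dvdz rmorphB /= !Fp_intP subr_eq0 => /eqP //.
have perz (u v w : int) : (p%:Z %| v - w)%Z -> z ^ (u * v) = z ^ (u * w).
  by move=> h; apply: (prim_exprz_eq pz); rewrite -mulrBr dvdz_mull.
have G : gauss_sum p z t = \sum_(b < p) (1 + jac b%:Z p)%:~R * z ^ (t * b%:Z).
  rewrite -(per (fun b => (1 + jac b p)%:~R * z ^ (t * b))); last first.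
    by move=> u v h; rewrite (perz _ _ _ h) (eq_jac op h).
  rewrite /gauss_sum -(per (fun x => z ^ (t * x ^+ 2))); last first.
    move=> u v h; apply: perz; have -> : u ^+ 2 - v ^+ 2 = (u - v) * (u + v) by ring.
    exact: dvdz_mulr.
  rewrite (partition_big (fun x : 'F_p => x ^+ 2) predT) //=; apply: eq_bigr => b _.
  rewrite (eq_bigr (fun=> z ^ (t * (b : nat)%:Z))); last first.
    move=> x /eqP e; apply: perz.
    by rewrite Fp_dvdz rmorphB rmorphXn /= !Fp_intP e subrr.
  rewrite -card_sqrt sumr_const mulr_natl; congr (_ *+ _).
  by rewrite -[RHS]cardsE; apply: eq_card => x; rewrite !inE Fp_intP.
have E0 : \sum_(b < p) z ^ (t * b%:Z) = (if (p%:Z %| t)%Z then p%:R else 0).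
  case: ifP => h.
    rewrite (eq_bigr (fun=> 1)) ?sumr_const ?card_ord // => b _.
    by rewrite -[RHS](expr0z z); apply: (prim_exprz_eq pz); rewrite subr0 dvdz_mulr.
  have zt : z ^ t != 1.
    apply/negP => /eqP e; move/negP: h; apply.
    pose u := `|(t %% p)%Z|%N.
    have uE : u%:Z = (t %% p)%Z by rewrite /u; have := @modz_ge0 t p%:Z; lia.
    have : z ^+ u == 1.
      rewrite exprnP uE -e; apply/eqP; apply: (prim_exprz_eq pz).
      by rewrite -eqz_mod_dvd modz_mod.
    rewrite -(prim_order_dvd pz) => hu.
    by apply/dvdz_mod0P; rewrite -uE; have := @ltz_pmod t p%:Z; have := dvdn_leq _ hu; lia.
  apply: (mulfI (x := z ^ t - 1)); first by rewrite subr_eq0.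
  rewrite mulr0; under eq_bigr => b _ do rewrite -exprz_exp -exprnP.
  by rewrite -subrX1 exprnP exprz_exp mulrC -exprz_exp -exprnP (prim_expr_order pz) exp1rz subrr.
move: G; under eq_bigr => b _ do rewrite rmorphD mulrDl mul1r.
rewrite big_split /= E0; case: ifP => h.
  have ct : ~~ coprimez t p%:Z by rewrite coprimez_prime -Fp_dvdz h.
  rewrite (jac_eq0 op ct) mul0r => e; apply: (addrI p%:R); rewrite -e addr0.
  rewrite /gauss_sum (eq_bigr (fun=> 1)) ?sumr_const ?card_ord // => b _.
  by rewrite -[RHS](expr0z z); apply: (prim_exprz_eq pz); rewrite subr0 dvdz_mulr.
have ct : coprimez t p%:Z by rewrite coprimez_prime -Fp_dvdz h.
by rewrite gauss_sum_unit // add0r.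
Qed.

End LegendrePrime.

Lemma squarefree_coprime m n : squarefree (m * n) -> coprime m n.
Proof.
move=> sq; rewrite /coprime; apply/eqP; apply: sq.
by rewrite expnS expn1 dvdn_mul ?dvdn_gcdl ?dvdn_gcdr.
Qed.

Lemma squarefree_dvd m n : (m %| n)%N -> squarefree n -> squarefree m.
Proof. by move=> mn sq k /dvdn_trans /(_ mn); apply: sq. Qed.

(** Induction splitting off the smallest prime factor. That the sum vanishes also for t not prime to
    n says that the character is primitive, which rests on n being squarefree. *)
Lemma jac_fourier (F : numFieldType) (n : nat) (z : F) : odd n -> squarefree n ->
  n.-primitive_root z ->
  forall t, \sum_(b < n) (jac b%:Z n)%:~R * z ^ (t * b%:Z) = (jac t n)%:~R * gauss_sum n z 1.
Proof.
elim/ltn_ind: n z => n IH z on sq pz t.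
have [n1|n1] := leqP n 1.
  have -> : n = 1%N by lia.
  by rewrite /gauss_sum !big_ord_recl !big_ord0 !jaca1 !mulr0 !mul1r !addr0.
set p := pdiv n; have pp : prime p by apply: pdiv_prime.
have pn : (p %| n)%N by apply: pdiv_dvd.
case/dvdnP: (pn) => m nE; have op : odd p by apply: dvdn_odd pn on.
have om : odd m by apply: dvdn_odd on; rewrite nE dvdn_mulr.
have cmp : coprime m p by apply: squarefree_coprime; rewrite -nE.
rewrite nE in pz *.
apply: jac_fourier_crt => //.
- by move=> a; apply: (jac_mulr_root _ _ _ _ pz).
- apply: IH => //; first by have := prime_gt1 pp; rewrite nE; nia.
    by apply: squarefree_dvd sq; rewrite nE dvdn_mulr.
  by apply: prim_root_crt pz; apply: prime_gt0.
- apply: jac_fourier_prime => //.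
  by apply: prim_root_crt; [apply: odd_gt0 om | rewrite mulnC].
Qed.

(** * Norms and limits of complex numbers *)

Section ComplexNorm.
Local Open Scope classical_set_scope.
Variable R : realType.
Local Notation C := R[i].
Implicit Types (z w : C) (x y : R).

(** The modulus as an element of [R]: the norm of [C] takes its values in [C], where linear
    arithmetic over an ordered field does not apply. *)
Definition nrm (z : C) : R := complex.Re `|z|.

Lemma normCE z : `|z| = (nrm z)%:C%C.
Proof. by rewrite /nrm normc_def. Qed.

Lemma nrmE z : nrm z = Num.sqrt (complex.Re z ^+ 2 + complex.Im z ^+ 2).
Proof. by rewrite /nrm normc_def. Qed.

Lemma nrm_ge0 z : 0 <= nrm z.
Proof. by rewrite nrmE sqrtr_ge0. Qed.

Lemma nrmM z w : nrm (z * w) = nrm z * nrm w.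
Proof. by apply: (@complexI R); rewrite rmorphM /= -!normCE normrM. Qed.

Lemma nrmD z w : nrm (z + w) <= nrm z + nrm w.
Proof. by rewrite -lecR rmorphD /= -!normCE ler_normD. Qed.

Lemma nrm_eq0 z : (nrm z == 0) = (z == 0).
Proof.
rewrite -[RHS]normr_eq0 normCE; apply/eqP/eqP => [->//|/(congr1 (@complex.Re R)) //].
Qed.

Lemma nrm0 : nrm 0 = 0. Proof. by apply/eqP; rewrite nrm_eq0. Qed.

Lemma nrm_real x : nrm x%:C%C = `|x|.
Proof. by rewrite nrmE /= expr0n addr0 sqrtr_sqr. Qed.

Lemma nrm1 : nrm 1 = 1. Proof. by rewrite -[1]/(1%:C%C) nrm_real normr1. Qed.

Lemma nrmN z : nrm (- z) = nrm z.
Proof. by rewrite /nrm normrN. Qed.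

Lemma nrmBC z w : nrm (z - w) = nrm (w - z).
Proof. by rewrite -nrmN opprB. Qed.

Lemma nrmV z : nrm z^-1 = (nrm z)^-1.
Proof.
have [->|z0] := eqVneq z 0; first by rewrite invr0 nrm0 invr0.
have n0 : nrm z != 0 by rewrite nrm_eq0.
by apply: (mulfI n0); rewrite -nrmM !divff // nrm1.
Qed.

Lemma nrmX z n : nrm (z ^+ n) = nrm z ^+ n.
Proof. by elim: n => [|n IH]; rewrite ?expr0 ?nrm1 // !exprS nrmM IH. Qed.

Lemma natCE n : n%:R = (n%:R : R)%:C%C.
Proof. by rewrite rmorph_nat. Qed.

Lemma intCE (m : int) : m%:~R = (m%:~R : R)%:C%C.
Proof. by rewrite rmorph_int. Qed.

Lemma nrm_nat n : nrm n%:R = n%:R.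
Proof. by rewrite natCE nrm_real ger0_norm. Qed.

Lemma nrm_int (m : int) : nrm m%:~R = `|m|%:~R.
Proof. by rewrite intCE nrm_real intr_norm. Qed.

Lemma nrm_i : nrm 'i%C = 1.
Proof. by rewrite nrmE /= expr0n expr1n add0r sqrtr1. Qed.

Lemma Re_le z : `|complex.Re z| <= nrm z.
Proof. by rewrite nrmE -sqrtr_sqr ler_wsqrtr // lerDl sqr_ge0. Qed.

Lemma Im_le z : `|complex.Im z| <= nrm z.
Proof. by rewrite nrmE -sqrtr_sqr ler_wsqrtr // lerDr sqr_ge0. Qed.

Lemma nrm_le z : nrm z <= `|complex.Re z| + `|complex.Im z|.
Proof.
case: z => a b /=.
have -> : (a +i* b)%C = a%:C%C + 'i%C * b%:C%C by rewrite [LHS]complexE.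
by apply: le_trans (nrmD _ _) _; rewrite nrmM nrm_i mul1r !nrm_real.
Qed.

Lemma nrm_sum (I : Type) (r : seq I) (P : pred I) (f : I -> C) :
  nrm (\sum_(i <- r | P i) f i) <= \sum_(i <- r | P i) nrm (f i).
Proof.
elim/big_ind2: _ => // [|x1 x2 y1 y2 h1 h2]; first by rewrite nrm0.
by apply: le_trans (nrmD _ _) _; rewrite lerD.
Qed.

Lemma nrm_prod (I : Type) (r : seq I) (P : pred I) (f : I -> C) :
  nrm (\prod_(i <- r | P i) f i) = \prod_(i <- r | P i) nrm (f i).
Proof. by apply: (big_morph nrm nrmM nrm1). Qed.

Lemma nrmB_tri w z z' : nrm (z - z') <= nrm (z - w) + nrm (w - z').
Proof. by have := nrmD (z - w) (w - z'); rewrite addrA subrK. Qed.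

Lemma nrmB_ge z w : nrm z - nrm w <= nrm (z - w).
Proof. by rewrite lerBlDr; have := nrmD (z - w) w; rewrite subrK. Qed.

Lemma eq_nrm_small z w : (forall e : R, 0 < e -> nrm (z - w) <= e) -> z = w.
Proof.
move=> h; apply/eqP; rewrite -subr_eq0 -nrm_eq0 eq_le nrm_ge0 andbT.
by apply/ler_addgt0Pl => e e0; rewrite addr0; apply: h.
Qed.

(** * Convergent sequences, sums and products *)

Definition cvC (u : nat -> C) (l : C) : Prop :=
  forall e : R, 0 < e -> exists n0, forall n, (n0 <= n)%N -> nrm (u n - l) < e.

Lemma cvCP (u : nat -> C) (l : C) :
  cvC u l <-> (u n : C^o) @[n --> \oo] --> (l : C^o).
Proof.
split => [h|h].
  apply/cvgrPdist_lt => e e0.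
  have eE : e = (complex.Re e)%:C%C by move: e0; case: e => a b; rewrite ltcE /= => /andP[/eqP ->].
  have [|n0 hn] := h (complex.Re e); first by move: e0; rewrite eE ltcR.
  by near=> n; rewrite distrC normCE eE ltcR; apply: hn; near: n; exists n0.
move=> e e0; have /cvgrPdist_lt/(_ e%:C%C) := h.
rewrite ltcR => /(_ e0) [n0 _ hn]; exists n0 => n le.
by have := hn n le; rewrite /= distrC normCE ltcR.
Unshelve. all: by end_near. Qed.

Lemma cvC_lim (u : nat -> C) l : cvC u l -> limn (u : nat -> C^o) = l.
Proof. by move=> /cvCP h; apply: cvg_lim. Qed.

Lemma cvC_uniq (u : nat -> C) l l' : cvC u l -> cvC u l' -> l = l'.
Proof. by move=> /cvC_lim <- /cvC_lim <-. Qed.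

Lemma cvC_cst (l : C) : cvC (fun=> l) l.
Proof. by move=> e e0; exists 0%N => n _; rewrite subrr nrm0. Qed.

Lemma eq_cvC (u v : nat -> C) l : u =1 v -> cvC u l -> cvC v l.
Proof. by move=> uv h e e0; have [n0 hn] := h e e0; exists n0 => n le; rewrite -uv hn. Qed.

Lemma cvCD (u v : nat -> C) l m : cvC u l -> cvC v m -> cvC (fun n => u n + v n) (l + m).
Proof.
move=> hu hv e e0; have e2 : 0 < e / 2 by lra.
have [n0 h0] := hu _ e2; have [n1 h1] := hv _ e2.
exists (maxn n0 n1) => n; rewrite geq_max => /andP[le0 le1].
have -> : u n + v n - (l + m) = (u n - l) + (v n - m) by ring.
have := nrmD (u n - l) (v n - m); have := h0 n le0; have := h1 n le1; lra.
Qed.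

Lemma cvCN (u : nat -> C) l : cvC u l -> cvC (fun n => - u n) (- l).
Proof. by move=> /cvCP hu; apply/cvCP; apply: (@cvgN C C^o). Qed.

Lemma cvCB (u v : nat -> C) l m : cvC u l -> cvC v m -> cvC (fun n => u n - v n) (l - m).
Proof. by move=> hu hv; apply: cvCD => //; apply: cvCN. Qed.

Lemma cvCM (u v : nat -> C) l m : cvC u l -> cvC v m -> cvC (fun n => u n * v n) (l * m).
Proof.
move=> hu hv e e0.
have l0 := nrm_ge0 l; have m0 := nrm_ge0 m.
have el : 0 < e / (2 * (nrm l + 1)) by apply: divr_gt0 => //; lra.
have em : 0 < e / (2 * (nrm m + 1)) by apply: divr_gt0 => //; lra.
have [n0 h0] := hu _ em; have [n1 h1] := hv _ el; have [n2 h2] := hu _ ltr01.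
exists (maxn n0 (maxn n1 n2)) => n; rewrite !geq_max => /andP[le0 /andP[le1 le2]].
have -> : u n * v n - l * m = u n * (v n - m) + m * (u n - l) by ring.
apply: le_lt_trans (nrmD _ _) _; rewrite !nrmM.
have H0 := h0 n le0; have H1 := h1 n le1; have H2 := h2 n le2.
have ub : nrm (u n) <= nrm l + 1 by have := nrmB_ge (u n) l; lra.
have : nrm (u n) * nrm (v n - m) <= (nrm l + 1) * (e / (2 * (nrm l + 1))).
  by apply: ler_pM; rewrite ?nrm_ge0 ?(ltW H1).
have : nrm m * nrm (u n - l) <= nrm m * (e / (2 * (nrm m + 1))).
  by apply: ler_pM; rewrite ?nrm_ge0 ?(ltW H0).
have -> : (nrm l + 1) * (e / (2 * (nrm l + 1))) = e / 2 by field; lra.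
have : nrm m * (e / (2 * (nrm m + 1))) < e / 2.
  have -> : nrm m * (e / (2 * (nrm m + 1))) = (e / 2) * (nrm m / (nrm m + 1)) by field; lra.
  rewrite -[X in _ < X]mulr1 ltr_pM2l ?ltr_pdivrMr; lra.
lra.
Qed.

Lemma cvCMl (c : C) (u : nat -> C) l : cvC u l -> cvC (fun n => c * u n) (c * l).
Proof. by move=> hu; apply: cvCM => //; apply: cvC_cst. Qed.

Lemma cvCV (u : nat -> C) l : l != 0 -> cvC u l -> cvC (fun n => (u n)^-1) l^-1.
Proof. by move=> l0 /cvCP hu; apply/cvCP; apply: (@cvgV C). Qed.

Lemma cvCX (u : nat -> C) l k : cvC u l -> cvC (fun n => u n ^+ k) (l ^+ k).
Proof.
move=> hu; elim: k => [|k IH]; first exact: cvC_cst.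
by rewrite exprS; apply: eq_cvC (cvCM hu IH) => n; rewrite exprS.
Qed.

Lemma cvC_sum (I : Type) (r : seq I) (f : I -> nat -> C) (l : I -> C) :
  (forall i, cvC (f i) (l i)) -> cvC (fun n => \sum_(i <- r) f i n) (\sum_(i <- r) l i).
Proof.
move=> h; elim: r => [|i r IH].
  by rewrite big_nil; apply: eq_cvC (cvC_cst 0) => n; rewrite big_nil.
by rewrite big_cons; apply: eq_cvC (cvCD (h i) IH) => n; rewrite big_cons.
Qed.

Lemma cvC_prod (I : Type) (r : seq I) (f : I -> nat -> C) (l : I -> C) :
  (forall i, cvC (f i) (l i)) -> cvC (fun n => \prod_(i <- r) f i n) (\prod_(i <- r) l i).
Proof.
move=> h; elim: r => [|i r IH].
  by rewrite big_nil; apply: eq_cvC (cvC_cst 1) => n; rewrite big_nil.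
by rewrite big_cons; apply: eq_cvC (cvCM (h i) IH) => n; rewrite big_cons.
Qed.

Lemma cvC_le (u : nat -> C) l (b : R) (n1 : nat) :
  (forall n, (n1 <= n)%N -> nrm (u n) <= b) -> cvC u l -> nrm l <= b.
Proof.
move=> hb h; apply/ler_addgt0Pr => e e0; have [n0 hn] := h e e0.
have h1 := hn (maxn n0 n1) (leq_maxl _ _); have h2 := hb (maxn n0 n1) (leq_maxr _ _).
have := nrmB_ge l (u (maxn n0 n1)); rewrite nrmBC; lra.
Qed.

Lemma cvC_sub (u : nat -> C) l (f : nat -> nat) : (forall n, (n <= f n)%N) ->
  cvC u l -> cvC (fun n => u (f n)) l.
Proof.
move=> hf h e e0; have [n0 hn] := h e e0; exists n0 => n le.
by apply: hn; apply: leq_trans le _.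
Qed.

Lemma cvC_shift (u : nat -> C) l k : cvC (fun n => u (n + k)%N) l -> cvC u l.
Proof.
move=> h e e0; have [n0 hn] := h e e0; exists (n0 + k)%N => n le.
by have := hn (n - k)%N; rewrite subnK; [apply; lia | lia].
Qed.

Lemma cvC0_dom (u : nat -> C) (v : nat -> C) :
  (forall n, nrm (u n) <= nrm (v n)) -> cvC v 0 -> cvC u 0.
Proof.
move=> h hv e e0; have [n0 hn] := hv e e0; exists n0 => n le; rewrite subr0.
by apply: le_lt_trans (h n) _; rewrite -[v n]subr0 hn.
Qed.

Lemma cvC_invn : cvC (fun n => n.+1%:R^-1) 0.
Proof.
move=> e e0; exists (Num.bound e^-1) => n le.
rewrite subr0 nrmV nrm_nat -[X in _ < X]invrK ltf_pV2 ?posrE ?invr_gt0 //.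
have := Num.Theory.archi_boundP (ltW (_ : 0 < e^-1)); rewrite invr_gt0 => /(_ e0) /lt_le_trans; apply.
by rewrite ler_nat; lia.
Qed.

(* Re u + v, Im u + v and v are nondecreasing and bounded. *)
Lemma cvC_dominated (u : nat -> C) (v : nat -> R) (b : R) :
  (forall m n, (m <= n)%N -> nrm (u n - u m) <= v n - v m) ->
  (forall n, v n <= b) -> exists l, cvC u l.
Proof.
move=> hd hb.
have vmono m n : (m <= n)%N -> v m <= v n.
  by move=> le; rewrite -subr_ge0; apply: le_trans (nrm_ge0 _) (hd _ _ le).
have cv (f : nat -> R) (c : R) : (forall m n, (m <= n)%N -> f m <= f n) -> (forall n, f n <= c) ->
    exists l : R, forall e, 0 < e -> exists n0, forall n, (n0 <= n)%N -> `|f n - l| < e.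
  move=> fm fb; exists (limn f) => e e0.
  have /cvgrPdist_lt/(_ e e0) [n0 _ hn] : f @ \oo --> limn f.
    apply: nondecreasing_is_cvgn => //; exists c => _ [n _ <-]; exact: fb.
  by exists n0 => n le; rewrite distrC; apply: hn.
have ub n : nrm (u n) <= nrm (u 0%N) + (b - v 0%N).
  have := hd 0%N n (leq0n n); have := nrmB_ge (u n) (u 0%N); have := hb n; lra.
have [lv hv] := cv v b vmono hb.
have [l1 h1] : exists l : R, forall e, 0 < e -> exists n0, forall n, (n0 <= n)%N ->
    `|(complex.Re (u n) + v n) - l| < e.
  apply: (cv _ (nrm (u 0%N) + (b - v 0%N) + b)) => [m n le|n].
    have := hd _ _ le; have := Re_le (u n - u m); rewrite raddfB /= ler_norml; lra.
  have := Re_le (u n); have := ub n; have := hb n; rewrite ler_norml; lra.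
have [l2 h2] : exists l : R, forall e, 0 < e -> exists n0, forall n, (n0 <= n)%N ->
    `|(complex.Im (u n) + v n) - l| < e.
  apply: (cv _ (nrm (u 0%N) + (b - v 0%N) + b)) => [m n le|n].
    have := hd _ _ le; have := Im_le (u n - u m); rewrite raddfB /= ler_norml; lra.
  have := Im_le (u n); have := ub n; have := hb n; rewrite ler_norml; lra.
exists ((l1 - lv) +i* (l2 - lv))%C => e e0.
have e4 : 0 < e / 4 by lra.
have [n0 H0] := hv _ e4; have [n1 H1] := h1 _ e4; have [n2 H2] := h2 _ e4.
exists (maxn n0 (maxn n1 n2)) => n; rewrite !geq_max => /andP[le0 /andP[le1 le2]].
move: (H0 n le0) (H1 n le1) (H2 n le2); rewrite !ltr_norml => K0 K1 K2.
have a1 : `|complex.Re (u n) - (l1 - lv)| < e / 2 by rewrite ltr_norml; lra.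
have a2 : `|complex.Im (u n) - (l2 - lv)| < e / 2 by rewrite ltr_norml; lra.
move: a1 a2; case: (u n) => p q /= a1 a2.
by apply: le_lt_trans (nrm_le _) _ => /=; lra.
Qed.

(** Adding a factor changes a product P by P(u - 1), and |P| is at most the product of the
    majorants; so the increments are dominated one by one. *)
Lemma prod_dominated (u : nat -> C) (v : nat -> R) (m n : nat) :
  (forall i, nrm (u i - 1) <= v i - 1) -> (m <= n)%N ->
  nrm (\prod_(i < n) u i - \prod_(i < m) u i) <= \prod_(i < n) v i - \prod_(i < m) v i.
Proof.
move=> h mn.
have v1 i : 1 <= v i by have := h i; have := nrm_ge0 (u i - 1); lra.
have uv i : nrm (u i) <= v i.
  have := h i; have := nrmB_ge (u i) 1; rewrite nrm1; lra.
have pv k : nrm (\prod_(i < k) u i) <= \prod_(i < k) v i.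
  by rewrite nrm_prod; apply: ler_prod => i _; rewrite nrm_ge0 uv.
rewrite -(subnKC mn); elim: (n - m)%N => [|k IH]; first by rewrite addn0 !subrr nrm0.
rewrite addnS !big_ord_recr /=.
set P := \prod_(i < m + k) u i in IH *; set Q := \prod_(i < m + k) v i in IH *.
have -> : P * u (m + k)%N - \prod_(i < m) u i =
   (P - \prod_(i < m) u i) + P * (u (m + k)%N - 1) by ring.
apply: le_trans (nrmD _ _) _; rewrite nrmM.
have : nrm P * nrm (u (m + k)%N - 1) <= Q * (v (m + k)%N - 1).
  by apply: ler_pM; rewrite ?nrm_ge0 ?h ?pv.
lra.
Qed.

Lemma prod_cvC (x : nat -> C) (b : R) : (forall n, \sum_(i < n) nrm (x i) <= b) ->
  exists l, cvC (fun n => \prod_(i < n) (1 + x i)) l.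
Proof.
move=> h; apply: (@cvC_dominated _ (fun n => \prod_(i < n) (1 + nrm (x i))) (expR b)).
  move=> m n mn; apply: (@prod_dominated (fun i => 1 + x i) (fun i => 1 + nrm (x i))) => // i.
  by rewrite addrC addKr addrC addKr.
move=> n; apply: (@le_trans _ _ (\prod_(i < n) expR (nrm (x i)))).
  by apply: ler_prod => i _; rewrite expR_ge1Dx andbT; have := nrm_ge0 (x i); lra.
by rewrite -expR_sum ler_expR.
Qed.

Lemma sum_dominated (u : nat -> C) (m n : nat) : (m <= n)%N ->
  nrm (\sum_(i < n) u i - \sum_(i < m) u i) <=
  \sum_(i < n) nrm (u i) - \sum_(i < m) nrm (u i).
Proof.
move=> mn; rewrite -(subnKC mn); elim: (n - m)%N => [|k IH]; first by rewrite addn0 !subrr nrm0.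
rewrite addnS !big_ord_recr /= addrAC [X in _ <= X]addrAC.
by apply: le_trans (nrmD _ _) _; rewrite lerD2r.
Qed.

Lemma sum_cvC (u : nat -> C) (b : R) : (forall n, \sum_(i < n) nrm (u i) <= b) ->
  exists l, cvC (fun n => \sum_(i < n) u i) l.
Proof.
move=> h; apply: (@cvC_dominated _ (fun n => \sum_(i < n) nrm (u i)) b) => //.
by move=> m n mn; apply: sum_dominated.
Qed.

(** The increments of [p] are dominated by those of a bounded monotone double array, so [p] is
    Cauchy as both indices grow and both iterated limits are the joint limit. This is the exchange
    of limits behind z -> -1/z, for the lattice product and for the Eisenstein series alike. *)
Lemma iterated_limits (p : nat -> nat -> C) (v : nat -> nat -> R) (b : R)
    (r s : nat -> C) (L1 L2 : C) :
  (forall m n m' n', (m <= m')%N -> (n <= n')%N ->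
     nrm (p m' n' - p m n) <= v m' n' - v m n) ->
  (forall m n, v m n <= b) ->
  (forall m, cvC (p m) (r m)) -> (forall n, cvC (fun m => p m n) (s n)) ->
  cvC r L1 -> cvC s L2 -> L1 = L2.
Proof.
move=> hd hb hr hs h1 h2; apply: eq_nrm_small => e e0.
have vm m n m' n' : (m <= m')%N -> (n <= n')%N -> v m n <= v m' n'.
  by move=> hm hn; rewrite -subr_ge0; apply: le_trans (nrm_ge0 _) (hd _ _ _ _ hm hn).
have [k hk] : exists k, forall m n, (k <= m)%N -> (k <= n)%N -> nrm (p m n - p k k) <= e / 4.
  have ub : has_sup (range (fun k => v k k)).
    by split; [exists (v 0%N 0%N), 0%N | exists b => _ [k _ <-]].
  have e4 : 0 < e / 4 by lra.
  have [_ [k _ <-] hk] := sup_adherent e4 ub.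
  exists k => m n km kn; apply: le_trans (hd _ _ _ _ km kn) _.
  have : v m n <= sup (range (fun k => v k k)).
    apply: (@le_trans _ _ (v (maxn m n) (maxn m n))); first by apply: vm; lia.
    by apply: sup_upper_bound => //; exists (maxn m n).
  lra.
have a1 : nrm (L1 - p k k) <= e / 4.
  apply: (@cvC_le (fun m => r m - p k k) _ _ k); last by apply: cvCB => //; apply: cvC_cst.
  move=> m km; apply: (@cvC_le (fun n => p m n - p k k) _ _ k) => [n kn|]; first exact: hk.
  by apply: cvCB => //; apply: cvC_cst.
have a2 : nrm (L2 - p k k) <= e / 4.
  apply: (@cvC_le (fun m => s m - p k k) _ _ k); last by apply: cvCB => //; apply: cvC_cst.
  move=> m km; apply: (@cvC_le (fun n => p n m - p k k) _ _ k) => [n kn|]; first exact: hk.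
  by apply: cvCB => //; apply: cvC_cst.
have := nrmB_tri (p k k) L1 L2; rewrite [nrm (p k k - L2)]nrmBC; lra.
Qed.

End ComplexNorm.

(** * The complex exponential *)

Section ComplexExp.
Variable R : realType.
Local Notation C := R[i].
Implicit Types (z w : C) (x y : R).

Lemma expCD z w : expC (z + w) = expC z * expC w.
Proof.
case: z w => a b [c d]; rewrite /expC /= expRD cosD sinD.
apply/eqP; rewrite eq_complex /=; apply/andP; split; apply/eqP; ring.
Qed.

Lemma expC0 : expC (0 : C) = 1.
Proof. by rewrite /expC /= expR0 cos0 sin0 mul1r. Qed.

Lemma expCN z : expC (- z) = (expC z)^-1.
Proof.
have h : expC z * expC (- z) = 1 by rewrite -expCD subrr expC0.
have z0 : expC z != 0 by apply/eqP => z0; move/eqP: h; rewrite z0 mul0r eq_sym oner_eq0.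
by apply: (mulfI z0); rewrite h divff.
Qed.

Lemma expC_neq0 z : expC z != 0.
Proof.
have h : expC z * expC (- z) = 1 by rewrite -expCD subrr expC0.
by apply/eqP => z0; move/eqP: h; rewrite z0 mul0r eq_sym oner_eq0.
Qed.

Lemma expCB z w : expC (z - w) = expC z / expC w.
Proof. by rewrite expCD expCN. Qed.

Lemma expCX z n : expC z ^+ n = expC (n%:R * z).
Proof.
elim: n => [|n IH]; first by rewrite mul0r expC0.
by rewrite exprS IH -expCD -natr1 mulrDl mul1r addrC.
Qed.

Lemma expCz z (m : int) : expC z ^ m = expC (m%:~R * z).
Proof.
case: m => n; first by rewrite -exprnP expCX.
by rewrite NegzE -exprnN expCX -expCN rmorphN mulNr.
Qed.

Lemma expC_sum (I : Type) (r : seq I) (P : pred I) (f : I -> C) :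
  expC (\sum_(i <- r | P i) f i) = \prod_(i <- r | P i) expC (f i).
Proof. by apply: (big_morph (@expC R) expCD expC0). Qed.

Lemma nrm_expC z : nrm (expC z) = expR (complex.Re z).
Proof.
rewrite /expC nrmM nrm_real ger0_norm ?expR_ge0 // nrmE /= cos2Dsin2 sqrtr1 mulr1 //.
Qed.

Lemma two_pi_i_neq0 : two_pi_i R != 0.
Proof.
rewrite /two_pi_i !mulf_neq0 ?pnatr_eq0 //.
  by rewrite (inj_eq (@complexI R) _ 0) gt_eqF // pi_gt0.
by rewrite -nrm_eq0 nrm_i oner_eq0.
Qed.

Lemma nrm_two_pi_i : nrm (two_pi_i R) = 2 * pi.
Proof. by rewrite /two_pi_i !nrmM nrm_nat nrm_i nrm_real ger0_norm ?pi_ge0 // mulr1. Qed.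

Lemma Re_two_pi_i z : complex.Re (two_pi_i R * z) = - (2 * pi * complex.Im z).
Proof.
rewrite /two_pi_i natCE -mulrA -rmorphM /= -mulrA.
by case: z => a b /=; ring.
Qed.

Lemma qexpD z w : qexp (z + w) = qexp z * qexp w.
Proof. by rewrite /qexp mulrDr expCD. Qed.

Lemma qexpN z : qexp (- z) = (qexp z)^-1.
Proof. by rewrite /qexp mulrN expCN. Qed.

Lemma qexpB z w : qexp (z - w) = qexp z / qexp w.
Proof. by rewrite qexpD qexpN. Qed.

Lemma qexp0 : qexp (0 : C) = 1.
Proof. by rewrite /qexp mulr0 expC0. Qed.

Lemma qexp_neq0 z : qexp z != 0.
Proof. exact: expC_neq0. Qed.

Lemma qexpX z n : qexp z ^+ n = qexp (n%:R * z).
Proof. by rewrite /qexp expCX mulrCA. Qed.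

Lemma qexpz z (m : int) : qexp z ^ m = qexp (m%:~R * z).
Proof. by rewrite /qexp expCz mulrCA. Qed.

Lemma qexp1 : qexp (1 : C) = 1.
Proof.
rewrite /qexp mulr1 /two_pi_i natCE -rmorphM /= /expC /=.
have -> : 2 * pi * 0 - 0 * 1 = 0 :> R by ring.
have -> : 2 * pi * 1 + 0 * 0 = pi *+ 2 :> R by rewrite mulr2n; ring.
by rewrite expR0 sin2pi cos2pi mul1r.
Qed.

Lemma qexp_int (m : int) : qexp (m%:~R : C) = 1.
Proof. by have := qexpz 1 m; rewrite qexp1 exp1rz mulr1. Qed.

Lemma qexp_half : qexp (2^-1 : C) = -1.
Proof.
have -> : qexp (2^-1 : C) = expC (pi%:C%C * 'i%C).
  by rewrite /qexp /two_pi_i; congr expC; field; rewrite ?pnatr_eq0.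
rewrite /expC /=.
have -> : pi * 0 - 0 * 1 = 0 :> R by ring.
have -> : pi * 1 + 0 * 0 = pi :> R by ring.
rewrite expR0 cospi sinpi mul1r.
by apply/eqP; rewrite eq_complex /= oppr0 !eqxx.
Qed.

Lemma nrm_qexp z : nrm (qexp z) = expR (- (2 * pi * complex.Im z)).
Proof. by rewrite /qexp nrm_expC Re_two_pi_i. Qed.

Lemma nrm_qexp_lt1 z : 0 < complex.Im z -> nrm (qexp z) < 1.
Proof.
by move=> h; rewrite nrm_qexp expR_lt1 oppr_lt0 mulr_gt0 // mulr_gt0 // pi_gt0.
Qed.

Lemma sin_le_id x : 0 <= x -> sin x <= x.
Proof.
rewrite le_eqVlt => /predU1P[<-|x0]; first by rewrite sin0.
have [|c _] := @MVT R (@sin R) (@cos R) 0 x x0.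
  by apply: continuous_subspaceT => y; apply: continuous_sin.
rewrite sin0 !subr0 => ->.
by rewrite ler_piMl ?cos_le1 // ltW.
Qed.

Lemma abs_sin_le x : `|sin x| <= `|x|.
Proof.
wlog x0 : x / 0 <= x.
  move=> h; have [/h //|x0] := leP 0 x.
  by have := h (- x); rewrite sinN !normrN; apply; lra.
rewrite [X in _ <= X]ger0_norm // ler_norml sin_le_id // andbT.
have [x1|x1] := leP x 1.
  have : 0 <= sin x by apply: sin_ge0_pi; have := @pi_ge2 R; lra.
  lra.
by have := sin_geN1 x; lra.
Qed.

Lemma cos_ge_sq x : 1 - cos x <= x ^+ 2 / 2.
Proof.
have -> : x = (x / 2) *+ 2 by rewrite mulr2n; lra.
rewrite cos_mulr2n cos2sin2.
have : sin (x / 2) ^+ 2 <= (x / 2) ^+ 2.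
  by rewrite -real_normK ?num_real // -[X in _ <= X]real_normK ?num_real // ler_pXn2r ?nnegrE // abs_sin_le.
have -> : (x / 2 *+ 2) ^+ 2 / 2 = 2 * (x / 2) ^+ 2 by rewrite mulr2n; field.
rewrite !mulr2n; lra.
Qed.

Lemma abs_sin_sub x : `|x| <= 1 -> `|sin x - x| <= x ^+ 2.
Proof.
wlog x0 : x / 0 <= x.
  move=> h; have [/h //|x0] := leP 0 x => hx.
  have := h (- x); rewrite sinN normrN sqrrN => /(_ _ hx).
  by rewrite -opprD normrN; apply; lra.
move: x0; rewrite le_eqVlt => /predU1P[<-|x0]; first by rewrite sin0 subrr normr0 expr0n.
rewrite (gtr0_norm x0) => x1.
have [|c] := @MVT R (@sin R) (@cos R) 0 x x0.
  by apply: continuous_subspaceT => y; apply: continuous_sin.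
rewrite in_itv /= => /andP[c0 cx]; rewrite sin0 !subr0 => ->.
have -> : cos c * x - x = - (x * (1 - cos c)) by ring.
rewrite normrN normrM (gtr0_norm x0) ger0_norm; last by have := cos_le1 c; lra.
rewrite expr2 ler_wpM2l ?(ltW x0) //.
have := cos_ge_sq c; have : c ^+ 2 <= c by rewrite expr2; nra.
nra.
Qed.

(** Real and imaginary parts are estimated separately; the upper bound for the real exponential
    comes from exp(-a) >= 1 - a by inversion. *)
Lemma expC_taylor_small z : nrm z <= 2^-1 -> nrm (expC z - 1 - z) <= 5 * nrm z ^+ 2.
Proof.
move=> hz; have hr := le_trans (Re_le z) hz; have hi := le_trans (Im_le z) hz.
have z2 : nrm z ^+ 2 = complex.Re z ^+ 2 + complex.Im z ^+ 2.
  by rewrite nrmE sqr_sqrtr // addr_ge0 ?sqr_ge0.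
rewrite z2; move: hr hi; case: z {hz z2} => a b /= hr hi.
have e1 := expR_ge1Dx a.
have e2 : expR a <= 1 + a + 2 * a ^+ 2.
  have h1 : 0 < 1 - a by move: hr; rewrite ler_norml; lra.
  have h2 : expR a <= (1 - a)^-1.
    rewrite -[expR a]invrK -expRN lef_pV2 ?posrE ?expR_gt0 //.
    by have := expR_ge1Dx (- a); lra.
  apply: le_trans h2 _; rewrite -[X in X <= _]mul1r ler_pdivrMr //.
  move: hr; rewrite ler_norml; nra.
have e3 := cos_ge_sq b; have e4 := cos_le1 b.
have e5 : `|sin b - b| <= b ^+ 2 by apply: abs_sin_sub; lra.
have -> : expC (a +i* b)%C - 1 - (a +i* b)%C =
   ((expR a * (cos b - 1) + (expR a - 1 - a)) +i* (expR a * (sin b - b) + (expR a - 1) * b))%C.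
  apply/eqP; rewrite /expC eq_complex /=; apply/andP; split; apply/eqP; ring.
apply: le_trans (nrm_le _) _ => /=.
have ea : expR a <= 2 by move: hr; rewrite ler_norml; nra.
have ea0 := expR_gt0 a.
have t1 : `|expR a * (cos b - 1) + (expR a - 1 - a)| <= b ^+ 2 + 2 * a ^+ 2.
  have l1 : 0 <= expR a * (1 - cos b) by apply: mulr_ge0; lra.
  have l2 : expR a * (1 - cos b) <= 2 * (b ^+ 2 / 2) by apply: ler_pM; lra.
  have sa := sqr_ge0 a; have sb := sqr_ge0 b.
  rewrite ler_norml; lra.
have t2 : `|expR a * (sin b - b)| <= 2 * b ^+ 2.
  by rewrite normrM (gtr0_norm ea0); apply: ler_pM => //; rewrite ?ltW.
have t3 : `|(expR a - 1) * b| <= a ^+ 2 + b ^+ 2.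
  have ha : `|expR a - 1| <= 2 * `|a|.
    move: hr; have [a0|a0] := leP 0 a.
      rewrite (ger0_norm a0) ger0_norm; nra.
    rewrite (ltr0_norm a0) ler0_norm; first by nra.
    by rewrite subr_le0 expR_le1 ltW.
  rewrite normrM.
  apply: (@le_trans _ _ (2 * `|a| * `|b|)); first by rewrite ler_wpM2r.
  rewrite -[a ^+ 2]real_normK ?num_real // -[b ^+ 2]real_normK ?num_real //.
  have := sqr_ge0 (`|a| - `|b|); nra.
have := ler_normD (expR a * (sin b - b)) ((expR a - 1) * b).
have sa := sqr_ge0 a; have sb := sqr_ge0 b; lra.
Qed.

(* The estimates propagate from z to 2z through exp(2z) = exp(z)^2. *)
Lemma expC_bounds z : nrm (expC z - 1) <= 4 * nrm z * expR (nrm z) /\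
  nrm (expC z - 1 - z) <= 8 * nrm z ^+ 2 * expR (nrm z).
Proof.
have small w : nrm w <= 2^-1 -> nrm (expC w - 1) <= 4 * nrm w * expR (nrm w) /\
    nrm (expC w - 1 - w) <= 8 * nrm w ^+ 2 * expR (nrm w).
  move=> hw; have h := expC_taylor_small hw; have w0 := nrm_ge0 w.
  have e1 : 1 <= expR (nrm w) by have := expR_ge1Dx (nrm w); lra.
  have h1 : nrm (expC w - 1) <= 4 * nrm w.
    have := nrmB_ge (expC w - 1) w; nra.
  split; first by apply: le_trans h1 _; rewrite ler_peMr // mulr_ge0.
  apply: le_trans h _; apply: (@le_trans _ _ (8 * nrm w ^+ 2)).
    by have := sqr_ge0 (nrm w); lra.
  by rewrite ler_peMr // mulr_ge0 // sqr_ge0.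
have [k hk] : exists k, nrm z <= 2^-1 * 2 ^+ k.
  exists (Num.bound (nrm z)).+1.
  have := Num.Theory.archi_boundP (nrm_ge0 z); set n := Num.bound _ => h.
  apply: (le_trans (ltW h)); rewrite exprS mulrA mulVf ?mul1r ?pnatr_eq0 //.
  by rewrite -natrX ler_nat ltnW // ltn_expl.
elim: k z hk => [|k IH] z hk; first by apply: small; rewrite mulr1 in hk.
have zE : z = (z / 2) + (z / 2) by field.
set w := z / 2 in zE; have [] := IH w.
  by rewrite /w nrmM nrmV nrm_nat; rewrite exprS in hk; lra.
have nz : nrm z = 2 * nrm w by rewrite /w nrmM nrmV nrm_nat; lra.
have Ez : expC z = expC w * expC w by rewrite -expCD -zE.
rewrite Ez nz; set E := expC w; set n := nrm w; set x := expR n.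
have n0 : 0 <= n by apply: nrm_ge0.
have x1 : 1 <= x by have := expR_ge1Dx n; rewrite -/x; lra.
have ex : expR (2 * n) = x * x by rewrite mulr_natl mulr2n expRD.
move=> h1 h2; rewrite ex.
have nE : nrm E <= x by rewrite nrm_expC ler_expR; apply: le_trans (ler_norm _) (Re_le _).
split.
  have -> : E * E - 1 = (E - 1) * (E + 1) by ring.
  rewrite nrmM; have : nrm (E + 1) <= 2 * x by have := nrmD E 1; rewrite nrm1; lra.
  move=> h3; apply: (@le_trans _ _ ((4 * n * x) * (2 * x))); last by rewrite le_eqVlt; apply/orP; left; apply/eqP; ring.
  by apply: ler_pM; rewrite ?nrm_ge0.
have -> : E * E - 1 - z = (E - 1) ^+ 2 + 2 * (E - 1 - w) by rewrite {1}zE; ring.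
apply: le_trans (nrmD _ _) _; rewrite nrmX nrmM nrm_nat.
have : nrm (E - 1) ^+ 2 <= (4 * n * x) ^+ 2 by rewrite ler_pXn2r ?nnegrE ?nrm_ge0 // !mulr_ge0 // ltW // expR_gt0.
have : 8 * n ^+ 2 * x <= 8 * n ^+ 2 * (x * x).
  by apply: ler_wpM2l; [rewrite mulr_ge0 // sqr_ge0 | rewrite ler_peMl // ltW // expR_gt0].
have -> : (4 * n * x) ^+ 2 = 16 * n ^+ 2 * (x * x) by ring.
have -> : 8 * (2 * n) ^+ 2 * (x * x) = 32 * n ^+ 2 * (x * x) by ring.
lra.
Qed.

End ComplexExp.

(** * Tannery's theorem and power sums *)

Section Tannery.
Variable R : realType.
Local Notation C := R[i].

Lemma prod_ge1_bounded (m : nat -> R) (b : R) :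
  (forall r, 0 <= m r) -> (forall n, \sum_(r < n) m r <= b) ->
  forall n, \prod_(r < n) (1 + m r) <= expR b.
Proof.
move=> m0 hb n; apply: (@le_trans _ _ (\prod_(i < n) expR (m i))).
  by apply: ler_prod => i _; rewrite expR_ge1Dx andbT; have := m0 i; lra.
by rewrite -expR_sum ler_expR.
Qed.

Lemma bounded_tail (v : nat -> R) (b e : R) : (forall m n, (m <= n)%N -> v m <= v n) ->
  (forall n, v n <= b) -> 0 < e -> exists k, forall n, (k <= n)%N -> v n - v k <= e.
Proof.
move=> vm vb e0.
have ub : has_sup (range v) by split; [exists (v 0%N), 0%N | exists b => _ [k _ <-]].
have [_ [k _ <-] hk] := sup_adherent e0 ub; exists k => n kn.
have : v n <= sup (range v) by apply: sup_upper_bound => //; exists n.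
lra.
Qed.

Lemma cvC_eventually (u v : nat -> C) l n0 : (forall n, (n0 <= n)%N -> u n = v n) ->
  cvC u l -> cvC v l.
Proof.
move=> uv h e e0; have [n1 hn] := h e e0; exists (maxn n0 n1) => n.
by rewrite geq_max => /andP[le0 le1]; rewrite -uv // hn.
Qed.

(** Past an index k chosen from the majorant product, all the products differ little from their
    first k factors, uniformly in K; those finitely many factors converge. *)
Lemma tannery_prod (x : nat -> nat -> C) (y : nat -> C) (m : nat -> R) (b : R) (L : C) :
  (forall K r, nrm (x K r) <= m r) -> (forall n, \sum_(r < n) m r <= b) ->
  (forall r, cvC (x ^~ r) (y r)) ->
  cvC (fun K => \prod_(r < K) (1 + x K r)) L -> cvC (fun K => \prod_(r < K) (1 + y r)) L.
Proof.
move=> xm mb xy hL.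
have m0 r : 0 <= m r by apply: le_trans (nrm_ge0 _) (xm 0%N r).
have ym r : nrm (y r) <= m r by apply: (@cvC_le _ (x ^~ r) _ _ 0%N) => // n _.
have [L' hL'] : exists L', cvC (fun K => \prod_(r < K) (1 + y r)) L'.
  apply: (@prod_cvC _ y b) => n; apply: le_trans (mb n); exact: ler_sum.
suff -> : L = L' by [].
apply: eq_nrm_small => e e0; have e4 : 0 < e / 4 by lra.
pose v n := \prod_(r < n) (1 + m r).
have vm i j : (i <= j)%N -> v i <= v j.
  move=> ij; rewrite -subr_ge0; apply: le_trans (nrm_ge0 _) _; last first.
    apply: (@prod_dominated _ (fun r => 1 + (m r)%:C%C) (fun r => 1 + m r)) ij => r.
    by rewrite addrC addKr nrm_real ger0_norm // addrC addKr.
have [k hk] := bounded_tail vm (prod_ge1_bounded m0 mb) e4.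
have dom (f : nat -> C) K : (forall r, nrm (f r) <= m r) -> (k <= K)%N ->
    nrm (\prod_(r < K) (1 + f r) - \prod_(r < k) (1 + f r)) <= e / 4.
  move=> fm kK; apply: le_trans (hk K kK).
  apply: (@prod_dominated _ (fun r => 1 + f r) (fun r => 1 + m r)) => // r.
  by rewrite addrC addKr addrC addKr.
have hf : cvC (fun K => \prod_(r < k) (1 + x K r)) (\prod_(r < k) (1 + y r)).
  apply: (@cvC_prod _ _ _ (fun r K => 1 + x K (nat_of_ord r))) => r; apply: cvCD => //; exact: cvC_cst.
have a1 : nrm (L - \prod_(r < k) (1 + y r)) <= e / 4.
  apply: (@cvC_le _ (fun K => \prod_(r < K) (1 + x K r) - \prod_(r < k) (1 + x K r)) _ _ k).
    by move=> K kK; apply: dom.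
  exact: cvCB.
have a2 : nrm (L' - \prod_(r < k) (1 + y r)) <= e / 4.
  apply: (@cvC_le _ (fun K => \prod_(r < K) (1 + y r) - \prod_(r < k) (1 + y r)) _ _ k).
    by move=> K kK; apply: dom.
  by apply: cvCB => //; apply: cvC_cst.
have := nrmB_tri (\prod_(r < k) (1 + y r)) L L'.
rewrite [nrm (\prod_(r < k) (1 + y r) - L')]nrmBC; lra.
Qed.

Lemma sum_inv_sqr n : \sum_(r < n) (r.+1%:R ^+ 2)^-1 <= 2 :> R.
Proof.
case: n => [|n]; first by rewrite big_ord0.
suff h : \sum_(r < n.+1) (r.+1%:R ^+ 2)^-1 <= 2 - n.+1%:R^-1 :> R.
  by apply: le_trans h _; rewrite gerBl invr_ge0.
elim: n => [|n IH]; first by rewrite big_ord1 expr1n invr1; lra.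
rewrite big_ord_recr /=; apply: le_trans (lerD IH (lexx _)) _.
have n0 : 0 < n.+1%:R :> R by [].
rewrite -[n.+2%:R]natr1; set x : R := n.+1%:R in n0 *.
rewrite -subr_ge0.
have -> : 2 - (x + 1)^-1 - (2 - x^-1 + ((x + 1) ^+ 2)^-1) = (x * (x + 1) ^+ 2)^-1.
  by field; rewrite !gt_eqF //; lra.
by rewrite invr_ge0 mulr_ge0 ?sqr_ge0 // ltW.
Qed.

(** Abel summation: multiplying by 1 - r replaces (t+1)^(k+1) by its difference, which is at most
    (k+1)(t+1)^k. *)
Lemma geom_pow_bounded (k : nat) (r : R) : 0 <= r < 1 ->
  exists b, forall n, \sum_(t < n) t.+1%:R ^+ k * r ^+ t <= b.
Proof.
move=> /andP[r0 r1]; elim: k => [|k [b hb]].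
  exists (1 - r)^-1 => n; under eq_bigr => t _ do rewrite expr0 mul1r.
  rewrite -[X in _ <= X]mul1r ler_pdivlMr ?subr_gt0 // mulrC -[X in _ <= X]opprK.
  have := subrX1 r n; have := exprn_ge0 n r0; lra.
exists (k.+1%:R * b / (1 - r)) => n.
rewrite ler_pdivlMr ?subr_gt0 // mulrBr mulr1.
have shift : \sum_(t < n) t%:R ^+ k.+1 * r ^+ t <= (\sum_(t < n) t.+1%:R ^+ k.+1 * r ^+ t) * r.
  case: n => [|n]; first by rewrite !big_ord0 mul0r.
  rewrite big_ord_recl /= expr0n /= mul0r add0r [X in _ <= X * _]big_ord_recr /= mulrDl.
  rewrite big_distrl /= ler_wpDr //.
    by rewrite !mulr_ge0 ?exprn_ge0.
  by apply: ler_sum => t _; rewrite -mulrA -exprSr.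
apply: (@le_trans _ _ (\sum_(t < n) (t.+1%:R ^+ k.+1 - t%:R ^+ k.+1) * r ^+ t)).
  by under [X in _ <= X]eq_bigr => t _ do rewrite mulrBl; rewrite sumrB; lra.
apply: (@le_trans _ _ (\sum_(t < n) k.+1%:R * (t.+1%:R ^+ k * r ^+ t))); last first.
  by rewrite -mulr_sumr ler_wpM2l.
apply: ler_sum => t _; rewrite mulrA ler_wpM2r ?exprn_ge0 //.
rewrite subrXX -[t.+1%:R - t%:R]natrB // subSn // subnn mul1r.
rewrite -[k.+1 in X in _ <= X]card_ord -sumr_const mulr_suml; apply: ler_sum => i _; rewrite mul1r.
rewrite -[X in _ <= _ ^+ X](@subnK i k) -1?ltnS // exprD.
by rewrite ler_wpM2l ?exprn_ge0 // lerXn2r ?nnegrE // ler_nat.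
Qed.

End Tannery.

(** * The sine product *)

Section Sine.
Variable R : realType.
Local Notation C := R[i].
Implicit Types (v a x y : C).

(** This is 2i sin(pi v), in exponential form because v is complex. *)
Definition sn (v : C) : C := qexp (v / 2) - qexp (- (v / 2)).

Lemma snN v : sn (- v) = - sn v.
Proof. by rewrite /sn mulNr opprK opprB. Qed.

Lemma sn_mul x y : sn (x + y) * sn (x - y) = sn x ^+ 2 - sn y ^+ 2.
Proof.
rewrite /sn !mulrDl mulNr !opprD !opprK !qexpD !qexpN.
have := qexp_neq0 (x / 2); have := qexp_neq0 (y / 2).
set a := qexp (x / 2); set b := qexp (y / 2) => b0 a0.
by field; rewrite a0 b0.
Qed.

Lemma sn_sqr a : sn a ^+ 2 = (1 - qexp a) ^+ 2 / qexp a.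
Proof.
have -> : qexp a = qexp (a / 2) ^+ 2 by rewrite qexpX; congr qexp; field.
rewrite /sn qexpN; have := qexp_neq0 (a / 2); set b := qexp _ => b0.
by field.
Qed.

Lemma sn_neq0 a : 0 < complex.Im a -> sn a != 0.
Proof.
move=> ha; rewrite -sqrf_eq0 sn_sqr mulf_eq0 invr_eq0 (negbTE (qexp_neq0 a)) orbF sqrf_eq0.
rewrite subr_eq0; apply/eqP => /(congr1 (@nrm R)); rewrite nrm1 => e.
by have := nrm_qexp_lt1 ha; rewrite -e ltxx.
Qed.

Lemma sn_real (t : R) : sn (t%:C%C) = 2 * 'i%C * (sin (pi * t))%:C%C.
Proof.
have -> : sn t%:C%C = expC (0 +i* (pi * t))%C - expC (0 +i* (- (pi * t)))%C.
  have e1 : two_pi_i R * (t%:C%C / 2) = (0 +i* (pi * t))%C.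
    have -> : two_pi_i R * (t%:C%C / 2) = (pi * t)%:C%C * 'i%C.
      by rewrite /two_pi_i rmorphM /=; field.
    by apply/eqP; rewrite eq_complex /=; apply/andP; split; apply/eqP; ring.
  rewrite /sn /qexp mulrN e1; congr (_ - expC _).
  by apply/eqP; rewrite eq_complex /= oppr0 !eqxx.
rewrite /expC /= expR0 cosN sinN natCE; apply/eqP; rewrite eq_complex /=.
by apply/andP; split; apply/eqP; ring.
Qed.

Lemma nrm_sn_real (t : R) : nrm (sn t%:C%C) = 2 * `|sin (pi * t)|.
Proof. by rewrite sn_real !nrmM nrm_i nrm_real nrm_nat mulr1. Qed.

Lemma sin_ge_linear (x : R) : 0 <= x <= pi / 2 -> x / 8 <= sin x.
Proof.
move=> /andP[x0 xp]; have p2 := @pihalf_lt2 R.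
have half (y : R) : 0 <= y <= 2^-1 -> y / 2 <= sin y.
  move=> hy; have : `|sin y - y| <= y ^+ 2 by apply: abs_sin_sub; rewrite ger0_norm; lra.
  rewrite ler_norml; nra.
have [h|h] := leP x 2^-1; first by have := half x; lra.
have h2 : 2^-1 / 2 <= sin (2^-1) :> R by apply: half; lra.
have : sin (2^-1) < sin x by rewrite ltr_sin // in_itv /=; apply/andP; split; lra.
lra.
Qed.

Lemma ratCE (i n : nat) : (i%:R / n%:R : C) = ((i%:R / n%:R : R)%:C)%C.
Proof. by rewrite rmorphM fmorphV /= !rmorph_nat. Qed.

Lemma nrm_sn_ratio (i n : nat) : (i.*2 <= n)%N -> (0 < n)%N ->
  i%:R / (2 * n%:R) <= nrm (sn (i%:R / n%:R)).
Proof.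
move=> h n0; rewrite ratCE nrm_sn_real.
have nz : 0 < n%:R :> R by rewrite ltr0n.
have p0 := @pi_ge2 R.
have i0 : 0 <= i%:R / n%:R :> R by rewrite divr_ge0.
have ih : i%:R / n%:R <= 2^-1 :> R.
  by rewrite ler_pdivrMr // mulrC -[X in _ <= X]/(n%:R / 2) ler_pdivlMr // mulrC -natrM ler_nat mul2n.
have : pi * (i%:R / n%:R) / 8 <= sin (pi * (i%:R / n%:R)) :> R by apply: sin_ge_linear; nra.
have -> : i%:R / (2 * n%:R) = (i%:R / n%:R) / 2 :> R by field; rewrite gt_eqF.
have := ler_norm (sin (pi * (i%:R / n%:R)) : R); nra.
Qed.

Lemma qexp_prim n : (0 < n)%N -> n.-primitive_root (qexp (n%:R^-1 : C)).
Proof.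
move=> n0; have nz : n%:R != 0 :> C by rewrite pnatr_eq0 -lt0n.
apply/andP; split=> //; apply/forallP => i; rewrite unity_rootE qexpX.
have [->|lt] := eqVneq i.+1 n; first by rewrite divff // qexp1 eqxx.
rewrite (_ : _ == 1 = false) //; apply/negbTE/eqP => e.
have : sn (i.+1%:R / n%:R) ^+ 2 == 0 by rewrite sn_sqr e subrr expr0n mul0r.
rewrite sqrf_eq0 -nrm_eq0 ratCE nrm_sn_real mulf_eq0 pnatr_eq0 /= normr_eq0 gt_eqF //.
have i1 : 0 < i.+1%:R / n%:R :> R by rewrite divr_gt0 ?ltr0n.
have i2 : i.+1%:R / n%:R < 1 :> R.
  by rewrite ltr_pdivrMr ?ltr0n // mul1r ltr_nat; have := ltn_ord i; lia.
have := @pi_gt0 R => p0; apply: sin_gt0_pi; nra.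
Qed.

Lemma sn_small v : nrm v <= 1 -> nrm (sn v - two_pi_i R * v) <= 16 * (2 * pi) ^+ 2 * expR (2 * pi) * nrm v ^+ 2.
Proof.
move=> hv; rewrite /sn /qexp mulrN; set x := two_pi_i R * (v / 2).
have nx : nrm x = pi * nrm v by rewrite /x nrmM nrm_two_pi_i nrmM nrmV nrm_nat; field.
have -> : expC x - expC (- x) - two_pi_i R * v = (expC x - 1 - x) - (expC (- x) - 1 - (- x)).
  have -> : two_pi_i R * v = x + x by rewrite /x; field.
  by ring.
have [_ h1] := expC_bounds x; have [_ h2] := expC_bounds (- x).
apply: le_trans (nrmD _ _) _; rewrite nrmN; rewrite nrmN in h2.
apply: (le_trans (lerD h1 h2)); rewrite nx.
have p0 := @pi_gt0 R; have v0 := nrm_ge0 v.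
have : expR (pi * nrm v) <= expR (2 * pi) by rewrite ler_expR; nra.
set A := expR (pi * nrm v); set B := expR (2 * pi) => AB.
have -> : 8 * (pi * nrm v) ^+ 2 * A + 8 * (pi * nrm v) ^+ 2 * A = (16 * (pi * nrm v) ^+ 2) * A by ring.
have -> : 16 * (2 * pi) ^+ 2 * B * nrm v ^+ 2 = (16 * (2 * pi * nrm v) ^+ 2) * B by ring.
apply: ler_pM => //; first by rewrite mulr_ge0 // sqr_ge0.
  exact: expR_ge0.
have -> : (2 * pi * nrm v) ^+ 2 = 4 * (pi * nrm v) ^+ 2 by ring.
by have := sqr_ge0 (pi * nrm v); lra.
Qed.

Lemma sn_scaled_cvC v (f : nat -> nat) : (forall K, (K <= f K)%N) ->
  cvC (fun K => (f K).+1%:R * sn (v / (f K).+1%:R)) (two_pi_i R * v).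
Proof.
move=> hf; set M := 16 * (2 * pi) ^+ 2 * expR (2 * pi) : R.
have h : cvC (fun n => n.+1%:R * sn (v / n.+1%:R)) (two_pi_i R * v); last exact: (cvC_sub hf h).
move=> e e0; have M0 : 0 <= M.
  by apply: mulr_ge0; [apply: mulr_ge0 => //; exact: sqr_ge0 | exact: expR_ge0].
have v0 := nrm_ge0 v.
have d0 : 0 < e / (M * nrm v ^+ 2 + 1) by apply: divr_gt0 => //; have := sqr_ge0 (nrm v); nra.
have [n0 hn] := @cvC_invn R _ d0; have d1 : 0 < (nrm v + 1)^-1 by rewrite invr_gt0; lra.
have [n1 hn1] := @cvC_invn R _ d1.
exists (maxn n0 n1) => n; rewrite geq_max => /andP[le0 le1].
have := hn n le0; have := hn1 n le1; rewrite subr0 nrmV nrm_nat; set x : R := n.+1%:R.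
have x0 : 0 < x by []; move=> hx1 hx2.
have nz : n.+1%:R != 0 :> C by rewrite pnatr_eq0.
have -> : n.+1%:R * sn (v / n.+1%:R) - two_pi_i R * v =
   n.+1%:R * (sn (v / n.+1%:R) - two_pi_i R * (v / n.+1%:R)).
  by move: nz; set y : C := n.+1%:R => nz; field.
have nv : nrm (v / n.+1%:R) = nrm v / x by rewrite nrmM nrmV nrm_nat.
rewrite nrmM nrm_nat -/x.
have hs : nrm (v / n.+1%:R) <= 1.
  rewrite nv ler_pdivrMr // mul1r.
  move: hx1; rewrite ltf_pV2 ?posrE //; lra.
have := sn_small hs; rewrite -/M nv => h3.
apply: (@le_lt_trans _ _ (x * (M * (nrm v / x) ^+ 2))); first by rewrite ler_pM2l.
have -> : x * (M * (nrm v / x) ^+ 2) = (M * nrm v ^+ 2) * x^-1 by field; rewrite gt_eqF.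
have x1 : 0 < x^-1 by rewrite invr_gt0.
move: hx2; rewrite ltr_pdivlMr; last by have := sqr_ge0 (nrm v); nra.
move=> h5; apply: le_lt_trans h5; rewrite mulrC ler_pM2l //; lra.
Qed.

(** Euler's argument: the sine of n = 2K + 1 times an angle is a finite product of sines, and
    Tannery's theorem lets K tend to infinity. *)
Lemma sine_product v :
  cvC (fun K => two_pi_i R * v * \prod_(r < K) (1 - v ^+ 2 / r.+1%:R ^+ 2)) (sn v).
Proof.
have [->|v0] := eqVneq v 0.
  rewrite mulr0; apply: (eq_cvC (u := fun=> 0)); first by move=> n; rewrite mul0r.
  by rewrite /sn mul0r oppr0 subrr; apply: cvC_cst.
pose n K := K.*2.+1.
have nz K : (n K)%:R != 0 :> C by rewrite pnatr_eq0.
(* The finite product: [prod_sine_full] at exp(pi i v / n), with [prod_sine_half] accounting for the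
   factor n. *)
have fin K : sn v = (n K)%:R * sn (v / (n K)%:R) *
   \prod_(r < K) (1 - sn (v / (n K)%:R) ^+ 2 / sn (r.+1%:R / (n K)%:R) ^+ 2).
  pose x : C := qexp ((n K)%:R^-1 / 2).
  have x0 : x != 0 by apply: qexp_neq0.
  have px : (K.*2.+1).-primitive_root (x ^+ 2).
    rewrite /x qexpX; have -> : 2 * ((n K)%:R^-1 / 2) = (n K)%:R^-1 :> C by field; rewrite nz.
    exact: qexp_prim.
  pose a := qexp (v / (n K)%:R / 2); have a0 : a != 0 by apply: qexp_neq0.
  have := prod_sine_full x0 a0 px.
  have -> : a ^+ K.*2.+1 - a ^- K.*2.+1 = sn v.
    rewrite /a qexpX /sn qexpN; congr (qexp _ - (qexp _)^-1); rewrite -/(n K); field; exact: nz.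
  move=> <-; rewrite /sprod /= ?oppr0 !expr0z !mul1r.
  have cE := prod_sine_half x0 px; rewrite -/(n K) in cE.
  rewrite -[X in _ = X * _ * _]cE mulrAC -big_split /= [RHS]mulrC.
  have snx : sn (v / (n K)%:R) = a - a^-1 by rewrite /sn qexpN.
  rewrite -snx; congr (_ * _); apply: eq_bigr => r _.
  have sr : sn (r.+1%:R / (n K)%:R) = x ^+ r.+1 - x ^- r.+1.
    rewrite /sn qexpN /x qexpX; congr (qexp _ - (qexp _)^-1); field; exact: nz.
  have sr0 : sn (r.+1%:R / (n K)%:R) != 0.
    rewrite -nrm_eq0 gt_eqF //; apply: lt_le_trans (nrm_sn_ratio _ _) => //.
      by rewrite divr_gt0 ?mulr_gt0 ?ltr0n.
    by rewrite /n; have := ltn_ord r; lia.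
  rewrite -sr; set w := sn (r.+1%:R / _) in sr0 *.
  have -> : - w ^+ 2 * (1 - sn (v / (n K)%:R) ^+ 2 / w ^+ 2) = sn (v / (n K)%:R) ^+ 2 - w ^+ 2.
    by field.
  rewrite snx /w sr opprK -!exprnN -!exprnP.
  have X0 : x ^+ r.+1 != 0 by rewrite expf_neq0.
  by move: X0; set X := x ^+ r.+1 => X0; field; rewrite a0 X0.
have lim1 : cvC (fun K => (n K)%:R * sn (v / (n K)%:R)) (two_pi_i R * v).
  by apply: (@sn_scaled_cvC v double) => K; rewrite -addnn leq_addr.
have tv0 : two_pi_i R * v != 0 by rewrite mulf_neq0 // two_pi_i_neq0.
suff h : cvC (fun K => \prod_(r < K) (1 - v ^+ 2 / r.+1%:R ^+ 2)) (sn v / (two_pi_i R * v)).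
  have := cvCMl (two_pi_i R * v) h; rewrite mulrCA divff // mulr1 //.
(* Beyond r = K the correction is set to 0, so that the majorant may be required for all K and r. *)
pose x K r : C := if (r < K)%N then - (sn (v / (n K)%:R) ^+ 2 / sn (r.+1%:R / (n K)%:R) ^+ 2) else 0.
(* A bound of n sn(v/n) uniform in K. Against the lower bound r/(2n) for sn(r/n), it gives the
   majorant 4 B^2 / r^2. *)
have [B hB] : exists B, forall K, nrm ((n K)%:R * sn (v / (n K)%:R)) <= B.
  pose b := 8 * pi * nrm v * expR (pi * nrm v) : R.
  exists b => K; rewrite nrmM nrm_nat /sn /qexp mulrN.
  set y := two_pi_i R * _; have ny : nrm y = pi * nrm v / (n K)%:R.
    by rewrite /y nrmM nrm_two_pi_i !nrmM !nrmV !nrm_nat; field; rewrite pnatr_eq0.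
  have n0 : 0 < (n K)%:R :> R by rewrite ltr0n.
  have [h1 _] := expC_bounds y; have [h2 _] := expC_bounds (- y).
  have -> : expC y - expC (- y) = (expC y - 1) - (expC (- y) - 1) by ring.
  have h3 := nrmD (expC y - 1) (- (expC (- y) - 1)); rewrite !nrmN in h2 h3.
  have p0 := @pi_gt0 R; have nv0 := nrm_ge0 v.
  have h4 : nrm (expC y - 1 - (expC (- y) - 1)) <= 8 * nrm y * expR (nrm y) by lra.
  apply: (@le_trans _ _ ((n K)%:R * (8 * nrm y * expR (nrm y)))); first by rewrite ler_pM2l.
  rewrite ny; have -> : (n K)%:R * (8 * (pi * nrm v / (n K)%:R) * expR (pi * nrm v / (n K)%:R)) =
     (8 * pi * nrm v) * expR (pi * nrm v / (n K)%:R) by field; rewrite gt_eqF.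
  have c0 : 0 <= pi * nrm v by nra.
  rewrite /b ler_wpM2l ?ler_expR ?ler_pdivrMr //; first by nra.
  by rewrite ler_peMr // ler1n.
have B0 : 0 <= B by apply: le_trans (nrm_ge0 _) (hB 0%N).
apply: (@tannery_prod _ x (fun r => - (v ^+ 2 / r.+1%:R ^+ 2))
          (fun r => 4 * B ^+ 2 / r.+1%:R ^+ 2) (4 * B ^+ 2 * 2)).
- move=> K r; rewrite /x; case: ifP => hr; last first.
    by rewrite nrm0 divr_ge0 ?sqr_ge0 // mulr_ge0 ?sqr_ge0.
  rewrite nrmN nrmM nrmV !nrmX.
  have n0 : 0 < (n K)%:R :> R by rewrite ltr0n.
  have h1 : nrm (sn (v / (n K)%:R)) <= B / (n K)%:R.
    by rewrite ler_pdivlMr // mulrC; have := hB K; rewrite nrmM nrm_nat.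
  have h2 : r.+1%:R / (2 * (n K)%:R) <= nrm (sn (r.+1%:R / (n K)%:R)).
    by apply: nrm_sn_ratio => //; rewrite /n; lia.
  have r0 : 0 < r.+1%:R / (2 * (n K)%:R) :> R by rewrite divr_gt0 ?mulr_gt0 ?ltr0n.
  have -> : 4 * B ^+ 2 / r.+1%:R ^+ 2 = (B / (n K)%:R) ^+ 2 * ((r.+1%:R / (2 * (n K)%:R)) ^+ 2)^-1.
    have alg (p q : R) : p != 0 -> q != 0 -> 4 * B ^+ 2 / p ^+ 2 = (B / q) ^+ 2 * ((p / (2 * q)) ^+ 2)^-1.
      by move=> p0 q0; field; rewrite ?p0 ?q0.
    by apply: alg; rewrite ?pnatr_eq0 // gt_eqF.
  apply: ler_pM; rewrite ?exprn_ge0 ?invr_ge0 ?exprn_ge0 ?nrm_ge0 //.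
    by rewrite ler_pXn2r ?nnegrE ?nrm_ge0 // divr_ge0 // ltW.
  rewrite lef_pV2 ?posrE ?exprn_gt0 //; last by apply: lt_le_trans h2.
  by rewrite ler_pXn2r ?nnegrE ?nrm_ge0 // ltW.
- move=> m; rewrite -mulr_sumr ler_wpM2l ?mulr_ge0 ?sqr_ge0 //; exact: sum_inv_sqr.
- move=> r; have rz : r.+1%:R != 0 :> C by rewrite pnatr_eq0.
  have tz := two_pi_i_neq0 R.
  have -> : - (v ^+ 2 / r.+1%:R ^+ 2) = - ((two_pi_i R * v) ^+ 2 / (two_pi_i R * r.+1%:R) ^+ 2).
    by move: (r.+1%:R : C) rz => p p0; field; rewrite ?p0 ?tz.
  (* The r-th correction is the padding value 0 until K exceeds r. *)
  apply: (@cvC_shift _ _ _ r.+1).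
  have hf K : (K <= (K + r.+1).*2)%N by lia.
  apply: eq_cvC (cvCN (cvCM (cvCX 2 (@sn_scaled_cvC v (fun K => (K + r.+1).*2) hf))
     (cvCV _ (cvCX 2 (@sn_scaled_cvC r.+1%:R (fun K => (K + r.+1).*2) hf))))).
    move=> K; rewrite /x (_ : (r < K + r.+1)%N) ?leq_addl // -/(n (K + r.+1)%N).
    by rewrite !exprMn invfM; congr (- _); rewrite mulrACA divff ?mul1r // expf_neq0.
  by rewrite expf_neq0 // mulf_neq0.
have tv1 : 0 < nrm (two_pi_i R * v) by rewrite lt_def nrm_eq0 tv0 nrm_ge0.
have [k hk] := lim1 _ tv1.
apply: (@cvC_eventually _ (fun K => sn v / ((n K)%:R * sn (v / (n K)%:R))) _ _ k); last first.
  by apply: cvCMl; apply: cvCV.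
move=> K kK.
have s0 : (n K)%:R * sn (v / (n K)%:R) != 0.
  apply/eqP => e; have := hk K kK; rewrite e sub0r nrmN ltxx //.
apply: (mulfI s0); rewrite mulrCA divff // mulr1 {1}(fin K); congr (_ * _).
by apply: eq_bigr => r _; rewrite /x ltn_ord.
Qed.

End Sine.

(** * Strong derivatives *)

Section StrongDerivative.
Variable R : realType.
Local Notation C := R[i].
Implicit Types (f g : C -> C) (z l : C).

(** A first-order expansion with quadratic remainder on a disc. It is stronger than
    differentiability and passes to the sum of a series as soon as the constants are summable
    ([sder_series]), without Cauchy's integral formula. *)
Definition sder f z l : Prop := exists d M : R, 0 < d /\
  forall h, nrm h <= d -> nrm (f (z + h) - f z - h * l) <= M * nrm h ^+ 2.

Lemma sder_uniq f z l l' : sder f z l -> sder f z l' -> l = l'.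
Proof.
move=> [d [M [d0 H]]] [d' [M' [d'0 H']]]; apply: eq_nrm_small => e e0.
pose t := Num.min (Num.min d d') (e / (`|M| + `|M'| + 1)).
have M0 : 0 < `|M| + `|M'| + 1 by have := normr_ge0 M; have := normr_ge0 M'; lra.
have t0 : 0 < t by rewrite !lt_min d0 d'0 divr_gt0.
have td : t <= d by rewrite /t !ge_min lexx.
have td' : t <= d' by rewrite /t !ge_min lexx orbT.
have te : t <= e / (`|M| + `|M'| + 1) by rewrite /t !ge_min lexx !orbT.
have nt : nrm t%:C%C = t by rewrite nrm_real gtr0_norm.
have := H t%:C%C; have := H' t%:C%C; rewrite nt => /(_ td') h' /(_ td) h.
have e1 : t%:C%C * (l - l') =
  (f (z + t%:C%C) - f z - t%:C%C * l') - (f (z + t%:C%C) - f z - t%:C%C * l) by ring.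
have h1 : t * nrm (l - l') <= (M + M') * t ^+ 2.
  rewrite -{1}nt -nrmM e1; apply: le_trans (nrmD _ _) _; rewrite nrmN; lra.
have h2 : nrm (l - l') <= (M + M') * t.
  by rewrite -(ler_pM2l t0) (le_trans h1) // expr2 mulrCA mulrA.
apply: le_trans h2 _; apply: (@le_trans _ _ ((`|M| + `|M'| + 1) * t)).
  by rewrite ler_pM2r //; have := ler_norm M; have := ler_norm M'; lra.
by rewrite mulrC -ler_pdivlMr.
Qed.

Lemma eq_sder f g z l d : 0 < d -> (forall h, nrm h <= d -> f (z + h) = g (z + h)) ->
  sder f z l -> sder g z l.
Proof.
move=> d0 fg [d' [M [d'0 H]]]; exists (Num.min d d'), M; split; first by rewrite lt_min d0.
move=> h; rewrite le_min => /andP[hd hd'].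
have := fg 0; rewrite addr0 nrm0 (ltW d0) => <- //; rewrite -fg // H //.
Qed.

Lemma sder_lin f z l c : sder f z l -> sder (fun x => c * f x) z (c * l).
Proof.
move=> [d [M [d0 H]]]; exists d, (nrm c * M); split=> // h hd.
have -> : c * f (z + h) - c * f z - h * (c * l) = c * (f (z + h) - f z - h * l) by ring.
by rewrite nrmM -mulrA ler_wpM2l ?nrm_ge0 // H.
Qed.

Lemma sder_series (u : nat -> C -> C) f z (l : nat -> C) L (m : nat -> R) b d :
  0 < d -> (forall h, nrm h <= d -> cvC (fun n => \sum_(i < n) u i (z + h)) (f (z + h))) ->
  cvC (fun n => \sum_(i < n) l i) L ->
  (forall i h, nrm h <= d -> nrm (u i (z + h) - u i z - h * l i) <= m i * nrm h ^+ 2) ->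
  (forall n, \sum_(i < n) m i <= b) -> sder f z L.
Proof.
move=> d0 hf hL hu hb; exists d, b; split=> // h hd.
have h0 := hf 0; rewrite addr0 nrm0 (ltW d0) in h0; have {h0} := h0 isT => h0.
apply: (@cvC_le _ (fun n => \sum_(i < n) u i (z + h) - \sum_(i < n) u i z - h * \sum_(i < n) l i) _ _ 0%N).
  move=> n _; rewrite mulr_sumr -!sumrB; apply: le_trans (nrm_sum _ _ _) _.
  apply: (@le_trans _ _ (\sum_(i < n) m i * nrm h ^+ 2)); first by apply: ler_sum => i _; apply: hu.
  by rewrite -mulr_suml ler_wpM2r ?exprn_ge0 ?nrm_ge0.
by apply: cvCB; [apply: cvCB => //; apply: hf | apply: cvCMl].
Qed.

End StrongDerivative.

(** * Lipschitz' formula *)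

Section Lipschitz.
Variable R : realType.
Local Notation C := R[i].
Implicit Types (a v z h : C).

Lemma Im_addr_real a (x : R) : complex.Im (a + x%:C%C) = complex.Im a.
Proof. by rewrite raddfD /= addr0. Qed.

Lemma Im_neq0 a : complex.Im a != 0 -> a != 0.
Proof. by apply: contra_neq => ->. Qed.

Lemma addr_int_neq0 a (n : int) : 0 < complex.Im a -> a + n%:~R != 0.
Proof. by move=> ha; apply: Im_neq0; rewrite intCE Im_addr_real gt_eqF. Qed.

Lemma shift_lower_bound a : 0 < complex.Im a ->
  exists2 c : R, 0 < c & forall n : int, c * (1 + `|n|%:~R) <= nrm (a + n%:~R).
Proof.
move=> ha; set y := complex.Im a in ha *; have a0 := nrm_ge0 a.
have q0 : 0 < 1 + (nrm a + 1) / y.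
  by have : 0 < (nrm a + 1) / y; [apply: divr_gt0; lra | lra].
(* From |a + n| >= Im a = y and |n| <= |a + n| + |a|, one gets 1 + |n| <= |a + n| (1 + (|a| +
   1)/y). *)
exists (1 + (nrm a + 1) / y)^-1; first by rewrite invr_gt0.
move=> n; set t := nrm (a + n%:~R); rewrite mulrC ler_pdivrMr //.
have ty : y <= t.
  have h := Im_le (a + n%:~R); rewrite {1}intCE Im_addr_real -/y in h.
  exact: le_trans (ler_norm _) h.
have tn : `|n|%:~R <= t + nrm a.
  by have := nrmB_ge n%:~R (- a); rewrite nrm_int nrmN opprK addrC; rewrite [n%:~R + a]addrC -/t; lra.
have : 1 <= t / y by rewrite ler_pdivlMr // mul1r.
rewrite mulrDr mulr1 mulrCA mulrA; nra.
Qed.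

Lemma srange_big (T : Type) (idx : T) (op : Monoid.com_law idx) (K : nat) (f : int -> T) :
  op (f 0) (\big[op/idx]_(r < K) op (f r.+1%:Z) (f (- r.+1%:Z))) =
  \big[op/idx]_(n <- 0 :: flatten [seq [:: r.+1%:Z; - r.+1%:Z] | r <- iota 0 K]) f n.
Proof.
have -> : iota 0 K = index_iota 0 K by rewrite /index_iota subn0.
rewrite big_cons big_flatten big_map big_mkord.
by congr (op _ _); apply: eq_bigr => r _; rewrite !big_cons big_nil Monoid.mulm1.
Qed.

(** The terms of order at least 2 are dominated by the same terms with |c| in place of -c, hence by
    exp(t) - 1 - t, where t is the sum of the |c|. *)
Lemma prod_linear (s : seq C) : nrm (\prod_(c <- s) (1 - c) - 1 + \sum_(c <- s) c) <=
  8 * (\sum_(c <- s) nrm c) ^+ 2 * expR (\sum_(c <- s) nrm c).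
Proof.
have h1 : nrm (\prod_(c <- s) (1 - c) - 1) <= \prod_(c <- s) (1 + nrm c) - 1 /\
  nrm (\prod_(c <- s) (1 - c) - 1 + \sum_(c <- s) c) <=
    \prod_(c <- s) (1 + nrm c) - 1 - \sum_(c <- s) nrm c.
  elim: s => [|c s [IH1 IH2]]; first by rewrite !big_nil !subrr !addr0 !nrm0.
  rewrite !big_cons; set P := \prod_(j <- s) _ in IH1 IH2 *; set Q := \prod_(j <- s) (1 + _) in IH1 IH2 *.
  set S := \sum_(j <- s) j in IH2 *; set T := \sum_(j <- s) _ in IH2 *.
  have c0 := nrm_ge0 c; split.
    have -> : (1 - c) * P - 1 = (P - 1) - c * (P - 1) - c by ring.
    apply: le_trans (nrmD _ _) _; rewrite nrmN.
    have := nrmD (P - 1) (- (c * (P - 1))); rewrite nrmN nrmM.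
    have := nrm_ge0 (P - 1); nra.
  have -> : (1 - c) * P - 1 + (c + S) = (P - 1 + S) - c * (P - 1) by ring.
  apply: le_trans (nrmD _ _) _; rewrite nrmN nrmM.
  have : nrm c * nrm (P - 1) <= nrm c * (Q - 1) by rewrite ler_wpM2l.
  nra.
have [_ h2] := h1; apply: le_trans h2 _; set t := \sum_(c <- s) nrm c.
have t0 : 0 <= t by apply: sumr_ge0 => c _; apply: nrm_ge0.
have h3 : \prod_(c <- s) (1 + nrm c) <= expR t.
  rewrite /t expR_sum; apply: ler_prod => c _; rewrite expR_ge1Dx andbT.
  by have := nrm_ge0 c; lra.
have [_] := expC_bounds (t%:C%C : C); rewrite nrm_real (ger0_norm t0).
have -> : expC (t%:C%C : C) - 1 - t%:C%C = (expR t - 1 - t)%:C%C.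
  by rewrite /expC /= cos0 sin0; apply/eqP; rewrite eq_complex /=; apply/andP; split; apply/eqP; ring.
rewrite nrm_real => h4; have := ler_norm (expR t - 1 - t); lra.
Qed.

(** Since 1 - v^2/(a+n)^2 = (a-v+n)(a+v+n)/(a+n)^2, this is a quotient of Euler products. It is one
    row of the lattice product for [phi], and its v^2-coefficient is Lipschitz' formula in weight
    2. *)
Lemma row_product a v : 0 < complex.Im a ->
  cvC (fun K => sprod K (fun n => 1 - v ^+ 2 / (a + n%:~R) ^+ 2))
      (sn (a - v) * sn (a + v) / sn a ^+ 2).
Proof.
move=> ha; have a0 : a != 0 by apply: Im_neq0; rewrite gt_eqF.
have s0 := sn_neq0 ha; have tz := two_pi_i_neq0 R.
apply: eq_cvC (cvCM (cvCM (sine_product (a - v)) (sine_product (a + v)))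
  (cvCV (_ : sn a ^+ 2 != 0) (cvCX 2 (sine_product a)))); last by rewrite expf_neq0.
move=> K; rewrite /sprod addr0.
set A := \prod_(r < K) (1 - (a - v) ^+ 2 / _); set B := \prod_(r < K) (1 - (a + v) ^+ 2 / _).
set D := \prod_(r < K) (1 - a ^+ 2 / _); set E := \prod_(r < K) (_ * _).
have nza (r : nat) : (1 - a ^+ 2 / r.+1%:R ^+ 2 != 0) /\ (a + r.+1%:R != 0) /\ (a - r.+1%:R != 0).
  have h1 := addr_int_neq0 r.+1%:Z ha; have h2 := addr_int_neq0 (- r.+1%:Z) ha.
  have r0 : r.+1%:R != 0 :> C by rewrite pnatr_eq0.
  rewrite rmorphN /= in h2; rewrite -!pmulrn in h1 h2; split=> //.
  move: (r.+1%:R : C) r0 h1 h2 => x r0 h1 h2.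
  have -> : 1 - a ^+ 2 / x ^+ 2 = - (a + x) * (a - x) / x ^+ 2 by field.
  by rewrite !mulf_neq0 ?oppr_eq0 ?invr_eq0 ?expf_neq0.
have D0 : D != 0 by apply/prodf_neq0 => r _; have [] := nza r.
have e : E * D ^+ 2 = A * B.
  rewrite expr2 -!big_split /=; apply: eq_bigr => r _; rewrite rmorphN /= -!pmulrn.
  have [_ [h1 h2]] := nza r; have r0 : r.+1%:R != 0 :> C by rewrite pnatr_eq0.
  by move: (r.+1%:R : C) r0 h1 h2 => x r0 h1 h2; field; rewrite ?r0 ?h1 ?h2.
have -> : two_pi_i R * (a - v) * A * (two_pi_i R * (a + v) * B) =
   two_pi_i R ^+ 2 * (a - v) * (a + v) * (A * B) by ring.
by rewrite -e; field; rewrite a0 D0 tz.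
Qed.

(** The constant 5 is 1 for n = 0 plus 2 times the bound 2 for the sum of the inverse squares. *)
Lemma ssum_inv_pow_bounded a (c : R) k K : (2 <= k)%N -> 0 < c ->
  (forall n : int, c * (1 + `|n|%:~R) <= nrm (a + n%:~R)) ->
  ssum K (fun n => nrm ((a + n%:~R) ^- k)) <= c ^- k * 5.
Proof.
move=> k2 c0 hc.
have h (n : int) : nrm ((a + n%:~R) ^- k) <= c ^- k * (1 + `|n|%:~R) ^- 2.
  have n1 : 1 <= 1 + `|n|%:~R :> R by rewrite lerDl ler0z.
  rewrite nrmV nrmX -invfM lef_pV2 ?posrE; last first.
  - by rewrite mulr_gt0 ?exprn_gt0 // ; lra.
  - by rewrite exprn_gt0 // (lt_le_trans _ (hc n)) // mulr_gt0 //; lra.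
  apply: (@le_trans _ _ ((c * (1 + `|n|%:~R)) ^+ k)).
    rewrite exprMn ler_pM2l ?exprn_gt0 // -(subnKC k2) exprD.
    by apply: ler_peMr; [apply: exprn_ge0; lra | exact: exprn_ege1].
  by rewrite lerXn2r ?nnegrE ?nrm_ge0 // mulr_ge0 //; lra.
apply: (@le_trans _ _ (ssum K (fun n => c ^- k * (1 + `|n|%:~R) ^- 2))).
  by rewrite /ssum lerD // ler_sum // => r _; rewrite lerD.
rewrite /ssum; under eq_bigr => r _ do rewrite normrN.
under eq_bigr => r _ do rewrite -mulr2n -mulrnAr.
rewrite -mulr_sumr -mulrDr ler_pM2l ?invr_gt0 ?exprn_gt0 // normr0 addr0 expr1n invr1.
have : \sum_(r < K) ((1 + (r.+1)%:R) ^- 2 *+ 2) <= 4 :> R.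
  rewrite sumrMnl; apply: (@le_trans _ _ (2 *+ 2)); last by rewrite mulr2n; lra.
  rewrite ler_wMn2r //; apply: le_trans (sum_inv_sqr R K); apply: ler_sum => r _.
  rewrite lef_pV2 ?posrE ?exprn_gt0 ?addr_gt0 // lerXn2r ?nnegrE // lerDr //.
have -> : \sum_(r < K) (1 + (r.+1)%:R) ^- 2 *+ 2 = \sum_(r < K) (1 + `|r.+1%:Z|%:~R) ^- 2 *+ 2 :> R.
  by apply: eq_bigr => r _; rewrite ger0_norm.
lra.
Qed.

Lemma ssum_inv_pow_cvC a k : (2 <= k)%N -> 0 < complex.Im a ->
  exists l, cvC (fun K => ssum K (fun n => (a + n%:~R) ^- k)) l.
Proof.
move=> k2 ha; have [c c0 hc] := shift_lower_bound ha.
pose u r : C := (a + r.+1%:Z%:~R) ^- k + (a + (- r.+1%:Z)%:~R) ^- k.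
have [|l hl] := @sum_cvC _ u (c ^- k * 5).
  move=> n; apply: le_trans (ssum_inv_pow_bounded n k2 c0 hc).
  rewrite /ssum -[X in X <= _]add0r lerD ?nrm_ge0 //; apply: ler_sum => r _; exact: nrmD.
exists ((a + 0%:~R) ^- k + l); apply: cvCD hl; exact: cvC_cst.
Qed.

(** By [sn_mul] the row product is 1 - sn(v)^2 / sn(a)^2; comparison of the coefficients of v^2,
    along v = 1/(n+1), gives the formula. *)
Lemma lipschitz2 a : 0 < complex.Im a ->
  cvC (fun K => ssum K (fun n => (a + n%:~R) ^- 2)) (two_pi_i R ^+ 2 / sn a ^+ 2).
Proof.
move=> ha; have [S hS] := ssum_inv_pow_cvC (leqnn 2) ha.
suff -> : two_pi_i R ^+ 2 / sn a ^+ 2 = S by [].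
have [c c0 hc] := shift_lower_bound ha; have s0 := sn_neq0 ha.
pose b := c ^- 2 * 5; have b0 : 0 <= b by rewrite mulr_ge0 // invr_ge0 exprn_ge0 // ltW.
pose B := 8 * b ^+ 2 * expR b.
(* The row product differs from its linear part 1 - v^2 S by terms of order v^4, uniformly in the
   cut-off because the row sums of the moduli are bounded. *)
have key v : nrm v <= 1 -> nrm (v ^+ 2 * S - sn v ^+ 2 / sn a ^+ 2) <= B * nrm v ^+ 4.
  move=> v1; have v0 := nrm_ge0 v.
  have hl : cvC (fun K => sprod K (fun n => 1 - v ^+ 2 / (a + n%:~R) ^+ 2) - 1 +
     v ^+ 2 * ssum K (fun n => (a + n%:~R) ^- 2)) (v ^+ 2 * S - sn v ^+ 2 / sn a ^+ 2).
    have -> : v ^+ 2 * S - sn v ^+ 2 / sn a ^+ 2 =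
       sn (a - v) * sn (a + v) / sn a ^+ 2 - 1 + v ^+ 2 * S.
      by rewrite [sn (a - v) * _]mulrC sn_mul; field.
    apply: cvCD; last exact: cvCMl.
    by apply: cvCB; [apply: row_product | apply: cvC_cst].
  apply: (cvC_le (n1 := 0%N)) hl => K _.
  have -> : sprod K (fun n => 1 - v ^+ 2 / (a + n%:~R) ^+ 2) = \prod_(c <-
     [seq v ^+ 2 / (a + n%:~R) ^+ 2 | n <- 0 :: flatten [seq [:: r.+1%:Z; - r.+1%:Z] | r <- iota 0 K]]) (1 - c).
    by rewrite big_map -srange_big.
  have -> : v ^+ 2 * ssum K (fun n => (a + n%:~R) ^- 2) = \sum_(c <-
     [seq v ^+ 2 / (a + n%:~R) ^+ 2 | n <- 0 :: flatten [seq [:: r.+1%:Z; - r.+1%:Z] | r <- iota 0 K]]) c.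
    by rewrite big_map -mulr_sumr -srange_big.
  apply: le_trans (prod_linear _) _; rewrite big_map.
  under eq_bigr => n _ do rewrite nrmM nrmX.
  rewrite -mulr_sumr -srange_big -[X in nrm v ^+ 2 * X]/(ssum K (fun n => nrm ((a + n%:~R) ^- 2))).
  set T := ssum K _.
  have T0 : 0 <= T.
    by rewrite addr_ge0 ?nrm_ge0 // sumr_ge0 // => r _; rewrite addr_ge0 ?nrm_ge0.
  have Tb : T <= b by apply: (ssum_inv_pow_bounded K (leqnn 2) c0 hc).
  have v2 : 0 <= nrm v ^+ 2 <= 1 by rewrite exprn_ge0 // exprn_ile1.
  have -> : 8 * (nrm v ^+ 2 * T) ^+ 2 * expR (nrm v ^+ 2 * T) =
    (8 * T ^+ 2 * expR (nrm v ^+ 2 * T)) * nrm v ^+ 4 by ring.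
  rewrite ler_wpM2r ?exprn_ge0 // /B; apply: ler_pM.
  - by rewrite mulr_ge0 // sqr_ge0.
  - exact: expR_ge0.
  - by rewrite ler_wpM2l // lerXn2r ?nnegrE.
  - rewrite ler_expR; nra.
have h1 : cvC (fun n => (n.+1%:R * sn (n.+1%:R^-1)) ^+ 2 / sn a ^+ 2) (two_pi_i R ^+ 2 / sn a ^+ 2).
  apply: cvCM; last exact: cvC_cst.
  apply: cvCX; have := @sn_scaled_cvC R 1 id (fun=> leqnn _); rewrite mulr1.
  by apply: eq_cvC => n; rewrite mul1r.
have B0 : 0 <= B.
  by apply: mulr_ge0; [apply: mulr_ge0 => //; exact: sqr_ge0 | exact: expR_ge0].
have h2 : cvC (fun n => S - (n.+1%:R * sn (n.+1%:R^-1)) ^+ 2 / sn a ^+ 2) 0.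
  apply: (@cvC0_dom _ _ (fun n => B%:C%C * n.+1%:R^-1)); last first.
    by rewrite -(mulr0 B%:C%C); apply: cvCMl; apply: cvC_invn.
  move=> n; have n0 : n.+1%:R != 0 :> C by rewrite pnatr_eq0.
  have x0 : 0 < n.+1%:R^-1 :> R by rewrite invr_gt0.
  have x1 : n.+1%:R^-1 <= 1 :> R by rewrite invf_le1 // ler1n.
  have := key (n.+1%:R^-1); rewrite nrmV nrm_nat nrmM nrmV nrm_nat nrm_real ger0_norm // => /(_ x1).
  have -> : S - (n.+1%:R * sn n.+1%:R^-1) ^+ 2 / sn a ^+ 2 =
     n.+1%:R ^+ 2 * (n.+1%:R^-1 ^+ 2 * S - sn n.+1%:R^-1 ^+ 2 / sn a ^+ 2).
    by move: (n.+1%:R : C) n0 => p p0; field; rewrite ?p0 ?s0.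
  rewrite nrmM nrmX nrm_nat; move: (n.+1%:R : R) x0 x1 => p; rewrite invr_gt0 => p0 p1 h.
  apply: (@le_trans _ _ (p ^+ 2 * (B * p^-1 ^+ 4))); first by rewrite ler_wpM2l ?sqr_ge0.
  have -> : p ^+ 2 * (B * p^-1 ^+ 4) = B * p^-1 * p^-1 by field; rewrite gt_eqF.
  by rewrite ler_piMr // mulr_ge0 // invr_ge0 ltW.
have := cvCD h1 h2; rewrite addr0 => h3.
apply: cvC_uniq h3 _; apply: eq_cvC (cvC_cst S) => n; ring.
Qed.

Definition Lser (k : nat) (a : C) : C :=
  limn (fun T => \sum_(t < T) t.+1%:R ^+ k.-1 * qexp a ^+ t.+1 : C^o).

Lemma Lser_cvC k a : 0 < complex.Im a ->
  cvC (fun T => \sum_(t < T) t.+1%:R ^+ k.-1 * qexp a ^+ t.+1) (Lser k a).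
Proof.
move=> ha; have q1 := nrm_qexp_lt1 ha; have q0 := nrm_ge0 (qexp a).
have [|b hb] := @geom_pow_bounded R k.-1 (nrm (qexp a)); first by rewrite q0.
have [|l hl] := @sum_cvC _ (fun t => t.+1%:R ^+ k.-1 * qexp a ^+ t.+1) b.
  move=> n; apply: le_trans (hb n); apply: ler_sum => t _.
  rewrite nrmM !nrmX nrm_nat exprS mulrCA; apply: ler_piMl; last exact: ltW.
  by rewrite mulr_ge0 ?exprn_ge0.
by rewrite /Lser (cvC_lim hl).
Qed.

Lemma Lser2 a : 0 < complex.Im a -> Lser 2 a = (sn a ^+ 2)^-1.
Proof.
move=> ha; have q1 := nrm_qexp_lt1 ha; set q := qexp a in q1 *.
have nq : 1 - q != 0.
  by rewrite subr_eq0; apply/eqP => e; move: q1; rewrite -e nrm1 ltxx.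
have h := Lser_cvC 2 ha; rewrite -/q /= in h.
rewrite sn_sqr -/q invfM invrK; apply: (mulfI (x := (1 - q) ^+ 2)); first by rewrite expf_neq0.
rewrite mulrA divff ?expf_neq0 // mul1r.
apply: cvC_uniq (cvCMl _ h) _.
(* Closed form of (1 - q)^2 times the partial sum; the bracket tends to 0. *)
apply: (eq_cvC (u := fun n => q - (n.+1%:R * q ^+ n.+1 - n%:R * q ^+ n.+2))).
  move=> n; elim: n => [|n IH]; first by rewrite big_ord0 mulr0 mul0r subr0 mul1r expr1 subrr.
  rewrite big_ord_recr /= mulrDr -IH expr1 !exprS -!natr1; ring.
rewrite -[X in cvC _ X]subr0; apply: cvCB; first exact: cvC_cst.
have q01 : 0 <= nrm q < 1 by rewrite nrm_ge0.
have [b hb] := @geom_pow_bounded R 2 (nrm q) q01.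
apply: (@cvC0_dom _ _ (fun n => (2 * b)%:C%C * n.+1%:R^-1)); last first.
  by rewrite -(mulr0 (2 * b)%:C%C); apply: cvCMl; apply: cvC_invn.
move=> n; rewrite nrmM nrmV nrm_nat nrm_real.
have b0 : n.+1%:R ^+ 2 * nrm q ^+ n <= b.
  apply: le_trans (hb n.+1); rewrite big_ord_recr /= ler_wpDl // sumr_ge0 // => i _.
  by rewrite mulr_ge0 ?exprn_ge0 ?nrm_ge0.
have q0 := nrm_ge0 q; have qn := exprn_ge0 n q0.
have p0 : 0 < n.+1%:R :> R by [].
rewrite ler_pdivlMr // ger0_norm; last first.
  by rewrite mulr_ge0 // (le_trans _ b0) // mulr_ge0 ?exprn_ge0.
apply: (@le_trans _ _ ((2 * (n.+1%:R * nrm q ^+ n)) * n.+1%:R)); last first.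
  by rewrite -mulrA ler_pM2l // mulrAC -expr2.
rewrite ler_pM2r //; apply: le_trans (nrmD _ _) _; rewrite nrmN nrmM nrmX nrm_nat nrmM nrmX nrm_nat !exprS.
have qn1 : nrm q * nrm q ^+ n <= nrm q ^+ n by rewrite ler_piMl // ltW.
have n1 : n%:R <= n.+1%:R :> R by rewrite ler_nat.
have n0 : 0 <= n%:R :> R by [].
have qn2 : nrm q * (nrm q * nrm q ^+ n) <= nrm q ^+ n by rewrite (le_trans _ qn1) // ler_piMl ?mulr_ge0 // ltW.
have : n%:R * (nrm q * (nrm q * nrm q ^+ n)) <= n.+1%:R * nrm q ^+ n.
  by apply: ler_pM => //; rewrite !mulr_ge0.
have : n.+1%:R * (nrm q * nrm q ^+ n) <= n.+1%:R * nrm q ^+ n by rewrite ler_pM2l.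
lra.
Qed.

Lemma inv_pow_taylor k : exists2 M : R, 0 <= M &
  forall u : C, nrm u <= 2^-1 -> nrm ((1 + u) ^- k - 1 + k%:R * u) <= M * nrm u ^+ 2.
Proof.
elim: k => [|k [M M0 IH]].
  by exists 0 => // u _; rewrite expr0 invr1 subrr mul0r addr0 nrm0 mul0r.
exists (2 * (M + k.+1%:R)); first by rewrite mulr_ge0 // addr_ge0.
move=> u hu; have lb : 2^-1 <= nrm (1 + u).
  by have := nrmB_ge 1 (- u); rewrite nrmN opprK nrm1; lra.
have u0 : 1 + u != 0 by rewrite -nrm_eq0 gt_eqF //; lra.
have -> : (1 + u) ^- k.+1 - 1 + k.+1%:R * u =
   (1 + u)^-1 * (((1 + u) ^- k - 1 + k%:R * u) + k.+1%:R * u ^+ 2).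
  rewrite exprS invfM -[k.+1%:R]natr1; move: ((1 + u) ^- k) => y; field.
  by rewrite ?u0.
rewrite nrmM nrmV.
have h1 : (nrm (1 + u))^-1 <= 2 by rewrite -[2]invrK lef_pV2 ?posrE //; lra.
have h2 : nrm ((1 + u) ^- k - 1 + k%:R * u + k.+1%:R * u ^+ 2) <= (M + k.+1%:R) * nrm u ^+ 2.
  apply: le_trans (nrmD _ _) _; rewrite nrmM nrm_nat nrmX mulrDl lerD2r; exact: IH.
by rewrite -mulrA; apply: ler_pM; rewrite ?invr_ge0 ?nrm_ge0.
Qed.

(** Termwise differentiation: the Taylor remainders of the terms are dominated by a row of exponent
    k + 2, whose sum is bounded. *)
Lemma row_sder k a (f : C -> C) l : (2 <= k)%N -> 0 < complex.Im a ->
  (forall z, 0 < complex.Im z -> cvC (fun K => ssum K (fun n => (z + n%:~R) ^- k)) (f z)) ->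
  cvC (fun K => ssum K (fun n => (a + n%:~R) ^- k.+1)) l -> sder f a (- k%:R * l).
Proof.
move=> k2 ha hf hl; have [c c0 hc] := shift_lower_bound ha.
have [M M0 hM] := inv_pow_taylor k.
pose d := complex.Im a / 2.
have nlb n : complex.Im a <= nrm (a + n%:~R).
  by have h := Im_le (a + n%:~R); rewrite {1}intCE Im_addr_real in h; apply: le_trans (ler_norm _) h.
have tay n h : nrm h <= d ->
    nrm ((a + h + n%:~R) ^- k - (a + n%:~R) ^- k - h * (- k%:R * (a + n%:~R) ^- k.+1)) <=
    (M * nrm ((a + n%:~R) ^- k.+2)) * nrm h ^+ 2.
  move=> hd; set x := a + n%:~R; have x0 : x != 0 by apply: addr_int_neq0.
  have -> : a + h + n%:~R = x * (1 + h / x) by rewrite /x; field.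
  have hu : nrm (h / x) <= 2^-1.
    rewrite nrmM nrmV ler_pdivrMr; last by apply: lt_le_trans ha (nlb n).
    by have := nlb n; rewrite -/x /d in hd *; lra.
  have := hM _ hu; set u := h / x in hu *.
  have -> : h = x * u by rewrite /u; field.
  move=> h1.
  have -> : (x * (1 + u)) ^- k - x ^- k - x * u * (- k%:R * x ^- k.+1) =
    x ^- k * ((1 + u) ^- k - 1 + k%:R * u).
    rewrite exprMn invfM exprS invfM; move: ((1 + u) ^- k) (x ^- k) => p q; field.
    by rewrite ?x0.
  rewrite nrmM nrmM exprMn.
  have -> : M * nrm (x ^- k.+2) * (nrm x ^+ 2 * nrm u ^+ 2) = nrm (x ^- k) * (M * nrm u ^+ 2).
    have y0 : nrm x != 0 by rewrite nrm_eq0.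
    by rewrite !nrmV !nrmX -addn2 exprD; field; rewrite ?y0 ?expf_neq0.
  by rewrite ler_wpM2l ?nrm_ge0.
pose u i (z : C) := if i is r.+1 then (z + r.+1%:Z%:~R) ^- k + (z + (- r.+1%:Z)%:~R) ^- k
   else (z + 0%:~R) ^- k : C.
pose m i := if i is r.+1 then M * nrm ((a + r.+1%:Z%:~R) ^- k.+2) + M * nrm ((a + (- r.+1%:Z)%:~R) ^- k.+2)
   else M * nrm ((a + 0%:~R) ^- k.+2).
pose l' i := if i is r.+1 then - k%:R * (a + r.+1%:Z%:~R) ^- k.+1 + - k%:R * (a + (- r.+1%:Z)%:~R) ^- k.+1
   else - k%:R * (a + 0%:~R) ^- k.+1 : C.
apply: (@sder_series _ u f a l' (- k%:R * l) m (M * (c ^- k.+2 * 5)) d).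
- by rewrite /d; lra.
- move=> h hd; apply: (@cvC_shift _ _ _ 1).
  have hi : 0 < complex.Im (a + h).
    rewrite raddfD /=; have := Im_le h; rewrite ler_norml => /andP[h1 _]; rewrite /d in hd; lra.
  by apply: eq_cvC (hf _ hi) => n; rewrite addn1 big_ord_recl.
- apply: (@cvC_shift _ _ _ 1).
  apply: eq_cvC (cvCMl (- k%:R) hl) => n; rewrite addn1 big_ord_recl /ssum mulrDr mulr_sumr.
  by congr (_ + _); apply: eq_bigr => r _; rewrite mulrDr.
- case=> [|r] h hd /=; first exact: tay.
  rewrite mulrDl; apply: le_trans (lerD (tay _ _ hd) (tay _ _ hd)).
  by apply: le_trans (nrmD _ _); rewrite le_eqVlt; apply/orP; left; apply/eqP; congr nrm; ring.
- case=> [|n]; first by rewrite big_ord0 mulr_ge0 // mulr_ge0 // invr_ge0 exprn_ge0 // ltW.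
  apply: le_trans (ler_wpM2l M0 (ssum_inv_pow_bounded n (leqW (leqW k2)) c0 hc)).
  rewrite big_ord_recl /ssum mulrDr mulr_sumr lerD //; apply: ler_sum => r _.
  by rewrite mulrDr.
Qed.

Lemma Lser_sder k a : (0 < k)%N -> 0 < complex.Im a -> sder (Lser k) a (two_pi_i R * Lser k.+1 a).
Proof.
move=> k0 ha; pose d := complex.Im a / 2.
(* On the disc of radius Im a / 2 half of the decay exp(-2 pi t Im a) survives, which leaves the
   ratio [r]. *)
pose r := expR (- (pi * complex.Im a)) : R.
have p0 := @pi_gt0 R.
have r01 : 0 <= r < 1.
  by rewrite expR_ge0 /r expR_lt1; nra.
have [b hb] := @geom_pow_bounded R k.+1 r r01.
pose m t := 8 * (2 * pi) ^+ 2 * (t.+1%:R ^+ k.+1 * r ^+ t) : R.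
apply: (@sder_series _ (fun t z => t.+1%:R ^+ k.-1 * qexp z ^+ t.+1) (Lser k) a
   (fun t => two_pi_i R * (t.+1%:R ^+ k * qexp a ^+ t.+1)) _ m (8 * (2 * pi) ^+ 2 * b) d).
- by rewrite /d; lra.
- move=> h hd; apply: Lser_cvC.
  rewrite raddfD /=; have := Im_le h; rewrite ler_norml => /andP[h1 _]; rewrite /d in hd; lra.
- apply: eq_cvC (cvCMl (two_pi_i R) (Lser_cvC k.+1 ha)) => n.
  by rewrite mulr_sumr.
- move=> t h hd; rewrite !qexpX; set x : C := two_pi_i R * (t.+1%:R * h).
  have -> : qexp (t.+1%:R * (a + h)) = qexp (t.+1%:R * a) * expC x by rewrite mulrDr qexpD.
  have -> : t.+1%:R ^+ k.-1 * (qexp (t.+1%:R * a) * expC x) -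
     t.+1%:R ^+ k.-1 * qexp (t.+1%:R * a) - h * (two_pi_i R * (t.+1%:R ^+ k * qexp (t.+1%:R * a))) =
     t.+1%:R ^+ k.-1 * qexp (t.+1%:R * a) * (expC x - 1 - x).
    rewrite -[in t.+1%:R ^+ k](prednK k0) exprS /x; ring.
  rewrite nrmM nrmM nrmX nrm_nat nrm_qexp.
  have [_ hx] := expC_bounds x.
  have nx : nrm x = 2 * pi * t.+1%:R * nrm h by rewrite /x nrmM nrm_two_pi_i nrmM nrm_nat; ring.
  have t0 : 0 < t.+1%:R :> R by [].
  have Imt : complex.Im (t.+1%:R * a) = t.+1%:R * complex.Im a.
    by rewrite natCE; case: (a) => p q /=; ring.
  rewrite Imt.
  have hx2 : expR (- (2 * pi * (t.+1%:R * complex.Im a))) * expR (nrm x) <= r ^+ t.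
    rewrite -expRD /r -expRM_natl ler_expR nx.
    have e1 : nrm h <= complex.Im a / 2 by [].
    have e2 : 2 * pi * t.+1%:R * nrm h <= 2 * pi * t.+1%:R * (complex.Im a / 2).
      by rewrite ler_wpM2l // !mulr_ge0 // ltW.
    have e3 : 0 <= pi * complex.Im a by nra.
    rewrite -[t.+1%:R]natr1 in e2 *; nra.
  apply: (@le_trans _ _ (t.+1%:R ^+ k.-1 * expR (- (2 * pi * (t.+1%:R * complex.Im a))) *
      (8 * nrm x ^+ 2 * expR (nrm x)))).
    by rewrite ler_wpM2l // mulr_ge0 ?exprn_ge0 ?expR_ge0.
  have -> : t.+1%:R ^+ k.-1 * expR (- (2 * pi * (t.+1%:R * complex.Im a))) *
      (8 * nrm x ^+ 2 * expR (nrm x)) = (t.+1%:R ^+ k.-1 * 8 * nrm x ^+ 2) *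
      (expR (- (2 * pi * (t.+1%:R * complex.Im a))) * expR (nrm x)) by ring.
  apply: (@le_trans _ _ ((t.+1%:R ^+ k.-1 * 8 * nrm x ^+ 2) * r ^+ t)).
    by rewrite ler_wpM2l // mulr_ge0 ?sqr_ge0 // mulr_ge0 ?exprn_ge0.
  rewrite /m nx le_eqVlt; apply/orP; left; apply/eqP.
  rewrite -[k.+1](_ : k.-1.+2 = _); last by rewrite prednK.
  by rewrite !exprS; ring.
- by move=> n; rewrite -mulr_sumr ler_wpM2l ?hb // mulr_ge0 // sqr_ge0.
Qed.

Definition lip_const (k : nat) : C := (- two_pi_i R) ^+ k / (k.-1)`!%:R.

(** Induction on k from weight 2 by differentiating both sides in a: the left one gains the factor
    -k, the right one 2 pi i, and the derivative is unique. *)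
Theorem lipschitz k a : (2 <= k)%N -> 0 < complex.Im a ->
  cvC (fun K => ssum K (fun n => (a + n%:~R) ^- k)) (lip_const k * Lser k a).
Proof.
move=> k2; rewrite -(subnKC k2); elim: (k - 2)%N a => [|j IH] a ha.
  rewrite addn0 /lip_const Lser2 // (_ : (2.-1)`! = 1%N) // divr1 sqrrN; exact: lipschitz2.
rewrite addnS; set i := (2 + j)%N in IH *; have i2 : (2 <= i)%N by rewrite /i.
have [l hl] := ssum_inv_pow_cvC (leqW i2) ha.
suff -> : lip_const i.+1 * Lser i.+1 a = l by [].
have h1 := row_sder i2 ha IH hl.
have h2 := sder_lin (lip_const i) (Lser_sder (ltnW i2) ha).
have i0 : i%:R != 0 :> C by rewrite pnatr_eq0.
have := sder_uniq h1 h2; rewrite /lip_const => e.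
have f0 : (i.-1)`!%:R != 0 :> C by rewrite pnatr_eq0 -lt0n fact_gt0.
apply: (mulfI (x := - i%:R)); first by rewrite oppr_eq0.
rewrite e /= exprS -[X in X`!%:R](prednK (ltnW i2)) factS natrM prednK ?(ltnW i2) //.
by field; rewrite ?i0 ?f0.
Qed.

End Lipschitz.

(** * The theta quotient phi and its inversion formula *)

Section Theta.
Variable R : realType.
Local Notation C := R[i].
Implicit Types (v z t q w x : C).

(** The infinite q-Pochhammer symbol (x; q). *)
Definition poch (q x : C) : C := limn (fun m => \prod_(n < m) (1 - q ^+ n * x) : C^o).

Lemma geom_bound q n : nrm q < 1 -> \sum_(i < n) nrm q ^+ i <= (1 - nrm q)^-1.
Proof.
move=> q1; have q0 := nrm_ge0 q; have h := subrX1 (nrm q) n.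
have qn := exprn_ge0 n q0.
rewrite -[X in _ <= X]mul1r ler_pdivlMr ?subr_gt0 // mulrC.
have -> : (1 - nrm q) * \sum_(i < n) nrm q ^+ i = 1 - nrm q ^+ n by rewrite -[LHS]opprK -mulNr opprB -h opprB.
lra.
Qed.

Lemma poch_cvC q x : nrm q < 1 -> cvC (fun m => \prod_(n < m) (1 - q ^+ n * x)) (poch q x).
Proof.
move=> q1; have [|l hl] := @prod_cvC _ (fun n => - (q ^+ n * x)) ((1 - nrm q)^-1 * nrm x).
  move=> n; under eq_bigr => i _ do rewrite nrmN nrmM nrmX.
  by rewrite -mulr_suml ler_wpM2r ?nrm_ge0 // geom_bound.
by rewrite /poch (cvC_lim hl).
Qed.

Lemma poch_rec q x : nrm q < 1 -> poch q x = (1 - x) * poch q (q * x).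
Proof.
move=> q1; apply: cvC_uniq (cvC_sub (fun n => leqnSn n) (poch_cvC x q1)) _.
apply: eq_cvC (cvCMl (1 - x) (poch_cvC (q * x) q1)) => n.
rewrite big_ord_recl expr0 mul1r; congr (_ * _); apply: eq_bigr => i _.
by rewrite lift0 exprSr mulrA.
Qed.

Lemma poch_close q x : nrm q < 1 -> nrm (poch q x - 1) <= expR (nrm x / (1 - nrm q)) - 1.
Proof.
move=> q1; apply: (@cvC_le _ (fun m => \prod_(n < m) (1 - q ^+ n * x) - 1) _ _ 0%N); last first.
  by apply: cvCB (cvC_cst 1); apply: poch_cvC.
move=> n _; apply: (@le_trans _ _ (\prod_(i < n) (1 + nrm (q ^+ i * x)) - 1)).
  have := @prod_dominated _ (fun i => 1 - q ^+ i * x) (fun i => 1 + nrm (q ^+ i * x)) 0 n.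
  rewrite !big_ord0; apply=> // i.
  by rewrite addrC addKr nrmN addrC addKr.
rewrite lerD2r; apply: (@prod_ge1_bounded _ (fun i => nrm (q ^+ i * x))) => [i|m]; first exact: nrm_ge0.
under eq_bigr => i _ do rewrite nrmM nrmX.
by rewrite -mulr_suml mulrC ler_wpM2l ?nrm_ge0 // geom_bound.
Qed.

Lemma poch_iter q x m : nrm q < 1 ->
  poch q x = \prod_(n < m) (1 - q ^+ n * x) * poch q (q ^+ m * x).
Proof.
move=> q1; elim: m => [|m IH]; first by rewrite big_ord0 !mul1r.
by rewrite IH [poch q (q ^+ m * x)]poch_rec // mulrA big_ord_recr /= [q ^+ m.+1]exprS -[q * _ * x]mulrA.
Qed.

Lemma expR_half_lt2 : expR (2^-1) < 2 :> R.
Proof.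
have h1 : 0 < 1 - 2^-1 :> R by lra.
have h : 1 - 2^-1 < expR (- 2^-1) :> R by apply: expR_gt1Dx; lra.
have : expR (2^-1) = (expR (- 2^-1))^-1 :> R by rewrite expRN invrK.
move=> ->; rewrite -[2 in X in _ < X]invrK ltf_pV2 ?posrE ?expR_gt0 //; lra.
Qed.

(** Finitely many factors, nonzero by hypothesis, are split off until the argument of the rest is so
    small that [poch_close] keeps it away from 0. *)
Lemma poch_neq0 q x : nrm q < 1 -> (forall n, q ^+ n * x != 1) -> poch q x != 0.
Proof.
move=> q1 hx.
have [m hm] : exists m, nrm (q ^+ m * x) / (1 - nrm q) <= 2^-1.
  have [b hb] := @geom_pow_bounded R 1 (nrm q) (introT andP (conj (nrm_ge0 q) q1)).
  pose B := b * nrm x / (1 - nrm q).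
  have q1' : 0 < 1 - nrm q by lra.
  have b0 m : m.+1%:R * nrm q ^+ m <= b.
    apply: le_trans (hb m.+1); rewrite big_ord_recr /= expr1 ler_wpDl // sumr_ge0 // => i _.
    by rewrite mulr_ge0 ?exprn_ge0 ?nrm_ge0.
  have bp : 0 <= b by apply: le_trans (b0 0%N); rewrite mulr1.
  exists (Num.bound (2 * B)); set m := Num.bound _.
  have hm : 2 * B < m%:R by apply: Num.Theory.archi_boundP; rewrite !mulr_ge0 ?nrm_ge0 // invr_ge0 ltW.
  rewrite nrmM nrmX ler_pdivrMr //.
  have m0 : 0 < m.+1%:R :> R by [].
  rewrite -(ler_pM2l m0) mulrA; apply: (@le_trans _ _ (b * nrm x)).
    by rewrite ler_wpM2r ?nrm_ge0.
  have -> : b * nrm x = B * (1 - nrm q) by rewrite /B divfK // gt_eqF.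
  rewrite mulrA ler_pM2r // -[m.+1%:R]natr1; lra.
rewrite (poch_iter x m q1) mulf_neq0 //.
  by apply/prodf_neq0 => n _; rewrite subr_eq0 eq_sym hx.
apply/eqP => e; have := poch_close (q ^+ m * x) q1; rewrite e sub0r nrmN nrm1.
have : expR (nrm (q ^+ m * x) / (1 - nrm q)) <= expR 2^-1 by rewrite ler_expR.
have := expR_half_lt2; lra.
Qed.

Lemma qexp_pow_neq1 z n : 0 < complex.Im z -> qexp z ^+ n.+1 != 1.
Proof.
move=> hz; apply/eqP => /(congr1 (@nrm R)); rewrite nrm1 nrmX => e.
by have := exprn_ilt1 n.+1 (nrm_ge0 (qexp z)) (nrm_qexp_lt1 hz); rewrite e ltxx.
Qed.

Lemma pochqq_neq0 z : 0 < complex.Im z -> poch (qexp z) (qexp z) != 0.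
Proof.
move=> hz; apply: poch_neq0 => [|n]; first exact: nrm_qexp_lt1.
by rewrite -exprSr qexp_pow_neq1.
Qed.

(** The product form of theta_1(v) / theta_1'(0), normalized so that phi(v) behaves like v at 0: the
    Weierstrass sigma function up to a factor exp(c v^2). *)
Definition phi (v t : C) : C :=
  qexp (v / 2) * poch (qexp t) (qexp (t + v)) * poch (qexp t) (qexp (- v)) /
  (two_pi_i R * poch (qexp t) (qexp t) ^+ 2).

Lemma snE v : sn v = qexp (v / 2) * (1 - qexp (- v)).
Proof.
rewrite /sn mulrBr mulr1 -qexpD; congr (_ - qexp _); by field.
Qed.

Lemma phiE v t : 0 < complex.Im t -> phi v t = sn v * poch (qexp t) (qexp (t + v)) *
  poch (qexp t) (qexp (t - v)) / (two_pi_i R * poch (qexp t) (qexp t) ^+ 2).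
Proof.
move=> ht; rewrite /phi [poch _ (qexp (- v))]poch_rec ?nrm_qexp_lt1 // -qexpD snE; congr (_ / _).
by ring.
Qed.

Lemma phi_addr1 v t : phi (v + 1) t = - phi v t.
Proof.
rewrite /phi mulrDl mul1r !opprD !addrA !qexpD !qexpN qexp1 invr1 !mulr1 qexp_half.
by ring.
Qed.

Lemma phi_addt v t : 0 < complex.Im t -> phi (v + t) t = - qexp (- (t / 2) - v) * phi v t.
Proof.
move=> ht; have q1 := nrm_qexp_lt1 ht; rewrite /phi [RHS]mulrA; congr (_ / _).
have e1 : poch (qexp t) (qexp (t + v)) = (1 - qexp (t + v)) * poch (qexp t) (qexp (t + (v + t))).
  by rewrite poch_rec // -qexpD; congr (_ * poch _ (qexp _)); ring.
have e2 : poch (qexp t) (qexp (- (v + t))) = (1 - qexp (- (v + t))) * poch (qexp t) (qexp (- v)).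
  by rewrite poch_rec // -qexpD; congr (_ * poch _ (qexp _)); ring.
rewrite e1 e2; set A := poch _ _; set B := poch _ _.
have -> : (v + t) / 2 = v / 2 + t / 2 by field.
have -> : qexp (- (t / 2) - v) = qexp (t / 2) * qexp (- (v + t)).
  by rewrite -qexpD; congr qexp; field.
have e3 : qexp (t + v) = (qexp (- (v + t)))^-1 by rewrite -qexpN opprK addrC.
have := qexp_neq0 (- (v + t)); rewrite e3 qexpD; move: (qexp (- (v + t))) => y y0.
by field.
Qed.

Lemma phi_opp v t : 0 < complex.Im t -> phi (- v) t = - phi v t.
Proof.
by move=> ht; rewrite !phiE // snN opprK; ring.
Qed.

Lemma expC_cvC (u : nat -> C) l : cvC u l -> cvC (fun n => expC (u n)) (expC l).
Proof.
move=> h e e0; have c0 : 0 < nrm (expC l) by rewrite nrm_expC expR_gt0.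
pose d := Num.min 1 (e / (nrm (expC l) * 4 * expR 1 * 2)).
have E0 : 0 < nrm (expC l) * 4 * expR 1 by rewrite !mulr_gt0 // expR_gt0.
have d0 : 0 < d by rewrite lt_min ltr01 divr_gt0 // mulr_gt0.
have [n0 hn] := h d d0; exists n0 => n le; have := hn n le; set x := u n - l => hx.
have -> : expC (u n) - expC l = expC l * (expC x - 1).
  by rewrite mulrBr mulr1 -expCD; congr (expC _ - _); rewrite /x; ring.
have [hb _] := expC_bounds x; have x0 := nrm_ge0 x.
have x1 : nrm x <= 1 by apply: ltW; apply: lt_le_trans hx _; rewrite ge_min lexx.
have x2 : nrm x <= e / (nrm (expC l) * 4 * expR 1 * 2).
  by apply: ltW; apply: lt_le_trans hx _; rewrite ge_min lexx orbT.
rewrite nrmM; apply: (@le_lt_trans _ _ (nrm (expC l) * (4 * nrm x * expR 1))).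
  rewrite ler_pM2l //; apply: le_trans hb _; rewrite ler_wpM2l ?mulr_ge0 // ler_expR //.
have -> : nrm (expC l) * (4 * nrm x * expR 1) = nrm x * (nrm (expC l) * 4 * expR 1) by ring.
apply: (@le_lt_trans _ _ (e / 2)); last by lra.
rewrite -ler_pdivlMr //; apply: le_trans x2 _.
by rewrite le_eqVlt; apply/orP; left; apply/eqP; field; rewrite ?gt_eqF // expR_gt0.
Qed.

(** * The product over the lattice Z t + Z *)

Lemma lattice_lower_bound t : 0 < complex.Im t ->
  exists2 c : R, 0 < c & forall m n : int, c * (`|m|%:~R + `|n|%:~R) <= nrm (m%:~R * t + n%:~R).
Proof.
move=> ht; set y := complex.Im t in ht *; have t0 := nrm_ge0 t.
have q0 : 0 < 1 + (nrm t + 1) / y.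
  by have : 0 < (nrm t + 1) / y; [apply: divr_gt0; lra | lra].
exists (1 + (nrm t + 1) / y)^-1; first by rewrite invr_gt0.
move=> m n; set s := nrm (m%:~R * t + n%:~R); rewrite mulrC ler_pdivrMr //.
have sy : `|m|%:~R * y <= s.
  have h := Im_le (m%:~R * t + n%:~R).
  have e : complex.Im (m%:~R * t + n%:~R) = m%:~R * y.
    by rewrite !intCE Im_addr_real /y; case: (t) => p q /=; ring.
  by rewrite e normrM -intr_norm (gtr0_norm ht) in h.
have sn : `|n|%:~R <= s + `|m|%:~R * nrm t.
  have := nrmB_ge n%:~R (- (m%:~R * t)); rewrite nrm_int nrmN nrmM nrm_int opprK [n%:~R + _]addrC -/s; lra.
have m0 : 0 <= `|m|%:~R :> R by rewrite ler0z.
have : `|m|%:~R <= s / y by rewrite ler_pdivlMr.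
have s0 : 0 <= s by apply: nrm_ge0.
rewrite mulrDr mulr1 mulrCA mulrA; nra.
Qed.

(* The nonzero points of the lattice up to sign, grouped so that the exchange of
   rows and columns becomes the transposition of a matrix. *)
Definition lat (g : C -> C) (t : C) (m n : nat) : C :=
  match m, n with
  | 0, 0 => 1
  | 0, n'.+1 => g n'.+1%:R
  | m'.+1, 0 => g (m'.+1%:R * t)
  | m'.+1, n'.+1 => g (m'.+1%:R * t + n'.+1%:R) * g (m'.+1%:R * t - n'.+1%:R)
  end.

Lemma lat_inv g t m n : t != 0 -> (forall x, g (- x) = g x) ->
  lat (fun x => g (t * x)) (- t^-1) m n = lat g t n m.
Proof.
move=> t0 ge; case: m n => [|m] [|n] //=.
- by rewrite mulrC.
- by rewrite -ge; congr g; field.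
rewrite mulrC; congr (_ * _); last by congr g; field.
by rewrite -ge; congr g; field.
Qed.

Definition ladd (y : C -> C) (t : C) (m n : nat) : C :=
  match m, n with
  | 0, 0 => 0
  | 0, n'.+1 => y n'.+1%:R
  | m'.+1, 0 => y (m'.+1%:R * t)
  | m'.+1, n'.+1 => y (m'.+1%:R * t + n'.+1%:R) + y (m'.+1%:R * t - n'.+1%:R)
  end.

Lemma lat_exp g y t m n :
  lat (fun x => g x * expC (y x)) t m n = lat g t m n * expC (ladd y t m n).
Proof.
case: m n => [|m] [|n] //=; first by rewrite expC0 mulr1.
by rewrite expCD mulrACA.
Qed.

(** The majorant separates the two indices, so its double products are at most exp(T times 2 times
    2), and [iterated_limits] applies. *)
Lemma double_prod_iterated (H : nat -> nat -> C) (T : R) (r s : nat -> C) L1 L2 : 0 <= T ->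
  (forall m n, nrm (H m n - 1) <= T / (m.+1%:R ^+ 2 * n.+1%:R ^+ 2)) ->
  (forall M, cvC (fun N => \prod_(m < M) \prod_(n < N) H m n) (r M)) ->
  (forall N, cvC (fun M => \prod_(m < M) \prod_(n < N) H m n) (s N)) ->
  cvC r L1 -> cvC s L2 -> L1 = L2.
Proof.
move=> T0 hH; pose V m n : R := 1 + T / (m.+1%:R ^+ 2 * n.+1%:R ^+ 2).
have V0 m n : 0 <= T / (m.+1%:R ^+ 2 * n.+1%:R ^+ 2) by rewrite divr_ge0 // mulr_ge0 ?exprn_ge0.
have HV m n : nrm (H m n - 1) <= V m n - 1 by rewrite /V [1 + _]addrC addrK.
have rowd (h : nat -> C) (v : nat -> R) N : (forall n, nrm (h n - 1) <= v n - 1) ->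
    nrm (\prod_(n < N) h n - 1) <= \prod_(n < N) v n - 1.
  by move=> hv; have := @prod_dominated _ h v 0 N hv isT; rewrite !big_ord0.
apply: (@iterated_limits _ _ (fun M N => \prod_(m < M) \prod_(n < N) V m n) (expR (T * 4))).
- move=> M N M' N' hM hN.
  have h1 : nrm (\prod_(m < M') \prod_(n < N') H m n - \prod_(m < M) \prod_(n < N') H m n) <=
     \prod_(m < M') \prod_(n < N') V m n - \prod_(m < M) \prod_(n < N') V m n.
    apply: (@prod_dominated _ (fun m => \prod_(n < N') H m n) (fun m => \prod_(n < N') V m n)) => // m.
    exact: rowd.
  have h2 : nrm (\prod_(m < M) \prod_(n < N') H m n - \prod_(m < M) \prod_(n < N) H m n) <=
     \prod_(m < M) \prod_(n < N') V m n - \prod_(m < M) \prod_(n < N) V m n.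
    have swC K : \prod_(m < M) \prod_(n < K) H m n = \prod_(n < K) \prod_(m < M) H m n.
      by rewrite exchange_big.
    have swV K : \prod_(m < M) \prod_(n < K) V m n = \prod_(n < K) \prod_(m < M) V m n.
      by rewrite exchange_big.
    rewrite !swC !swV.
    apply: (@prod_dominated _ (fun n => \prod_(m < M) H m n) (fun n => \prod_(m < M) V m n)) => // n.
    exact: (rowd (fun m => H m n) (fun m => V m n)).
  apply: le_trans (nrmB_tri (\prod_(m < M) \prod_(n < N') H m n) _ _) _; lra.
- move=> M N.
  apply: (@le_trans _ _ (\prod_(m < M) \prod_(n < N) expR (T / (m.+1%:R ^+ 2 * n.+1%:R ^+ 2)))).
    have V1 m n : 0 <= V m n by rewrite addr_ge0 //; exact: V0.
    apply: ler_prod => m _; apply/andP; split; first by apply: prodr_ge0 => n _.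
    by apply: ler_prod => n _; rewrite V1 expR_ge1Dx.
  under eq_bigr => m _ do rewrite -expR_sum.
  rewrite -expR_sum ler_expR.
  apply: (@le_trans _ _ (T * ((\sum_(i < M) (i.+1%:R ^+ 2)^-1) * (\sum_(j < N) (j.+1%:R ^+ 2)^-1)))).
    rewrite big_distrl mulr_sumr /=; apply: ler_sum => i _; rewrite big_distrr mulr_sumr /=.
    by apply: ler_sum => j _; rewrite invfM.
  rewrite ler_wpM2l //; have -> : 4 = 2 * 2 :> R by ring.
  by apply: ler_pM; rewrite ?sum_inv_sqr // sumr_ge0 // => i _; rewrite invr_ge0 exprn_ge0.
Qed.

Lemma Lser_bound k (y : R) : 0 < y ->
  exists2 b : R, 0 <= b & forall a : C, y <= complex.Im a -> nrm (Lser k a) <= b * nrm (qexp a).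
Proof.
move=> y0; pose r : R := expR (- (2 * pi * y)).
have r01 : 0 <= r < 1 by rewrite expR_ge0 expR_lt1 oppr_lt0 !mulr_gt0 // pi_gt0.
have [b hb] := @geom_pow_bounded R k.-1 r r01.
have b0 : 0 <= b by have := hb 0%N; rewrite big_ord0.
exists b => // a ya; have ha : 0 < complex.Im a by lra.
apply: (cvC_le (n1 := 0%N)) (Lser_cvC k ha) => n _.
apply: le_trans (nrm_sum _ _ _) _; rewrite mulrC.
apply: (@le_trans _ _ (nrm (qexp a) * \sum_(t < n) t.+1%:R ^+ k.-1 * r ^+ t)); last first.
  by rewrite ler_wpM2l ?nrm_ge0.
rewrite mulr_sumr; apply: ler_sum => t _; rewrite nrmM !nrmX nrm_nat exprS mulrCA.
rewrite ler_wpM2l ?nrm_ge0 // ler_wpM2l ?exprn_ge0 // lerXn2r ?nnegrE ?nrm_ge0 ?expR_ge0 //.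
by rewrite nrm_qexp ler_expR lerN2 ler_pM2l // mulr_gt0 // pi_gt0.
Qed.

Lemma Im_natr_mul t n : complex.Im (n%:R * t) = n%:R * complex.Im t.
Proof. by rewrite natCE; case: t => p q /=; ring. Qed.

Lemma Lser_sum_cvC k t : 0 < complex.Im t -> exists l, cvC (fun M => \sum_(m < M) Lser k (m.+1%:R * t)) l.
Proof.
move=> ht; have [b b0 hb] := Lser_bound k ht; have q1 := nrm_qexp_lt1 ht.
apply: (@sum_cvC _ (fun m => Lser k (m.+1%:R * t)) (b * (1 - nrm (qexp t))^-1)) => n.
apply: (@le_trans _ _ (\sum_(m < n) b * nrm (qexp t) ^+ m)); last first.
  by rewrite -mulr_sumr ler_wpM2l // geom_bound.
apply: ler_sum => m _; apply: le_trans (hb _ _) _.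
  by rewrite Im_natr_mul ler_peMl ?ler1n // ltW.
rewrite -qexpX nrmX ler_wpM2l // exprS ler_piMl ?exprn_ge0 ?nrm_ge0 // ltW //.
Qed.

(** The Weierstrass factors of x and -x taken together. The exponential makes the deviation from 1
    of order x^-4, so that the product over the lattice converges absolutely. *)
Definition lfac v (x : C) : C := (1 - v ^+ 2 / x ^+ 2) * expC (v ^+ 2 / x ^+ 2).

(** Each row is a product of sines, and together the rows form [phi]. The convergence factors
    contribute exp(v^2 G), where G is half the weight 2 Eisenstein series summed by rows: its
    dependence on the order of summation is the Gaussian of the inversion formula. *)
Lemma lat_rows t : 0 < complex.Im t -> exists G : C, forall v, v != 0 -> exists2 r : nat -> C,
  (forall M, cvC (fun N => \prod_(m < M) \prod_(n < N) lat (lfac v) t m n) (r M)) &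
  cvC r (phi v t / v * expC (v ^+ 2 * G)).
Proof.
move=> ht; have q1 := nrm_qexp_lt1 ht; have tz := two_pi_i_neq0 R.
have [z2 hz2] : exists l : C, cvC (fun n => \sum_(i < n) (i.+1%:R ^+ 2)^-1) l.
  apply: (@sum_cvC _ (fun i => (i.+1%:R ^+ 2)^-1 : C) 2) => n; apply: le_trans (sum_inv_sqr R n).
  by apply: ler_sum => i _; rewrite nrmV nrmX nrm_nat.
have [l2 hl2] := Lser_sum_cvC 2 ht.
have Ia (m : nat) : 0 < complex.Im (m.+1%:R * t) by rewrite Im_natr_mul mulr_gt0.
exists (z2 + lip_const R 2 * l2) => v v0.
pose r0 m : C := if m is m'.+1 then
  sn (m'.+1%:R * t - v) * sn (m'.+1%:R * t + v) / sn (m'.+1%:R * t) ^+ 2 else sn v / (two_pi_i R * v).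
pose s0 m : C := if m is m'.+1 then lip_const R 2 * Lser 2 (m'.+1%:R * t) else z2.
have rowg m : cvC (fun N => \prod_(n < N.+1) lat (fun x => 1 - v ^+ 2 / x ^+ 2) t m n) (r0 m).
  case: m => [|m] /=.
    have tv : two_pi_i R * v != 0 by apply: mulf_neq0.
    have h := cvCMl (two_pi_i R * v)^-1 (sine_product v); rewrite mulrC.
    by apply: eq_cvC h => N; rewrite big_ord_recl /= mul1r mulrA mulVf // mul1r.
  apply: eq_cvC (row_product v (Ia m)) => N; rewrite big_ord_recl /= /sprod addr0.
  by congr (_ * _).
have rows m : cvC (fun N => \sum_(n < N.+1) ladd (fun x => v ^+ 2 / x ^+ 2) t m n) (v ^+ 2 * s0 m).
  case: m => [|m] /=.
    apply: eq_cvC (cvCMl (v ^+ 2) hz2) => N; rewrite big_ord_recl /= add0r mulr_sumr; exact: eq_bigr.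
  apply: eq_cvC (cvCMl (v ^+ 2) (lipschitz (leqnn 2) (Ia m))) => N.
  rewrite big_ord_recl /= /ssum addr0 mulrDr mulr_sumr; congr (_ + _).
  by apply: eq_bigr => i _; rewrite rmorphN /= -!pmulrn mulrDr.
exists (fun M => \prod_(m < M) r0 m * expC (\sum_(m < M) v ^+ 2 * s0 m)).
  move=> M; apply: (@cvC_shift _ _ _ 1).
  apply: eq_cvC (cvCM (@cvC_prod _ _ (index_enum 'I_M) (fun m N => \prod_(n < N.+1)
     lat (fun x => 1 - v ^+ 2 / x ^+ 2) t m n) (fun m => r0 m) (fun m => rowg m))
     (expC_cvC (@cvC_sum _ _ (index_enum 'I_M) (fun m N => \sum_(n < N.+1)
     ladd (fun x => v ^+ 2 / x ^+ 2) t m n) (fun m => v ^+ 2 * s0 m) (fun m => rows m)))) => N.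
  rewrite expC_sum -big_split /= addn1; apply: eq_bigr => m _.
  by rewrite expC_sum -big_split /=; apply: eq_bigr => n _; rewrite /lfac lat_exp.
apply: (@cvC_shift _ _ _ 1).
have hs : cvC (fun M => \sum_(m < M + 1) v ^+ 2 * s0 m) (v ^+ 2 * (z2 + lip_const R 2 * l2)).
  apply: eq_cvC (cvCMl (v ^+ 2) (cvCD (cvC_cst z2) (cvCMl (lip_const R 2) hl2))) => M.
  by rewrite -mulr_sumr addn1 big_ord_recl /= mulr_sumr.
apply: cvCM (expC_cvC hs).
have -> : phi v t / v = sn v / (two_pi_i R * v) * (poch (qexp t) (qexp (t + v)) *
  poch (qexp t) (qexp (t - v)) / poch (qexp t) (qexp t) ^+ 2).
  by have p0 := pochqq_neq0 ht; rewrite phiE //; field; rewrite ?v0 ?tz ?p0.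
apply: (eq_cvC (u := fun M => sn v / (two_pi_i R * v) * (\prod_(m < M) (1 - qexp t ^+ m * qexp (t + v)) *
   \prod_(m < M) (1 - qexp t ^+ m * qexp (t - v)) / (\prod_(m < M) (1 - qexp t ^+ m * qexp t)) ^+ 2))).
  move=> M; rewrite addn1 big_ord_recl /=; congr (_ * _).
  rewrite expr2 invfM -!prodfV -!big_split /=; apply: eq_bigr => m _.
  set a := m.+1%:R * t.
  have ea x : qexp t ^+ m * qexp (t + x) = qexp (a + x).
    by rewrite qexpX -qexpD; congr qexp; rewrite /a -natr1; ring.
  have -> : qexp t ^+ m * qexp (t + v) = qexp (a + v) := ea v.
  have -> : qexp t ^+ m * qexp (t - v) = qexp (a - v) := ea (- v).
  have -> : qexp t ^+ m * qexp t = qexp a by have := ea 0; rewrite !addr0.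
  have sn2 x : sn x = - qexp (- (x / 2)) * (1 - qexp x).
    have ex : qexp (x / 2) = qexp (- (x / 2)) * qexp x by rewrite -qexpD; congr qexp; field.
    by rewrite /sn ex; ring.
  rewrite sn_sqr ![sn (a + _)]sn2.
  have -> : - qexp (- ((a - v) / 2)) * (1 - qexp (a - v)) * (- qexp (- ((a + v) / 2)) * (1 - qexp (a + v))) =
     (qexp (- ((a - v) / 2)) * qexp (- ((a + v) / 2))) * ((1 - qexp (a + v)) * (1 - qexp (a - v))) by ring.
  rewrite -qexpD; have -> : - ((a - v) / 2) - (a + v) / 2 = - a by field.
  rewrite qexpN; have qa := qexp_neq0 a.
  have na : 1 - qexp a != 0.
    by have := sn_neq0 (Ia m); rewrite -/a sn2 mulf_eq0 negb_or => /andP[].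
  by field; rewrite ?qa ?na.
apply: cvCMl; apply: cvCM; first by apply: cvCM; apply: poch_cvC.
by apply: cvCV; [rewrite expf_neq0 // pochqq_neq0 | apply: cvCX; apply: poch_cvC].
Qed.

Lemma lfac_close v x : nrm (lfac v x - 1) <=
  12 * (nrm v ^+ 2 / nrm x ^+ 2) ^+ 2 * expR (nrm v ^+ 2 / nrm x ^+ 2).
Proof.
rewrite /lfac; set y := v ^+ 2 / x ^+ 2.
have -> : nrm v ^+ 2 / nrm x ^+ 2 = nrm y by rewrite /y nrmM nrmV !nrmX.
have [h1 h2] := expC_bounds y; have y0 := nrm_ge0 y.
have -> : (1 - y) * expC y - 1 = (expC y - 1 - y) - y * (expC y - 1) by ring.
apply: le_trans (nrmD _ _) _; rewrite nrmN nrmM.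
have : nrm y * nrm (expC y - 1) <= nrm y * (4 * nrm y * expR (nrm y)) by rewrite ler_wpM2l.
have -> : nrm y * (4 * nrm y * expR (nrm y)) = 4 * nrm y ^+ 2 * expR (nrm y) by ring.
lra.
Qed.

Lemma lat_lfac_close t v : 0 < complex.Im t -> exists2 T : R, 0 <= T &
  forall m n, nrm (lat (lfac v) t m n - 1) <= T / (m.+1%:R ^+ 2 * n.+1%:R ^+ 2).
Proof.
move=> ht; have [c c0 hc] := lattice_lower_bound ht.
pose Y := nrm v ^+ 2 / c ^+ 2; have Y0 : 0 <= Y by rewrite divr_ge0 ?exprn_ge0 ?nrm_ge0 // ltW.
pose B := 12 * Y ^+ 2 * expR Y.
have B0 : 0 <= B by rewrite /B; apply: mulr_ge0; [apply: mulr_ge0 => //; exact: sqr_ge0 | exact: expR_ge0].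
have one (m n : int) : (0 < `|m| + `|n|)%N ->
    nrm (lfac v (m%:~R * t + n%:~R) - 1) <= B / ((`|m| + `|n|)%N%:R ^+ 4).
  move=> h; set s : R := (`|m| + `|n|)%N%:R; have s1 : 1 <= s by rewrite ler1n.
  have hs : c * s <= nrm (m%:~R * t + n%:~R).
    by apply: le_trans (hc m n); rewrite /s natrD !natr_absz.
  apply: le_trans (lfac_close _ _) _; set u := _ / _.
  have uY : u <= Y / s ^+ 2.
    rewrite /u /Y -mulrA -invfM -exprMn ler_wpM2l ?exprn_ge0 ?nrm_ge0 //.
    have cs : 0 < c * s by rewrite mulr_gt0 //; lra.
    rewrite lef_pV2 ?posrE ?exprn_gt0 //; last by apply: lt_le_trans hs.
    by rewrite lerXn2r ?nnegrE ?nrm_ge0 // ltW.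
  have u0 : 0 <= u by rewrite /u divr_ge0 ?exprn_ge0 ?nrm_ge0.
  have uY' : u <= Y.
    apply: le_trans uY _; rewrite ler_pdivrMr; last by rewrite exprn_gt0 //; lra.
    by rewrite ler_peMr // exprn_ege1.
  apply: (@le_trans _ _ (12 * (Y / s ^+ 2) ^+ 2 * expR Y)).
    apply: ler_pM; [by apply: mulr_ge0 => //; exact: sqr_ge0 | exact: expR_ge0 | | by rewrite ler_expR].
    have Ys : 0 <= Y / s ^+ 2 by apply: le_trans uY.
    by rewrite ler_pM2l // lerXn2r ?nnegrE.
  rewrite /B le_eqVlt; apply/orP; left; apply/eqP; field; rewrite gt_eqF //; lra.
have sq (m n : nat) : (0 < m + n)%N -> (6 * (m + n)%:R ^+ 4)^-1 <= (m.+1%:R ^+ 2 * n.+1%:R ^+ 2)^-1 :> R.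
  move=> h; rewrite lef_pV2 ?posrE ?mulr_gt0 ?exprn_gt0 ?ltr0n //.
  (* The arithmetic-geometric mean with m + n + 2 <= 3(m + n). Squaring yields the constant 81/16,
     below the 6 of the claim. *)
  have h1 : (4 * (m.+1 * n.+1) <= 9 * (m + n) ^ 2)%N by nia.
  have h2 := leq_mul h1 h1; rewrite -!natrX -!natrM ler_nat -expnMn -mulnn.
  by rewrite (_ : (m + n) ^ 4 = (m + n) ^ 2 * (m + n) ^ 2)%N -?expnD //; nia.
have S0 : 0 <= 6 * (2 * B + B ^+ 2) by have := sqr_ge0 B; lra.
exists (6 * (2 * B + B ^+ 2)) => //.
have fin (m n : nat) (x : R) : (0 < m + n)%N -> x <= (2 * B + B ^+ 2) / (m + n)%:R ^+ 4 ->
    x <= 6 * (2 * B + B ^+ 2) / (m.+1%:R ^+ 2 * n.+1%:R ^+ 2).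
  move=> h hx; apply: le_trans hx _.
  have s0 : (m + n)%:R != 0 :> R by rewrite pnatr_eq0 -lt0n.
  have -> : (2 * B + B ^+ 2) / (m + n)%:R ^+ 4 = 6 * (2 * B + B ^+ 2) * (6 * (m + n)%:R ^+ 4)^-1.
    by move: ((m + n)%:R : R) s0 => p p0; field.
  by rewrite ler_wpM2l ?sq.
have bsum (m n : nat) : (0 < m + n)%N -> B / (m + n)%:R ^+ 4 <= (2 * B + B ^+ 2) / (m + n)%:R ^+ 4.
  by move=> h; rewrite ler_wpM2r ?invr_ge0 ?exprn_ge0 //; have := sqr_ge0 B; lra.
case=> [|m] [|n] /=.
- by rewrite subrr nrm0; apply: divr_ge0 => //; apply: mulr_ge0; apply: exprn_ge0.
- apply: fin => //; apply: le_trans (bsum 0%N n.+1 isT); have := one 0 n.+1%:Z isT.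
  by rewrite mul0r add0r.
- apply: fin => //; apply: le_trans (bsum m.+1 0%N isT); have := one m.+1%:Z 0 isT.
  by rewrite addr0.
apply: fin => //.
have h1 := one m.+1%:Z n.+1%:Z isT; have := one m.+1%:Z (- n.+1%:Z).
rewrite abszN /= rmorphN /= -!pmulrn in h1 * => /(_ isT) h2.
move: h1 h2; set g := lfac v _; set g' := lfac v (_ - _); set s : R := _%:R ^+ 4 => h1 h2.
have s1 : 1 <= s by rewrite exprn_ege1 // ler1n.
have -> : g * g' - 1 = (g - 1) + (g' - 1) + (g - 1) * (g' - 1) by ring.
apply: le_trans (nrmD _ _) _; rewrite nrmM; have h3 := nrmD (g - 1) (g' - 1).
have h4 : nrm (g - 1) * nrm (g' - 1) <= (B / s) * (B / s) by apply: ler_pM; rewrite ?nrm_ge0.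
have h5 : (B / s) * (B / s) <= B ^+ 2 / s.
  have si : s^-1 <= 1 by rewrite invf_le1; lra.
  have sp : 0 <= s^-1 by rewrite invr_ge0; lra.
  by rewrite mulrACA -expr2 ler_wpM2l ?sqr_ge0 // ler_piMr.
rewrite mulrDl -mulrA; lra.
Qed.

Lemma Im_inv_gt0 t : 0 < complex.Im t -> 0 < complex.Im (- t^-1).
Proof.
case: t => a b /= b0; rewrite opprK divr_gt0 //.
have := sqr_ge0 a; have : 0 < b ^+ 2 by rewrite exprn_gt0.
lra.
Qed.

(** Multiplication by t maps the lattice of -1/t to that of t with rows and columns exchanged. Both
    iterated products agree, and only the two convergence factors remain. *)
Lemma phi_inv_exp t : 0 < complex.Im t -> exists A : C, forall v,
  t * phi (v / t) (- t^-1) = expC (A * v ^+ 2) * phi v t.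
Proof.
move=> ht; have t0 : t != 0 by apply: Im_neq0; rewrite gt_eqF.
have ht' := Im_inv_gt0 ht.
have [G hG] := lat_rows ht; have [G' hG'] := lat_rows ht'.
exists (G - G' / t ^+ 2) => v; have [->|v0] := eqVneq v 0.
  by rewrite mul0r !phiE // /sn mul0r oppr0 subrr !mul0r !mulr0.
have vt0 : v / t != 0 by rewrite mulf_neq0 ?invr_eq0.
have [r hr Lr] := hG v v0; have [s hs Ls] := hG' _ vt0.
have [T T0 hT] := lat_lfac_close v ht.
have lE m n : lat (lfac (v / t)) (- t^-1) m n = lat (lfac v) t n m.
  rewrite -(lat_inv m n t0) => [|x]; last by rewrite /lfac sqrrN.
  have fE x : lfac (v / t) x = lfac v (t * x).
    have e : (v / t) ^+ 2 / x ^+ 2 = v ^+ 2 / (t * x) ^+ 2 by rewrite [(v / t) ^+ 2]exprMn [(t * x) ^+ 2]exprMn exprVn (invfM (t ^+ 2) (x ^+ 2)) mulrA.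
    by rewrite /lfac e.
  by case: m n => [|m] [|n] //=; rewrite !fE.
have := double_prod_iterated T0 hT hr _ Lr Ls => /(_ _) e.
have {}e : phi v t / v * expC (v ^+ 2 * G) = phi (v / t) (- t^-1) / (v / t) * expC ((v / t) ^+ 2 * G').
  apply: e => N; apply: eq_cvC (hs N) => M; rewrite [RHS]exchange_big /=.
  by apply: eq_bigr => m _; apply: eq_bigr => n _; rewrite lE.
have -> : (G - G' / t ^+ 2) * v ^+ 2 = v ^+ 2 * G - (v / t) ^+ 2 * G' by field.
rewrite expCB; have E0 := expC_neq0 ((v / t) ^+ 2 * G').
have -> : phi v t = phi (v / t) (- t^-1) / (v / t) * expC ((v / t) ^+ 2 * G') * v / expC (v ^+ 2 * G).
  by rewrite -e; move: (expC_neq0 (v ^+ 2 * G)); move: (expC (v ^+ 2 * G)) => x x0; field; rewrite ?x0 ?v0.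
by move: (expC_neq0 (v ^+ 2 * G)) E0; move: (expC (v ^+ 2 * G)) (expC _) => x y x0 y0; field; rewrite ?x0 ?y0 ?t0 ?v0.
Qed.

Lemma phi_real_neq0 t (x : R) : 0 < complex.Im t -> sin (pi * x) != 0 -> phi x%:C%C t != 0.
Proof.
move=> ht hx; rewrite phiE //; have q1 := nrm_qexp_lt1 ht.
have pn (y : R) : poch (qexp t) (qexp (t + y%:C%C)) != 0.
  apply: poch_neq0 => // n; rewrite qexpD mulrA -exprSr; apply/eqP => /(congr1 (@nrm R)).
  rewrite nrmM nrm1 nrmX [nrm (qexp y%:C%C)]nrm_qexp /= mulr0 oppr0 expR0 mulr1 => e.
  by have := exprn_ilt1 n.+1 (nrm_ge0 (qexp t)) q1; rewrite e ltxx.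
apply: mulf_neq0; last first.
  rewrite invr_eq0; apply: mulf_neq0; first exact: two_pi_i_neq0.
  by rewrite expf_neq0 // pochqq_neq0.
apply: mulf_neq0; last by rewrite -rmorphN; apply: pn.
apply: mulf_neq0 => //.
by rewrite -nrm_eq0 nrm_sn_real; apply: mulf_neq0; rewrite ?pnatr_eq0 ?normr_eq0.
Qed.

(** The constant of [phi_inv_exp] is found without evaluating a weight 2 series: the shift v -> v +
    1 at t is a shift by the period at -1/t. Comparing the two quasi-periodicities gives exp(B s) =
    1 for the error B and all s in an interval. *)
Theorem phi_inv v t : 0 < complex.Im t ->
  t * phi (v / t) (- t^-1) = qexp (v ^+ 2 / (2 * t)) * phi v t.
Proof.
move=> ht; have t0 : t != 0 by apply: Im_neq0; rewrite gt_eqF.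
have ht' := Im_inv_gt0 ht; have [A hA] := phi_inv_exp ht.
suff AE : A = two_pi_i R / (2 * t).
  by rewrite hA AE /qexp; congr (expC _ * _); field.
pose B := A - two_pi_i R / (2 * t).
suff : B = 0 by move/eqP; rewrite subr_eq0 => /eqP.
have key (s : R) : 0 < s < 1 -> expC (B * s%:C%C) = 1.
  (* Chosen so that (v1 + 1)^2 - v1^2 = s; moreover v1 is real in (-1/2, 0), where [phi] does not
     vanish. *)
  move=> hs; pose v1 := ((s - 1) / 2)%:C%C : C.
  have p0 := @pi_gt0 R.
  have v0 : phi v1 t != 0.
    apply: phi_real_neq0 => //; rewrite -oppr_eq0 -sinN gt_eqF //; apply: sin_gt0_pi.
    have -> : - (pi * ((s - 1) / 2)) = pi * ((1 - s) / 2) by field.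
    apply/andP; split; first by apply: mulr_gt0 => //; lra.
    by rewrite gtr_pMr //; lra.
  have h1 := hA (v1 + 1); rewrite phi_addr1 in h1.
  have h2 := phi_addt (v1 / t + t^-1) ht'.
  have e1 : v1 / t + t^-1 - t^-1 = v1 / t by ring.
  have e2 : (v1 + 1) / t = v1 / t + t^-1 by ring.
  have e3 : - (- t^-1 / 2) = t^-1 / 2 by ring.
  rewrite e1 e3 in h2; rewrite e2 in h1.
  have h3 := hA v1; rewrite h2 in h3.
  have h4 : expC (A * v1 ^+ 2) * phi v1 t =
    qexp (t^-1 / 2 - (v1 / t + t^-1)) * (expC (A * (v1 + 1) ^+ 2) * phi v1 t).
    rewrite -h3.
    have -> : expC (A * (v1 + 1) ^+ 2) * phi v1 t = - (t * phi (v1 / t + t^-1) (- t^-1)).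
      by rewrite h1; ring.
    by ring.
  have {h4} h4 : expC (A * v1 ^+ 2) = qexp (t^-1 / 2 - (v1 / t + t^-1)) * expC (A * (v1 + 1) ^+ 2).
    by apply: (mulIf v0); rewrite h4; ring.
  have vE : v1 = (s%:C%C - 1) / 2.
    by rewrite /v1 rmorphM fmorphV rmorphB /= rmorph1 rmorph_nat.
  have -> : B * s%:C%C = A * (v1 + 1) ^+ 2 + two_pi_i R * (t^-1 / 2 - (v1 / t + t^-1)) - A * v1 ^+ 2.
    by rewrite vE /B; field.
  rewrite expCB expCD.
  have -> : expC (A * (v1 + 1) ^+ 2) * expC (two_pi_i R * (t^-1 / 2 - (v1 / t + t^-1))) = expC (A * v1 ^+ 2).
    by rewrite h4 mulrC.
  by rewrite divff ?expC_neq0.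
have [//|B0] := eqVneq B 0.
have nB : 0 < nrm B by rewrite lt_def nrm_eq0 B0 nrm_ge0.
(* Then |B s| is at most 1/100, too small and nonzero for the quadratic remainder of exp(B s) to
   cancel the linear term. *)
pose s : R := (100 * (nrm B + 1))^-1.
have s0 : 0 < s by rewrite invr_gt0; lra.
have s1 : s < 1 by rewrite invf_lt1; lra.
have := key s; rewrite s0 s1 => /(_ isT) e; have [_] := expC_bounds (B * s%:C%C).
rewrite e subrr sub0r nrmN nrmM nrm_real gtr0_norm //; set x := nrm B * s.
have x0 : 0 < x by rewrite mulr_gt0.
have x1 : x <= 100^-1.
  rewrite /x /s invfM mulrCA ler_piMr ?invr_ge0 // ler_pdivrMr; lra.
have ex : expR x < 2 by apply: le_lt_trans expR_half_lt2; rewrite ler_expR; lra.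
have := expR_gt0 x => ex0 h; exfalso.
have : 8 * x ^+ 2 * expR x < 8 * x ^+ 2 * 2 by rewrite ltr_pM2l // mulr_gt0 // exprn_gt0.
nra.
Qed.

End Theta.

(** * Klein forms and the modular group *)

(** Generation of SL2(Z) by translations and inversion, as an induction principle: Euclid's
    algorithm on the first column, with |c| as the measure. The steps multiply the matrix on the
    left. *)
Lemma SL2_ind (P : int -> int -> int -> int -> Prop) :
  P 1 0 0 1 ->
  (forall a b c e : int, a * e - b * c = 1 -> P a b c e -> P (a + c) (b + e) c e) ->
  (forall a b c e : int, a * e - b * c = 1 -> P a b c e -> P (a - c) (b - e) c e) ->
  (forall a b c e : int, a * e - b * c = 1 -> P a b c e -> P (- c) (- e) a b) ->
  forall a b c e : int, a * e - b * c = 1 -> P a b c e.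
Proof.
move=> P1 PT PT' PS.
have Tn (n : nat) a b c e : a * e - b * c = 1 -> P a b c e -> P (a + n%:Z * c) (b + n%:Z * e) c e.
  move=> h; elim: n => [|n IH] hP; first by rewrite !mul0r !addr0.
  have S x y : x + n.+1%:Z * y = x + n%:Z * y + y by rewrite -addn1 PoszD; ring.
  by rewrite !S; apply: PT (IH hP); rewrite -h; ring.
have Tn' (n : nat) a b c e : a * e - b * c = 1 -> P a b c e -> P (a - n%:Z * c) (b - n%:Z * e) c e.
  move=> h; elim: n => [|n IH] hP; first by rewrite !mul0r !subr0.
  have S x y : x - n.+1%:Z * y = x - n%:Z * y - y by rewrite -addn1 PoszD; ring.
  by rewrite !S; apply: PT' (IH hP); rewrite -h; ring.
have Tz (n : int) a b c e : a * e - b * c = 1 -> P a b c e -> P (a + n * c) (b + n * e) c e.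
  case: n => n h hP; first exact: Tn.
  by rewrite NegzE !mulNr; apply: Tn'.
(* The inversion has order 4, so its inverse is its cube. *)
have PS3 a b c e : a * e - b * c = 1 -> P a b c e -> P c e (- a) (- b).
  move=> h hP; have h1 := PS _ _ _ _ h hP.
  have h2 := PS _ _ _ _ _ h1; have h3 := PS _ _ _ _ _ (h2 _).
  by rewrite !opprK in h3; apply: h3; rewrite -h; ring.
move=> a b c e; have [m] := ubnP `|c|%N; elim: m a b c e => // m IH a b c e.
rewrite ltnS => hm h; have [c0|c0] := eqVneq c 0.
  rewrite c0 in h *; rewrite mulr0 subr0 in h.
  have /andP[/eqP ua _] : (`|a| == 1)%N && (`|e| == 1)%N by rewrite -muln_eq1 -abszM h.
  have [[a1 e1]|[a1 e1]] : (a = 1 /\ e = 1) \/ (a = -1 /\ e = -1).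
    by have [a1|a1] : a = 1 \/ a = -1; [lia| |]; rewrite a1 in h *; [left|right]; lia.
    have H : P (1 + b * 0) (0 + b * 1) 0 1 by apply: Tz => //.
    by rewrite a1 e1; move: H; rewrite mulr0 addr0 add0r mulr1.
  have h2 : P (- 0) (- 1) 1 0 by apply: PS => //.
  have {}h2 : P (- 1) (- 0) (- 0) (- 1) by apply: PS h2; lia.
  have H : P (- 1 + - b * - 0) (- 0 + - b * - 1) (- 0) (- 1) by apply: Tz h2; lia.
  by rewrite a1 e1; move: H; rewrite oppr0 mulr0 addr0 add0r mulrN1 opprK.
pose n := (a %/ c)%Z; have ea := divz_eq a c; rewrite -/n in ea.
have rb := modz_ge0 a c0; have rc := ltz_mod a c0.
have hP : P (- c) (- e) (a - n * c) (b - n * e).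
  apply: IH; last by rewrite -h; ring.
  by apply: leq_trans hm; lia.
have hP2 := PS3 _ _ _ _ _ hP.
have := Tz n _ _ _ _ _ (hP2 _); rewrite !opprK !subrK; apply; rewrite -h; ring.
Qed.

(** * The action of SL2(Z) on the upper half-plane *)

Section Moebius.
Variable R : realType.
Local Notation C := R[i].
Implicit Types (z t : C) (a b c e : int).

Definition aut c e z : C := c%:~R * z + e%:~R.
Definition mob a b c e z : C := aut a b z / aut c e z.

Lemma aut_neq0 a b c e z : a * e - b * c = 1 -> 0 < complex.Im z -> aut c e z != 0.
Proof.
move=> h hz; rewrite /aut; have [c0|c0] := eqVneq c 0.
  rewrite c0 mul0r add0r intr_eq0; apply/eqP => e0; move: h; rewrite c0 e0; lia.
apply: Im_neq0; rewrite !intCE Im_addr_real.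
have -> : complex.Im ((c%:~R : R)%:C%C * z) = c%:~R * complex.Im z by case: (z) => p q /=; ring.
by rewrite mulf_neq0 ?intr_eq0 // gt_eqF.
Qed.

Lemma mob_T a b c e z : a * e - b * c = 1 -> 0 < complex.Im z ->
  mob (a + c) (b + e) c e z = mob a b c e z + 1.
Proof.
move=> h hz; have := aut_neq0 h hz; rewrite /mob => j0.
have -> : aut (a + c) (b + e) z = aut a b z + aut c e z by rewrite /aut !intrD; ring.
by rewrite mulrDl divff.
Qed.

Lemma mob_T' a b c e z : a * e - b * c = 1 -> 0 < complex.Im z ->
  mob (a - c) (b - e) c e z = mob a b c e z - 1.
Proof.
move=> h hz; have := aut_neq0 h hz; rewrite /mob => j0.
have -> : aut (a - c) (b - e) z = aut a b z - aut c e z by rewrite /aut !intrB; ring.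
by rewrite mulrBl divff.
Qed.

Lemma mob_S a b c e z : mob (- c) (- e) a b z = - (mob a b c e z)^-1.
Proof.
rewrite /mob invf_div; have -> : aut (- c) (- e) z = - aut c e z by rewrite /aut !rmorphN /=; ring.
by rewrite mulNr.
Qed.

Lemma Im_mob_gt0 a b c e z : a * e - b * c = 1 -> 0 < complex.Im z -> 0 < complex.Im (mob a b c e z).
Proof.
move=> h hz; move: a b c e h.
apply: (@SL2_ind (fun a b c e => 0 < complex.Im (mob a b c e z))).
- by rewrite /mob /aut mul1r mul0r add0r addr0 divr1.
- by move=> a b c e h; rewrite mob_T // -[1 in X in _ -> X]/(1%:C%C) Im_addr_real.
- by move=> a b c e h; rewrite mob_T' // -[1]/(1%:C%C) -rmorphN Im_addr_real.
by move=> a b c e h; rewrite mob_S; exact: Im_inv_gt0.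
Qed.

Lemma aut_S a b c e z : a * e - b * c = 1 -> 0 < complex.Im z ->
  aut a b z = mob a b c e z * aut c e z.
Proof. by move=> h hz; rewrite /mob divfK // (aut_neq0 h hz). Qed.

End Moebius.

(** * Klein forms *)

Section Klein.
Variable R : realType.
Local Notation C := R[i].
Implicit Types (x y z t v : C).

(* Locked, so that rewriting with ring identities does not look inside. *)
Fact klein_key : unit. Proof. exact: tt. Qed.
Definition klein (x y t : C) : C :=
  locked_with klein_key (qexp (x * (x * t + y) / 2) * phi (x * t + y) t).

(** The Klein form of characteristic (x, y), of weight -1: the exponential absorbs the Gaussian of
    [phi_inv], so that SL2(Z) merely acts linearly on the characteristic ([klein_mob]). *)
Lemma kleinE x y t : klein x y t = qexp (x * (x * t + y) / 2) * phi (x * t + y) t.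
Proof. by rewrite /klein unlock. Qed.

Lemma phi_T v t : phi v (t + 1) = phi v t.
Proof. by rewrite /phi [t + 1 + v]addrAC !(qexpD _ 1) qexp1 !mulr1. Qed.

Lemma klein_T x y t : klein x y (t + 1) = klein x (x + y) t.
Proof.
have e : x * (t + 1) + y = x * t + (x + y) by ring.
by rewrite !kleinE phi_T e.
Qed.

Lemma klein_T' x y t : klein x y (t - 1) = klein x (y - x) t.
Proof. by have := klein_T x (y - x) (t - 1); rewrite subrK => ->; rewrite addrCA subrr addr0. Qed.

Lemma klein_S x y t : 0 < complex.Im t -> klein x y (- t^-1) = t^-1 * klein y (- x) t.
Proof.
move=> ht; have t0 : t != 0 by apply: Im_neq0; rewrite gt_eqF.
rewrite !kleinE; set v := y * t - x.
have -> : x * - t^-1 + y = v / t by rewrite /v; field.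
have h := phi_inv v ht.
have -> : phi (v / t) (- t^-1) = t^-1 * (qexp (v ^+ 2 / (2 * t)) * phi v t) by rewrite -h mulKf.
have -> : qexp (y * v / 2) = qexp (x * (v / t) / 2) * qexp (v ^+ 2 / (2 * t)).
  by rewrite -qexpD; congr qexp; rewrite /v; field.
by ring.
Qed.

Lemma klein_mob (a b c e : int) x y t : a * e - b * c = 1 -> 0 < complex.Im t ->
  klein x y (mob a b c e t) =
  (aut c e t)^-1 * klein (x * a%:~R + y * c%:~R) (x * b%:~R + y * e%:~R) t.
Proof.
move=> h ht; move: a b c e h x y.
apply: (@SL2_ind (fun a b c e => forall x y, klein x y (mob a b c e t) =
  (aut c e t)^-1 * klein (x * a%:~R + y * c%:~R) (x * b%:~R + y * e%:~R) t)).
- move=> x y; rewrite /mob /aut mul1r mul0r add0r addr0 divr1.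
  by rewrite invr1 mul1r !mulr1 !mulr0 addr0 add0r.
- move=> a b c e h IH x y; rewrite mob_T // klein_T IH.
  have -> : x * (a + c)%:~R + y * c%:~R = x * a%:~R + (x + y) * c%:~R by rewrite intrD; ring.
  by have -> : x * (b + e)%:~R + y * e%:~R = x * b%:~R + (x + y) * e%:~R by rewrite intrD; ring.
- move=> a b c e h IH x y; rewrite mob_T' // klein_T' IH.
  have -> : x * (a - c)%:~R + y * c%:~R = x * a%:~R + (y - x) * c%:~R by rewrite intrB; ring.
  by have -> : x * (b - e)%:~R + y * e%:~R = x * b%:~R + (y - x) * e%:~R by rewrite intrB; ring.
move=> a b c e h IH x y; rewrite mob_S klein_S ?Im_mob_gt0 // IH mulrA -invfM -aut_S //.
have -> : x * (- c)%:~R + y * a%:~R = y * a%:~R + - x * c%:~R by rewrite rmorphN /=; ring.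
by have -> : x * (- e)%:~R + y * b%:~R = y * b%:~R + - x * e%:~R by rewrite rmorphN /=; ring.
Qed.

Lemma klein_add1l x y t : 0 < complex.Im t -> klein (x + 1) y t = - qexp (- (y / 2)) * klein x y t.
Proof.
move=> ht; rewrite !kleinE; have -> : (x + 1) * t + y = x * t + y + t by ring.
rewrite phi_addt //; set v := x * t + y.
have -> : - qexp (- (y / 2)) * (qexp (x * v / 2) * phi v t) = - (qexp (- (y / 2)) * qexp (x * v / 2)) * phi v t.
  by ring.
rewrite mulrA mulrN -!qexpD; congr (- qexp _ * _); rewrite /v; by field.
Qed.

Lemma klein_add2l x y t : 0 < complex.Im t -> klein (x + 2) y t = qexp (- y) * klein x y t.
Proof.
move=> ht; have -> : x + 2 = x + 1 + 1 by ring.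
rewrite !klein_add1l // mulrA mulrNN -qexpD; congr (qexp _ * _); by field.
Qed.

Lemma klein_add2r x y t : klein x (y + 2) t = qexp x * klein x y t.
Proof.
rewrite !kleinE; have -> : x * t + (y + 2) = x * t + y + 1 + 1 by ring.
by rewrite !phi_addr1 opprK mulrA -qexpD; congr (qexp _ * _); field.
Qed.

(** Shifting by odd integers would also bring in signs. This is why the characteristics used below
    have even numerators 2r and 2j, which for odd denominators run over the same classes. *)
Lemma klein_add_even x y t (m n : int) : 0 < complex.Im t ->
  klein (x + 2 * m%:~R) (y + 2 * n%:~R) t = qexp (n%:~R * x - m%:~R * y) * klein x y t.
Proof.
move=> ht.
have l0 (j : nat) u w : klein (u + 2 * j%:~R) w t = qexp (- (j%:~R * w)) * klein u w t.
  elim: j => [|j IH]; first by rewrite mulr0 addr0 mul0r oppr0 qexp0 mul1r.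
  have -> : u + 2 * j.+1%:~R = u + 2 * j%:~R + 2 by rewrite -[j.+1]addn1 PoszD intrD; ring.
  rewrite klein_add2l // IH mulrA -qexpD; congr (qexp _ * _).
  by rewrite -[j.+1]addn1 PoszD intrD; ring.
have l u w : klein (u + 2 * m%:~R) w t = qexp (- (m%:~R * w)) * klein u w t.
  case: (m) => j; first exact: l0.
  rewrite NegzE rmorphN /=; have := l0 j.+1 (u + 2 * - j.+1%:~R) w.
  rewrite mulrN subrK => ->; rewrite mulrA -qexpD -[LHS]mul1r -qexp0; congr (qexp _ * _); ring.
have r0 (j : nat) u w : klein u (w + 2 * j%:~R) t = qexp (j%:~R * u) * klein u w t.
  elim: j => [|j IH]; first by rewrite mulr0 addr0 mul0r qexp0 mul1r.
  have -> : w + 2 * j.+1%:~R = w + 2 * j%:~R + 2 by rewrite -[j.+1]addn1 PoszD intrD; ring.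
  rewrite klein_add2r // IH mulrA -qexpD; congr (qexp _ * _).
  by rewrite -[j.+1]addn1 PoszD intrD; ring.
have r u w : klein u (w + 2 * n%:~R) t = qexp (n%:~R * u) * klein u w t.
  case: (n) => j; first exact: r0.
  rewrite NegzE rmorphN /=; have := r0 j.+1 u (w + 2 * - j.+1%:~R).
  rewrite mulrN subrK => ->; rewrite mulrA -qexpD -[LHS]mul1r -qexp0; congr (qexp _ * _); ring.
rewrite r l mulrA -qexpD.
have -> : n%:~R * (x + 2 * m%:~R) + - (m%:~R * y) = n%:~R * x - m%:~R * y + (2 * (n * m))%:~R.
  by rewrite !intrM; ring.
by rewrite qexpD qexp_int mulr1.
Qed.

Lemma klein_opp x y t : 0 < complex.Im t -> klein (- x) (- y) t = - klein x y t.
Proof.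
move=> ht; rewrite !kleinE; have -> : - x * t - y = - (x * t + y) by ring.
by rewrite phi_opp // mulrN; congr (- (qexp _ * _)); ring.
Qed.

End Klein.

(** * The eta quotient as a product of Klein forms *)

Section SymmetricProducts.
Variable A : comPzRingType.
Implicit Types f g : int -> A.

Lemma eq_sprod m f g : f =1 g -> sprod m f = sprod m g.
Proof. by move=> e; rewrite /sprod e; congr (_ * _); apply: eq_bigr => r _; rewrite !e. Qed.

Lemma sprodM m f g : sprod m (fun j => f j * g j) = sprod m f * sprod m g.
Proof.
by rewrite /sprod mulrACA -big_split /=; congr (_ * _); apply: eq_bigr => r _; rewrite mulrACA.
Qed.

Lemma sprod_const m (c : A) : sprod m (fun=> c) = c ^+ m.*2.+1.
Proof. by rewrite /sprod prodr_const card_ord -expr2 -exprM mul2n exprS. Qed.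

Lemma sprodN m f : sprod m (fun j => f (- j)) = sprod m f.
Proof.
by rewrite /sprod oppr0; congr (_ * _); apply: eq_bigr => r _; rewrite opprK mulrC.
Qed.

Lemma sprod_unit m f (a : int) : coprimez a m.*2.+1%:Z ->
  (forall t u, (m.*2.+1%:Z %| t - u)%Z -> f t = f u) ->
  sprod m (fun j => f (a * j)) = sprod m f.
Proof.
move=> ca hf; rewrite !sprod_periodic //; last first.
  by move=> t u h; apply: hf; rewrite -mulrBr dvdz_mull.
apply: (@periodic_big_reindex _ _ _ m.*2.+1 'I_m.*2.+1 (fun x => a * x%:Z)) => //; first exact: card_ord.
move=> t u; rewrite -mulrBr Gauss_dvdzr; last by rewrite coprimez_sym.
move=> h; apply/val_inj => /=; apply/eqP; have := ltn_ord t; have := ltn_ord u.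
move: (nat_of_ord t) (nat_of_ord u) h => x y /dvdzP[l hl] hx hy; apply/eqP.
by have [l0|l0] : l = 0 \/ (`|l| >= 1)%N; [lia|rewrite l0 in hl; lia|nia].
Qed.

End SymmetricProducts.

Lemma sum_sqr (F : numFieldType) m :
  \sum_(r < m) r.+1%:R ^+ 2 = m%:R * (m%:R + 1) * (2 * m%:R + 1) / 6 :> F.
Proof.
elim: m => [|m IH]; first by rewrite big_ord0 !mul0r.
by rewrite big_ord_recr /= IH -natr1; field.
Qed.

Lemma sum_lin (F : numFieldType) m : \sum_(r < m) r.+1%:R = m%:R * (m%:R + 1) / 2 :> F.
Proof.
elim: m => [|m IH]; first by rewrite big_ord0 !mul0r.
by rewrite big_ord_recr /= IH -natr1; field.
Qed.

(** The odd numbers below 2m + 1 are the complements 2m + 1 - 2r of the even ones. *)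
Lemma big_even_odd (A : comPzRingType) (m : nat) (F : nat -> A) :
  \prod_(j < m.*2.+1) F j.+1 =
  F m.*2.+1 * \prod_(r < m) (F r.+1.*2 * F (m.*2.+1 - r.+1.*2)%N).
Proof.
rewrite big_ord_recr /= mulrC; congr (_ * _).
have -> : \prod_(j < m.*2) F j.+1 = \prod_(r < m) (F r.*2.+1 * F r.+1.*2).
  elim: m => [|m IH]; first by rewrite !big_ord0.
  by rewrite doubleS !big_ord_recr /= IH -mulrA.
rewrite !big_split /= mulrC; congr (_ * _).
rewrite (reindex_inj rev_ord_inj) /=; apply: eq_bigr => r _; congr F.
by have := ltn_ord r; lia.
Qed.

Section EtaPochhammer.
Variable R : realType.
Local Notation C := R[i].
Implicit Types (z : C).

Lemma qexp_sum (I : Type) (r : seq I) (P : pred I) (f : I -> C) :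
  qexp (\sum_(i <- r | P i) f i) = \prod_(i <- r | P i) qexp (f i).
Proof. by rewrite /qexp mulr_sumr expC_sum. Qed.

Lemma eta_poch z : 0 < complex.Im z -> dedekind_eta z = qexp (z / 24) * poch (qexp z) (qexp z).
Proof.
move=> hz; rewrite /dedekind_eta /qexp mulrA; congr (_ * _); apply: cvC_lim.
apply: eq_cvC (poch_cvC (qexp z) (nrm_qexp_lt1 hz)) => m.
by rewrite big_add1 /= big_mkord; apply: eq_bigr => i _; rewrite exprSr.
Qed.

Lemma eta_neq0 z : 0 < complex.Im z -> dedekind_eta z != 0.
Proof. by move=> hz; rewrite eta_poch // mulf_neq0 ?qexp_neq0 ?pochqq_neq0. Qed.

End EtaPochhammer.

(** * Products of Klein forms at division points *)

Section EtaKlein.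
Variable R : realType.
Local Notation C := R[i].
Implicit Types (x y z t v q w : C).

Lemma prod_1_sub_root n w y : n.-primitive_root w -> \prod_(j < n) (1 - w ^+ j * y) = 1 - y ^+ n.
Proof.
move=> pw; have n0 := prim_order_gt0 pw.
have [->|y0] := eqVneq y 0.
  by rewrite expr0n eqn0Ngt n0 subr0 big1 // => j _; rewrite mulr0 subr0.
have := factor_Xn_sub_1 pw; rewrite big_mkord => /(congr1 (fun p => p.[y^-1])).
rewrite horner_prod !hornerE => e.
have -> : 1 - y ^+ n = y ^+ n * (y^-1 ^+ n - 1).
  by rewrite mulrBr mulr1 -exprMn divff // expr1n.
have {1}<- : \prod_(j < n) y = y ^+ n by rewrite prodr_const card_ord.
rewrite -e -big_split /=; apply: eq_bigr => j _.
by rewrite !hornerE mulrBr divff // mulrC.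
Qed.

Lemma nrmX_lt1 q n : nrm q < 1 -> (0 < n)%N -> nrm (q ^+ n) < 1.
Proof. by move=> q1 n0; rewrite nrmX exprn_ilt1 ?nrm_ge0 // -lt0n. Qed.

Lemma poch_root q x n w : nrm q < 1 -> n.-primitive_root w ->
  \prod_(j < n) poch q (w ^+ j * x) = poch (q ^+ n) (x ^+ n).
Proof.
move=> q1 pw; have n0 := prim_order_gt0 pw.
have h := @cvC_prod _ _ (index_enum 'I_n) (fun j m => \prod_(i < m) (1 - q ^+ i * (w ^+ j * x)))
  (fun j => poch q (w ^+ j * x)) (fun j => poch_cvC _ q1).
apply: cvC_uniq h _; apply: eq_cvC (poch_cvC (x ^+ n) (nrmX_lt1 q1 n0)) => m.
rewrite exchange_big /=; apply: eq_bigr => i _.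
rewrite -exprM mulnC exprM -exprMn -(prod_1_sub_root _ pw); apply: eq_bigr => j _.
by rewrite mulrCA.
Qed.

Lemma poch_split q x n : nrm q < 1 -> (0 < n)%N ->
  \prod_(j < n) poch (q ^+ n) (q ^+ j * x) = poch q x.
Proof.
move=> q1 n0; have qn := nrmX_lt1 q1 n0.
have h := @cvC_prod _ _ (index_enum 'I_n) (fun j m => \prod_(i < m) (1 - (q ^+ n) ^+ i * (q ^+ j * x)))
  (fun j => poch (q ^+ n) (q ^+ j * x)) (fun j => poch_cvC _ qn).
apply: cvC_uniq h _; have hf m : (m <= m * n)%N by rewrite leq_pmulr.
apply: eq_cvC (cvC_sub hf (poch_cvC x q1)) => m; rewrite exchange_big /=.
elim: m => [|m IH]; first by rewrite mul0n !big_ord0.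
rewrite big_ord_recr /= -IH mulSn addnC big_split_ord /=; congr (_ * _); apply: eq_bigr => j _.
by rewrite exprD mulrA -exprM mulnC.
Qed.

Lemma qexp2_prim m : m.*2.+1.-primitive_root (qexp (m.*2.+1%:R^-1 : C) ^+ 2).
Proof.
have h := @qexp_prim R m.*2.+1 isT; rewrite prim_root_exp_coprime //.
by rewrite coprime2n /= odd_double.
Qed.

Lemma sprod_qexp_lin m x y : sprod m (fun j => qexp (x + j%:~R * y)) = qexp (m.*2.+1%:R * x).
Proof.
transitivity (sprod m (fun j : int => qexp x * qexp (j%:~R * y))).
  by apply: eq_sprod => j; rewrite qexpD.
rewrite sprodM sprod_const qexpX -[RHS]mulr1; congr (_ * _).
rewrite /sprod mul0r qexp0 mul1r big1 // => r _.
by rewrite -qexpD rmorphN /= mulNr subrr qexp0.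
Qed.

Lemma sprod_poch_root m q x : nrm q < 1 ->
  sprod m (fun j => poch q (x * qexp (j%:~R * (2 / m.*2.+1%:R)))) = poch (q ^+ m.*2.+1) (x ^+ m.*2.+1).
Proof.
move=> q1; set n := m.*2.+1; pose w := qexp (n%:R^-1 : C) ^+ 2.
have pw : n.-primitive_root w by apply: qexp2_prim.
have wE (j : int) : qexp (j%:~R * (2 / n%:R)) = w ^ j.
  by rewrite /w qexpX qexpz.
transitivity (sprod m (fun j => poch q (x * w ^ j))); first by apply: eq_sprod => j; rewrite wE.
rewrite sprod_periodic -/n.
  by rewrite -(poch_root _ q1 pw); apply: eq_bigr => j _; rewrite mulrC.
by move=> t u h; congr (poch q (x * _)); apply: prim_exprz_eq h.
Qed.

(** For odd n, a definite square root of (-1)^((n-1)/2) n, see [Psin_sqr]; it is the Gauss sum up to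
    a sign ([gsumE]). *)
Definition Psin (n : nat) : C := \prod_(r < n./2) sn (2 * r.+1%:R / n%:R).

Lemma sn_add_even v (l : int) : sn (v + 2 * l%:~R) = sn v.
Proof.
rewrite /sn; have -> : (v + 2 * l%:~R) / 2 = v / 2 + l%:~R by field.
by rewrite opprD qexpD qexpB qexp_int divr1 mulr1.
Qed.

Lemma Psin_sqr m : Psin m.*2.+1 ^+ 2 = (-1) ^+ m * m.*2.+1%:R.
Proof.
have h := qexp2_prim m; have := prod_sine_half (qexp_neq0 _) h.
rewrite /Psin /= uphalf_double; set x := qexp _ => e.
transitivity ((-1) ^+ m * \prod_(r < m) (- (x ^+ r.+1 - x ^- r.+1) ^+ 2)); last by rewrite e.
have -> : (-1) ^+ m = \prod_(r < m) (-1) :> C by rewrite prodr_const card_ord.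
rewrite -prodrXl -big_split /=; apply: eq_bigr => r _; rewrite mulN1r opprK; congr (_ ^+ 2).
have n0 : m.*2.+1%:R != 0 :> C by rewrite pnatr_eq0.
rewrite /sn /x -exprVn -qexpN !qexpX; move: (m.*2.+1%:R : C) n0 => n n0.
congr (qexp _ - qexp _); by field.
Qed.

Lemma Psin_neq0 m : Psin m.*2.+1 != 0.
Proof.
have := Psin_sqr m; apply: contra_eq_neq => ->; rewrite expr0n /= eq_sym mulf_neq0 ?signr_eq0 //.
Qed.

Fact kleinS_key : unit. Proof. exact: tt. Qed.
Definition kleinS (d : nat) x t : C :=
  locked_with kleinS_key (sprod d./2 (fun j => klein x (2 * j%:~R / d%:R) t)).

Lemma kleinSE d x t : kleinS d x t = sprod d./2 (fun j => klein x (2 * j%:~R / d%:R) t).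
Proof. by rewrite /kleinS unlock. Qed.

(** For odd d and D, the characteristics (2r/D, 2j/d) run over the nonzero classes of (Z/D) x (Z/d)
    up to sign. There are (dD - 1)/2 of them, whence the weight k of the quotient. *)
Definition kprod (d D : nat) t : C :=
  \prod_(s < d./2) klein 0 (2 * s.+1%:R / d%:R) t * \prod_(r < D./2) kleinS d (2 * r.+1%:R / D%:R) t.

Lemma klein0_prod m t : 0 < complex.Im t -> let d := m.*2.+1 in
  \prod_(s < m) klein 0 (2 * s.+1%:R / d%:R) t =
  Psin d * (poch (qexp t ^+ d) (qexp t ^+ d) / poch (qexp t) (qexp t)) /
  (two_pi_i R * poch (qexp t) (qexp t) ^+ 2) ^+ m.
Proof.
move=> ht d; have q1 := nrm_qexp_lt1 ht; have p0 := pochqq_neq0 ht.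
have := sprod_poch_root m (qexp t) q1; rewrite -/d /sprod mul0r qexp0 mulr1 => <-.
rewrite [poch _ _ * \prod_(r < m) _]mulrC mulfK // /Psin /d /= uphalf_double -/d.
have -> : forall c : C, c ^+ m = \prod_(r < m) c by move=> c; rewrite prodr_const card_ord.
rewrite -prodfV -!big_split /=; apply: eq_bigr => r _.
rewrite kleinE !mul0r qexp0 mul1r add0r phiE // rmorphN /= mulNr.
have -> : r.+1%:~R * (2 / d%:R) = 2 * r.+1%:R / d%:R :> C by rewrite -pmulrn mulrCA mulrA.
by rewrite -!qexpD !mulrA.
Qed.

Lemma kleinS_eval m x t : 0 < complex.Im t -> let d := m.*2.+1 in
  kleinS d x t = qexp (d%:R * ((x ^+ 2 + x) * t / 2)) *
   (poch (qexp t ^+ d) (qexp (d%:R * (t + x * t))) * poch (qexp t ^+ d) (qexp (- (d%:R * (x * t))))) /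
   (two_pi_i R * poch (qexp t) (qexp t) ^+ 2) ^+ d.
Proof.
move=> ht d; have q1 := nrm_qexp_lt1 ht.
have e1 := sprod_poch_root m (qexp (t + x * t)) q1.
have e2 := sprod_poch_root m (qexp (- (x * t))) q1; rewrite -sprodN in e2.
rewrite -/d !qexpX mulrN in e1 e2.
rewrite qexpX -e1 -e2 -!sprodM -(sprod_qexp_lin _ _ ((x + 1) / d%:R)).
have -> : forall c : C, (c ^+ d)^-1 = sprod m (fun=> c^-1) by move=> c; rewrite sprod_const exprVn.
rewrite -!sprodM kleinSE /d /= uphalf_double -/d; apply: eq_sprod => j.
set y := 2 * j%:~R / d%:R; have d0 : d%:R != 0 :> C by rewrite pnatr_eq0.
have -> : qexp ((x ^+ 2 + x) * t / 2 + j%:~R * ((x + 1) / d%:R)) =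
    qexp (x * (x * t + y) / 2) * qexp ((x * t + y) / 2).
  by rewrite -qexpD; congr qexp; rewrite /y; move: (d%:R : C) d0 => D D0; field.
have -> : qexp (t + x * t) * qexp (j%:~R * (2 / d%:R)) = qexp (t + (x * t + y)).
  by rewrite -qexpD; congr qexp; rewrite /y; ring.
have -> : qexp (- (x * t)) * qexp ((- j)%:~R * (2 / d%:R)) = qexp (- (x * t + y)).
  by rewrite -qexpD; congr qexp; rewrite /y rmorphN /=; ring.
rewrite kleinE /phi; by ring.
Qed.

(** The forms with x = 0 combine over d-th roots of unity. Those with x = 2r/D give the powers of Q
    = exp(2 pi i d z) with exponents in the classes of 2r and -2r modulo D, which together with
    class 0 rebuild the product of eta(dz). *)
Lemma eta_klein (md mD : nat) z : 0 < complex.Im z ->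
  let d := md.*2.+1 in let D := mD.*2.+1 in
  dedekind_eta (D%:R * z) ^+ (d * D) * kprod d D (D%:R * z) =
  Psin d * (-1) ^+ mD / two_pi_i R ^+ ((d * D)./2) * dedekind_eta (d%:R * z).
Proof.
move=> hz d D; set t := D%:R * z.
have ht : 0 < complex.Im t by rewrite /t Im_natr_mul mulr_gt0.
have hdz : 0 < complex.Im (d%:R * z) by rewrite Im_natr_mul mulr_gt0.
have q1 := nrm_qexp_lt1 ht; have Q1 := nrm_qexp_lt1 hdz.
pose Q := qexp (d%:R * z); pose p := poch (qexp t) (qexp t).
have p0 : p != 0 := pochqq_neq0 ht.
have QD : qexp t ^+ d = Q ^+ D by rewrite !qexpX; congr qexp; rewrite /t mulrCA.
have D0 : D%:R != 0 :> C by rewrite pnatr_eq0.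
have row (r : 'I_mD) : kleinS d (2 * r.+1%:R / D%:R) t =
    - qexp (d%:R * z * (2 * r.+1%:R ^+ 2 / D%:R - r.+1%:R)) *
    (poch (Q ^+ D) (Q ^+ r.+1.*2) * poch (Q ^+ D) (Q ^+ (D - r.+1.*2))) / (two_pi_i R * p ^+ 2) ^+ d.
  rewrite kleinS_eval // -/d -/p; congr (_ / _); rewrite QD.
  have hr : (r.+1.*2 <= D)%N by rewrite /D; have := ltn_ord r; lia.
  have -> : qexp (d%:R * (t + 2 * r.+1%:R / D%:R * t)) = Q ^+ D * Q ^+ r.+1.*2.
    rewrite -exprD qexpX; congr qexp; rewrite /t natrD -[r.+1.*2]mul2n natrM.
    by move: (D%:R : C) (r.+1%:R : C) D0 => x y x0; field.
  have E : qexp (- (d%:R * (2 * r.+1%:R / D%:R * t))) = (Q ^+ r.+1.*2)^-1.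
    rewrite qexpX -qexpN; congr qexp; rewrite /t -[r.+1.*2]mul2n natrM.
    by move: (D%:R : C) (r.+1%:R : C) D0 => x y x0; field.
  have Q2 : Q ^+ r.+1.*2 != 0 by rewrite expf_neq0 // qexp_neq0.
  have QDl : nrm (Q ^+ D) < 1 by apply: nrmX_lt1.
  (* Here 1 - 1/y = -(1 - y)/y for y = Q^(2r) brings the exponents back to positive ones; it is the
     source of the sign (-1)^mD and of the linear term in the phase. *)
  rewrite E [poch _ (Q ^+ r.+1.*2)^-1]poch_rec // [poch _ (Q ^+ r.+1.*2)]poch_rec //.
  have -> : Q ^+ D * (Q ^+ r.+1.*2)^-1 = Q ^+ (D - r.+1.*2) by rewrite expfB_cond // (negPf (qexp_neq0 _)).
  have -> : qexp (d%:R * z * (2 * r.+1%:R ^+ 2 / D%:R - r.+1%:R)) =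
     qexp (d%:R * (((2 * r.+1%:R / D%:R) ^+ 2 + 2 * r.+1%:R / D%:R) * t / 2)) * (Q ^+ r.+1.*2)^-1.
    rewrite -E -qexpD; congr qexp; rewrite /t.
    by move: (D%:R : C) (r.+1%:R : C) D0 => x y x0; field.
  move: (poch _ _) (poch _ _) (qexp (d%:R * _)) Q2; move: (Q ^+ r.+1.*2) => a b c e a0.
  by field.
have split : \prod_(r < mD) (poch (Q ^+ D) (Q ^+ r.+1.*2) * poch (Q ^+ D) (Q ^+ (D - r.+1.*2))) *
   poch (Q ^+ D) (Q ^+ D) = poch Q Q.
  rewrite mulrC -(big_even_odd mD (fun j => poch (Q ^+ D) (Q ^+ j))) -(@poch_split Q Q D) //.
  by apply: eq_bigr => j _; rewrite exprSr.
have kE : (d * D)./2 = (md + d * mD)%N by rewrite /d /D; lia.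
rewrite kE /kprod.
have -> : d./2 = md by rewrite /d /= uphalf_double.
have -> : D./2 = mD by rewrite /D /= uphalf_double.
under [X in _ * (_ * X)]eq_bigr => r _ do rewrite row.
rewrite klein0_prod // -/d -/p QD !eta_poch // -/Q -/p -split.
rewrite !big_split /= prodrN card_ord -qexp_sum -mulr_sumr prodr_const card_ord.
rewrite sumrB -mulr_suml -mulr_sumr sum_sqr sum_lin.
set c := two_pi_i R * p ^+ 2; set X := \prod_(i < mD) _ * \prod_(i < mD) _.
set W := d%:R * z * (_ - _); set PP := poch (Q ^+ D) (Q ^+ D).
have tp := two_pi_i_neq0 R.
have c0 : c != 0 by rewrite /c; apply: mulf_neq0 => //; rewrite expf_neq0.
have -> : c ^- d ^+ mD = (c ^+ (d * mD))^-1 by rewrite -exprVn -exprM exprVn.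
(* The fractional powers of q: the sums of r^2 and of r in W turn dD t/24 into dz/24. *)
have e1 : (qexp (t / 24) * p) ^+ (d * D) * qexp W = qexp (d%:R * z / 24) * p ^+ (d * D).
  rewrite [(_ * p) ^+ _]exprMn mulrAC qexpX -qexpD; congr (qexp _ * _).
  rewrite /W /t natrM; have DE : D%:R = 2 * mD%:R + 1 :> C by rewrite /D -natr1 -mul2n natrM.
  by rewrite DE in D0 *; field.
have e2 : p * (c ^+ md * c ^+ (d * mD)) = two_pi_i R ^+ (md + d * mD) * p ^+ (d * D).
  rewrite -exprD /c exprMn mulrCA -exprM -exprS; congr (_ * p ^+ _).
  by rewrite /d /D; nia.
have -> : two_pi_i R ^+ (md + d * mD) = p * (c ^+ md * c ^+ (d * mD)) / p ^+ (d * D).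
  by rewrite e2 mulfK // expf_neq0.
have alg1 (w S P q x y s u v : C) : q != 0 -> x != 0 -> y != 0 ->
    w * (S * (P / q) / x * (s * u * v / y)) = w * u * (S * P * s * v / (q * (x * y))).
  by move=> q0 x0 y0; field; rewrite q0 x0 y0.
have alg2 (S P q r x y s u v : C) : q != 0 -> r != 0 -> x != 0 -> y != 0 ->
    u * r * (S * P * s * v / (q * (x * y))) = S * s / (q * (x * y) / r) * (u * (v * P)).
  by move=> q0 r0 x0 y0; field; rewrite q0 r0 x0 y0.
by rewrite alg1 ?expf_neq0 // e1 alg2 ?expf_neq0.
Qed.

Lemma kprod_neq0 md mD z : 0 < complex.Im z ->
  kprod md.*2.+1 mD.*2.+1 (mD.*2.+1%:R * z) != 0.
Proof.
move=> hz; have := eta_klein md mD hz; apply: contra_eq_neq => ->; rewrite mulr0 eq_sym.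
apply: mulf_neq0; last by rewrite eta_neq0 // Im_natr_mul mulr_gt0.
apply: mulf_neq0; last by rewrite invr_eq0 expf_neq0 // two_pi_i_neq0.
by apply: mulf_neq0; [exact: Psin_neq0 | rewrite signr_eq0].
Qed.

Lemma eta_quotientE md mD z : 0 < complex.Im z ->
  let d := md.*2.+1 in let D := mD.*2.+1 in
  dedekind_eta (D%:R * z) ^+ (d * D) / dedekind_eta (d%:R * z) =
  Psin d * (-1) ^+ mD / two_pi_i R ^+ ((d * D)./2) / kprod d D (D%:R * z).
Proof.
move=> hz d D; have e := eta_klein md mD hz; have k0 := kprod_neq0 md mD hz.
have n0 : dedekind_eta (d%:R * z) != 0 by rewrite eta_neq0 // Im_natr_mul mulr_gt0.
by apply: (mulIf k0); apply: (mulIf n0); rewrite [LHS]mulrAC divfK // e -/d -/D divfK.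
Qed.

End EtaKlein.

(** * Transformation of the Klein product *)

Section KleinProduct.
Variable R : realType.
Local Notation C := R[i].
Implicit Types (x y z t v : C).

(** The sum is m(m+1)n/6 with n = 2m + 1. As 3 does not divide 2m + 1, it divides m(m+1); this is
    where the level being prime to 3 makes the quadratic phases trivial. *)
Lemma sum_sqr_dvd n : odd n -> ~~ (3 %| n)%N ->
  exists l : nat, \sum_(s < n./2) s.+1%:R ^+ 2 = n%:R * l%:R :> C.
Proof.
move=> on n3; have nE := odd_half on; set m := n./2 in nE *.
have [l hl] : exists l, (m * m.+1 = 6 * l)%N.
  exists (m * m.+1 %/ 6)%N; rewrite [(6 * _)%N]mulnC divnK //.
  rewrite (@Gauss_dvd 2 3) //; apply/andP; split; first by rewrite dvdn2 oddM /= andbN.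
  rewrite Euclid_dvdM //; move: n3; rewrite nE; lia.
exists l; rewrite sum_sqr nE -[m.*2.+1%:R]natr1 -mul2n natrM.
have : m%:R * (m%:R + 1) = 6 * l%:R :> C by rewrite natr1 -!natrM hl.
by move=> ->; field.
Qed.

Lemma phase_sqr n (u : int) : odd n -> ~~ (3 %| n)%N ->
  \prod_(s < n./2) qexp (u%:~R * s.+1%:R ^+ 2 / n%:R) = 1 :> C.
Proof.
move=> on n3; rewrite -qexp_sum -mulr_suml -mulr_sumr; have [l ->] := sum_sqr_dvd on n3.
have n0 : n%:R != 0 :> C by rewrite pnatr_eq0; case: n on {n3}.
have -> : u%:~R * (n%:R * l%:R) / n%:R = (u * l%:Z)%:~R :> C.
  by rewrite mulrCA mulrAC divff // mul1r intrM.
exact: qexp_int.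
Qed.

Lemma sphase_sqr n (u : int) : odd n -> ~~ (3 %| n)%N ->
  sprod n./2 (fun j => qexp (u%:~R * j%:~R ^+ 2 / n%:R)) = 1 :> C.
Proof.
move=> on n3; rewrite /sprod expr0n /= mulr0 mul0r qexp0 mul1r big_split /=.
have h := phase_sqr u on n3.
rewrite [X in X * _](_ : _ = 1) ?mul1r; last by rewrite -[RHS]h; apply: eq_bigr => s _; rewrite -pmulrn.
by rewrite -[RHS]h; apply: eq_bigr => s _; rewrite rmorphN /= sqrrN -pmulrn.
Qed.

Lemma sphase_lin m y : sprod m (fun j => qexp (j%:~R * y)) = 1.
Proof.
transitivity (sprod m (fun j : int => qexp (0 + j%:~R * y))).
  by apply: eq_sprod => j; rewrite add0r.
by rewrite sprod_qexp_lin mulr0 qexp0.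
Qed.

Section Odd.
Variables (d D : nat) (od : odd d) (oD : odd D).

Let d0 : d%:R != 0 :> C.
Proof. by rewrite pnatr_eq0; case: d od. Qed.

Let D0 : D%:R != 0 :> C.
Proof. by rewrite pnatr_eq0; case: D oD. Qed.

Lemma half_ratio_eq n (t u : int) : n%:R != 0 :> C -> (n%:Z %| t - u)%Z ->
  exists l : int, 2 * t%:~R / n%:R = 2 * u%:~R / n%:R + 2 * l%:~R :> C.
Proof.
move=> n0 /dvdzP[l hl]; exists l.
have -> : t = u + l * n%:Z by rewrite -hl addrC subrK.
rewrite intrD intrM -pmulrn; move: (n%:R : C) n0 => x x0; by field.
Qed.

Lemma klein0_jac (e : int) t : 0 < complex.Im t -> coprimez e d%:Z ->
  \prod_(s < d./2) klein 0 (2 * s.+1%:R / d%:R * e%:~R) t =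
  (jac e d)%:~R * \prod_(s < d./2) klein 0 (2 * s.+1%:R / d%:R) t.
Proof.
move=> ht ce; pose F (n : int) : C := klein 0 (2 * n%:~R / d%:R) t.
have := @prod_half_odd d od e ce _ F.
have -> : \prod_(r < d./2) F (e * r.+1%:Z) = \prod_(s < d./2) klein 0 (2 * s.+1%:R / d%:R * e%:~R) t.
  apply: eq_bigr => s _; rewrite /F.
  by have -> : 2 * (e * s.+1%:Z)%:~R / d%:R = 2 * s.+1%:R / d%:R * e%:~R :> C by rewrite intrM -pmulrn; ring.
apply.
  move=> n; rewrite /F -klein_opp // oppr0.
  by have -> : 2 * (- n)%:~R / d%:R = - (2 * n%:~R / d%:R) :> C by rewrite rmorphN /=; ring.
move=> n u h; have [l e'] := half_ratio_eq d0 h; rewrite /F e'.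
have := klein_add_even 0 (2 * u%:~R / d%:R) 0 l ht.
by rewrite mulr0 addr0 mulr0 mul0r subrr qexp0 mul1r.
Qed.

Lemma kleinS_unit (e : int) x t : 0 < complex.Im t -> coprimez e d%:Z ->
  sprod d./2 (fun j => klein x (2 * j%:~R / d%:R * e%:~R) t) = kleinS d x t.
Proof.
(* The linear phase makes the factor genuinely periodic modulo d, so that multiplication by a unit
   permutes the factors; over the symmetric range the phases multiply to 1. *)
move=> ht ce; pose F (n : int) : C := qexp (n%:~R * - (x / d%:R)) * klein x (2 * n%:~R / d%:R) t.
have dE := odd_half od.
have hF : forall n u, (d./2.*2.+1%:Z %| n - u)%Z -> F n = F u.
  rewrite -dE => n u h; have [l e'] := half_ratio_eq d0 h; rewrite /F e'.
  have := klein_add_even x (2 * u%:~R / d%:R) 0 l ht; rewrite mulr0 addr0 mul0r subr0 => ->.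
  rewrite mulrA -qexpD; congr (qexp _ * _); move: e'; move: (d%:R : C) d0 => y y0 e'.
  have -> : n%:~R = u%:~R + l%:~R * y :> C.
    have -> : n%:~R = (2 * n%:~R / y) * y / 2 :> C by field.
    by rewrite e'; field.
  by field.
have := sprod_unit (m := d./2) _ hF; rewrite -dE => /(_ _ ce) {hF}.
rewrite /F [in X in _ = X]sprodM sphase_lin mul1r -kleinSE => <-.
transitivity (sprod d./2 (fun j => qexp (j%:~R * (e%:~R * - (x / d%:R))) *
   klein x (2 * j%:~R / d%:R * e%:~R) t)); first by rewrite sprodM sphase_lin mul1r.
apply: eq_sprod => j.
have -> : 2 * (e * j)%:~R / d%:R = 2 * j%:~R / d%:R * e%:~R :> C by rewrite intrM; ring.
by have -> : (e * j)%:~R * - (x / d%:R) = j%:~R * (e%:~R * - (x / d%:R)) by rewrite intrM; ring.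
Qed.

Lemma kleinS_opp x t : 0 < complex.Im t -> kleinS d (- x) t = - kleinS d x t.
Proof.
move=> ht; rewrite !kleinSE -sprodN.
transitivity (sprod d./2 (fun j : int => -1 * klein x (2 * j%:~R / d%:R) t)).
  apply: eq_sprod => j; have -> : 2 * (- j)%:~R / d%:R = - (2 * j%:~R / d%:R) :> C by rewrite rmorphN /=; ring.
  by rewrite klein_opp // mulN1r.
by rewrite sprodM sprod_const exprS -mul2n exprM sqrrN expr1n expr1n mulr1 mulN1r.
Qed.

Lemma kleinS_add_even x (l : int) t : 0 < complex.Im t -> kleinS d (x + 2 * l%:~R) t = kleinS d x t.
Proof.
move=> ht; rewrite !kleinSE.
transitivity (sprod d./2 (fun j : int => qexp (j%:~R * - (l%:~R * 2 / d%:R)) * klein x (2 * j%:~R / d%:R) t)).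
  apply: eq_sprod => j; have := klein_add_even x (2 * j%:~R / d%:R) l 0 ht.
  by rewrite mulr0 addr0 mul0r sub0r => ->; congr (qexp _ * _); ring.
by rewrite sprodM sphase_lin mul1r.
Qed.

Lemma kleinS_jac (a : int) t : 0 < complex.Im t -> coprimez a D%:Z ->
  \prod_(r < D./2) kleinS d (2 * r.+1%:R / D%:R * a%:~R) t =
  (jac a D)%:~R * \prod_(r < D./2) kleinS d (2 * r.+1%:R / D%:R) t.
Proof.
move=> ht ca; pose F (n : int) : C := kleinS d (2 * n%:~R / D%:R) t.
have := @prod_half_odd D oD a ca _ F.
have -> : \prod_(r < D./2) F (a * r.+1%:Z) = \prod_(r < D./2) kleinS d (2 * r.+1%:R / D%:R * a%:~R) t.
  apply: eq_bigr => s _; rewrite /F.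
  by have -> : 2 * (a * s.+1%:Z)%:~R / D%:R = 2 * s.+1%:R / D%:R * a%:~R :> C by rewrite intrM -pmulrn; ring.
apply.
  move=> n; rewrite /F -kleinS_opp //.
  by have -> : 2 * (- n)%:~R / D%:R = - (2 * n%:~R / D%:R) :> C by rewrite rmorphN /=; ring.
by move=> n u h; have [l e'] := half_ratio_eq D0 h; rewrite /F e' kleinS_add_even.
Qed.

Definition kprodg (a b c e : int) t : C :=
  \prod_(s < d./2) klein (2 * s.+1%:R / d%:R * c%:~R) (2 * s.+1%:R / d%:R * e%:~R) t *
  \prod_(r < D./2) sprod d./2 (fun j =>
     klein (2 * r.+1%:R / D%:R * a%:~R + 2 * j%:~R / d%:R * c%:~R)
           (2 * r.+1%:R / D%:R * b%:~R + 2 * j%:~R / d%:R * e%:~R) t).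

Lemma kprod_mob (a b c e : int) t : a * e - b * c = 1 -> 0 < complex.Im t ->
  kprod d D (mob a b c e t) = (aut c e t) ^- ((d * D)./2) * kprodg a b c e t.
Proof.
move=> h ht; have dE := odd_half od; have DE := odd_half oD.
have kE : (d * D)./2 = (d./2 + d * D./2)%N by rewrite {1}dE {1}DE {2}dE; lia.
have c1 m (c' : C) : c' ^- m = \prod_(i < m) c'^-1 by rewrite prodr_const card_ord exprVn.
rewrite kE exprD invfM mulrACA /kprod; congr (_ * _).
  rewrite c1 -big_split /=; apply: eq_bigr => s _; rewrite klein_mob //.
  by rewrite !mul0r !add0r.
have -> : (aut c e t) ^- (d * D./2) = \prod_(r < D./2) sprod d./2 (fun=> (aut c e t)^-1).
  by rewrite sprod_const -dE prodr_const card_ord -exprM exprVn.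
rewrite -big_split /=; apply: eq_bigr => r _; rewrite kleinSE -sprodM; apply: eq_sprod => j.
by rewrite klein_mob.
Qed.

Hypotheses (d3 : ~~ (3 %| d)%N) (D3 : ~~ (3 %| D)%N).

Lemma kprodg_fst (c e : int) t : 0 < complex.Im t -> coprimez e d%:Z ->
  \prod_(s < d./2) klein (2 * s.+1%:R / d%:R * (d%:Z * c)%:~R) (2 * s.+1%:R / d%:R * e%:~R) t =
  (jac e d)%:~R * \prod_(s < d./2) klein 0 (2 * s.+1%:R / d%:R) t.
Proof.
move=> ht ce; rewrite -(klein0_jac ht ce).
transitivity (\prod_(s < d./2) (qexp ((- (2 * c * e))%:~R * s.+1%:R ^+ 2 / d%:R) *
   klein 0 (2 * s.+1%:R / d%:R * e%:~R) t)); last by rewrite big_split /= phase_sqr // mul1r.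
apply: eq_bigr => s _.
have := klein_add_even 0 (2 * s.+1%:R / d%:R * e%:~R) (s.+1%:Z * c) 0 ht.
rewrite [2 * 0]mulr0 addr0 [0%:~R * 0]mul0r sub0r add0r => E.
have -> : 2 * s.+1%:R / d%:R * (d%:Z * c)%:~R = 2 * (s.+1%:Z * c)%:~R :> C.
  rewrite !intrM -!pmulrn; move: (d%:R : C) d0 => y y0; by field.
rewrite E; congr (qexp _ * _).
by rewrite !(rmorphN, rmorphM) /= -?pmulrn; ring.
Qed.

Lemma prod_sprod_phase (u u' : int) :
  \prod_(r < D./2) sprod d./2 (fun j => qexp (u%:~R * r.+1%:R ^+ 2 / D%:R + u'%:~R * j%:~R ^+ 2 / d%:R)) = 1 :> C.
Proof.
have dE := odd_half od.
rewrite -[RHS](phase_sqr (u * d%:Z) oD D3); apply: eq_bigr => r _.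
transitivity (sprod d./2 (fun j : int => qexp (u%:~R * r.+1%:R ^+ 2 / D%:R + j%:~R * 0) *
   qexp (u'%:~R * j%:~R ^+ 2 / d%:R)) : C).
  by apply: eq_sprod => j; rewrite mulr0 addr0 qexpD.
rewrite sprodM sphase_sqr // mulr1 sprod_qexp_lin -dE; congr qexp.
by rewrite intrM -pmulrn; ring.
Qed.

(** A matrix of Gamma0(dD) acts on t = Dz through one of this shape. Up to even shifts it multiplies
    the two coordinates of the characteristic by a and e, which yields one symbol each, and the
    phases of the shifts multiply to 1. *)
Lemma kprod_Gamma0 (a b c e : int) t : 0 < complex.Im t -> coprimez a D%:Z -> coprimez e d%:Z ->
  kprodg a (D%:Z * b) (d%:Z * c) e t = (jac e d * jac a D)%:~R * kprod d D t.
Proof.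
move=> ht ca ce; rewrite /kprodg kprodg_fst // /kprod [(jac e d * _)%:~R]intrM mulrACA; congr (_ * _).
rewrite -(kleinS_jac ht ca).
transitivity (\prod_(r < D./2) (sprod d./2 (fun j => qexp ((2 * a * b)%:~R * r.+1%:R ^+ 2 / D%:R +
   (- (2 * c * e))%:~R * j%:~R ^+ 2 / d%:R)) * kleinS d (2 * r.+1%:R / D%:R * a%:~R) t)); last first.
  by rewrite big_split /= prod_sprod_phase mul1r.
apply: eq_bigr => r _; rewrite -(kleinS_unit _ ht ce) -sprodM; apply: eq_sprod => j.
set x := 2 * r.+1%:R / D%:R * a%:~R; set y := 2 * j%:~R / d%:R * e%:~R.
have := klein_add_even x y (j * c) (r.+1%:Z * b) ht.
have -> : x + 2 * (j * c)%:~R = x + 2 * j%:~R / d%:R * (d%:Z * c)%:~R.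
  congr (_ + _); rewrite !intrM -!pmulrn; move: (d%:R : C) d0 => w w0; by field.
have -> : y + 2 * (r.+1%:Z * b)%:~R = 2 * r.+1%:R / D%:R * (D%:Z * b)%:~R + y.
  rewrite [RHS]addrC; congr (_ + _); rewrite !intrM -!pmulrn; move: (D%:R : C) D0 => w w0; by field.
move=> ->; congr (qexp _ * _); rewrite /x /y !(rmorphN, rmorphM) /= -?pmulrn; ring.
Qed.

End Odd.
End KleinProduct.

(** * Limits at the cusps *)

Section CuspLimit.
Variable R : realType.
Local Notation C := R[i].
Implicit Types (x y z t v l : C) (F G : C -> C).

(** Limit as Im z tends to infinity, uniformly in Re z: the mode of convergence required of a cusp
    form. *)
Definition cvI F l : Prop := forall e : R, 0 < e ->
  exists A : R, forall z, 0 < complex.Im z -> A <= complex.Im z -> nrm (F z - l) <= e.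

Lemma cvI_cst l : cvI (fun=> l) l.
Proof. by move=> e e0; exists 0 => z _ _; rewrite subrr nrm0 ltW. Qed.

Lemma eq_cvI F G l : (forall z, 0 < complex.Im z -> F z = G z) -> cvI F l -> cvI G l.
Proof. by move=> h hF e e0; have [A hA] := hF e e0; exists A => z z0 zA; rewrite -h // hA. Qed.

Lemma cvID F G l m : cvI F l -> cvI G m -> cvI (fun z => F z + G z) (l + m).
Proof.
move=> hF hG e e0; have e2 : 0 < e / 2 by lra.
have [A hA] := hF _ e2; have [B hB] := hG _ e2; exists (Num.max A B) => z z0.
rewrite ge_max => /andP[zA zB]; have -> : F z + G z - (l + m) = (F z - l) + (G z - m) by ring.
apply: le_trans (nrmD _ _) _; have := hA z z0 zA; have := hB z z0 zB; lra.
Qed.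

Lemma cvIM F G l m : cvI F l -> cvI G m -> cvI (fun z => F z * G z) (l * m).
Proof.
move=> hF hG e e0; pose b := nrm l + nrm m + 1.
have b0 : 0 < b by have := nrm_ge0 l; have := nrm_ge0 m; rewrite /b; lra.
pose d := Num.min 1 (e / (2 * b)).
have d0 : 0 < d by rewrite lt_min ltr01 divr_gt0 //; lra.
have [A hA] := hF d d0; have [B hB] := hG d d0; exists (Num.max A B) => z z0.
rewrite ge_max => /andP[zA zB].
have -> : F z * G z - l * m = (F z - l) * (G z - m) + (F z - l) * m + l * (G z - m) by ring.
have hx := hA z z0 zA; have hy := hB z z0 zB; set x := F z - l in hx *; set y := G z - m in hy *.
have d1 : d <= 1 by rewrite ge_min lexx.
have d2 : d * (2 * b) <= e by rewrite -ler_pdivlMr ?ge_min ?lexx ?orbT //; lra.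
have x0 := nrm_ge0 x; have y0 := nrm_ge0 y; have l0 := nrm_ge0 l; have m0 := nrm_ge0 m.
apply: (@le_trans _ _ (nrm x * nrm y + nrm x * nrm m + nrm l * nrm y)).
  by rewrite -!nrmM; apply: le_trans (nrmD _ _) _; rewrite lerD2r; exact: nrmD.
have h1 : nrm x * nrm y <= d * 1 by apply: ler_pM => //; lra.
have h2 : nrm x * nrm m <= d * nrm m by rewrite ler_wpM2r.
have h3 : nrm l * nrm y <= d * nrm l by rewrite mulrC ler_wpM2r.
rewrite /b in d2; lra.
Qed.

Lemma cvIMl c F l : cvI F l -> cvI (fun z => c * F z) (c * l).
Proof. by move=> h; apply: cvIM h; exact: cvI_cst. Qed.

Lemma cvIN F l : cvI F l -> cvI (fun z => - F z) (- l).
Proof.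
by move=> h; rewrite -mulN1r; apply: eq_cvI (cvIMl (-1) h) => z _; rewrite mulN1r.
Qed.

Lemma cvIV F l : l != 0 -> cvI F l -> cvI (fun z => (F z)^-1) l^-1.
Proof.
move=> l0 hF e e0; have nl : 0 < nrm l by rewrite lt_def nrm_eq0 l0 nrm_ge0.
pose d := Num.min (nrm l / 2) (e * nrm l ^+ 2 / 2).
have l2 : 0 < nrm l ^+ 2 by rewrite exprn_gt0.
have d0 : 0 < d by rewrite lt_min; apply/andP; split; [|have := mulr_gt0 e0 l2]; lra.
have [A hA] := hF d d0; exists A => z z0 zA; have h := hA z z0 zA.
have d1 : d <= nrm l / 2 by rewrite ge_min lexx.
have d2 : d <= e * nrm l ^+ 2 / 2 by rewrite ge_min lexx orbT.
have hb : nrm l / 2 <= nrm (F z).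
  have e' : l - (l - F z) = F z by ring.
  by have := nrmB_ge l (l - F z); rewrite e' [nrm (l - _)]nrmBC; lra.
have F0 : F z != 0 by rewrite -nrm_eq0 gt_eqF //; lra.
have -> : (F z)^-1 - l^-1 = (l - F z) / (F z * l) by field; rewrite F0 l0.
rewrite nrmM nrmV nrmM nrmBC ler_pdivrMr; last by rewrite mulr_gt0 //; lra.
apply: le_trans h _; apply: le_trans d2 _; rewrite -mulrA ler_pM2l //; nra.
Qed.

Lemma cvI_prod (I : Type) (r : seq I) (P : pred I) (f : I -> C -> C) (m : I -> C) :
  (forall i, P i -> cvI (f i) (m i)) ->
  cvI (fun z => \prod_(i <- r | P i) f i z) (\prod_(i <- r | P i) m i).
Proof.
move=> h; elim: r => [|i r IH].
  by rewrite big_nil; apply: eq_cvI (cvI_cst 1) => z _; rewrite big_nil.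
rewrite big_cons; case: ifP => Pi.
  by apply: eq_cvI (cvIM (h i Pi) IH) => z _; rewrite big_cons Pi.
by apply: eq_cvI IH => z _; rewrite big_cons Pi.
Qed.

Lemma cvI_sprod m (f : int -> C -> C) (g : int -> C) :
  (forall j : int, (`|j| <= m)%N -> cvI (f j) (g j)) -> cvI (fun z => sprod m (f^~ z)) (sprod m g).
Proof.
move=> h; apply: cvIM; first exact: h.
by apply: cvI_prod => r _; apply: cvIM; apply: h; rewrite ?abszN; have := ltn_ord r.
Qed.

Lemma cvI_comp F l (g : C -> C) (a : R) : 0 < a ->
  (forall z, complex.Im (g z) = a * complex.Im z) -> cvI F l -> cvI (fun z => F (g z)) l.
Proof.
move=> a0 hg hF e e0; have [A hA] := hF e e0; exists (A / a) => z z0 zA.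
by apply: hA; rewrite hg; [rewrite mulr_gt0 | rewrite mulrC -ler_pdivrMr].
Qed.

Lemma cvI_qexp (a : R) y : 0 < a -> cvI (fun t => qexp (a%:C%C * t + y)) 0.
Proof.
move=> a0 e e0; have p0 := @pi_gt0 R.
have pa : 0 < 2 * pi * a by rewrite !mulr_gt0.
exists ((e^-1 - 2 * pi * complex.Im y) / (2 * pi * a)) => z z0.
rewrite ler_pdivrMr // => h; rewrite subr0 nrm_qexp.
have -> : complex.Im (a%:C%C * z + y) = a * complex.Im z + complex.Im y.
  by case: (z) => p q; case: (y) => r s /=; ring.
set u := 2 * pi * _; have ue : e^-1 <= u by rewrite /u; lra.
have u0 : 0 < u by apply: lt_le_trans ue; rewrite invr_gt0.
rewrite expRN -[e]invrK lef_pV2 ?posrE ?expR_gt0 ?invr_gt0 //.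
apply: le_trans ue _; have := expR_ge1Dx u; lra.
Qed.

Lemma cvI_poch (u : C -> C) : cvI u 0 -> cvI (fun t => poch (qexp t) (u t)) 1.
Proof.
move=> hu e e0; pose e' := Num.min (4^-1) (e / 4).
have e'0 : 0 < e' by rewrite lt_min; apply/andP; split; lra.
have h2 : 0 < 2^-1 :> R by lra.
have [A hA] := hu e' e'0; have [B hB] := cvI_qexp 0 (@ltr01 R) h2.
exists (Num.max A B) => t t0; rewrite ge_max => /andP[tA tB].
have := hA t t0 tA; have := hB t t0 tB; rewrite !subr0 mul1r addr0 => hq hx.
have h4 : e' <= 4^-1 by rewrite ge_min lexx.
have h5 : e' <= e / 4 by rewrite ge_min lexx orbT.
have q1 : nrm (qexp t) < 1 by lra.
apply: le_trans (poch_close _ q1) _; set w := nrm (u t) / _.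
have u0 := nrm_ge0 (u t).
have w2 : w <= 2 * nrm (u t).
  rewrite /w ler_pdivrMr; last by lra.
  nra.
have : expR w <= expR (2 * nrm (u t)) by rewrite ler_expR.
set x := 2 * nrm (u t) in w2 *; have x0 : 0 <= x by rewrite /x; lra.
have x1 : x <= 2^-1 by rewrite /x; lra.
have : expR x <= (1 - x)^-1.
  rewrite -[expR x]invrK -expRN lef_pV2 ?posrE ?expR_gt0 //; last by lra.
  by apply: le_trans (expR_ge1Dx (- x)); lra.
have : (1 - x)^-1 <= 1 + 2 * x.
  rewrite -[X in X <= _]mul1r ler_pdivrMr; last by lra.
  nra.
rewrite /x; lra.
Qed.

Lemma klein0_cvI y : cvI (klein 0 y) (sn y / two_pi_i R).
Proof.
have h (w : C) : cvI (fun t => poch (qexp t) (qexp (t + w))) 1.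
  apply: cvI_poch; apply: eq_cvI (cvI_qexp w (@ltr01 R)) => t _; by rewrite mul1r.
have h0 : cvI (fun t => poch (qexp t) (qexp t)) 1.
  by apply: eq_cvI (h 0) => t _; rewrite addr0.
have tp := two_pi_i_neq0 R.
have := cvIM (cvIMl (sn y / two_pi_i R) (cvIM (h y) (h (- y)))) (cvIV _ (cvIM h0 h0)).
rewrite !mulr1 invr1 mulr1 oner_eq0 => /(_ isT).
apply: eq_cvI => t ht; rewrite kleinE !mul0r qexp0 mul1r add0r phiE //.
have p0 := pochqq_neq0 ht; field; rewrite tp.
by rewrite p0.
Qed.

(** The leading exponent of q in the Klein form is x(x - 1)/2, negative on this range. *)
Lemma klein_inv_cvI0 (x : R) y : 0 < x < 1 -> cvI (fun t => (klein x%:C%C y t)^-1) 0.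
Proof.
move=> /andP[x0 x1]; have tp := two_pi_i_neq0 R.
have x2 : 0 < 1 - x by lra.
have xx : 0 < (1 - x) * x / 2 by rewrite !mulr_gt0 //; lra.
have h (a : R) (w : C) : 0 < a -> cvI (fun t => poch (qexp t) (qexp (a%:C%C * t + w))) 1.
  by move=> a0; apply: cvI_poch; exact: cvI_qexp.
have h1 := h (1 + x) y; have h2 := h (1 - x) (- y) x2.
have {}h1 := h1 ltac:(lra).
have h0 : cvI (fun t => poch (qexp t) (qexp t)) 1.
  by apply: eq_cvI (h 1 0 (@ltr01 R)) => t _; rewrite mul1r addr0.
have hv : cvI (fun t => 1 - qexp (x%:C%C * t + y)) 1.
  by have := cvID (cvI_cst 1) (cvIN (cvI_qexp y x0)); rewrite oppr0 addr0.
have hV F : cvI F 1 -> cvI (fun t => (F t)^-1) 1.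
  by move=> hF; rewrite -invr1; apply: cvIV => //; exact: oner_neq0.
have hq : cvI (fun t => qexp ((1 - x%:C%C) * (x%:C%C * t + y) / 2)) 0.
  apply: eq_cvI (cvI_qexp ((1 - x%:C%C) * y / 2) xx) => t _.
  have -> : ((1 - x) * x / 2)%:C%C = (1 - x%:C%C) * x%:C%C / 2 :> C.
    by rewrite !rmorphM fmorphV rmorphB /= rmorph1 rmorph_nat.
  by congr qexp; ring.
have := cvIM (cvIMl (- two_pi_i R) (cvIM h0 h0)) (cvIM hq (cvIM (hV _ hv) (cvIM (hV _ h1) (hV _ h2)))).
rewrite mul0r mulr0; apply: eq_cvI => t ht; rewrite kleinE phiE //.
have E1 : (1 + x)%:C%C * t + y = t + (x%:C%C * t + y) :> C by rewrite rmorphD /= rmorph1; ring.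
have E2 : (1 - x)%:C%C * t - y = t - (x%:C%C * t + y) :> C by rewrite rmorphB /= rmorph1; ring.
rewrite E1 E2; set v := x%:C%C * t + y.
have -> : sn v = - (qexp (- (v / 2)) * (1 - qexp v)).
  by rewrite -[v in LHS]opprK snN snE opprK mulNr.
have -> : qexp ((1 - x%:C%C) * v / 2) = (qexp (x%:C%C * v / 2) * qexp (- (v / 2)))^-1.
  by rewrite -qexpD -qexpN; congr qexp; field.
have alg (T p E u w P Q : C) : - T * (p * p) * ((E * u)^-1 * (w^-1 * (P^-1 * Q^-1))) =
   (E * (- (u * w) * P * Q / (T * p ^+ 2)))^-1.
  by rewrite expr2 -mulNr !invfM !invrK invrN; ring.
exact: alg.
Qed.

(** For limits that only have to be recognized as zero or not, the constant is immaterial, so odd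
    shifts are allowed here. *)
Lemma klein_add_int x y (n : int) : exists2 c : C, c != 0 &
  forall t, 0 < complex.Im t -> klein (x + n%:~R) y t = c * klein x y t.
Proof.
have nE := divz_eq n 2; set m := (n %/ 2)%Z in nE.
have even u t : 0 < complex.Im t -> klein (u + 2 * m%:~R) y t = qexp (- (m%:~R * y)) * klein u y t.
  move=> ht; have := klein_add_even u y m 0 ht.
  by rewrite [2 * 0]mulr0 addr0 [0%:~R * u]mul0r sub0r.
have [e|e] : (n %% 2)%Z = 0 \/ (n %% 2)%Z = 1.
  by have := modz_ge0 n (isT : (2 : int) != 0); have := ltz_mod n (isT : (2 : int) != 0); lia.
  exists (qexp (- (m%:~R * y))) => [|t ht]; first exact: qexp_neq0.
  have -> : n%:~R = 2 * m%:~R :> C by rewrite nE e addr0 mulrC intrM.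
  exact: even.
exists (qexp (- (m%:~R * y)) * - qexp (- (y / 2))) => [|t ht].
  by apply: mulf_neq0; rewrite ?oppr_eq0; exact: qexp_neq0.
have -> : x + n%:~R = x + 1 + 2 * m%:~R by rewrite nE e mulrC intrD intrM; ring.
by rewrite even // klein_add1l // mulrA.
Qed.

Lemma qexp_ratio_neq1 n (j : int) : (0 < n)%N -> ~~ (n%:Z %| j)%Z -> qexp (j%:~R / n%:R : C) != 1.
Proof.
move=> n0 nj; have pz := @qexp_prim R n n0; set z := qexp _ in pz.
have -> : qexp (j%:~R / n%:R : C) = z ^ j by rewrite /z qexpz.
have nz : n%:Z != 0 by rewrite eqz_nat -lt0n.
have := modz_ge0 j nz; case e : (j %% n)%Z => [m|//] _.
have -> : z ^ j = z ^+ m.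
  rewrite -[z ^+ m]/(z ^ m%:Z); apply: prim_exprz_eq pz _.
  by rewrite -e {1}(divz_eq j n%:Z) addrK dvdz_mull.
rewrite -(prim_order_dvd pz); apply: contra nj => nm.
by rewrite (divz_eq j n%:Z) e rpredD ?dvdz_mull.
Qed.

Lemma sn_ratio_neq0 n (j : int) : (0 < n)%N -> ~~ (n%:Z %| j)%Z -> sn (j%:~R / n%:R : C) != 0.
Proof.
move=> n0 nj; rewrite snE; apply: mulf_neq0; first exact: qexp_neq0.
rewrite subr_eq0 eq_sym qexpN; apply: contra (qexp_ratio_neq1 n0 nj) => /eqP e.
by rewrite -[qexp _]invrK e invr1.
Qed.

(* The flag Z records a sufficient condition for the limit to be zero. *)
Definition exI F (Z : Prop) : Prop := exists2 l, cvI F l & (Z -> l = 0).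

Lemma exI_imp F (Z W : Prop) : (W -> Z) -> exI F Z -> exI F W.
Proof. by move=> h [l hl z]; exists l => // /h. Qed.

Lemma eq_exI F G Z : (forall t, 0 < complex.Im t -> F t = G t) -> exI F Z -> exI G Z.
Proof. by move=> h [l hl z]; exists l => //; exact: eq_cvI hl. Qed.

Lemma exI_mul F G Z W : exI F Z -> exI G W -> exI (fun t => F t * G t) (Z \/ W).
Proof.
move=> [l hl z] [m hm w]; exists (l * m); first exact: cvIM.
by case=> [/z ->|/w ->]; rewrite (mul0r, mulr0).
Qed.

Lemma exI_prod (I : finType) (f : I -> C -> C) (Z : I -> Prop) : (forall i, exI (f i) (Z i)) ->
  exI (fun t => \prod_i f i t) (exists i, Z i).
Proof.
move=> h; suff : forall r : seq I, exI (fun t => \prod_(i <- r) f i t) (exists2 i, i \in r & Z i).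
  by move/(_ (index_enum I)); apply: exI_imp => -[i zi]; exists i => //; rewrite mem_index_enum.
elim=> [|i r IH].
  exists 1; last by case.
  by apply: eq_cvI (cvI_cst 1) => t _; rewrite big_nil.
apply: (@eq_exI (fun t => f i t * \prod_(j <- r) f j t)) => [t _|]; first by rewrite big_cons.
apply: exI_imp (exI_mul (h i) IH) => -[j]; rewrite inE => /predU1P[->|jr] zj; [by left|right].
by exists j.
Qed.

Lemma exI_sprod m (f : int -> C -> C) (Z : int -> Prop) : (forall j, exI (f j) (Z j)) ->
  exI (fun t => sprod m (f^~ t)) (Z 0).
Proof.
move=> h; apply: exI_imp (exI_mul (h 0) (exI_prod (fun r : 'I_m => exI_mul (h r.+1%:Z) (h (- r.+1%:Z))))).
by left.
Qed.

Lemma klein_inv_exI n (i j : int) : (0 < n)%N -> ~~ ((n%:Z %| i)%Z && (n%:Z %| j)%Z) ->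
  exI (fun t => (klein (i%:~R / n%:R) (j%:~R / n%:R) t)^-1) (~~ (n%:Z %| i)%Z).
Proof.
move=> n0 hij; have nz : n%:Z != 0 by rewrite eqz_nat -lt0n.
have n0' : n%:R != 0 :> C by rewrite pnatr_eq0 -lt0n.
have := modz_ge0 i nz; have := ltz_mod i nz; case e : (i %% n)%Z => [m|//] mn _.
have iE : i%:~R / n%:R = m%:R / n%:R + (i %/ n)%Z%:~R :> C.
  rewrite {1}(divz_eq i n%:Z) e intrD intrM -!pmulrn; move: (n%:R : C) n0' => y y0; by field.
have [c c0 hc] := klein_add_int (m%:R / n%:R) (j%:~R / n%:R) (i %/ n)%Z.
have di : (n%:Z %| i)%Z = (m == 0)%N.
  apply/idP/eqP => [/dvdzP[q hq]|m0]; last by apply/dvdz_mod0P; rewrite e m0.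
  by move: e; rewrite hq modzMl => -[].
have [m0|m0] := posnP m.
  rewrite di m0 eqxx /= in hij *; exists (c^-1 / (sn (j%:~R / n%:R) / two_pi_i R)) => //.
  apply: eq_cvI (cvIMl c^-1 (cvIV _ (klein0_cvI (j%:~R / n%:R)))) => [t ht|].
    by rewrite iE hc // m0 mul0r invfM.
  by apply: mulf_neq0; [exact: sn_ratio_neq0 | rewrite invr_eq0 two_pi_i_neq0].
exists 0 => //; rewrite -(mulr0 c^-1).
have x01 : 0 < (m%:R / n%:R : R) < 1.
  by rewrite divr_gt0 ?ltr0n //= ltr_pdivrMr ?ltr0n // mul1r ltr_nat; move: mn; lia.
apply: eq_cvI (cvIMl c^-1 (klein_inv_cvI0 (j%:~R / n%:R) x01)) => t ht.
by rewrite iE hc // -ratCE invfM.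
Qed.

End CuspLimit.

(** * The eta quotient under the modular group *)

Lemma half_lt_dvd n s : odd n -> (s < n./2)%N -> ~~ (n%:Z %| 2 * s.+1%:Z)%Z.
Proof.
move=> on hs; have nE := odd_half on; apply/negP => /dvdzP[q hq].
have [q0|q0] : q <= 0 \/ 1 <= q by lia.
  by nia.
by nia.
Qed.

Lemma dvdz_odd2 n (a : int) : odd n -> (n%:Z %| 2 * a)%Z = (n%:Z %| a)%Z.
Proof. by move=> on; rewrite Gauss_dvdzr // coprimezE /= coprimen2. Qed.

Lemma jac_unit_inv (R : realType) a n : odd n -> coprimez a n%:Z ->
  ((jac a n)%:~R : R[i])^-1 = (jac a n)%:~R.
Proof. by move=> on ca; have [->|->] := jac_cases on ca; rewrite ?rmorphN /= ?invrN invr1. Qed.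

Lemma int_unit_eq (x y : int) : x * y = 1 -> x = y.
Proof.
move=> h; have /andP[/eqP ux _] : (`|x| == 1)%N && (`|y| == 1)%N by rewrite -muln_eq1 -abszM h.
by have [e|e] : x = 1 \/ x = -1; [lia| |]; rewrite e in h *; lia.
Qed.

Lemma coprimez_det (a e b c : int) : a * e - b * c = 1 -> coprimez a c.
Proof. by move=> h; apply/coprimezP; exists (e, - b) => /=; rewrite -h; ring. Qed.

(** The Klein product sits at Dz, so a cusp leads to the matrix (Da, Db; c, e) of determinant D. It
    is factored as an element of SL2(Z) times an upper triangular matrix, with A = gcd(Da, c). *)
Lemma hecke_decomp (D : nat) (a b c e : int) : (0 < D)%N -> a * e - b * c = 1 ->
  exists a1 b1 c1 e1 A B Δ : int, [/\ a1 * e1 - b1 * c1 = 1, D%:Z * a = a1 * A, c = c1 * A,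
    D%:Z * b = a1 * B + b1 * Δ & e = c1 * B + e1 * Δ] /\ [/\ 0 < A, 0 < Δ & A * Δ = D%:Z].
Proof.
move=> D0 h; set A := gcdz (D%:Z * a) c.
have A0 : A != 0.
  rewrite gcdz_eq0; apply/negP => /andP[/eqP h1 /eqP h2]; move: h; rewrite h2 mulr0 subr0 => h.
  have : a = 0 by nia.
  by move=> a0; move: h; rewrite a0 mul0r.
have Ap : 0 < A by rewrite lt_def A0.
have [a1 ha] := dvdzP (dvdz_gcdl (D%:Z * a) c); have [c1 hc] := dvdzP (dvdz_gcdr (D%:Z * a) c).
rewrite -/A in ha hc; have [u [v huv]] := Bezoutz (D%:Z * a) c.
have h1 : a1 * u - - v * c1 = 1.
  apply: (mulIf A0); rewrite mul1r -[RHS]huv ha hc; ring.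
exists a1, (- v), c1, u, A, (u * (D%:Z * b) + v * e), (a1 * e - c1 * (D%:Z * b)).
have hAD : A * (a1 * e - c1 * (D%:Z * b)) = D%:Z.
  by rewrite mulrBr !mulrA ![A * _]mulrC -ha -hc -[RHS]mulr1 -h; ring.
split; split => //.
- have -> : a1 * (u * (D%:Z * b) + v * e) + - v * (a1 * e - c1 * (D%:Z * b)) =
    (a1 * u - - v * c1) * (D%:Z * b) by ring.
  by rewrite h1 mul1r.
- have -> : c1 * (u * (D%:Z * b) + v * e) + u * (a1 * e - c1 * (D%:Z * b)) =
    (a1 * u - - v * c1) * e by ring.
  by rewrite h1 mul1r.
by nia.
Qed.

(** * Automorphy and cusp limits of the quotient *)

Section EtaQuotient.
Variable R : realType.
Local Notation C := R[i].
Implicit Types (x y z t v : C).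

Lemma sprodV m (f : int -> C) : (sprod m f)^-1 = sprod m (fun j => (f j)^-1).
Proof.
by rewrite /sprod invfM -prodfV; congr (_ * _); apply: eq_bigr => r _; rewrite invfM.
Qed.

Lemma sprod_sn d x : odd d -> sprod d./2 (fun j => sn (x + 2 * j%:~R / d%:R)) = sn (d%:R * x).
Proof.
move=> od; have dE := odd_half od; have d0 : d%:R != 0 :> C by rewrite pnatr_eq0; case: d od {dE}.
have := prod_sine_full (qexp_neq0 (d./2.*2.+1%:R^-1 : C)) (qexp_neq0 (x / 2)) (qexp2_prim R d./2).
rewrite -dE !qexpX -qexpN => h.
have -> : sn (d%:R * x) = qexp (d%:R * (x / 2)) - (qexp (d%:R * (x / 2)))^-1 by rewrite /sn qexpN mulrA.
rewrite -h; apply: eq_sprod => j; rewrite /sn !qexpz -!qexpD.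
move: (d%:R : C) d0 => y y0; congr (qexp _ - qexp _); rewrite ?rmorphN /=; by field.
Qed.

Section Level.
Variables (d D : nat) (od : odd d) (oD : odd D) (d3 : ~~ (3 %| d)%N) (D3 : ~~ (3 %| D)%N).

Let d0 : d%:R != 0 :> C.
Proof. by rewrite pnatr_eq0; case: d od. Qed.

Let D0 : D%:R != 0 :> C.
Proof. by rewrite pnatr_eq0; case: D oD. Qed.

Let dD0 : (0 < d * D)%N.
Proof. by rewrite muln_gt0; case: d D od oD => [|m] [|n]. Qed.

(** One Klein form with nonintegral first characteristic forces the limit 0. If d does not divide c
    it is found at s = 1; if d divides c but D does not divide a, at r = 1 and j = 0. *)
Lemma kprodg_inv_exI (a b c e : int) : a * e - b * c = 1 ->
  exI (fun t => (kprodg d D a b c e t : C)^-1) (~~ ((d%:Z %| c)%Z && (D%:Z %| a)%Z)).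
Proof.
move=> h; have dz : d%:Z != 0 by rewrite eqz_nat; case: d od.
have Dz : D%:Z != 0 by rewrite eqz_nat; case: D oD.
have ratio (i : int) x : x * (d%:R * D%:R) = i%:~R -> x = i%:~R / (d * D)%:R.
  by move=> <-; rewrite natrM mulfK // mulf_neq0.
have cc : coprimez e c by apply: (@coprimez_det e a b c); rewrite mulrC.
have fst (s : 'I_(d./2)) : exI (fun t => (klein (2 * s.+1%:R / d%:R * c%:~R)
    (2 * s.+1%:R / d%:R * e%:~R) t : C)^-1) (~~ (d%:Z %| c * (2 * s.+1%:Z))%Z).
  have := @klein_inv_exI R (d * D) (c * (2 * s.+1%:Z) * D%:Z) (e * (2 * s.+1%:Z) * D%:Z) dD0.
  have E (i : int) : 2 * s.+1%:R / d%:R * i%:~R = (i * (2 * s.+1%:Z) * D%:Z)%:~R / (d * D)%:R :> C.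
    apply: ratio; rewrite !intrM -!pmulrn; move: (d%:R : C) d0 => y y0; by field.
  rewrite -!E PoszM !dvdz_mul2r //; apply; apply/negP => /andP[h1 h2].
  have := half_lt_dvd od (ltn_ord s).
  have -> : 2 * s.+1%:Z = a * (e * (2 * s.+1%:Z)) - b * (c * (2 * s.+1%:Z)).
    by transitivity ((a * e - b * c) * (2 * s.+1%:Z)); [rewrite h mul1r | ring].
  by move/negP; apply; apply: rpredB; apply: dvdz_mull.
have snd (r : 'I_(D./2)) (j : int) : exI (fun t => (klein
     (2 * r.+1%:R / D%:R * a%:~R + 2 * j%:~R / d%:R * c%:~R)
     (2 * r.+1%:R / D%:R * b%:~R + 2 * j%:~R / d%:R * e%:~R) t : C)^-1)
     (~~ ((d * D)%:Z %| a * (2 * r.+1%:Z) * d%:Z + c * (2 * j) * D%:Z)%Z).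
  have := @klein_inv_exI R (d * D) (a * (2 * r.+1%:Z) * d%:Z + c * (2 * j) * D%:Z)
     (b * (2 * r.+1%:Z) * d%:Z + e * (2 * j) * D%:Z) dD0.
  have E (i i' : int) : 2 * r.+1%:R / D%:R * i%:~R + 2 * j%:~R / d%:R * i'%:~R =
     (i * (2 * r.+1%:Z) * d%:Z + i' * (2 * j) * D%:Z)%:~R / (d * D)%:R :> C.
    apply: ratio; rewrite !(intrD, intrM) -!pmulrn.
    by move: (d%:R : C) (D%:R : C) d0 D0 => y w y0 w0; field; rewrite y0 w0.
  rewrite -!E; apply; apply/negP => /andP[h1 h2].
  have := half_lt_dvd oD (ltn_ord r); rewrite -(dvdz_mul2r dz) -PoszM mulnC.
  have -> : 2 * r.+1%:Z * d%:Z = e * (a * (2 * r.+1%:Z) * d%:Z + c * (2 * j) * D%:Z) -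
     c * (b * (2 * r.+1%:Z) * d%:Z + e * (2 * j) * D%:Z).
    by transitivity ((a * e - b * c) * (2 * r.+1%:Z * d%:Z)); [rewrite h mul1r | ring].
  by move/negP; apply; apply: rpredB; apply: dvdz_mull.
have := exI_mul (exI_prod fst) (exI_prod (fun r => exI_sprod d./2 (snd r))).
move=> H; apply: eq_exI; last (apply: exI_imp H).
  move=> t _; rewrite /kprodg invfM -!prodfV; congr (_ * _); apply: eq_bigr => r _.
  by rewrite sprodV.
case dc: (d%:Z %| c)%Z => /= hD; [right|left].
  case: (posnP D./2) => [D2|D2].
    move: hD; rewrite (odd_half oD) D2; by rewrite dvd1z.
  exists (Ordinal D2) => /=.
  have -> : a * (2 * 1%:Z) * d%:Z + c * (2 * 0) * D%:Z = 2 * a * d%:Z by ring.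
  by rewrite mulnC PoszM dvdz_mul2r // dvdz_odd2.
case: (posnP d./2) => [d2|d2].
  by move: dc; rewrite (odd_half od) d2 dvd1z.
by exists (Ordinal d2) => /=; rewrite mulr1 mulrC dvdz_odd2 // dc.
Qed.

Lemma Psin_jac (b : int) : coprimez b D%:Z ->
  \prod_(r < D./2) sn (2 * r.+1%:R / D%:R * b%:~R) = (jac b D)%:~R * Psin R D.
Proof.
move=> cb; pose F (n : int) : C := sn (2 * n%:~R / D%:R).
have := @prod_half_odd D oD b cb _ F.
have -> : \prod_(r < D./2) F (b * r.+1%:Z) = \prod_(r < D./2) sn (2 * r.+1%:R / D%:R * b%:~R).
  apply: eq_bigr => r _; rewrite /F.
  by have -> : 2 * (b * r.+1%:Z)%:~R / D%:R = 2 * r.+1%:R / D%:R * b%:~R :> C by rewrite intrM -pmulrn; ring.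
apply.
  move=> n; rewrite /F -snN.
  by have -> : 2 * (- n)%:~R / D%:R = - (2 * n%:~R / D%:R) :> C by rewrite rmorphN /=; ring.
by move=> n u h; have [l e'] := half_ratio_eq D0 h; rewrite /F e' sn_add_even.
Qed.

(** Here every first characteristic is an even integer and can be shifted to 0; the Klein forms then
    tend to sines, which the multiplication formula and the half systems collect into the two
    constants [Psin]. *)
Lemma kprodg_cusp (a b c e : int) : D%:Z * a * e - b * (d%:Z * c) = 1 ->
  cvI (kprodg d D (D%:Z * a) b (d%:Z * c) e)
   ((jac e d * jac (d%:Z * b) D)%:~R * (Psin R d * Psin R D) / two_pi_i R ^+ ((d * D)./2)).
Proof.
move=> h; have dE := odd_half od; have tp := two_pi_i_neq0 R.
have ce : coprimez e d%:Z.
  by apply/coprimezP; exists (D%:Z * a, - (b * c)) => /=; rewrite -h; ring.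
have cb : coprimez (d%:Z * b) D%:Z.
  by apply/coprimezP; exists (- c, a * e) => /=; rewrite -h; ring.
have kE : (d * D)./2 = (d./2 + d * D./2)%N.
  by have DE := odd_half oD; rewrite {1}dE {1}DE {2}dE; lia.
pose Y (r : 'I_(D./2)) (j : int) : C := 2 * r.+1%:R / D%:R * b%:~R + 2 * j%:~R / d%:R * e%:~R.
have lim1 : cvI (fun t => (jac e d)%:~R * \prod_(s < d./2) klein 0 (2 * s.+1%:R / d%:R) t *
    \prod_(r < D./2) sprod d./2 (fun j => klein 0 (Y r j) t))
   ((jac e d)%:~R * \prod_(s < d./2) (sn (2 * s.+1%:R / d%:R) / two_pi_i R) *
    \prod_(r < D./2) sprod d./2 (fun j => sn (Y r j) / two_pi_i R)).
  apply: cvIM; first by apply: cvIMl; apply: cvI_prod => s _; exact: klein0_cvI.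
  apply: cvI_prod => r _.
  by apply: (@cvI_sprod R d./2 (fun j t => klein 0 (Y r j) t)) => j _; exact: klein0_cvI.
have -> : (jac e d * jac (d%:Z * b) D)%:~R * (Psin R d * Psin R D) / two_pi_i R ^+ ((d * D)./2) =
   (jac e d)%:~R * \prod_(s < d./2) (sn (2 * s.+1%:R / d%:R) / two_pi_i R) *
    \prod_(r < D./2) sprod d./2 (fun j => sn (Y r j) / two_pi_i R).
  have -> : \prod_(r < D./2) sprod d./2 (fun j => sn (Y r j) / two_pi_i R) =
     (jac (d%:Z * b) D)%:~R * Psin R D / two_pi_i R ^+ (d * D./2).
    rewrite -Psin_jac //.
    have -> : (two_pi_i R ^+ (d * D./2))^-1 = \prod_(r < D./2) (two_pi_i R)^-1 ^+ d.
      by rewrite prodr_const card_ord -exprM exprVn.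
    rewrite -big_split /=; apply: eq_bigr => r _; rewrite sprodM sprod_const -dE; congr (_ * _).
    have -> : 2 * r.+1%:R / D%:R * (d%:Z * b)%:~R = d%:R * (2 * r.+1%:R / D%:R * b%:~R) :> C.
      by rewrite intrM -pmulrn; ring.
    rewrite -sprod_sn //; set x := 2 * r.+1%:R / D%:R * b%:~R.
    pose F (j : int) : C := sn (x + 2 * j%:~R / d%:R).
    have hF : forall n u, (d./2.*2.+1%:Z %| n - u)%Z -> F n = F u.
      by rewrite -dE => n u hn; have [l e'] := half_ratio_eq d0 hn; rewrite /F e' addrA sn_add_even.
    have := sprod_unit (m := d./2) _ hF; rewrite -dE => /(_ _ ce) <-; apply: eq_sprod => j.
    have E : 2 * (e * j)%:~R / d%:R = 2 * j%:~R / d%:R * e%:~R :> C by rewrite intrM; ring.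
    by rewrite /F /Y -/x E.
  rewrite [\prod_(s < d./2) _]big_split /= prodr_const card_ord -/(Psin R d) kE exprD intrM exprVn.
  by rewrite invfM; ring.
apply: eq_cvI lim1 => t ht; rewrite /kprodg kprodg_fst //; congr (_ * _).
transitivity (\prod_(r < D./2) (sprod d./2 (fun j => qexp ((- (2 * a * b))%:~R * r.+1%:R ^+ 2 / D%:R +
   (- (2 * c * e))%:~R * j%:~R ^+ 2 / d%:R)) * sprod d./2 (fun j => klein 0 (Y r j) t))).
  by rewrite [RHS]big_split /= prod_sprod_phase // mul1r.
apply: eq_bigr => r _.
have <- : sprod d./2 (fun j => qexp (j%:~R * - (r.+1%:R * (2 * a%:~R * e%:~R / d%:R + 2 * b%:~R * c%:~R / D%:R)))) *
  sprod d./2 (fun j => klein 0 (Y r j) t) = sprod d./2 (fun j => klein 0 (Y r j) t).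
  by rewrite sphase_lin mul1r.
rewrite -!sprodM; apply: eq_sprod => j.
have := klein_add_even 0 (Y r j) (r.+1%:Z * a + j * c) 0 ht.
rewrite [2 * 0]mulr0 addr0 [0%:~R * 0]mul0r sub0r add0r.
have -> : 2 * (r.+1%:Z * a + j * c)%:~R = 2 * r.+1%:R / D%:R * (D%:Z * a)%:~R + 2 * j%:~R / d%:R * (d%:Z * c)%:~R :> C.
  rewrite !(intrD, intrM) -!pmulrn.
  by move: (d%:R : C) (D%:R : C) d0 D0 => y w y0 w0; field; rewrite y0 w0.
rewrite /Y => ->; rewrite mulrA -qexpD; congr (qexp _ * _).
by rewrite !(rmorphN, rmorphD, rmorphM) /= -?pmulrn; ring.
Qed.

Definition equot (z : C) : C := dedekind_eta (D%:R * z) ^+ (d * D) / dedekind_eta (d%:R * z).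

Definition equot_const : C := Psin R d * (-1) ^+ D./2 / two_pi_i R ^+ ((d * D)./2).

Lemma equotE z : 0 < complex.Im z -> equot z = equot_const / kprod d D (D%:R * z).
Proof.
have dE := odd_half od; have DE := odd_half oD => hz.
by have := eta_quotientE d./2 D./2 hz; rewrite -dE -DE.
Qed.

Lemma equot_Gamma0 (a b c e : int) z : 0 < complex.Im z -> a * e - b * c = 1 ->
  ((d * D)%:Z %| c)%Z ->
  equot (mob a b c e z) = (jac e d * jac a D)%:~R * aut c e z ^+ ((d * D)./2) * equot z.
Proof.
move=> hz h /dvdzP[c' hc]; have hm := Im_mob_gt0 h hz; rewrite !equotE //.
have hDz : 0 < complex.Im (D%:R * z) by rewrite Im_natr_mul mulr_gt0 // ltr0n; case: D oD.
have h' : a * e - D%:Z * b * (d%:Z * c') = 1 by rewrite -h hc PoszM; ring.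
have ca : coprimez a D%:Z.
  by apply/coprimezP; exists (e, - (b * (d%:Z * c'))) => /=; rewrite -h'; ring.
have ce : coprimez e d%:Z.
  by apply/coprimezP; exists (a, - (D%:Z * b * c')) => /=; rewrite -h'; ring.
have aE : aut (d%:Z * c') e (D%:R * z) = aut c e z :> C.
  by rewrite /aut hc PoszM !intrM -!pmulrn; ring.
have -> : D%:R * mob a b c e z = mob a (D%:Z * b) (d%:Z * c') e (D%:R * z).
  by rewrite /mob aE mulrA; congr (_ / _); rewrite /aut !intrM -!pmulrn; ring.
rewrite kprod_mob // aE kprod_Gamma0 // !invfM invrK intrM !invfM !jac_unit_inv //; by ring.
Qed.

(** After the decomposition of [hecke_decomp] the limit is that of a Klein product at (Az +
    B)/Delta. The divisibility conditions on its matrix have to be translated into conditions on c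
    alone; the symbol modulo D takes care of the case where c and D share a factor. *)
Lemma equot_cusp (a b c e : int) : a * e - b * c = 1 ->
  cvI (fun z => aut c e z ^- ((d * D)./2) * equot (mob a b c e z))
   (((d%:Z %| c)%Z : nat)%:R * (jac (D%:Z * a) d * jac (- (d%:Z * c)) D)%:~R *
     ((-1) ^+ D./2 / (D%:R ^+ ((d * D)./2) * Psin R D))).
Proof.
move=> h; have Dp : (0 < D)%N by case: D oD.
have tp := two_pi_i_neq0 R; have DE := odd_half oD; have dE := odd_half od.
have [a1 [b1 [c1 [e1 [A [B [Δ [[h1 ha hc hb he] [A0 Δ0 AΔ]]]]]]]]] := hecke_decomp Dp h.
set k := (d * D)./2.
have Δ0' : Δ%:~R != 0 :> C by rewrite intr_eq0 gt_eqF.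
pose g z : C := (A%:~R * z + B%:~R) / Δ%:~R.
have Img z : complex.Im (g z) = (A%:~R / Δ%:~R) * complex.Im z.
  rewrite /g !intCE -fmorphV; case: z => p q /=; ring.
have r0 : 0 < A%:~R / Δ%:~R :> R by rewrite divr_gt0 ?ltr0z.
have gE z : 0 < complex.Im z -> aut c e z ^- k * equot (mob a b c e z) =
    equot_const / Δ%:~R ^+ k * (kprodg d D a1 b1 c1 e1 (g z))^-1.
  move=> hz; have hg : 0 < complex.Im (g z) by rewrite Img mulr_gt0.
  have aE : aut c1 e1 (g z) = aut c e z / Δ%:~R.
    by rewrite /aut /g hc he !(intrD, intrM); field.
  have aE' : aut a1 b1 (g z) = aut (D%:Z * a) (D%:Z * b) z / Δ%:~R.
    by rewrite /aut /g ha hb !(intrD, intrM); field.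
  have z0 := aut_neq0 h hz.
  have mE : D%:R * mob a b c e z = mob a1 b1 c1 e1 (g z).
    rewrite /mob aE aE' /aut !intrM -!pmulrn in z0 *; by field; rewrite Δ0' z0.
  rewrite equotE ?Im_mob_gt0 // mE kprod_mob // aE invfM invrK -/k exprMn exprVn.
  have := expf_neq0 k z0; have := expf_neq0 k Δ0'.
  move: (aut c e z ^+ k) (Δ%:~R ^+ k) ((kprodg _ _ _ _ _ _ _)^-1) equot_const => x y w u y0 x0.
  by field; rewrite x0 y0.
have gE' z (hz : 0 < complex.Im z) : equot_const / Δ%:~R ^+ k * (kprodg d D a1 b1 c1 e1 (g z))^-1 =
    aut c e z ^- k * equot (mob a b c e z) by rewrite gE.
apply: eq_cvI gE' _; apply: (@cvI_comp R (fun t => equot_const / Δ%:~R ^+ k * (kprodg d D a1 b1 c1 e1 t)^-1) _ g _ r0) => //.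
(* The vanishing case. If d divides c and the symbol modulo D is not 0, then c is prime to D, so A =
   1, c1 = c and a1 = Da, and both divisibilities would hold. *)
case E : ((d%:Z %| c1)%Z && (D%:Z %| a1)%Z); last first.
  have [l hl /(_ _)] := kprodg_inv_exI h1; rewrite E => /(_ isT) l0.
  rewrite l0 in hl; have := cvIMl (equot_const / Δ%:~R ^+ k) hl; rewrite mulr0.
  suff -> : ((d%:Z %| c)%Z : nat)%:R * (jac (D%:Z * a) d * jac (- (d%:Z * c)) D)%:~R = 0 :> C by rewrite mul0r.
  case dc : (d%:Z %| c)%Z; last by rewrite mul0r.
  have [cD|cD] := boolP (coprimez (- (d%:Z * c)) D%:Z); last by rewrite (jac_eq0 oD cD) mulr0 mulr0.
  have A1 : A = 1.
    have /coprimezP[[u v] /= uv] := cD.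
    have : (A %| A * (- u * d%:Z * c1 + v * Δ))%Z by exact: dvdz_mulr.
    have -> : A * (- u * d%:Z * c1 + v * Δ) = 1 by rewrite -uv hc -AΔ; ring.
    by rewrite dvdz1 => /eqP; lia.
  have c1E : c1 = c by rewrite hc A1 mulr1.
  have a1E : a1 = D%:Z * a by rewrite ha A1 mulr1.
  by move: E; rewrite c1E a1E dc dvdz_mulr.
have /andP[/dvdzP[c' hc1] /dvdzP[a' ha1]] := E.
have aA : a = a' * A by apply: (mulfI (_ : D%:Z != 0)); [rewrite eqz_nat -lt0n | rewrite ha ha1; ring].
(* Both a = a'A and c = c1 A are divisible by A, which therefore divides the determinant 1; hence
   Delta = D. *)
have A1 : A = 1.
  have : (A %| A * (a' * e - b * c1))%Z by exact: dvdz_mulr.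
  have -> : A * (a' * e - b * c1) = 1 by rewrite -h aA [in RHS]hc; ring.
  by rewrite dvdz1 => /eqP; lia.
rewrite A1 !mulr1 in aA hc; rewrite A1 mul1r in AΔ.
have hc' : c1 = d%:Z * c' by rewrite hc1 mulrC.
have ha' : a1 = D%:Z * a' by rewrite ha1 mulrC.
rewrite hc' ha' in h1 *; rewrite AΔ hc hc' dvdz_mulr //= mul1r aA.
have ce : coprimez e1 d%:Z.
  by apply/coprimezP; exists (D%:Z * a', - (b1 * c')) => /=; rewrite -h1; ring.
have cb : coprimez (d%:Z * b1) D%:Z.
  by apply/coprimezP; exists (- c', a' * e1) => /=; rewrite -h1; ring.
have cd : coprimez d%:Z D%:Z.
  by apply/coprimezP; exists (- (b1 * c'), a' * e1) => /=; rewrite -h1; ring.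
(* The determinant, read modulo d, makes D a' and e1 inverse to each other, and symbols of inverse
   classes are equal. *)
have j1 : jac (D%:Z * a') d = jac e1 d.
  apply: int_unit_eq; rewrite -jacM //; transitivity (jac 1 d); last exact: jac1n.
  by apply: eq_jac => //; rewrite -h1 opprB addrCA subrr addr0 mulrCA dvdz_mulr.
have j2 : jac (- (d%:Z * (d%:Z * c'))) D = jac (d%:Z * b1) D.
  apply: int_unit_eq; rewrite -jacM //.
  have -> : - (d%:Z * (d%:Z * c')) * (d%:Z * b1) = d%:Z * d%:Z * (1 - D%:Z * (a' * e1)) by rewrite -h1; ring.
  rewrite jacM // jacM // -expr2 jac_sqr // mul1r; transitivity (jac 1 D); last exact: jac1n.
  by apply: eq_jac => //; rewrite addrAC subrr add0r rpredN dvdz_mulr.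
rewrite j1 j2.
have P0 := Psin_neq0 R d./2; rewrite -dE in P0; have P1 := Psin_neq0 R D./2; rewrite -DE in P1.
have jE := jac_unit_inv R od ce; have jE' := jac_unit_inv R oD cb.
have jn0 : (jac e1 d)%:~R != 0 :> C.
  by have [->|->] := jac_cases od ce; rewrite ?rmorphN ?oppr_eq0 /= oner_eq0.
have jn0' : (jac (d%:Z * b1) D)%:~R != 0 :> C.
  by have [->|->] := jac_cases oD cb; rewrite ?rmorphN ?oppr_eq0 /= oner_eq0.
have lim := kprodg_cusp h1; rewrite intrM in lim *.
have tpk := expf_neq0 k tp; have Dk := expf_neq0 k D0.
have lim' := cvIMl (equot_const / D%:R ^+ k) (cvIV _ lim).
rewrite -jE -jE' -pmulrn; rewrite [X in cvI _ X](_ : _ = equot_const / D%:R ^+ k *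
  ((jac e1 d)%:~R * (jac (d%:Z * b1) D)%:~R * (Psin R d * Psin R D) / two_pi_i R ^+ (d * D)./2)^-1).
  apply: lim'; apply: mulf_neq0; last by rewrite invr_eq0.
  by apply: mulf_neq0; apply: mulf_neq0.
have alg (sg u v w x y y' : C) : u != 0 -> v != 0 -> w != 0 -> x != 0 -> y != 0 -> y' != 0 ->
  y^-1 * y'^-1 * (sg / (v * x)) = w * sg / u / v / (y * y' * (w * x) / u).
  by move=> u0 v0 w0 x0 y0 y0'; field; rewrite u0 v0 w0 x0 y0 y0'.
exact: alg.
Qed.

End Level.
End EtaQuotient.

(** * Eisenstein series of a periodic weight *)

Section SymmetricSums.
Variable V : nmodType.
Implicit Types f g : int -> V.

(** The range as a list turns a symmetric sum into one big operator, for which the exchange of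
    summations is available. *)
Definition srange (M : nat) : seq int := 0 :: flatten [seq [:: r.+1%:Z; - r.+1%:Z] | r <- iota 0 M].

Lemma ssumE M f : ssum M f = \sum_(n <- srange M) f n.
Proof. exact: srange_big. Qed.

Lemma eq_ssum M f g : f =1 g -> ssum M f = ssum M g.
Proof. by move=> e; rewrite !ssumE; apply: eq_bigr. Qed.

Lemma ssumD M f g : ssum M (fun n => f n + g n) = ssum M f + ssum M g.
Proof. by rewrite !ssumE big_split. Qed.

Lemma ssum_refl M f : ssum M (fun n => f (- n)) = ssum M f.
Proof. by rewrite /ssum oppr0; congr (_ + _); apply: eq_bigr => r _; rewrite opprK addrC. Qed.

Lemma exchange_ssum M K (f : int -> int -> V) :
  ssum M (fun i => ssum K (f i)) = ssum K (fun j => ssum M (fun i => f i j)).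
Proof.
under eq_ssum do rewrite ssumE; rewrite ssumE exchange_big /= ssumE.
by apply: eq_bigr => j _; rewrite ssumE.
Qed.

Lemma ssumS M f : ssum M.+1 f = ssum M f + (f M.+1%:Z + f (- M.+1%:Z)).
Proof. by rewrite /ssum big_ord_recr /= addrA. Qed.

Lemma ssum_ord h f : ssum h f = \sum_(r < h.*2.+1) f (r%:Z - h%:Z).
Proof.
elim: h f => [|h IH] f; first by rewrite /ssum big_ord0 addr0 big_ord1.
rewrite ssumS IH doubleS [RHS]big_ord_recl [X in _ = _ + X]big_ord_recr /=.
rewrite sub0r [RHS]addrC -!addrA; congr (_ + _).
  by apply: eq_bigr => i _; congr f; rewrite /bump /=; lia.
by congr (f _ + _); rewrite /bump /=; lia.
Qed.

Lemma ssum_block h M f : ssum (h.*2.+1 * M + h) f =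
  ssum M (fun i => ssum h (fun a => f (h.*2.+1%:Z * i + a))).
Proof.
set n := h.*2.+1; elim: M => [|M IH].
  by rewrite muln0 add0n [RHS]/ssum big_ord0 addr0; apply: eq_ssum => a; rewrite mulr0 add0r.
rewrite ssumS -IH; set m := (n * M + h)%N.
have -> : (n * M.+1 + h = m + n)%N by rewrite /m mulnSr addnAC.
have -> : ssum (m + n) f = ssum m f + \sum_(r < n) (f (m + r).+1%:Z + f (- (m + r).+1%:Z)).
  by rewrite /ssum big_split_ord /= addrA.
congr (_ + _); rewrite big_split /=; congr (_ + _).
  by rewrite ssum_ord; apply: eq_bigr => r _; congr f; rewrite /m /n; lia.
rewrite -[RHS]ssum_refl ssum_ord; apply: eq_bigr => r _; congr f; rewrite /m /n; lia.
Qed.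

End SymmetricSums.

Section SymmetricSumsReal.
Variable R : realType.
Local Notation C := R[i].

Lemma ssumZ M (c : C) f : ssum M (fun n => c * f n) = c * ssum M f.
Proof. by rewrite !ssumE mulr_sumr. Qed.

Lemma eq_limC (u v : nat -> C) : u =1 v -> limn (u : nat -> C^o) = limn (v : nat -> C^o).
Proof. by move/funext->. Qed.

Lemma cvC_ssum M (f : int -> nat -> C) (l : int -> C) :
  (forall i, cvC (f i) (l i)) -> cvC (fun n => ssum M (fun i => f i n)) (ssum M l).
Proof.
move=> h; rewrite ssumE; apply: eq_cvC (cvC_sum (srange M) h) => n.
by rewrite ssumE.
Qed.

Lemma srange_abs M i : i \in srange M -> (`|i| <= M)%N.
Proof.
rewrite inE => /predU1P[->//|/flatten_mapP[r]]; rewrite mem_iota !inE => /andP[_ hr].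
by case/orP => /eqP ->; lia.
Qed.

Lemma nrm_ssum M (f : int -> C) (g : int -> R) :
  (forall i : int, (`|i| <= M)%N -> nrm (f i) <= g i) -> nrm (ssum M f) <= ssum M g.
Proof.
move=> h; rewrite !ssumE big_seq [X in _ <= X]big_seq; apply: le_trans (nrm_sum _ _ _) _.
by apply: ler_sum => i hi; apply: h; exact: srange_abs.
Qed.

Lemma ssum_const M (c : R) : ssum M (fun=> c) = M.*2.+1%:R * c.
Proof. by rewrite ssum_ord sumr_const card_ord mulr_natl. Qed.

Lemma inv_pow_diff k (x y : C) (d : R) : 0 < d -> d <= nrm x -> d <= nrm y ->
  nrm (x ^- k - y ^- k) <= k%:R * nrm (x - y) * d ^- k.+1.
Proof.
move=> d0 hx hy; case: k => [|k]; first by rewrite !expr0 subrr nrm0 !mul0r.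
have x0 : x != 0 by rewrite -nrm_eq0 gt_eqF //; lra.
have y0 : y != 0 by rewrite -nrm_eq0 gt_eqF //; lra.
rewrite -!exprVn subrXX nrmM.
have -> : x^-1 - y^-1 = (y - x) * (x^-1 * y^-1) by field; rewrite x0 y0.
have hV u : d <= nrm u -> nrm u^-1 <= d^-1 by move=> hu; rewrite nrmV lef_pV2 ?posrE //; lra.
have d1 : 0 <= d^-1 by rewrite invr_ge0; lra.
rewrite !nrmM [nrm (y - x)]nrmBC.
have h1 : nrm (\sum_(i < k.+1) x^-1 ^+ (k.+1.-1 - i) * y^-1 ^+ i) <= k.+1%:R * d^-1 ^+ k.
  apply: le_trans (nrm_sum _ _ _) _; apply: (@le_trans _ _ (\sum_(i < k.+1) d^-1 ^+ k)); last first.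
    by rewrite sumr_const card_ord mulr_natl.
  apply: ler_sum => i _; rewrite nrmM !nrmX /=.
  have -> : d^-1 ^+ k = d^-1 ^+ (k - i) * d^-1 ^+ i by rewrite -exprD subnK // -ltnS.
  by apply: ler_pM; rewrite ?exprn_ge0 ?nrm_ge0 // lerXn2r ?nnegrE ?nrm_ge0 // hV.
apply: (@le_trans _ _ (nrm (x - y) * (d^-1 * d^-1) * (k.+1%:R * d^-1 ^+ k))).
  apply: ler_pM => //; rewrite ?nrm_ge0 //; first by rewrite !mulr_ge0 // nrm_ge0.
  by rewrite ler_wpM2l ?nrm_ge0 //; apply: ler_pM; rewrite ?nrm_ge0 // hV.
rewrite le_eqVlt; apply/orP; left; apply/eqP; rewrite !exprS; ring.
Qed.

Lemma ssum_dominated (f : int -> C) (g : int -> R) M M' : (forall i, nrm (f i) <= g i) ->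
  (M <= M')%N -> nrm (ssum M' f - ssum M f) <= ssum M' g - ssum M g.
Proof.
move=> h /subnK <-; elim: (M' - M)%N => [|n IH]; first by rewrite !subrr nrm0.
rewrite addSn !ssumS; set u := ssum (n + M) f in IH *; set v := ssum (n + M) g in IH *.
set x := f (n + M).+1%:Z; set y := f (- _).
have hx : nrm x <= g (n + M).+1%:Z by exact: h.
have hy : nrm y <= g (- (n + M).+1%:Z) by exact: h.
have -> : u + (x + y) - ssum M f = (u - ssum M f) + (x + y) by ring.
apply: le_trans (nrmD _ _) _; have := nrmD x y; lra.
Qed.

Lemma sum_inv_cube M K : \sum_(i < M) \sum_(j < K) (((i + j).+1%:R : R) ^+ 3)^-1 <= 3.
Proof.
(* With x = n + 1, the difference 3(a(n) - a(n+1)) is 6/(x(x+1)(x+2)), at least x^-3; the values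
   a(n) telescope in turn. *)
pose a (n : nat) : R := (n.+1%:R * n.+2%:R)^-1.
have col i : \sum_(j < K) (((i + j).+1%:R : R) ^+ 3)^-1 <= 3 * (a i - a (i + K)%N).
  elim: K => [|K IH]; first by rewrite big_ord0 addn0 subrr mulr0.
  rewrite big_ord_recr /= addnS.
  suff : (((i + K).+1%:R : R) ^+ 3)^-1 <= 3 * (a (i + K)%N - a (i + K).+1).
    by move: IH; move: (\sum_(j < K) _) (_^-1) (a _) (a _) (a _) => x1 x2 x3 x4 x5; lra.
  rewrite /a; move: (i + K)%N => n.
  have -> : n.+3%:R = n.+1%:R + 2 :> R by rewrite -!natr1; ring.
  have -> : n.+2%:R = n.+1%:R + 1 :> R by rewrite -!natr1; ring.
  have : 1 <= n.+1%:R :> R by rewrite ler1n.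
  move: (n.+1%:R : R) => x x1.
  have -> : 3 * ((x * (x + 1))^-1 - ((x + 1) * (x + 2))^-1) = (x * (x + 1) * (x + 2) / 6)^-1.
    by field; apply/and3P; split; rewrite gt_eqF //; lra.
  have x0 : 0 < x ^+ 2 by rewrite exprn_gt0 //; lra.
  rewrite lef_pV2 ?posrE.
  - rewrite ler_pdivrMr // exprS expr2 -!mulrA; apply: ler_wpM2l; first lra.
    nra.
  - by rewrite exprn_gt0 //; lra.
  - by rewrite !mulr_gt0 ?invr_gt0 //; lra.
apply: (@le_trans _ _ (\sum_(i < M) 3 * a i)).
  apply: ler_sum => i _; apply: le_trans (col i) _; rewrite ler_wpM2l //.
  by rewrite gerBl /a invr_ge0 mulr_ge0.
rewrite -mulr_sumr -[X in _ <= X]mulr1 ler_wpM2l //.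
have -> : \sum_(i < M) a i = 1 - M.+1%:R^-1.
  elim: M => [|M IH]; first by rewrite big_ord0 invr1 subrr.
  rewrite big_ord_recr /= IH /a.
  have -> : M.+2%:R = M.+1%:R + 1 :> R by rewrite -!natr1.
  have : 0 < M.+1%:R :> R by [].
  by move: (M.+1%:R : R) => x x0; field; apply/andP; split; rewrite gt_eqF //; lra.
by rewrite gerBl invr_ge0.
Qed.

Lemma ssum_abs_le M (g : nat -> R) : (forall n, 0 <= g n) ->
  ssum M (fun i => g `|i|%N) <= 2 * \sum_(i < M.+1) g i.
Proof.
move=> g0; rewrite /ssum big_ord_recl /=.
have -> : \sum_(r < M) (g r.+1 + g `|- r.+1%:Z|%N) = 2 * \sum_(i < M) g (bump 0 i).
  by rewrite mulr_sumr; apply: eq_bigr => r _; rewrite abszN /= /bump /=; ring.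
have := g0 0%N; lra.
Qed.

End SymmetricSumsReal.

(** * Series over pairs (m, n) with admissible weights *)

Section Eisenstein.
Variable R : realType.
Local Notation C := R[i].
Variables (h k : nat).
Hypothesis k2 : (2 <= k)%N.
Local Notation N := h.*2.+1.
Implicit Types (w : int -> int -> C) (z : C).

(** The field [adm_sum] provides convergence: for k = 2 the terms are not absolutely summable, but
    with mean 0 over a period each N by N block loses its leading term. The parity [adm_sgn] makes
    the rows m and -m equal. *)
Record admissible w : Prop := Admissible {
  adm_per : forall m m' n n', (N%:Z %| m - m')%Z -> (N%:Z %| n - n')%Z -> w m n = w m' n';
  adm_sgn : forall m n, w (- m) (- n) = (-1) ^+ k * w m n;
  adm_sum : ssum h (fun a => ssum h (w a)) = 0;
  adm_bnd : exists W : R, forall m n, nrm (w m n) <= W }.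

(** The weight is composed with the inverse matrix acting on row vectors, since m(az + b) + n(cz +
    e) is the linear form of the vector (m, n) times the matrix. *)
Definition wact w (a b c e : int) (m n : int) : C := w (m * e - n * c) (n * a - m * b).

Let N0 : N%:R != 0 :> C.
Proof. by rewrite pnatr_eq0. Qed.

Lemma admissible_T w b : admissible w -> admissible (wact w 1 b 0 1).
Proof.
move=> [hp hs hz [W hW]]; split; rewrite /wact.
- move=> m m' n n' h1 h2; apply: hp; first by rewrite !mulr1 !mulr0 !subr0.
  have -> : n * 1 - m * b - (n' * 1 - m' * b) = (n - n') - (m - m') * b by ring.
  by rewrite rpredB // dvdz_mulr.
- move=> m n; rewrite -hs; congr w; ring.
- rewrite -[RHS]hz; apply: eq_ssum => a; rewrite !ssum_periodic.
  + transitivity (\sum_(x < N) w a (1 * x%:Z + - (a * b))).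
      by apply: eq_bigr => x _; congr w; ring.
    apply: periodic_sum_unit => //; first by rewrite coprimezE coprime1n.
    by move=> t u htu; apply: hp => //; rewrite subrr dvdz0.
  + by move=> t u htu; apply: hp => //; rewrite subrr dvdz0.
  + move=> t u htu; apply: hp; first by rewrite !mulr0 subrr dvdz0.
    by have -> : t * 1 - a * b - (u * 1 - a * b) = t - u by ring.
by exists W => m n.
Qed.

Lemma admissible_S w : admissible w -> admissible (wact w 0 (-1) 1 0).
Proof.
move=> [hp hs hz [W hW]]; split; rewrite /wact.
- move=> m m' n n' h1 h2; apply: hp.
    have -> : m * 0 - n * 1 - (m' * 0 - n' * 1) = - (n - n') by ring.
    by rewrite rpredN.
  by have -> : n * 0 - m * -1 - (n' * 0 - m' * -1) = m - m' by ring.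
- move=> m n; rewrite -hs; congr w; ring.
- rewrite -[RHS]hz exchange_ssum -[RHS]ssum_refl; apply: eq_ssum => b; apply: eq_ssum => a.
  congr w; ring.
by exists W => m n.
Qed.

(** The pair m = n = 0 contributes nothing for k > 0, by the convention that the inverse of 0 is
    0. *)
Definition box w z (M K : nat) : C :=
  ssum (N * M + h) (fun m => ssum (N * K + h) (fun n => w m n * (m%:~R * z + n%:~R) ^- k)).

Lemma box_S w z M K : z != 0 -> box w (- z^-1) M K = z ^+ k * box (wact w 0 (-1) 1 0) z K M.
Proof.
move=> z0; rewrite /box exchange_ssum -ssumZ; apply: eq_ssum => n.
rewrite -ssum_refl -ssumZ; apply: eq_ssum => m; rewrite /wact.
have -> : n * 0 - m * 1 = - m by ring.
have -> : m * 0 - n * -1 = n by ring.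
have -> : (- m)%:~R * - z^-1 + n%:~R = (n%:~R * z + m%:~R) / z.
  by rewrite rmorphN /=; field.
by rewrite exprMn exprVn invfM invrK; ring.
Qed.

Definition blk w z (i j : int) : C := ssum h (fun a => ssum h (fun b =>
  w (N%:Z * i + a) (N%:Z * j + b) * ((N%:Z * i + a)%:~R * z + (N%:Z * j + b)%:~R) ^- k)).

Lemma box_blk w z M K : box w z M K = ssum M (fun i => ssum K (blk w z i)).
Proof.
rewrite /box ssum_block; apply: eq_ssum => i; rewrite /blk exchange_ssum.
by rewrite ssum_block; apply: eq_ssum => j; rewrite exchange_ssum.
Qed.

(** A block far from the origin gains one power over its individual terms and is of cubic decay,
    hence summable in two dimensions. The block at the origin is bounded by itself. *)
Lemma blk_bound w z : admissible w -> 0 < complex.Im z ->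
  exists2 B : R, 0 <= B & forall i j, nrm (blk w z i j) <= B / ((`|i| + `|j|).+1%:R ^+ 3).
Proof.
move=> [hp hs hz [W hW]] hz0; have [c c0 hc] := lattice_lower_bound hz0.
have W0 : 0 <= W by apply: le_trans (hW 0 0); exact: nrm_ge0.
(* From [inv_pow_diff]: the points of a block lie within h|z| + h of its centre Y, and all of them
   are at least c s away from 0. *)
pose T := W * (k%:R * (h%:R * nrm z + h%:R) * c ^- k.+1).
have T0 : 0 <= T.
  by rewrite /T mulr_ge0 // mulr_ge0 ?invr_ge0 ?exprn_ge0 ?(ltW c0) // mulr_ge0 // addr_ge0 // mulr_ge0 ?nrm_ge0.
have NT : 0 <= N%:R * (N%:R * T) by apply: mulr_ge0 => //; apply: mulr_ge0.
exists (nrm (blk w z 0 0) + 8 * (N%:R * (N%:R * T))).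
  by have := nrm_ge0 (blk w z 0 0); lra.
move=> i j; set s := (`|i| + `|j|)%N.
have B0 := nrm_ge0 (blk w z 0 0).
have [s0|s0] := posnP s.
  have -> : i = 0 by move: s0; rewrite /s; lia.
  have -> : j = 0 by move: s0; rewrite /s; lia.
  by rewrite s0 expr1n divr1; lra.
have s1 : 1 <= s%:R :> R by rewrite ler1n.
pose Y := (N%:Z * i)%:~R * z + (N%:Z * j)%:~R.
have cs : 0 < c * s%:R by rewrite mulr_gt0 //; lra.
have low (a b : int) : (`|a| <= h)%N -> (`|b| <= h)%N ->
    c * s%:R <= nrm ((N%:Z * i + a)%:~R * z + (N%:Z * j + b)%:~R).
  move=> ha hb; apply: le_trans (hc _ _); rewrite ler_pM2l // -!intrD -[s%:R]/(s%:Z%:~R) ler_int.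
  have q (m n : int) : (`|n| <= h)%N -> `|m| <= `|N%:Z * m + n|.
    move=> hn; have [->|m0] := eqVneq m 0; first by rewrite normr0.
    by have [m1|m1] : 1 <= m \/ m <= -1; [lia| |]; nia.
  by rewrite /s PoszD !abszE lerD // q.
(* Subtracting the value at the centre is free because the weights of a block add up to 0. *)
have -> : blk w z i j = ssum h (fun a => ssum h (fun b => w a b *
    (((N%:Z * i + a)%:~R * z + (N%:Z * j + b)%:~R) ^- k - Y ^- k))).
  have E : ssum h (fun a => ssum h (fun b => - Y ^- k * w a b)) = 0.
    by under eq_ssum do rewrite ssumZ; rewrite ssumZ hz mulr0.
  rewrite -[LHS]addr0 -E /blk -ssumD; apply: eq_ssum => a; rewrite -ssumD; apply: eq_ssum => b.
  have -> : w (N%:Z * i + a) (N%:Z * j + b) = w a b.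
    by apply: hp; rewrite addrK dvdz_mulr.
  by ring.
apply: (@le_trans _ _ (ssum h (fun=> ssum h (fun=> T / s%:R ^+ 3)))).
  apply: nrm_ssum => a ha; apply: nrm_ssum => b hb; rewrite nrmM.
  have hX := low a b ha hb.
  have hY : c * s%:R <= nrm Y by have := low 0 0 isT isT; rewrite !addr0.
  have D := inv_pow_diff k cs hX hY.
  have XY : nrm ((N%:Z * i + a)%:~R * z + (N%:Z * j + b)%:~R - Y) <= h%:R * nrm z + h%:R.
    have -> : (N%:Z * i + a)%:~R * z + (N%:Z * j + b)%:~R - Y = a%:~R * z + b%:~R :> C.
      by rewrite /Y !intrD; ring.
    apply: le_trans (nrmD _ _) _; rewrite nrmM !nrm_int.
    have ia (x : int) : (`|x| <= h)%N -> `|x|%:~R <= h%:R :> R.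
      by move=> hx; rewrite -[h%:R]/(h%:Z%:~R) ler_int -abszE.
    by apply: lerD; [rewrite ler_wpM2r ?nrm_ge0 ?ia | exact: ia].
  have P : (c * s%:R) ^- k.+1 <= c ^- k.+1 * s%:R ^- 3.
    rewrite exprMn invfM ler_wpM2l ?invr_ge0 ?exprn_ge0 ?(ltW c0) //.
    rewrite lef_pV2 ?posrE ?exprn_gt0 //; try lra.
    by rewrite ler_weXn2l.
  apply: (@le_trans _ _ (W * (k%:R * (h%:R * nrm z + h%:R) * (c ^- k.+1 * s%:R ^- 3)))).
    apply: ler_pM; rewrite ?nrm_ge0 //; apply: le_trans D _.
    apply: ler_pM => //; rewrite ?mulr_ge0 ?nrm_ge0 ?invr_ge0 ?exprn_ge0 ?(ltW cs) //.
    by rewrite ler_wpM2l.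
  by rewrite /T !mulrA.
rewrite !ssum_const.
have s3 : (s%:R ^+ 3)^-1 <= 8 / (s.+1%:R ^+ 3) :> R.
  rewrite -[8 / _]invf_div lef_pV2 ?posrE ?exprn_gt0 ?divr_gt0 //; try by lra.
  have -> : s.+1%:R = s%:R + 1 :> R by rewrite natr1.
  rewrite ler_pdivrMr // -[8](_ : 2 ^+ 3 = _); last by ring.
  by rewrite -exprMn lerXn2r ?nnegrE //; lra.
have q0 : 0 <= (s.+1%:R ^+ 3)^-1 :> R by rewrite invr_ge0 exprn_ge0.
have -> : N%:R * (N%:R * (T / s%:R ^+ 3)) = N%:R * (N%:R * T) * (s%:R ^+ 3)^-1 by ring.
apply: (@le_trans _ _ (N%:R * (N%:R * T) * (8 / (s.+1%:R ^+ 3)))); first by rewrite ler_wpM2l.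
rewrite [X in _ <= X]mulrDl [leLHS](_ : _ = 8 * (N%:R * (N%:R * T)) / s.+1%:R ^+ 3); last by ring.
by rewrite lerDr; apply: mulr_ge0.
Qed.

Lemma box_dominated w z : admissible w -> 0 < complex.Im z ->
  exists (v : nat -> nat -> R) (b : R),
  (forall m n m' n', (m <= m')%N -> (n <= n')%N ->
     nrm (box w z m' n' - box w z m n) <= v m' n' - v m n) /\ (forall m n, v m n <= b).
Proof.
move=> hw hz; have [B B0 hB] := blk_bound hw hz.
pose g (i j : int) : R := B / ((`|i| + `|j|).+1%:R ^+ 3).
exists (fun M K => ssum M (fun i => ssum K (g i))), (4 * (B * 3)); split.
  move=> M K M' K' hM hK; rewrite !box_blk.
  have h1 : nrm (ssum M' (fun i => ssum K' (blk w z i)) - ssum M (fun i => ssum K' (blk w z i))) <=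
    ssum M' (fun i => ssum K' (g i)) - ssum M (fun i => ssum K' (g i)).
    by apply: ssum_dominated => // i; apply: nrm_ssum => j _; exact: hB.
  have h2 : nrm (ssum M (fun i => ssum K' (blk w z i)) - ssum M (fun i => ssum K (blk w z i))) <=
    ssum M (fun i => ssum K' (g i)) - ssum M (fun i => ssum K (g i)).
    rewrite ![ssum M (fun i => ssum _ _)]exchange_ssum.
    by apply: ssum_dominated => // j; apply: nrm_ssum => i _; exact: hB.
  apply: le_trans (nrmB_tri (ssum M (fun i => ssum K' (blk w z i))) _ _) _; lra.
move=> M K; pose g' (i j : nat) : R := B / ((i + j).+1%:R ^+ 3).
have g'0 i j : 0 <= g' i j by rewrite /g' mulr_ge0 // invr_ge0 exprn_ge0.
apply: (@le_trans _ _ (ssum M (fun i => 2 * \sum_(j < K.+1) g' `|i|%N j))).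
  rewrite !ssumE; apply: ler_sum => i _; exact: (ssum_abs_le K (g'0 `|i|%N)).
apply: le_trans (@ssum_abs_le R M (fun i => 2 * \sum_(j < K.+1) g' i j) _) _.
  by move=> n; rewrite mulr_ge0 // sumr_ge0.
rewrite -mulr_sumr mulrA; have -> : 2 * 2 = 4 :> R by ring.
rewrite ler_wpM2l //; under eq_bigr => i _ do rewrite -mulr_sumr.
by rewrite -mulr_sumr ler_wpM2l // sum_inv_cube.
Qed.

Lemma row_bound_cvC (u : int -> C) (W : R) : (forall n, nrm (u n) <= W) ->
  exists l, cvC (fun K => ssum K (fun n => u n * n%:~R ^- k)) l.
Proof.
move=> hu; have W0 : 0 <= W by apply: le_trans (hu 0); exact: nrm_ge0.
have [|l hl] := @sum_cvC _ (fun r => u r.+1%:Z * r.+1%:Z%:~R ^- k + u (- r.+1%:Z) * (- r.+1%:Z)%:~R ^- k) (2 * W * 2).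
  move=> n; apply: (@le_trans _ _ (2 * W * \sum_(r < n) (r.+1%:R ^+ 2)^-1)); last first.
    by rewrite ler_wpM2l ?sum_inv_sqr //; lra.
  rewrite mulr_sumr; apply: ler_sum => r _.
  have one (m : int) : `|m|%N = r.+1 -> nrm (u m * m%:~R ^- k) <= W * (r.+1%:R ^+ 2)^-1.
    move=> hm; rewrite nrmM nrmV nrmX nrm_int -abszE hm -pmulrn.
    apply: ler_pM; rewrite ?nrm_ge0 ?invr_ge0 ?exprn_ge0 //.
    by rewrite lef_pV2 ?posrE ?exprn_gt0 // ler_weXn2l // ler1n.
  apply: le_trans (nrmD _ _) _; have := one r.+1%:Z erefl; have := one (- r.+1%:Z) (abszN _).
  rewrite -[2 * W * _]mulrA; move: (W * _) (nrm _) (nrm _) => x y y'; lra.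
by exists (u 0 * 0%:~R ^- k + l); apply: cvCD (cvC_cst _) hl.
Qed.

Definition Lsum (u : int -> C) : C := limn (fun K => ssum K (fun n => u n * n%:~R ^- k) : C^o).

Lemma Lsum_cvC u (W : R) : (forall n, nrm (u n) <= W) ->
  cvC (fun K => ssum K (fun n => u n * n%:~R ^- k)) (Lsum u).
Proof. by move=> hu; have [l hl] := row_bound_cvC hu; rewrite /Lsum (cvC_lim hl). Qed.

(** The sum of u(n)(a + n)^-k over Z, for u of period 2g + 1, by Lipschitz' formula in each residue
    class ([row_limit]). *)
Definition rowsum (g : nat) (u : int -> C) (a : C) : C :=
  g.*2.+1%:R ^- k * lip_const R k * ssum g (fun b => u b * Lser k ((a + b%:~R) / g.*2.+1%:R)).

Lemma Im_div_nat (a : C) n : complex.Im (a / n%:R) = complex.Im a / n%:R.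
Proof. by rewrite natCE -fmorphV; case: a => p q /=; ring. Qed.

Lemma row_limit g (u : int -> C) a : 0 < complex.Im a ->
  (forall n n', (g.*2.+1%:Z %| n - n')%Z -> u n = u n') ->
  cvC (fun K => ssum (g.*2.+1 * K + g) (fun n => u n * (a + n%:~R) ^- k)) (rowsum g u a).
Proof.
move=> ha hu; set p := g.*2.+1; have p0 : p%:R != 0 :> C by rewrite pnatr_eq0.
have Ib (b : int) : 0 < complex.Im ((a + b%:~R) / p%:R).
  by rewrite Im_div_nat intCE Im_addr_real divr_gt0.
have H := @cvC_ssum R g (fun b K => u b * (p%:R ^- k * ssum K (fun j => ((a + b%:~R) / p%:R + j%:~R) ^- k)))
  (fun b => u b * (p%:R ^- k * (lip_const R k * Lser k ((a + b%:~R) / p%:R))))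
  (fun b => cvCMl (u b) (cvCMl (p%:R ^- k) (lipschitz k2 (Ib b)))).
have -> : rowsum g u a = ssum g (fun b => u b * (p%:R ^- k * (lip_const R k * Lser k ((a + b%:~R) / p%:R)))).
  by rewrite /rowsum -ssumZ; apply: eq_ssum => b; rewrite -/p; ring.
apply: eq_cvC H => K; rewrite ssum_block exchange_ssum; apply: eq_ssum => b.
rewrite -!ssumZ; apply: eq_ssum => j.
have -> : u (g.*2.+1%:Z * j + b) = u b by apply: hu; rewrite addrK dvdz_mulr.
have -> : a + (g.*2.+1%:Z * j + b)%:~R = p%:R * ((a + b%:~R) / p%:R + j%:~R).
  by rewrite intrD intrM -pmulrn -/p; move: (p%:R : C) p0 => x x0; field.
by rewrite exprMn invfM.
Qed.

Lemma rowsum_bound (y : R) : 0 < y -> exists2 B : R, 0 <= B & forall (u : int -> C) (W : R) a,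
  (forall n, nrm (u n) <= W) -> y <= complex.Im a ->
  nrm (rowsum h u a) <= B * W * nrm (qexp (a / N%:R)).
Proof.
move=> y0; have yN : 0 < y / N%:R by rewrite divr_gt0.
have [b b0 hb] := @Lser_bound R k _ yN.
exists (nrm (N%:R ^- k * lip_const R k) * (N%:R * b)); first by rewrite !mulr_ge0 // nrm_ge0.
move=> u W a hu ya; have W0 : 0 <= W by apply: le_trans (hu 0); exact: nrm_ge0.
rewrite /rowsum nrmM.
have -> : nrm (N%:R ^- k * lip_const R k) * (N%:R * b) * W * nrm (qexp (a / N%:R)) =
  nrm (N%:R ^- k * lip_const R k) * (N%:R * (W * (b * nrm (qexp (a / N%:R))))) by ring.
rewrite ler_wpM2l ?nrm_ge0 // -ssum_const; apply: nrm_ssum => j _; rewrite nrmM.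
have Ij : complex.Im ((a + j%:~R) / N%:R) = complex.Im a / N%:R.
  by rewrite Im_div_nat intCE Im_addr_real.
apply: ler_pM; rewrite ?nrm_ge0 //.
have -> : nrm (qexp (a / N%:R)) = nrm (qexp ((a + j%:~R) / N%:R)) by rewrite !nrm_qexp Ij Im_div_nat.
by apply: hb; rewrite Ij ler_pM2r // invr_gt0.
Qed.

Definition Eis_tail w z : C := limn (fun M => \sum_(m < M) rowsum h (w m.+1%:Z) (m.+1%:R * z) : C^o).
(** Summation by rows, n inside and m outside; the factor 2 stands for the rows with m < 0. *)
Definition Eis w z : C := Lsum (w 0) + 2 * Eis_tail w z.

Lemma Eis_tail_spec (y : R) : 0 < y -> exists2 B : R, 0 <= B & forall w (W : R) z,
  (forall m n, nrm (w m n) <= W) -> y <= complex.Im z ->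
  cvC (fun M => \sum_(m < M) rowsum h (w m.+1%:Z) (m.+1%:R * z)) (Eis_tail w z) /\
  nrm (Eis_tail w z) <= B * W * (nrm (qexp (z / N%:R)) / (1 - nrm (qexp (z / N%:R)))).
Proof.
move=> y0; have [B B0 hB] := rowsum_bound y0; exists B => // w W z hw yz.
have hz : 0 < complex.Im z by lra.
have W0 : 0 <= W by apply: le_trans (hw 0 0); exact: nrm_ge0.
have q1 : nrm (qexp (z / N%:R)) < 1 by apply: nrm_qexp_lt1; rewrite Im_div_nat divr_gt0.
have bnd n : \sum_(m < n) nrm (rowsum h (w m.+1%:Z) (m.+1%:R * z)) <=
   B * W * (nrm (qexp (z / N%:R)) / (1 - nrm (qexp (z / N%:R)))).
  apply: (@le_trans _ _ (\sum_(m < n) B * W * (nrm (qexp (z / N%:R)) * nrm (qexp (z / N%:R)) ^+ m))).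
    apply: ler_sum => m _; rewrite -exprS -nrmX qexpX mulrA; apply: hB => //.
    by rewrite Im_natr_mul; apply: le_trans yz _; rewrite ler_peMl ?ler1n // ltW.
  rewrite -!mulr_sumr ler_wpM2l ?mulr_ge0 // ler_wpM2l ?nrm_ge0 //; exact: geom_bound.
have [l hl] := @sum_cvC R (fun m => rowsum h (w m.+1%:Z) (m.+1%:R * z)) _ bnd; have -> : Eis_tail w z = l by exact: (cvC_lim hl).
split=> //; apply: (cvC_le (n1 := 0%N)) hl => n _.
by apply: le_trans (nrm_sum _ _ _) _; exact: bnd.
Qed.

Lemma Eis_cusp w : admissible w -> cvI (Eis w) (Lsum (w 0)).
Proof.
move=> [_ _ _ [W hW]]; have [B B0 hB] := Eis_tail_spec (@ltr01 R).
have W0 : 0 <= W by apply: le_trans (hW 0 0); exact: nrm_ge0.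
move=> e e0; pose e' := Num.min 2^-1 (e / (4 * (B * W + 1))).
have BW : 0 <= B * W by rewrite mulr_ge0.
have e'0 : 0 < e' by rewrite lt_min; apply/andP; split; [lra | rewrite divr_gt0 //; lra].
have N1 : 0 < (N%:R^-1 : R) by rewrite invr_gt0.
have [A hA] := @cvI_qexp R _ 0 N1 e' e'0; exists (Num.max A 1) => z z0.
rewrite ge_max => /andP[zA z1]; have := hA z z0 zA; rewrite subr0 addr0 => hq.
have [_ ht] := hB w W z hW z1.
have qE : (N%:R^-1)%:C%C * z = z / N%:R :> C by rewrite fmorphV rmorph_nat mulrC.
rewrite qE in hq; set x := nrm _ in hq ht; have x0 : 0 <= x := nrm_ge0 _.
have x1 : x <= 2^-1 by apply: le_trans hq _; rewrite ge_min lexx.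
have x2 : x * (4 * (B * W + 1)) <= e.
  by rewrite -ler_pdivlMr; [apply: le_trans hq _; rewrite ge_min lexx orbT | lra].
have -> : Eis w z - Lsum (w 0) = 2 * Eis_tail w z by rewrite /Eis addrC addKr.
rewrite nrmM nrm_nat.
have h3 : x / (1 - x) <= 2 * x by rewrite ler_pdivrMr; [nra | lra].
have h4 : B * W * (x / (1 - x)) <= B * W * (2 * x) by rewrite ler_wpM2l.
nra.
Qed.

Definition Rsum w z T : C := Lsum (w 0) + 2 * \sum_(m < T) rowsum h (w m.+1%:Z) (m.+1%:R * z).

Lemma Rsum_cvC w z : admissible w -> 0 < complex.Im z ->
  cvC (fun M => Rsum w z (N * M + h)) (Eis w z).
Proof.
move=> [_ _ _ [W hW]] hz; have [B B0 hB] := Eis_tail_spec hz.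
have [H _] := hB w W z hW (lexx _).
apply: cvCD (cvC_cst _) _; apply: cvCMl.
apply: (cvC_sub (f := fun M => (N * M + h)%N) _ H) => M; by rewrite mulSn; lia.
Qed.

Lemma box_row_limit w z M : admissible w -> 0 < complex.Im z ->
  cvC (box w z M) (Rsum w z (N * M + h)).
Proof.
move=> [hp hs _ [W hW]] hz.
pose l (m : int) : C := if m == 0 then Lsum (w 0) else rowsum h (w `|m|%N%:Z) (`|m|%:R * z).
have -> : Rsum w z (N * M + h) = ssum (N * M + h) l.
  rewrite /Rsum /ssum /l eqxx mulr_sumr; congr (_ + _); apply: eq_bigr => m _.
  have -> : (m.+1%:Z == 0) = false by [].
  have -> : (- m.+1%:Z == 0) = false by [].
  by rewrite abszN /=; ring.
have le K : (K <= N * K + h)%N by rewrite mulSn; lia.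
have pos m : (0 < m)%N -> cvC (fun K => ssum (N * K + h) (fun n => w m%:Z n * (m%:Z%:~R * z + n%:~R) ^- k))
    (rowsum h (w m%:Z) (m%:R * z)).
  move=> m0; apply: row_limit; first by rewrite Im_natr_mul mulr_gt0 // ltr0n.
  by move=> n n' hn; apply: hp => //; rewrite subrr dvdz0.
apply: (@cvC_ssum R (N * M + h) (fun m K => ssum (N * K + h) (fun n => w m n * (m%:~R * z + n%:~R) ^- k))) => m.
rewrite /l; have [->|m0] := eqVneq m 0.
  apply: eq_cvC (cvC_sub le (Lsum_cvC (hW 0))) => K; apply: eq_ssum => n.
  by rewrite mul0r add0r.
case: m m0 => [m|m] m0; first by apply: pos; rewrite lt0n.
apply: eq_cvC (pos m.+1 isT) => K; rewrite -[RHS]ssum_refl; apply: eq_ssum => n.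
rewrite NegzE hs.
have -> : (- m.+1%:Z)%:~R * z + (- n)%:~R = -1 * (m.+1%:Z%:~R * z + n%:~R) :> C by rewrite !rmorphN /=; ring.
rewrite exprMn invfM.
have e1 : (-1) ^+ k * ((-1) ^+ k)^-1 = 1 :> C by rewrite divff // signr_eq0.
by rewrite mulrACA e1 mul1r.
Qed.

(** The boxes at -1/z are transposed boxes at z, and dominated increments make both orders of
    summation agree. For mean zero weights no correction term arises, even in weight 2. *)
Lemma Eis_S w z : admissible w -> 0 < complex.Im z ->
  Eis w (- z^-1) = z ^+ k * Eis (wact w 0 (-1) 1 0) z.
Proof.
move=> hw hz; have z0 : z != 0 by apply: Im_neq0; rewrite gt_eqF.
have hz' := Im_inv_gt0 hz; have hw' := admissible_S hw.
have [v [b [hv hb]]] := box_dominated hw hz'.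
apply: (@iterated_limits R (box w (- z^-1)) v b (fun M => Rsum w (- z^-1) (N * M + h))
  (fun K => z ^+ k * Rsum (wact w 0 (-1) 1 0) z (N * K + h))) => //.
- by move=> M; exact: box_row_limit.
- move=> K; apply: eq_cvC (cvCMl (z ^+ k) (box_row_limit K hw' hz)) => M.
  by rewrite box_S.
- exact: Rsum_cvC.
by apply: cvCMl; exact: Rsum_cvC.
Qed.

Lemma Lser_addz (a : C) (n : int) : Lser k (a + n%:~R) = Lser k a.
Proof. by rewrite /Lser qexpD qexp_int mulr1. Qed.

Lemma Eis_T w z (b : int) : admissible w -> Eis w (z + b%:~R) = Eis (wact w 1 b 0 1) z.
Proof.
move=> [hp hs _ _]; rewrite /Eis.
have -> : Lsum (wact w 1 b 0 1 0) = Lsum (w 0).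
  by congr Lsum; apply/funext => n; rewrite /wact; congr w; ring.
suff E : Eis_tail w (z + b%:~R) = Eis_tail (wact w 1 b 0 1) z by rewrite E.
apply: eq_limC => M.
apply: eq_bigr => m _; rewrite /rowsum.
suff E : ssum h (fun n => w m.+1%:Z n * Lser k ((m.+1%:R * (z + b%:~R) + n%:~R) / N%:R)) =
  ssum h (fun n => wact w 1 b 0 1 m.+1%:Z n * Lser k ((m.+1%:R * z + n%:~R) / N%:R)).
  exact: (congr1 (fun x => N%:R ^- k * lip_const R k * x) E).
pose F n := w m.+1%:Z (n - m.+1%:Z * b) * Lser k ((m.+1%:R * z + n%:~R) / N%:R).
have Fp t u : (N%:Z %| t - u)%Z -> F t = F u.
  move=> htu; rewrite /F.
  have e1 : w m.+1%:Z (t - m.+1%:Z * b) = w m.+1%:Z (u - m.+1%:Z * b).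
    by apply: hp; rewrite ?subrr ?dvdz0 // opprB addrA subrK.
  have e2 : Lser k ((m.+1%:R * z + t%:~R) / N%:R) = Lser k ((m.+1%:R * z + u%:~R) / N%:R).
    have /dvdzP[q hq] := htu; have -> : t = u + q * N%:Z by rewrite -hq addrC subrK.
    have -> : (m.+1%:R * z + (u + q * N%:Z)%:~R) / N%:R = (m.+1%:R * z + u%:~R) / N%:R + q%:~R :> C.
      by rewrite intrD intrM -[N%:Z%:~R]pmulrn; move: (N%:R : C) N0 => x x0; field.
    exact: Lser_addz.
  exact: (congr2 (fun x y => x * y) e1 e2).
transitivity (ssum h F); last first.
  by apply: eq_ssum => n; rewrite /F /wact; congr (w _ _ * _); ring.
have S1 : ssum h F = \sum_(x < N) F x%:Z by exact: ssum_periodic.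
pose G n := F (1 * n + m.+1%:Z * b).
have S2 : \sum_(x < N) G x%:Z = \sum_(x < N) F x%:Z.
  by apply: periodic_sum_unit => //; rewrite coprimezE coprime1n.
have Gp t u : (N%:Z %| t - u)%Z -> G t = G u.
  by move=> htu; apply: Fp; rewrite opprD addrACA subrr addr0 !mul1r.
have S3 : ssum h G = \sum_(x < N) G x%:Z by exact: ssum_periodic.
apply: etrans (etrans S3 (etrans S2 (esym S1))); apply: eq_ssum => n; rewrite /G /F mul1r addrK.
by have -> : m.+1%:R * z + (n + m.+1%:Z * b)%:~R = m.+1%:R * (z + b%:~R) + n%:~R :> C
  by rewrite intrD intrM -pmulrn; ring.
Qed.

Lemma wact_comp w a b c e a' b' c' e' m n : wact (wact w a b c e) a' b' c' e' m n =
  wact w (a * a' + b * c') (a * b' + b * e') (c * a' + e * c') (c * b' + e * e') m n.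
Proof. by rewrite /wact; congr w; ring. Qed.

(** The generators act on the weight too, so the induction must quantify over all admissible w. *)
Lemma Eis_mob w z (a b c e : int) : admissible w -> 0 < complex.Im z -> a * e - b * c = 1 ->
  Eis w (mob a b c e z) = aut c e z ^+ k * Eis (wact w a b c e) z.
Proof.
move=> hw hz hd; move: a b c e hd w hw.
have step w w' : (forall m n, w m n = w' m n) -> w = w' by move=> E; apply/funext => m; apply/funext.
apply: (@SL2_ind (fun a b c e => forall w, admissible w ->
  Eis w (mob a b c e z) = aut c e z ^+ k * Eis (wact w a b c e) z)).
- move=> w hw; rewrite /mob /aut mul1r mul0r add0r addr0 divr1 expr1n mul1r; congr Eis.
  by apply: step => m n; rewrite /wact; congr w; ring.
- move=> a b c e hd IH w hw; rewrite mob_T // -[1]/(1%:~R) Eis_T // IH; last exact: admissible_T.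
  by congr (_ * Eis _ _); apply: step => m n; rewrite wact_comp; congr (wact w _ _ _ _ _ _); ring.
- move=> a b c e hd IH w hw; rewrite mob_T' // -[- 1]/((-1)%:~R) Eis_T // IH; last exact: admissible_T.
  by congr (_ * Eis _ _); apply: step => m n; rewrite wact_comp; congr (wact w _ _ _ _ _ _); ring.
move=> a b c e hd IH w hw; have e1 := Eis_S hw (Im_mob_gt0 hd hz).
have e2 : aut a b z ^+ k = mob a b c e z ^+ k * aut c e z ^+ k by rewrite -exprMn -(aut_S hd hz).
have e3 : wact (wact w 0 (-1) 1 0) a b c e = wact w (- c) (- e) a b.
  by apply: step => m n; rewrite wact_comp; congr (wact w _ _ _ _ _ _); ring.
have e4 : Eis (wact w 0 (-1) 1 0) (mob a b c e z) = aut c e z ^+ k * Eis (wact w (- c) (- e) a b) z.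
  by rewrite -e3; exact: IH _ (admissible_S hw).
rewrite (mob_S a b c e z) e1 e4 e2; move: (Eis _ _) => E.
by rewrite mulrA.
Qed.

End Eisenstein.

(** * Values of the L-series *)

Section PowerSums.
Variable R : realType.
Local Notation C := R[i].
Implicit Types (x y : C).

Definition pser (c : nat -> C) (j : nat) (y : C) : C :=
  limn (fun T => \sum_(t < T) c t.+1 * t.+1%:R ^+ j * y ^+ t.+1 : C^o).

Lemma pser_cvC (c : nat -> C) j y : (forall n, nrm (c n) <= 1) -> nrm y < 1 ->
  cvC (fun T => \sum_(t < T) c t.+1 * t.+1%:R ^+ j * y ^+ t.+1) (pser c j y).
Proof.
move=> hc y1; have y01 : 0 <= nrm y < 1 by rewrite nrm_ge0.
have [b hb] := @geom_pow_bounded R j _ y01.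
have [|l hl] := @sum_cvC R (fun t => c t.+1 * t.+1%:R ^+ j * y ^+ t.+1) b; last by rewrite /pser (cvC_lim hl).
move=> n; apply: le_trans (hb n); apply: ler_sum => t _; rewrite nrmM nrmM !nrmX nrm_nat.
have h1 : nrm (c t.+1) * t.+1%:R ^+ j <= 1 * t.+1%:R ^+ j by rewrite ler_wpM2r ?exprn_ge0.
rewrite mul1r in h1; apply: ler_pM => //; rewrite ?mulr_ge0 ?exprn_ge0 ?nrm_ge0 //.
by rewrite exprS ler_piMl ?exprn_ge0 ?nrm_ge0 // ltW.
Qed.

Lemma nrm_one_le1 : forall n : nat, nrm ((fun=> 1) n : C) <= 1.
Proof. by move=> n; rewrite nrm1. Qed.

(** Splitting off the first period and expanding (n + t)^j. With period 1 it continues the series to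
    the unit circle away from 1; with period N it becomes, at y = 1, the recursion of the Bernoulli
    numbers. *)
Lemma pser_shift (c : nat -> C) n j y : (forall m, nrm (c m) <= 1) -> (forall m, c (m + n)%N = c m) ->
  nrm y < 1 ->
  pser c j y = \sum_(t < n) c t.+1 * t.+1%:R ^+ j * y ^+ t.+1 +
    y ^+ n * \sum_(i < j.+1) 'C(j, i)%:R * n%:R ^+ (j - i) * pser c i y.
Proof.
move=> hc hp y1; apply: cvC_uniq (cvC_sub (fun T => leq_addl n T) (pser_cvC j hc y1)) _.
have H := @cvC_sum R _ (index_enum 'I_j.+1) (fun i T => 'C(j, i)%:R * n%:R ^+ (j - i) *
   \sum_(t < T) c t.+1 * t.+1%:R ^+ i * y ^+ t.+1) (fun i => 'C(j, i)%:R * n%:R ^+ (j - i) * pser c i y)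
   (fun i => cvCMl _ (pser_cvC i hc y1)).
apply: eq_cvC (cvCD (cvC_cst _) (cvCMl (y ^+ n) H)) => T.
rewrite big_split_ord /=; congr (_ + _).
under eq_bigr => i _ do rewrite mulr_sumr.
rewrite exchange_big /= mulr_sumr; apply: eq_bigr => t _.
have -> : c (n + t).+1 = c t.+1 by rewrite -addnS addnC hp.
have -> : ((n + t).+1%:R : C) ^+ j = \sum_(i < j.+1) 'C(j, i)%:R * n%:R ^+ (j - i) * t.+1%:R ^+ i.
  rewrite -addnS natrD exprDn; apply: eq_bigr => i _; rewrite -mulr_natl; ring.
have -> : y ^+ (n + t).+1 = y ^+ n * y ^+ t.+1 by rewrite -exprD addnS.
rewrite [in RHS]mulr_sumr [in RHS]mulr_suml [in LHS]mulr_sumr; apply: eq_bigr => i _; by ring.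
Qed.

(** For j > 0 the shift by 1 expresses (1 - y) times the series through the series of smaller j; so
    each is a rational function of y with its only pole at 1. *)
Lemma pser1_cvC (u : nat -> C) z j : (forall n, nrm (u n) < 1) -> z != 1 -> cvC u z ->
  exists l, cvC (fun n => pser (fun=> 1) j (u n)) l.
Proof.
move=> hu z1 hz.
suff : exists l : nat -> C, forall i, (i <= j)%N -> cvC (fun n => pser (fun=> 1) i (u n)) (l i).
  by move=> [l hl]; exists (l j); exact: hl.
elim: j => [|j [l hl]].
  exists (fun=> z / (1 - z)) => i; rewrite leqn0 => /eqP ->.
  have h1 : cvC (fun n => u n / (1 - u n)) (z / (1 - z)).
    apply: (cvCM hz); apply: cvCV; first by rewrite subr_eq0 eq_sym.
    exact: (cvCB (cvC_cst 1) hz).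
  apply: eq_cvC h1 => n; have h := pser_shift 0 (c := fun=> 1) (n := 1) nrm_one_le1 (fun _ => erefl) (hu n).
  have u1 : 1 - u n != 0.
    by rewrite subr_eq0 eq_sym; apply/eqP => e; have := hu n; rewrite e nrm1 ltxx.
  apply: (mulIf u1); rewrite divfK //; move: h; rewrite !big_ord1 /= !expr1 !expr0 bin0; set p := pser _ _ _ => h.
  have {h} h : p = 1 * 1 * u n + u n * (1 * 1 * p) := h.
  have -> : p * (1 - u n) = p - u n * p by ring.
  by rewrite {1}h; ring.
pose L := z * (1 + \sum_(i < j.+1) 'C(j.+1, i)%:R * l i) / (1 - z).
exists (fun i => if (i <= j)%N then l i else L) => i hi; case: ifP => ij; first exact: hl.
have -> : i = j.+1 by move: hi ij; lia.
have h1 : cvC (fun n => u n * (1 + \sum_(i < j.+1) 'C(j.+1, i)%:R * pser (fun=> 1) i (u n)) / (1 - u n)) L.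
  apply: cvCM; last first.
    by apply: cvCV; [rewrite subr_eq0 eq_sym | exact: (cvCB (cvC_cst 1) hz)].
  apply: (cvCM hz); apply: (cvCD (cvC_cst 1)).
  apply: (@cvC_sum R _ (index_enum 'I_j.+1) (fun i n => 'C(j.+1, i)%:R * pser (fun=> 1) i (u n))
    (fun i => 'C(j.+1, i)%:R * l i)) => i'.
  by apply: cvCMl; apply: hl; rewrite -ltnS.
apply: eq_cvC h1 => n; have h := pser_shift j.+1 (c := fun=> 1) (n := 1) nrm_one_le1 (fun _ => erefl) (hu n).
have u1 : 1 - u n != 0.
  by rewrite subr_eq0 eq_sym; apply/eqP => e; have := hu n; rewrite e nrm1 ltxx.
apply: (mulIf u1); rewrite divfK //; move: h.
rewrite [\sum_(t < 1) _]big_ord1 [\sum_(i0 < j.+2) _]big_ord_recr /= binn subnn expr0 !expr1 !expr1n; set p := pser _ j.+1 _.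
set S := \sum_(i0 < j.+1) _ => h; set S' := \sum_(i0 < j.+1) _.
have SS : S = S' by apply: eq_bigr => i0 _; rewrite expr1n mulr1.
have -> : p * (1 - u n) = p - u n * p by ring.
by rewrite {1}h SS; ring.
Qed.

Lemma bernoulli_unique (N : nat) (b t : nat -> C) (r : nat -> C) : (0 < N)%N ->
  (forall j, \sum_(i < j) 'C(j, i)%:R * N%:R ^+ (j - i) * b i = r j) ->
  (forall j, \sum_(i < j) 'C(j, i)%:R * N%:R ^+ (j - i) * t i = r j) -> forall i, b i = t i.
Proof.
move=> N0 hb ht i; have [n] := ubnP i; elim: n i => // n IH i; rewrite ltnS => hi.
have := hb i.+1; rewrite -(ht i.+1) !big_ord_recr /= subSnn expr1.
have -> : \sum_(i0 < i) 'C(i.+1, i0)%:R * N%:R ^+ (i.+1 - i0) * b i0 =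
  \sum_(i0 < i) 'C(i.+1, i0)%:R * N%:R ^+ (i.+1 - i0) * t i0 :> C.
  by apply: eq_bigr => i0 _; rewrite IH //; apply: leq_trans (ltn_ord i0) hi.
move/addrI; apply: mulfI; rewrite binSn; apply: mulf_neq0; rewrite pnatr_eq0 //.
by rewrite -lt0n.
Qed.

(** The coefficients of the generating identity. Since the values of [psi] add up to 0, so does the
    zeroth Bernoulli number vanish, which makes the recursion one for the quotients
    B_(i+1)/(i+1). *)
Lemma gen_bernoulli_rec (N : nat) (psi : int -> int) j : (0 < N)%N ->
  \sum_(1 <= a < N.+1) (psi a%:Z)%:~R = 0 :> C ->
  \sum_(i < j) 'C(j, i)%:R * N%:R ^+ (j - i) * (gen_bernoulli C N psi i.+1 / i.+1%:R) =
  \sum_(1 <= a < N.+1) (psi a%:Z)%:~R * a%:R ^+ j.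
Proof.
move=> N0 s0; have f0 m : m`!%:R != 0 :> C by rewrite pnatr_eq0 -lt0n fact_gt0.
have N0' : N%:R != 0 :> C by rewrite pnatr_eq0 -lt0n.
have B0 : gen_bernoulli C N psi 0 = 0.
  have := gen_bernoulliE C psi N0 1; rewrite /fps_mul !big_ord_recl big_ord0 /= /bump /=.
  rewrite subn0 subnn expr0 expr1 fact0 !divr1 subrr mulr0 !addr0 subr0.
  under eq_bigr do rewrite mulr1.
  by rewrite s0 => /eqP; rewrite mulf_eq0 (negPf N0') orbF => /eqP.
have := gen_bernoulliE C psi N0 j.+1; rewrite /fps_mul big_ord_recr /= subnn expr0 fact0 divr1 subrr mulr0 addr0.
rewrite big_ord_recl /= B0 mul0r mul0r add0r => h.
have -> : \sum_(1 <= a < N.+1) (psi a%:Z)%:~R * a%:R ^+ j =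
   j`!%:R * \sum_(1 <= a < N.+1) (psi a%:Z)%:~R * (a%:R ^+ j / j`!%:R) :> C.
  rewrite mulr_sumr; apply: eq_bigr => a _; have := f0 j; move: (j`!%:R : C) => y y0; by field.
rewrite -h mulr_sumr; apply: eq_bigr => i _; rewrite /bump /= add1n subSS.
have -> : (j - i == 0)%N = false by rewrite subn_eq0 leqNgt ltn_ord.
rewrite subr0.
have e2 : (i.+1)`!%:R = i.+1%:R * i`!%:R :> C by rewrite factS natrM.
have e3 : j`!%:R = 'C(j, i)%:R * (i`!%:R * (j - i)`!%:R) :> C.
  by rewrite -natrM -natrM bin_fact // ltnW.
rewrite e2 e3; have := f0 i; have := f0 (j - i)%N; have : i.+1%:R != 0 :> C by rewrite pnatr_eq0.
move: (gen_bernoulli _ _ _ _) (i.+1%:R : C) (i`!%:R : C) ((j - i)`!%:R : C) ('C(j, i)%:R : C) (N%:R ^+ _).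
by move=> B x y w b p x0 y0 w0; field; rewrite x0 y0 w0.
Qed.

End PowerSums.

(** * The L-value through Lipschitz' formula at the real axis *)

Section LValue.
Variable R : realType.
Local Notation C := R[i].
Variables (h k : nat).
Hypothesis k2 : (2 <= k)%N.
Local Notation N := h.*2.+1.
Hypotheses (N1 : (1 < N)%N) (sqN : squarefree N).

Let oN : odd N. Proof. by rewrite /= odd_double. Qed.
Let N0 : N%:R != 0 :> C. Proof. by rewrite pnatr_eq0. Qed.
Let u (n : int) : C := (jac n N)%:~R.
Let cN (n : nat) : C := u n%:Z.
Let z : C := qexp (N%:R^-1 : C).
Let pz : N.-primitive_root z. Proof. exact: qexp_prim. Qed.
Let G : C := gauss_sum N z 1.
Let G0 : G != 0. Proof. exact: gauss_sum_neq0. Qed.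

Lemma jac_bound n (a : int) : odd n -> nrm ((jac a n)%:~R : C) <= 1.
Proof.
move=> on; have [ca|ca] := boolP (coprimez a n%:Z); last by rewrite (jac_eq0 on ca) nrm0.
by have [->|->] := jac_cases on ca; rewrite ?rmorphN ?nrmN /= nrm1.
Qed.

Lemma jac_period n (t v : int) : odd n -> (n%:Z %| t - v)%Z -> ((jac t n)%:~R : C) = (jac v n)%:~R.
Proof. by move=> on hh; rewrite (eq_jac on hh). Qed.

Lemma jac0n n : odd n -> (1 < n)%N -> jac 0 n = 0.
Proof.
move=> on n1; apply: jac_eq0 => //; rewrite coprimezE /= /coprime gcd0n; by rewrite gtn_eqF.
Qed.

Lemma rowsum_jac a : 0 < complex.Im a ->
  rowsum k h u a = N%:R ^- k * lip_const R k * (G * pser cN k.-1 (qexp (a / N%:R))).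
Proof.
move=> ha; rewrite /rowsum.
suff E : ssum h (fun b => u b * Lser k ((a + b%:~R) / N%:R)) = G * pser cN k.-1 (qexp (a / N%:R)).
  exact: (congr1 (fun x => N%:R ^- k * lip_const R k * x) E).
have q1 : nrm (qexp (a / N%:R)) < 1 by apply: nrm_qexp_lt1; rewrite Im_div_nat divr_gt0.
have Ib (b : int) : 0 < complex.Im ((a + b%:~R) / N%:R).
  by rewrite Im_div_nat intCE Im_addr_real divr_gt0.
have H := @cvC_ssum R h (fun b T => u b * \sum_(t < T) t.+1%:R ^+ k.-1 * qexp ((a + b%:~R) / N%:R) ^+ t.+1)
  (fun b => u b * Lser k ((a + b%:~R) / N%:R)) (fun b => cvCMl (u b) (Lser_cvC k (Ib b))).
apply: cvC_uniq H _.
have cb n : nrm (cN n) <= 1 by exact: jac_bound.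
apply: eq_cvC (cvCMl G (pser_cvC k.-1 cb q1)) => T; rewrite ssumE.
under [RHS]eq_bigr => b _ do rewrite mulr_sumr.
rewrite exchange_big /= mulr_sumr; apply: eq_bigr => t _; rewrite -ssumE.
have := jac_fourier oN sqN pz t.+1%:Z; rewrite -/G => F.
transitivity (t.+1%:R ^+ k.-1 * qexp (a / N%:R) ^+ t.+1 * ((jac t.+1%:Z N)%:~R * G)).
  by rewrite /cN /u; ring.
rewrite -F -(@ssum_periodic _ h (fun b => (jac b N)%:~R * z ^ (t.+1%:Z * b))); last first.
  move=> b b' hb; rewrite (jac_period oN hb); congr (_ * _); apply: (prim_exprz_eq pz).
  by rewrite -mulrBr dvdz_mull.
rewrite -ssumZ; apply: eq_ssum => b.
have -> : qexp ((a + b%:~R) / N%:R) ^+ t.+1 = qexp (a / N%:R) ^+ t.+1 * z ^ (t.+1%:Z * b).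
  rewrite !qexpX /z qexpz -qexpD mulrDl mulrDr intrM -pmulrn; congr (qexp (_ + _)); by ring.
by rewrite /u; ring.
Qed.

Lemma cvC_sum_ex (I : Type) (r : seq I) (f : I -> nat -> C) :
  (forall i, exists l, cvC (f i) l) -> exists l, cvC (fun n => \sum_(i <- r) f i n) l.
Proof.
move=> hf; elim: r => [|i r [l hl]].
  by exists 0; apply: eq_cvC (cvC_cst 0) => n; rewrite big_nil.
have [m hm] := hf i; exists (m + l); apply: eq_cvC (cvCD hm hl) => n.
by rewrite big_cons.
Qed.

(** The Abel value of the divergent sum of (t/N) t^j. Once the limits are known to exist, the shift
    by N at y = 1 gives them the same triangular recursion as the Bernoulli quotients. *)
Lemma pser_jac_lim (x : nat -> C) : (forall n, nrm (x n) < 1) -> cvC x 1 ->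
  forall j, cvC (fun n => pser cN j (x n)) (- (gen_bernoulli C N (fun b => jac b N) j.+1 / j.+1%:R)).
Proof.
move=> hx x1.
have cb n : nrm (cN n) <= 1 by exact: jac_bound.
have zb (b : 'I_N) n : nrm (z ^+ b * x n) < 1.
  rewrite nrmM nrmX nrm_qexp.
  have -> : complex.Im (N%:R^-1 : C) = 0 by rewrite natCE -fmorphV.
  by rewrite mulr0 oppr0 expR0 expr1n mul1r.
have key j n : G * pser cN j (x n) = \sum_(b < N) u b%:Z * pser (fun=> 1) j (z ^+ b * x n).
  apply: cvC_uniq (cvCMl G (pser_cvC j cb (hx n))) _.
  apply: eq_cvC (@cvC_sum R _ (index_enum 'I_N) (fun b T => u b%:Z * \sum_(t < T) 1 * t.+1%:R ^+ j * (z ^+ b * x n) ^+ t.+1)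
    (fun b => u b%:Z * pser (fun=> 1) j (z ^+ b * x n)) (fun b => cvCMl _ (pser_cvC j (@nrm_one_le1 R) (zb b n)))) => T.
  under eq_bigr => b _ do rewrite mulr_sumr.
  rewrite exchange_big /= mulr_sumr; apply: eq_bigr => t _.
  have := jac_fourier oN sqN pz t.+1%:Z; rewrite -/G => F.
  transitivity (t.+1%:R ^+ j * x n ^+ t.+1 * ((jac t.+1%:Z N)%:~R * G)); last by rewrite /cN /u; ring.
  rewrite -F mulr_sumr; apply: eq_bigr => b _; rewrite /u exprMn -exprM.
  have -> : z ^ (t.+1%:Z * b%:Z) = z ^+ (b * t.+1) by rewrite -PoszM mulnC.
  by ring.
(* Expanding the symbol in additive characters moves the point 1 to the N-th roots of unity; the
   singular one, b = 0, carries the coefficient (0/N) = 0. *)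
have ex j : exists l, cvC (fun n => pser cN j (x n)) l.
  have [|l hl] := @cvC_sum_ex _ (index_enum 'I_N) (fun b n => u b%:Z * pser (fun=> 1) j (z ^+ b * x n)).
    move=> b; have [b0|b0] := posnP b.
      exists 0; apply: eq_cvC (cvC_cst 0) => n; by rewrite b0 /u jac0n // mul0r.
    have zn1 : z ^+ b != 1.
      by rewrite -(prim_order_dvd pz) gtnNdvd // ltn_ord.
    have hb : cvC (fun n => z ^+ b * x n) (z ^+ b) by rewrite -[X in cvC _ X]mulr1; apply: cvCMl.
    have [l hl] := pser1_cvC j (zb b) zn1 hb.
    by exists (u b%:Z * l); exact: cvCMl.
  exists (G^-1 * l); apply: eq_cvC (cvCMl G^-1 hl) => n.
  by rewrite -key mulKf.
pose tau j := limn (fun n => pser cN j (x n) : C^o).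
have htau j : cvC (fun n => pser cN j (x n)) (tau j).
  by have [l hl] := ex j; rewrite /tau (cvC_lim hl).
have shift j : tau j = \sum_(t < N) cN t.+1 * t.+1%:R ^+ j +
    \sum_(i < j.+1) 'C(j, i)%:R * N%:R ^+ (j - i) * tau i.
  apply: cvC_uniq (htau j) _.
  have per m : cN (m + N)%N = cN m.
    by apply: jac_period => //; rewrite PoszD addrC addKr dvdzz.
  have L1 : cvC (fun n => \sum_(t < N) cN t.+1 * t.+1%:R ^+ j * x n ^+ t.+1) (\sum_(t < N) cN t.+1 * t.+1%:R ^+ j * 1 ^+ t.+1).
    apply: (@cvC_sum R _ (index_enum 'I_N) (fun t n => cN t.+1 * t.+1%:R ^+ j * x n ^+ t.+1)
      (fun t => cN t.+1 * t.+1%:R ^+ j * 1 ^+ t.+1)) => t.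
    by apply: cvCMl; exact: cvCX.
  have L2 : cvC (fun n => x n ^+ N * \sum_(i < j.+1) 'C(j, i)%:R * N%:R ^+ (j - i) * pser cN i (x n))
     (1 ^+ N * \sum_(i < j.+1) 'C(j, i)%:R * N%:R ^+ (j - i) * tau i).
    apply: cvCM; first exact: cvCX.
    apply: (@cvC_sum R _ (index_enum 'I_j.+1) (fun i n => 'C(j, i)%:R * N%:R ^+ (j - i) * pser cN i (x n))
      (fun i => 'C(j, i)%:R * N%:R ^+ (j - i) * tau i)) => i.
    exact: cvCMl.
  have E1 : \sum_(t < N) cN t.+1 * t.+1%:R ^+ j * 1 ^+ t.+1 = \sum_(t < N) cN t.+1 * t.+1%:R ^+ j.
    by apply: eq_bigr => t _; rewrite expr1n mulr1.
  rewrite E1 expr1n mul1r in L1 L2; apply: eq_cvC (cvCD L1 L2) => n.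
  by rewrite [RHS](pser_shift j cb per (hx n)).
(* At y = 1 the term i = j cancels the left side, which leaves a recursion for the smaller
   indices. *)
have rec j : \sum_(i < j) 'C(j, i)%:R * N%:R ^+ (j - i) * tau i = - \sum_(t < N) cN t.+1 * t.+1%:R ^+ j.
  have := shift j; rewrite [X in _ + X]big_ord_recr /= binn subnn expr0 !mul1r addrA => /eqP.
  by rewrite -subr_eq subrr eq_sym => /eqP E; apply/eqP; rewrite -addr_eq0 addrC E.
have sum1 j : \sum_(1 <= a < N.+1) (jac a%:Z N)%:~R * a%:R ^+ j = \sum_(t < N) cN t.+1 * t.+1%:R ^+ j :> C.
  by rewrite big_add1 /= big_mkord.
have s0 : \sum_(1 <= a < N.+1) (jac a%:Z N)%:~R = 0 :> C.
  have := rec 0%N; rewrite big_ord0 -sum1 => /esym/eqP; rewrite oppr_eq0 => /eqP E; rewrite -[RHS]E.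
  by apply: eq_bigr => a _; rewrite expr0 mulr1.
move=> j; have -> : - (gen_bernoulli C N (fun b => jac b N) j.+1 / j.+1%:R) = tau j; last exact: htau.
apply: (@bernoulli_unique R N (fun i => - (gen_bernoulli C N (fun b => jac b N) i.+1 / i.+1%:R)) tau
  (fun j => - \sum_(t < N) cN t.+1 * t.+1%:R ^+ j)) => //.
move=> j'; rewrite -sum1 -(@gen_bernoulli_rec R N (fun b => jac b N) j' isT s0) -sumrN.
by apply: eq_bigr => i _; rewrite mulrN.
Qed.

(** A twisted row sum is evaluated as its base point tends to 0 along the imaginary axis: termwise
    it becomes the L-series, and by Lipschitz' formula a power series approaching 1. This takes the
    place of the functional equation. *)
Lemma Lsum_jacE : Lsum k u =
  N%:R ^- k * lip_const R k * (G * - (gen_bernoulli C N (fun b => jac b N) k / k%:R)).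
Proof.
pose a n : C := n.+1%:R^-1 * 'i%C.
have aI n : a n = (0 +i* (n.+1%:R^-1))%C.
  by rewrite /a natCE -fmorphV /=; apply/eqP; rewrite eq_complex /=; apply/andP; split; apply/eqP; ring.
have Ia n : 0 < complex.Im (a n) by rewrite aI /= invr_gt0.
have a0 : cvC a 0 by rewrite -(mul0r 'i%C); apply: cvCM (cvC_cst _); exact: cvC_invn.
have ub n : nrm (u n) <= 1 by exact: jac_bound.
have up n n' : (N%:Z %| n - n')%Z -> u n = u n' by exact: jac_period.
have le K : (K <= N * K + h)%N by rewrite mulSn; lia.
have lim1 : cvC (fun n => rowsum k h u (a n)) (Lsum k u).
  (* Each difference is at most k|a|/m^2, as a + m stays at distance |m| from 0; the term m = 0,
     which would blow up, has coefficient (0/N) = 0. The 4 is twice the bound 2 for the sum of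
     inverse squares. *)
  have bnd n : nrm (rowsum k h u (a n) - Lsum k u) <= nrm (4 * k%:R * a n).
    apply: (cvC_le (n1 := 0%N)) (cvCB (row_limit k2 (Ia n) up) (cvC_sub le (Lsum_cvC k2 ub))) => K _.
    set T := (N * K + h)%N.
    have -> : ssum T (fun m => u m * (a n + m%:~R) ^- k) - ssum T (fun m => u m * m%:~R ^- k) =
      ssum T (fun m => u m * ((a n + m%:~R) ^- k - m%:~R ^- k)).
      rewrite -[X in _ - X]mul1r -mulNr -ssumZ -ssumD; apply: eq_ssum => m; by ring.
    apply: (@le_trans _ _ (ssum T (fun m => k%:R * nrm (a n) * (`|m|%:R ^+ 2)^-1))).
      apply: nrm_ssum => m _; have [->|m0] := eqVneq m 0.
        by rewrite /u jac0n // mul0r nrm0 !mulr_ge0 ?nrm_ge0 // invr_ge0 exprn_ge0.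
      have m1 : 1 <= `|m|%:R :> R by rewrite ler1n absz_gt0.
      have hm : `|m|%:R <= nrm (m%:~R : C) by rewrite nrm_int -abszE.
      have hm' : `|m|%:R <= nrm (a n + m%:~R).
        apply: le_trans (Re_le _); rewrite aI intCE /= add0r.
        by rewrite -intr_norm -abszE.
      have m0' : 0 < `|m|%:R :> R by lra.
      have := inv_pow_diff k m0' hm' hm; rewrite addrK => hd.
      rewrite nrmM; apply: (@le_trans _ _ (1 * (k%:R * nrm (a n) * `|m|%:R ^- k.+1))).
        by apply: ler_pM; rewrite ?nrm_ge0.
      rewrite mul1r ler_wpM2l ?mulr_ge0 ?nrm_ge0 // lef_pV2 ?posrE ?exprn_gt0 //.
      by rewrite ler_weXn2l // ltnW.
    rewrite /ssum expr0n /= invr0 mulr0 add0r.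
    have -> : \sum_(r < T) (k%:R * nrm (a n) * (r.+1%:R ^+ 2)^-1 + k%:R * nrm (a n) * (`|- r.+1%:Z|%:R ^+ 2)^-1) =
      2 * (k%:R * nrm (a n)) * \sum_(r < T) (r.+1%:R ^+ 2)^-1.
      by rewrite mulr_sumr; apply: eq_bigr => r _; rewrite abszN /=; ring.
    rewrite nrmM nrmM !nrm_nat; have -> : 4 * k%:R * nrm (a n) = 2 * (k%:R * nrm (a n)) * 2 by ring.
    by rewrite ler_wpM2l ?sum_inv_sqr // !mulr_ge0 // nrm_ge0.
  have h0 : cvC (fun n => rowsum k h u (a n) - Lsum k u) 0.
    by apply: (cvC0_dom bnd); rewrite -(mulr0 (4 * k%:R)); exact: cvCMl.
  have := cvCD h0 (cvC_cst (Lsum k u)); rewrite add0r.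
  by apply: eq_cvC => n; rewrite subrK.
pose x n := qexp (a n / N%:R).
have hx n : nrm (x n) < 1 by apply: nrm_qexp_lt1; rewrite Im_div_nat divr_gt0.
have x1 : cvC x 1.
  have := cvCMl (two_pi_i R) (cvCM a0 (cvC_cst N%:R^-1)); rewrite mul0r mulr0 => /expC_cvC.
  by rewrite expC0.
have kE : k = k.-1.+1 by case: (k) k2.
have lim2 := cvCMl (N%:R ^- k * lip_const R k) (cvCMl G (pser_jac_lim hx x1 k.-1)).
rewrite -kE in lim2; apply: cvC_uniq lim1 _.
by apply: eq_cvC lim2 => n; rewrite rowsum_jac.
Qed.

(** Under the parity condition the terms of n and -n agree, and the term n = 1 outweighs all the
    others. *)
Lemma Lsum_jac_neq0 : jac (-1) N = (-1) ^+ k -> Lsum k u != 0.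
Proof.
move=> hs; have ub n : nrm (u n) <= 1 by exact: jac_bound.
have H := Lsum_cvC k2 ub.
have low K : 2^-1 <= nrm (ssum K.+1 (fun n => u n * n%:~R ^- k)).
  have -> : ssum K.+1 (fun n => u n * n%:~R ^- k) = 2 * (1 + \sum_(r < K) u r.+2%:Z * r.+2%:R ^- k).
    rewrite /ssum {1}/u jac0n // mul0r add0r big_ord_recl mulrDr mulr1 mulr_sumr.
    have E (r : nat) : u r.+1%:Z * r.+1%:Z%:~R ^- k + u (- r.+1%:Z) * (- r.+1%:Z)%:~R ^- k =
        2 * (u r.+1%:Z * r.+1%:R ^- k).
      have -> : u (- r.+1%:Z) = (-1) ^+ k * u r.+1%:Z.
        have -> : - r.+1%:Z = -1 * r.+1%:Z by rewrite mulN1r.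
        by rewrite /u jacM // hs intrM rmorphXn /= rmorphN.
      have -> : (- r.+1%:Z)%:~R = -1 * r.+1%:R :> C by rewrite rmorphN /= mulN1r -pmulrn.
      rewrite exprMn invfM -pmulrn mulrACA divff ?signr_eq0 //; ring.
    rewrite E {1}/u jac1n // expr1n invr1 !mulr1; congr (_ + _).
    by apply: eq_bigr => r _; rewrite E.
  rewrite nrmM nrm_nat; set S := \sum_(r < K) _.
  (* 1/4 from n = 2, and at most 1/2 from n >= 3 by telescoping. *)
  have hS : nrm S <= 3 / 4.
    apply: le_trans (nrm_sum _ _ _) _.
    apply: (@le_trans _ _ (\sum_(r < K) (r.+2%:R ^+ 2)^-1)).
      apply: ler_sum => r _; rewrite nrmM nrmV nrmX nrm_nat -[X in _ <= X]mul1r.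
      apply: ler_pM; rewrite ?nrm_ge0 ?invr_ge0 ?exprn_ge0 //.
      by rewrite lef_pV2 ?posrE ?exprn_gt0 // ler_weXn2l // ler1n.
    have tel m : \sum_(r < m) (r.+3%:R ^+ 2)^-1 <= 2^-1 - m.+2%:R^-1 :> R.
      elim: m => [|m IH]; first by rewrite big_ord0 subrr.
      rewrite big_ord_recr /=; move: IH; set s := \sum_(r < m) _.
      have -> : m.+3%:R = m.+2%:R + 1 :> R by rewrite natr1.
      have : 0 < m.+2%:R :> R by [].
      move: (m.+2%:R : R) => y y0 IH.
      have : ((y + 1) ^+ 2)^-1 <= y^-1 - (y + 1)^-1.
        have -> : y^-1 - (y + 1)^-1 = (y * (y + 1))^-1 by field; apply/andP; split; rewrite gt_eqF //; lra.
        rewrite lef_pV2 ?posrE ?exprn_gt0 ?mulr_gt0 //; try lra.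
      by move: (y^-1) ((y + 1)^-1) (_^-1) IH => p q r; lra.
    case: (K) => [|m]; first by rewrite big_ord0; lra.
    rewrite big_ord_recl /=; have := tel m.
    have : 0 <= m.+2%:R^-1 :> R by rewrite invr_ge0.
    have -> : \sum_(r < m) (r.+3%:R ^+ 2)^-1 = \sum_(i < m) ((bump 0 i).+2%:R ^+ 2)^-1 :> R by apply: eq_bigr.
    by move: (_^-1 : R) (\sum_(i < m) _) => p q; lra.
  have := nrmB_ge 1 (- S); rewrite opprK nrmN nrm1; lra.
apply/eqP => L0; rewrite L0 in H; have e0 : 0 < 4^-1 :> R by lra.
have [n0 hn] := H _ e0; have := hn n0.+1 (leqnSn n0); rewrite subr0; have := low n0; lra.
Qed.

End LValue.

(** * The Eisenstein series attached to the pair of characters *)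

Section DominatedNets.
Variable R : realType.
Local Notation C := R[i].

Lemma sum_rect (V : nmodType) (g : nat -> nat -> V) n M T : (M <= n)%N -> (T <= n)%N ->
  \sum_(m < n) \sum_(t < n) (if (m < M)%N && (t < T)%N then g m t else 0) =
  \sum_(m < M) \sum_(t < T) g m t.
Proof.
move=> hM hT; rewrite (big_ord_widen n (fun m => \sum_(t < T) g m t) hM) [RHS]big_mkcond /=.
apply: eq_bigr => m _; case: ifP => _ /=; last by rewrite big1.
by rewrite (big_ord_widen n (g m) hT) [RHS]big_mkcond.
Qed.

(** An absolutely convergent double series may be summed along regions that swallow every square.
    The regions needed are bounded by hyperbolas mt <= n, which contain the square of side s once
    s^2 <= n. *)
Lemma double_sum_exhaust (a : nat -> nat -> C) (b : nat -> nat -> R) (B : R) (A : nat -> C) (L : C)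
    (P : nat -> nat -> nat -> bool) :
  (forall m t, nrm (a m t) <= b m t) -> (forall M T, \sum_(m < M) \sum_(t < T) b m t <= B) ->
  (forall m, cvC (fun T => \sum_(t < T) a m t) (A m)) -> cvC (fun M => \sum_(m < M) A m) L ->
  (forall s n m t, (s * s <= n)%N -> (m < s)%N -> (t < s)%N -> P n m t) ->
  cvC (fun n => \sum_(m < n) \sum_(t < n) (if P n m t then a m t else 0)) L.
Proof.
move=> hab hB hA hL hP e e0; have e4 : 0 < e / 4 by lra.
have b0 m t : 0 <= b m t by apply: le_trans (hab m t); exact: nrm_ge0.
pose v n := \sum_(m < n) \sum_(t < n) b m t.
have vE s n : (s <= n)%N -> v n - v s =
    \sum_(m < n) \sum_(t < n) (b m t - (if (m < s)%N && (t < s)%N then b m t else 0)).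
  move=> sn; rewrite /v -(sum_rect b sn sn) -sumrB; apply: eq_bigr => m _.
  by rewrite -sumrB.
have vm m n : (m <= n)%N -> v m <= v n.
  move=> mn; rewrite -subr_ge0 vE // sumr_ge0 // => i _; rewrite sumr_ge0 // => t _.
  by case: ifP => _; rewrite ?subrr ?subr0.
have [s hs] := bounded_tail vm (fun n => hB n n) e4.
pose p M T := \sum_(m < M) \sum_(t < T) a m t.
have claim (Q : nat -> nat -> bool) n : (s <= n)%N -> (forall m t, (m < s)%N -> (t < s)%N -> Q m t) ->
    nrm (\sum_(m < n) \sum_(t < n) (if Q m t then a m t else 0) - p s s) <= e / 4.
  move=> sn hQ; apply: le_trans (hs n sn); rewrite vE // /p -(sum_rect a sn sn) -sumrB.
  apply: le_trans (nrm_sum _ _ _) _; apply: ler_sum => m _; rewrite -sumrB.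
  apply: le_trans (nrm_sum _ _ _) _; apply: ler_sum => t _.
  case sq : ((m < s)%N && (t < s)%N).
    by have /andP[hm ht] := sq; rewrite hQ // !subrr nrm0.
  by rewrite !subr0; case: ifP => _; rewrite ?nrm0.
have rect M T : (s <= M)%N -> (s <= T)%N -> nrm (p M T - p s s) <= e / 4.
  move=> sM sT; have := claim (fun m t => (m < M)%N && (t < T)%N) (maxn M T).
  rewrite sum_rect ?leq_maxl ?leq_maxr //; apply; first by rewrite leq_max sM.
  by move=> m t hm ht; rewrite (leq_trans hm sM) (leq_trans ht sT).
have hr M : (s <= M)%N -> nrm (\sum_(m < M) A m - p s s) <= e / 4.
  move=> sM; apply: (cvC_le (n1 := s) (u := fun T => p M T - p s s)) => [T sT|]; first exact: rect.
  by apply: cvCB (cvC_cst _); apply: (@cvC_sum R _ (index_enum 'I_M) (fun m T => \sum_(t < T) a m t)).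
have hLs : nrm (L - p s s) <= e / 4.
  by apply: (cvC_le (n1 := s)) (cvCB hL (cvC_cst (p s s))) => M sM; exact: hr.
exists (maxn s (s * s)) => n; rewrite geq_max => /andP[sn ssn].
have h1 := claim (P n) n sn (fun m t => hP s n m t ssn).
apply: le_lt_trans (nrmB_tri (p s s) _ _) _; rewrite [nrm (p s s - L)]nrmBC; lra.
Qed.

Lemma sum_divisors_ord (F : nat -> C) j n : (0 < j <= n)%N ->
  \sum_(t <- divisors j) F t = \sum_(t < n) (if (t.+1 %| j)%N then F t.+1 else 0).
Proof.
move=> /andP[j0 jn]; rewrite -big_mkcond /=.
transitivity (\sum_(1 <= t < n.+1 | (t %| j)%N) F t); last by rewrite big_add1 /= big_mkord.
rewrite -[RHS]big_filter; apply: perm_big.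
apply: uniq_perm; rewrite ?divisors_uniq ?filter_uniq ?iota_uniq // => t.
rewrite mem_filter mem_index_iota -dvdn_divisors // andbC; case: (boolP (t %| j)%N) => [tj|_]; last by rewrite andbF.
by rewrite /= andbT; have := dvdn_leq j0 tj; have := dvdn_gt0 j0 tj; lia.
Qed.

Lemma hyperbola_sum (F : nat -> nat -> C) (q : C) n :
  \sum_(1 <= j < n.+1) (\sum_(t <- divisors j) F (j %/ t)%N t) * q ^+ j =
  \sum_(m < n) \sum_(t < n) (if (m.+1 * t.+1 <= n)%N then F m.+1 t.+1 * q ^+ (m.+1 * t.+1) else 0).
Proof.
rewrite big_add1 /= big_mkord.
transitivity (\sum_(j < n) \sum_(t < n) \sum_(m < n)
  (if (m.+1 * t.+1 == j.+1)%N then F m.+1 t.+1 * q ^+ (m.+1 * t.+1) else 0)).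
  apply: eq_bigr => j _; have jn : (0 < j.+1 <= n)%N by rewrite ltn_ord.
  rewrite (sum_divisors_ord (fun t => F (j.+1 %/ t)%N t) jn) mulr_suml; apply: eq_bigr => t _.
  case: ifP => [/dvdnP[m' hm]|ndv]; last first.
    rewrite mul0r big1 // => m _; case: eqP => // E.
    by move: ndv; rewrite -E dvdn_mull.
  have m'0 : (0 < m')%N by case: m' hm.
  have m'n : (m'.-1 < n)%N by have := ltn_ord j; have := leq_pmulr m' (ltn0Sn t); lia.
  have jt : (j.+1 %/ t.+1 = m')%N by rewrite hm mulnK.
  rewrite jt (bigD1 (Ordinal m'n)) //= prednK // -hm eqxx big1 ?addr0 // => m.
  rewrite -val_eqE /= => mne; case: eqP => // E; move: mne; rewrite hm in E.
  by move/eqP: E; rewrite eqn_pmul2r // => /eqP <- /=; rewrite eqxx.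
rewrite exchange_big /= [RHS]exchange_big /=; apply: eq_bigr => t _; rewrite exchange_big /=.
apply: eq_bigr => m _; case: ifP => [le|nle].
  have jn : ((m.+1 * t.+1).-1 < n)%N by rewrite prednK.
  rewrite (bigD1 (Ordinal jn)) //= eqxx big1 ?addr0 // => j.
  move=> jne; case: eqP => // E; case/eqP: jne; apply: ord_inj.
  by transitivity j.+1.-1 => //; rewrite -E.
rewrite big1 // => j _; case: eqP => // E; move: nle; by rewrite E ltn_ord.
Qed.

Lemma sum_multiples (F : nat -> C) d T : (0 < d)%N ->
  (forall M, ~~ (d %| M.+1)%N -> F M = 0) ->
  \sum_(M < d * T) F M = \sum_(m < T) F (d * m.+1).-1%N.
Proof.
move=> d0 hF; elim: T => [|T IH]; first by rewrite muln0 !big_ord0.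
rewrite mulnSr big_split_ord /= IH big_ord_recr /=; congr (_ + _).
have dm : (d.-1 < d)%N by rewrite prednK.
rewrite (bigD1 (Ordinal dm)) //= big1 ?addr0.
  by congr F; rewrite mulnSr; lia.
move=> i; rewrite -val_eqE /= => ine; apply: hF; rewrite -addnS dvdn_addr ?dvdn_mulr //.
by apply/negP => /dvdn_leq => /(_ isT); have := ltn_ord i; lia.
Qed.

(** The q-expansion adds up by the product n = mt, the Eisenstein series by rows m; absolute
    convergence identifies the two orders. *)
Lemma eisenstein_sumE (k : nat) (f g : int -> int) (z : C) (L : C) : 0 < complex.Im z ->
  (forall n, nrm ((f n)%:~R : C) <= 1) -> (forall n, nrm ((g n)%:~R : C) <= 1) ->
  cvC (fun M => \sum_(m < M) (f m.+1%:Z)%:~R * pser (fun t => (g t%:Z)%:~R) k (qexp z ^+ m.+1)) L ->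
  eisenstein_sum k%:Z f g z = L.
Proof.
move=> hz hf hg hL; have q1 := nrm_qexp_lt1 hz; set q := qexp z in q1 hL *.
pose F (m t : nat) : C := (f m%:Z * g t%:Z)%:~R * t%:R ^+ k.
have q01 : 0 <= nrm q < 1 by rewrite nrm_ge0.
have [b hb] := @geom_pow_bounded R k _ q01.
have b0 : 0 <= b by have := hb 0%N; rewrite big_ord0.
have H := @double_sum_exhaust (fun m t => F m.+1 t.+1 * q ^+ (m.+1 * t.+1))
  (fun m t => nrm q ^+ m * (t.+1%:R ^+ k * nrm q ^+ t)) ((1 - nrm q)^-1 * b)
  (fun m => (f m.+1%:Z)%:~R * pser (fun t => (g t%:Z)%:~R) k (q ^+ m.+1)) L
  (fun n m t => (m.+1 * t.+1 <= n)%N).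
apply: cvC_lim; apply: eq_cvC (H _ _ _ hL _).
- move=> n; rewrite -hyperbola_sum; apply: eq_bigr => j _; congr (_ * _).
- move=> m t; rewrite nrmM nrmX /F nrmM intrM nrmM nrmX nrm_nat.
  have qm : nrm q ^+ (m.+1 * t.+1) <= nrm q ^+ m * nrm q ^+ t.
    rewrite -exprD; apply: ler_wiXn2l; rewrite ?nrm_ge0 ?(ltW q1) //; nia.
  have fg : nrm ((f m.+1%:Z)%:~R : C) * nrm ((g t.+1%:Z)%:~R : C) <= 1 * 1 by apply: ler_pM; rewrite ?nrm_ge0.
  rewrite mulr1 in fg.
  have -> : nrm q ^+ m * (t.+1%:R ^+ k * nrm q ^+ t) = 1 * t.+1%:R ^+ k * (nrm q ^+ m * nrm q ^+ t) by ring.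
  apply: ler_pM; rewrite ?mulr_ge0 ?exprn_ge0 ?nrm_ge0 //.
  by rewrite ler_wpM2r ?exprn_ge0.
- move=> M T; under eq_bigr do rewrite -mulr_sumr; rewrite -mulr_suml.
  apply: ler_pM; rewrite ?geom_bound ?hb ?sumr_ge0 // => i _; rewrite ?mulr_ge0 ?exprn_ge0 ?nrm_ge0 //.
- move=> m; have qm1 : nrm (q ^+ m.+1) < 1 by exact: nrmX_lt1.
  apply: eq_cvC (cvCMl _ (pser_cvC k (fun n => hg n%:Z) qm1)) => T.
  rewrite mulr_sumr; apply: eq_bigr => t _; rewrite /F intrM -exprM; ring.
move=> s n m t ss ms ts; apply: leq_trans ss; exact: leq_mul.
Qed.

End DominatedNets.

(** * The weight of the pair of characters *)

Section Weight.
Variable R : realType.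
Local Notation C := R[i].

Lemma jac_mulr a n1 n2 : odd n1 -> odd n2 -> coprime n1 n2 ->
  jac a (n1 * n2) = jac a n1 * jac a n2.
Proof.
move=> o1 o2 c12; apply: (@jac_mulr_root _ (qexp ((n1 * n2)%:R^-1 : C))) => //.
by apply: qexp_prim; rewrite muln_gt0; case: n1 n2 o1 o2 {c12} => [|?] [|?].
Qed.

Lemma sum_jac n : odd n -> (1 < n)%N -> squarefree n -> \sum_(b < n) (jac b%:Z n)%:~R = 0 :> C.
Proof.
move=> on n1 sn; have n0 : (0 < n)%N by apply: ltnW.
have := jac_fourier on sn (@qexp_prim R n n0) 0; rewrite jac0n // mul0r => E.
by rewrite -[RHS]E; apply: eq_bigr => b _; rewrite mul0r expr0z mulr1.
Qed.

Variables (d D : nat).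
Hypotheses (od : odd d) (oD : odd D) (sN : squarefree (d * D)) (N4 : (4 < d * D)%N).

Let cdD : coprime d D. Proof. exact: squarefree_coprime. Qed.
Let sd : squarefree d. Proof. by apply: squarefree_dvd sN; exact: dvdn_mulr. Qed.
Let sD : squarefree D. Proof. by apply: squarefree_dvd sN; exact: dvdn_mull. Qed.
Let oN : odd (d * D). Proof. by rewrite oddM od oD. Qed.
Local Notation k := (d * D)./2.
Let NE : k.*2.+1 = (d * D)%N. Proof. by rewrite -odd_half. Qed.
Let k2 : (2 <= k)%N. Proof. by have := NE; have := N4; move: (d * D)%N => n; lia. Qed.
Let d0 : (0 < d)%N. Proof. by case: d od. Qed.
Let D0 : (0 < D)%N. Proof. by case: D oD. Qed.

(** For m = dm' the first symbol is (m'/D), because d^2 is a square prime to D. Written with dm it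
    is defined for every m and periodic. *)
Definition wgt (m n : int) : C :=
  ((d%:Z %| m)%Z : nat)%:R * ((jac (d%:Z * m) D)%:~R * (jac n d)%:~R).

Lemma dvdN_d (t : int) : (k.*2.+1%:Z %| t)%Z -> (d%:Z %| t)%Z.
Proof. by rewrite NE PoszM; apply: dvdz_trans; exact: dvdz_mulr. Qed.

Lemma dvdN_D (t : int) : (k.*2.+1%:Z %| t)%Z -> (D%:Z %| t)%Z.
Proof. by rewrite NE PoszM; apply: dvdz_trans; exact: dvdz_mull. Qed.

Lemma jacN n a : odd n -> jac (- a) n = (-1) ^+ n./2 * jac a n.
Proof. by move=> on; rewrite (_ : - a = -1 * a) ?mulN1r // -mulN1r jacM // jacN1. Qed.

Lemma sign_level : (-1) ^+ D./2 * (-1) ^+ d./2 = (-1) ^+ k :> C.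
Proof.
have dE := odd_half od; have DE := odd_half oD.
have -> : k = (d./2 + d * D./2)%N by rewrite {1}dE {1}DE {2}dE; lia.
by rewrite exprD mulrC; congr (_ * _); rewrite -[RHS]signr_odd oddM od /= signr_odd.
Qed.

(** The double sum factors. The symbol modulo d adds up to 0 if d > 1; otherwise D > 1 and the
    symbol modulo D does. *)
Lemma admissible_wgt : admissible k k wgt.
Proof.
split.
- move=> m m' n n' hm hn; rewrite /wgt.
  have -> : (d%:Z %| m)%Z = (d%:Z %| m')%Z.
    by rewrite -[in LHS](subrK m' m) rpredDl // dvdN_d.
  have -> : jac (d%:Z * m) D = jac (d%:Z * m') D.
    by apply: eq_jac => //; rewrite -mulrBr dvdz_mull // dvdN_D.
  by have -> : jac n d = jac n' d by apply: eq_jac => //; exact: dvdN_d.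
- move=> m n; rewrite /wgt rpredN mulrN !jacN // !intrM !rmorphXn /= !rmorphN /= -sign_level; ring.
- have fac : ssum k (fun a => ssum k (wgt a)) =
    ssum k (fun a => ((d%:Z %| a)%Z : nat)%:R * (jac (d%:Z * a) D)%:~R) * ssum k (fun n => (jac n d)%:~R) :> C.
    rewrite mulrC -ssumZ; apply: eq_ssum => a; rewrite mulrC -ssumZ; apply: eq_ssum => n.
    by rewrite /wgt mulrA.
  rewrite fac; have [d1|d1] := ltnP 1 d.
    have p1 (t u : int) : (k.*2.+1%:Z %| t - u)%Z -> (jac t d)%:~R = (jac u d)%:~R :> C.
      by move=> htu; apply: jac_period => //; exact: dvdN_d.
    have -> : ssum k (fun n => (jac n d)%:~R) = 0 :> C; last by rewrite mulr0.
    rewrite (ssum_periodic p1) NE.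
    rewrite (@periodic_sum_crt _ d D (fun n => (jac n d)%:~R : C)) //; last by rewrite -NE.
    have in0 (x : 'I_d) : \sum_(y < D) (jac (D%:Z * x%:Z + d%:Z * y%:Z) d)%:~R =
        D%:R * ((jac D%:Z d)%:~R * (jac x%:Z d)%:~R) :> C.
      transitivity (\sum_(y < D) ((jac D%:Z d)%:~R * (jac x%:Z d)%:~R) : C); last first.
        by rewrite sumr_const card_ord mulr_natl.
      apply: eq_bigr => y _.
      rewrite -intrM -jacM //; apply: jac_period => //.
      by rewrite addrC addKr dvdz_mulr.
    by under eq_bigr do rewrite in0; rewrite -!mulr_sumr sum_jac // !mulr0.
  have dE : d = 1%N by move: d0 d1; lia.
  have D1 : (1 < D)%N by move: N4; rewrite dE mul1n; lia.
  have -> : ssum k (fun a => ((d%:Z %| a)%Z : nat)%:R * (jac (d%:Z * a) D)%:~R) = 0 :> C; last by rewrite mul0r.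
  transitivity (ssum k (fun a => (jac a D)%:~R) : C).
    by apply: eq_ssum => a; rewrite dE dvd1z mul1r mul1r.
  rewrite ssum_periodic; first by rewrite NE dE mul1n sum_jac.
  by move=> t u htu; apply: jac_period => //; exact: dvdN_D.
exists 1 => m n; rewrite /wgt !nrmM nrm_nat.
have h1 := @jac_bound R D (d%:Z * m) oD; have h2 := @jac_bound R d n od.
have h3 : nrm ((jac (d%:Z * m) D)%:~R : C) * nrm ((jac n d)%:~R : C) <= 1 * 1.
  by apply: ler_pM; rewrite ?nrm_ge0.
rewrite mulr1 in h3; case: (d%:Z %| m)%Z; [by rewrite mul1r | by rewrite mul0r ler01].
Qed.

Lemma LsumZ (c : C) (u : int -> C) : (forall n, nrm (u n) <= 1) ->
  Lsum k (fun n => c * u n) = c * Lsum k u.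
Proof.
move=> hu; apply: cvC_lim; apply: eq_cvC (cvCMl c (Lsum_cvC k2 hu)) => K.
by rewrite -ssumZ; apply: eq_ssum => n; rewrite mulrA.
Qed.

Definition Lval : C := Lsum k (fun n => (jac n (d * D))%:~R).

(** In the row m = 0 of the transformed weight, n enters both symbols, and they combine to (n/dD).
    This is why a single L-value serves all cusps. *)
Lemma wgt_cusp (a b c e : int) : a * e - b * c = 1 ->
  Lsum k (wact wgt a b c e 0) =
  ((d%:Z %| c)%Z : nat)%:R * ((jac (- (d%:Z * c)) D)%:~R * (jac a d)%:~R) * Lval.
Proof.
move=> hd; rewrite /Lval -LsumZ; last by move=> n; exact: jac_bound.
congr Lsum; apply/funext => n; rewrite /wact /wgt jac_mulr // intrM.
have -> : 0 * e - n * c = - (n * c) by ring.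
have -> : n * a - 0 * b = n * a by ring.
have [cn|cn] := boolP (coprimez n d%:Z); last first.
  have -> : jac (n * a) d = 0 by rewrite jacM // (jac_eq0 od cn) mul0r.
  by rewrite (jac_eq0 od cn) !(mul0r, mulr0).
have -> : (d%:Z %| - (n * c))%Z = (d%:Z %| c)%Z by rewrite rpredN Gauss_dvdzr // coprimez_sym.
have -> : d%:Z * - (n * c) = - (d%:Z * c) * n by ring.
by rewrite !jacM // !intrM; ring.
Qed.

Lemma wgt_Gamma0 (a b c e : int) : a * e - b * c = 1 -> ((d * D)%:Z %| c)%Z ->
  wact wgt a b c e = fun m n => (jac e d * jac a D)%:~R * wgt m n.
Proof.
move=> hd hc; apply/funext => m; apply/funext => n; rewrite /wact /wgt.
have dc : (d%:Z %| c)%Z by apply: dvdN_d; rewrite NE.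
have Dc : (D%:Z %| c)%Z by apply: dvdN_D; rewrite NE.
have [ce De] := (dvdzP dc, dvdzP Dc); case: ce => q hq; case: De => q' hq'.
have ced : coprimez e d%:Z by apply/coprimezP; exists (a, - (b * q)) => /=; rewrite -hd hq; ring.
have jd : jac a d = jac e d.
  apply: int_unit_eq; rewrite -jacM //; transitivity (jac 1 d); last exact: jac1n.
  by apply: eq_jac => //; rewrite -hd opprB addrCA subrr addr0 dvdz_mull.
have jD : jac a D = jac e D.
  apply: int_unit_eq; rewrite -jacM //; transitivity (jac 1 D); last exact: jac1n.
  by apply: eq_jac => //; rewrite -hd opprB addrCA subrr addr0 dvdz_mull.
have -> : (d%:Z %| m * e - n * c)%Z = (d%:Z %| m)%Z.
  rewrite rpredBr; last by apply: dvdz_mull.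
  by rewrite mulrC Gauss_dvdzr // coprimez_sym.
case dm: (d%:Z %| m)%Z; last by rewrite !mul0r mulr0.
have -> : jac (d%:Z * (m * e - n * c)) D = jac (d%:Z * m) D * jac e D.
  rewrite -jacM //; apply: eq_jac => //.
  have -> : d%:Z * (m * e - n * c) - d%:Z * m * e = - (d%:Z * n) * c by ring.
  exact: dvdz_mull.
have -> : jac (n * a - m * b) d = jac n d * jac a d.
  rewrite -jacM //; apply: eq_jac => //; rewrite addrAC subrr add0r rpredN.
  exact: dvdz_mulr.
by rewrite jd jD !intrM; ring.
Qed.

Lemma rowsumZ g c (u : int -> C) a : rowsum k g (fun n => c * u n) a = c * rowsum k g u a.
Proof.
have E : ssum g (fun b => c * u b * Lser k ((a + b%:~R) / g.*2.+1%:R)) =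
    c * ssum g (fun b => u b * Lser k ((a + b%:~R) / g.*2.+1%:R)).
  by rewrite -ssumZ; apply: eq_ssum => b; rewrite mulrA.
by rewrite /rowsum E mulrCA.
Qed.

(** Lipschitz' formula with modulus d and with modulus dD sums the same row: the symmetric cut-offs
    dDK + k of the second are among those of the first. *)
Lemma rowsum_level (u : int -> C) a : 0 < complex.Im a ->
  (forall n n', (d%:Z %| n - n')%Z -> u n = u n') -> rowsum k k u a = rowsum k d./2 u a.
Proof.
move=> ha hu; have dE := odd_half od; have DE := odd_half oD.
have h1 := row_limit k2 (g := k) ha (fun n n' h => hu n n' (dvdN_d h)).
have hu' : forall n n', (d./2.*2.+1%:Z %| n - n')%Z -> u n = u n' by rewrite -dE.
have h2 := row_limit k2 ha hu'.
have le K : (K <= D * K + D./2)%N by rewrite (leq_trans (leq_pmull K D0)) // leq_addr.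
apply: cvC_uniq h1 _; apply: eq_cvC (cvC_sub le h2) => K; congr ssum.
have kE : k = (d * D./2 + d./2)%N by rewrite {1}dE {1}DE {2}dE; lia.
by rewrite NE -dE kE mulnDr mulnA addnA.
Qed.

Definition gsum n : C := gauss_sum n (qexp (n%:R^-1 : C)) 1.

Lemma rowsum_wgt m z : 0 < complex.Im z ->
  rowsum k k (wgt (d * m.+1)%N%:Z) ((d * m.+1)%:R * z) =
  d%:R ^- k * lip_const R k * gsum d *
    ((jac m.+1%:Z D)%:~R * pser (fun t => (jac t%:Z d)%:~R) k.-1 (qexp z ^+ m.+1)).
Proof.
move=> hz; have dE := odd_half od; have d0' : d%:R != 0 :> C by rewrite pnatr_eq0 -lt0n.
have Ia : 0 < complex.Im ((d * m.+1)%:R * z) by rewrite Im_natr_mul mulr_gt0 // ltr0n muln_gt0 d0.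
have -> : wgt (d * m.+1)%N%:Z = fun n => (jac m.+1%:Z D)%:~R * (jac n d)%:~R.
  apply/funext => n; rewrite /wgt PoszM dvdz_mulr //= mul1r mulrA jacM // jacM // -expr2 jac_sqr ?mul1r //.
rewrite rowsumZ rowsum_level // => [|n n' hn]; last exact: jac_period.
have sd' : squarefree d./2.*2.+1 by rewrite -dE.
have := @rowsum_jac R d./2 k sd' _ Ia; rewrite -dE => ->.
have -> : (d * m.+1)%:R * z / d%:R = m.+1%:R * z :> C.
  by rewrite natrM; move: (d%:R : C) d0' => x x0; field.
by rewrite -qexpX /gsum; ring.
Qed.

Lemma lip_const_neq0 : lip_const R k != 0.
Proof.
apply: mulf_neq0; first by rewrite expf_neq0 // oppr_eq0 two_pi_i_neq0.
by rewrite invr_eq0 pnatr_eq0 -lt0n fact_gt0.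
Qed.

Lemma gsum_neq0 n : odd n -> gsum n != 0.
Proof. by move=> on; apply: gauss_sum_neq0 => //; apply: qexp_prim; case: n on. Qed.

(** Only the rows with d | m survive, and each is evaluated with modulus d by the Fourier expansion
    of (n/d). The row m = 0 is present only for D = 1. *)
Lemma Eis_wgt z : 0 < complex.Im z ->
  Eis k k wgt z = (jac 0 D)%:~R * Lval +
    2 * (d%:R ^- k * lip_const R k * gsum d *
      eisenstein_sum k.-1%:Z (fun n => jac n D) (fun n => jac n d) z).
Proof.
move=> hz; rewrite /Eis.
have -> : Lsum k (wgt 0) = (jac 0 D)%:~R * Lval.
  rewrite /Lval -LsumZ; last by move=> n; exact: jac_bound.
  congr Lsum; apply/funext => n; rewrite /wgt dvdz0 mul1r mulr0.
  have [D1|D1] := ltnP 1 D; first by rewrite jac0n // !mul0r.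
  have -> : D = 1%N by move: D0 D1; lia.
  by rewrite muln1.
suff -> : Eis_tail k k wgt z = d%:R ^- k * lip_const R k * gsum d *
   eisenstein_sum k.-1%:Z (fun n => jac n D) (fun n => jac n d) z by [].
set c := d%:R ^- k * lip_const R k * gsum d.
have c0 : c != 0.
  rewrite /c; apply: mulf_neq0; last exact: gsum_neq0.
  apply: mulf_neq0; last exact: lip_const_neq0.
  by rewrite invr_eq0 expf_neq0 // pnatr_eq0 -lt0n.
have [W hW] := adm_bnd admissible_wgt.
have [B _ hB] := Eis_tail_spec k k hz; have [H _] := hB wgt W z hW (lexx _).
have le T : (T <= d * T)%N by rewrite leq_pmull.
have {}H := cvCMl c^-1 (cvC_sub le H).
rewrite (@eisenstein_sumE R k.-1 _ _ z (c^-1 * Eis_tail k k wgt z)) //.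
- by rewrite mulVKf.
- by move=> n; exact: jac_bound.
- by move=> n; exact: jac_bound.
apply: eq_cvC H => T.
rewrite (@sum_multiples R (fun M => rowsum k k (wgt M.+1%:Z) (M.+1%:R * z)) d T) //; last first.
  move=> M nd; have -> : wgt M.+1%:Z = fun n => 0 * 0.
    apply/funext => n; rewrite /wgt (_ : (d%:Z %| M.+1%:Z)%Z = false) ?mul0r //.
    exact: negPf.
  by rewrite rowsumZ mul0r.
rewrite mulr_sumr; apply: eq_bigr => m _.
have -> : (d * m.+1).-1.+1 = (d * m.+1)%N by rewrite prednK // muln_gt0 d0.
by rewrite rowsum_wgt // mulKf.
Qed.

End Weight.

(** * Holomorphy *)

Section Holomorphy.
Variable R : realType.
Local Notation C := R[i].
Implicit Types (f g : C -> C) (z l m x : C).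

Lemma sder_derivable f z l : sder f z l -> derivable (f : C^o -> C^o) z 1.
Proof.
move=> [d [M [d0 hd]]]; apply/cvg_ex; exists (l : C^o); apply/cvgrPdist_le => e e0.
have eE : e = (complex.Re e)%:C%C by move: e0; case: e => a b; rewrite ltcE /= => /andP[/eqP ->].
have r0 : 0 < complex.Re e by move: e0; rewrite eE ltcR.
pose M' := `|M| + 1; have M0 : 0 < M' by rewrite /M' ltr_wpDl.
pose r := Num.min d (complex.Re e / M').
have rp : 0 < r by rewrite lt_min d0 divr_gt0.
have rC : 0 < r%:C%C :> C by rewrite ltcR.
exists r%:C%C => //= h hh h0.
have hr : nrm h < r.
  by have : `|0 - h| < r%:C%C :> C := hh; rewrite sub0r normrN normCE ltcR.
rewrite normCE eE lecR.
have h1 : nrm h <= d by apply: ltW; apply: lt_le_trans hr _; rewrite ge_min lexx.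
have h2 : nrm h * M' <= complex.Re e.
  by rewrite -ler_pdivlMr //; apply: ltW; apply: lt_le_trans hr _; rewrite ge_min lexx orbT.
have hn : 0 < nrm h by rewrite lt_def nrm_eq0 h0 nrm_ge0.
have -> : l - h^-1 *: (f (h *: 1 + z) - f z) = - (h^-1 * (f (z + h) - f z - h * l)).
  have -> : h *: 1 + z = z + h by rewrite addrC /GRing.scale /= mulr1.
  by rewrite /GRing.scale /=; field.
rewrite nrmN nrmM nrmV mulrC ler_pdivrMr //; apply: le_trans (hd h h1) _.
apply: (@le_trans _ _ (M' * nrm h ^+ 2)).
  rewrite ler_wpM2r ?exprn_ge0 ?nrm_ge0 //; apply: le_trans (ler_norm M) _; rewrite /M'; lra.
by rewrite expr2 mulrA ler_pM2r // mulrC.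
Qed.

Definition hol f z : Prop := exists l, sder f z l.

Lemma sder_local f z l : sder f z l -> exists d M : R, [/\ 0 < d, d <= 1, 0 <= M &
  forall h, nrm h <= d -> nrm (f (z + h) - f z - h * l) <= M * nrm h ^+ 2 /\
    nrm (f (z + h) - f z) <= (nrm l + M) * nrm h].
Proof.
move=> [d [M [d0 hd]]]; exists (Num.min d 1), `|M|; split => //.
- by rewrite lt_min d0 ltr01.
- by rewrite ge_min lexx orbT.
move=> h; rewrite le_min => /andP[hd' h1]; have n0 := nrm_ge0 h.
have A : nrm (f (z + h) - f z - h * l) <= `|M| * nrm h ^+ 2.
  by apply: le_trans (hd h hd') _; rewrite ler_wpM2r ?exprn_ge0 // ler_norm.
split=> //; have -> : f (z + h) - f z = h * l + (f (z + h) - f z - h * l) by ring.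
apply: le_trans (nrmD _ _) _; rewrite nrmM mulrDl [nrm l * _]mulrC lerD2l.
apply: le_trans A _; rewrite ler_wpM2l // expr2 ler_piMl //.
Qed.

Lemma hol_cst c z : hol (fun=> c) z.
Proof.
by exists 0, 1, 0; split => // h _; rewrite subrr mulr0 subrr nrm0 mul0r.
Qed.

Lemma hol_lin c z : hol (fun x => c * x) z.
Proof.
exists c, 1, 0; split => // h _; have -> : c * (z + h) - c * z - h * c = 0 by ring.
by rewrite nrm0 mul0r.
Qed.

Lemma holD f g z : hol f z -> hol g z -> hol (fun x => f x + g x) z.
Proof.
move=> [l hf] [m hg]; exists (l + m).
have [d [M [d0 _ M0 h1]]] := sder_local hf; have [d' [M' [d0' _ M0' h2]]] := sder_local hg.
exists (Num.min d d'), (M + M'); split; first by rewrite lt_min d0.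
move=> h; rewrite le_min => /andP[hd hd']; have [A _] := h1 h hd; have [B _] := h2 h hd'.
have -> : f (z + h) + g (z + h) - (f z + g z) - h * (l + m) =
  (f (z + h) - f z - h * l) + (g (z + h) - g z - h * m) by ring.
apply: le_trans (nrmD _ _) _; rewrite mulrDl; lra.
Qed.

Lemma holM f g z : hol f z -> hol g z -> hol (fun x => f x * g x) z.
Proof.
move=> [l hf] [m hg]; exists (l * g z + f z * m).
have [d [M [d0 _ M0 h1]]] := sder_local hf; have [d' [M' [d0' d1' M0' h2]]] := sder_local hg.
pose K := nrm l + M; pose K' := nrm m + M'.
exists (Num.min d d'), (M * nrm (g z) + nrm (f z) * M' + K * K'); split; first by rewrite lt_min d0.
move=> h; rewrite le_min => /andP[hd hd']; have [A A'] := h1 h hd; have [B B'] := h2 h hd'.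
set u := f (z + h) - f z in A A'; set v := g (z + h) - g z in B B'.
have -> : f (z + h) * g (z + h) - f z * g z - h * (l * g z + f z * m) =
  (u - h * l) * g z + f z * (v - h * m) + u * v by rewrite /u /v; ring.
apply: le_trans (nrmD _ _) _.
have a1 := nrmD ((u - h * l) * g z) (f z * (v - h * m)).
have a2 : nrm ((u - h * l) * g z) <= M * nrm h ^+ 2 * nrm (g z) by rewrite nrmM ler_wpM2r ?nrm_ge0.
have a3 : nrm (f z * (v - h * m)) <= nrm (f z) * (M' * nrm h ^+ 2) by rewrite nrmM ler_wpM2l ?nrm_ge0.
have a4 : nrm (u * v) <= (K * nrm h) * (K' * nrm h) by rewrite nrmM; apply: ler_pM; rewrite ?nrm_ge0.
have -> : (M * nrm (g z) + nrm (f z) * M' + K * K') * nrm h ^+ 2 =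
  M * nrm h ^+ 2 * nrm (g z) + nrm (f z) * (M' * nrm h ^+ 2) + (K * nrm h) * (K' * nrm h) by ring.
lra.
Qed.

Lemma holX f z n : hol f z -> hol (fun x => f x ^+ n) z.
Proof.
move=> hf; elim: n => [|n IH]; first exact: hol_cst.
have [l [d [M [d0 hl]]]] := holM hf IH; exists l, d, M; split => // h hd.
have E y : f y ^+ n.+1 = f y * f y ^+ n by rewrite exprS.
by rewrite !E; exact: hl.
Qed.

Lemma hol_comp f g z : hol f z -> hol g (f z) -> hol (fun x => g (f x)) z.
Proof.
move=> [l hf] [m hg]; exists (l * m).
have [d [M [d0 d1 M0 h1]]] := sder_local hf; have [d' [M' [d0' d1' M0' h2]]] := sder_local hg.
pose K := nrm l + M + 1; have K0 : 0 < K by have := nrm_ge0 l; rewrite /K; lra.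
exists (Num.min d (d' / K)), (M * nrm m + M' * K ^+ 2); split; first by rewrite lt_min d0 divr_gt0.
move=> h; rewrite le_min => /andP[hd hd']; have [A A'] := h1 h hd.
set u := f (z + h) - f z in A A'; have n0 := nrm_ge0 h.
have uK : nrm u <= K * nrm h by apply: le_trans A' _; rewrite ler_wpM2r // /K; lra.
have ud : nrm u <= d' by apply: le_trans uK _; rewrite mulrC -ler_pdivlMr.
have [B _] := h2 u ud; have fE : f z + u = f (z + h) by rewrite /u addrC subrK.
rewrite fE in B.
have -> : g (f (z + h)) - g (f z) - h * (l * m) =
  (g (f (z + h)) - g (f z) - u * m) + (u - h * l) * m by ring.
apply: le_trans (nrmD _ _) _.
have a1 : nrm ((u - h * l) * m) <= M * nrm h ^+ 2 * nrm m by rewrite nrmM ler_wpM2r ?nrm_ge0.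
have a2 : M' * nrm u ^+ 2 <= M' * (K * nrm h) ^+ 2.
  by rewrite ler_wpM2l // lerXn2r ?nnegrE ?nrm_ge0 // mulr_ge0 // ltW.
have -> : (M * nrm m + M' * K ^+ 2) * nrm h ^+ 2 = M * nrm h ^+ 2 * nrm m + M' * (K * nrm h) ^+ 2 by ring.
lra.
Qed.

Lemma hol_inv z : z != 0 -> hol (fun x => x^-1) z.
Proof.
move=> z0; have n0 : 0 < nrm z by rewrite lt_def nrm_eq0 z0 nrm_ge0.
exists (- (z ^+ 2)^-1), (nrm z / 2), (2 * nrm z ^- 3); split; first lra.
move=> h hh; have hb : nrm z / 2 <= nrm (z + h).
  by have := nrmB_ge z (- h); rewrite opprK nrmN; lra.
have zh : z + h != 0 by rewrite -nrm_eq0 gt_eqF //; lra.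
have -> : (z + h)^-1 - z^-1 - h * - (z ^+ 2)^-1 = h ^+ 2 * (z + h)^-1 * z ^- 2 by field; rewrite z0 zh.
rewrite nrmM nrmM !nrmV !nrmX.
have i1 : (nrm (z + h))^-1 <= 2 * (nrm z)^-1.
  have -> : 2 * (nrm z)^-1 = (nrm z / 2)^-1 by field; rewrite gt_eqF.
  by rewrite lef_pV2 ?posrE //; lra.
have -> : 2 * nrm z ^- 3 * nrm h ^+ 2 = nrm h ^+ 2 * (2 * (nrm z)^-1) * nrm z ^- 2.
  by move: (nrm z) n0 => y y0; field; rewrite gt_eqF.
by rewrite ler_wpM2r ?invr_ge0 ?exprn_ge0 ?nrm_ge0 // ler_wpM2l ?exprn_ge0 ?nrm_ge0.
Qed.

Lemma hol_qexp z : hol (@qexp R) z.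
Proof.
exists (two_pi_i R * qexp z), 1, (nrm (qexp z) * (8 * (2 * pi) ^+ 2 * expR (2 * pi))); split => // h h1.
have p0 := @pi_gt0 R; have n0 := nrm_ge0 h.
have -> : qexp (z + h) - qexp z - h * (two_pi_i R * qexp z) =
  qexp z * (expC (two_pi_i R * h) - 1 - two_pi_i R * h).
  by rewrite qexpD {2}/qexp; ring.
have [_ hb] := expC_bounds (two_pi_i R * h); rewrite nrmM nrm_two_pi_i in hb.
rewrite nrmM -[X in _ <= X]mulrA ler_wpM2l ?nrm_ge0 //; apply: le_trans hb _.
have c0 : 0 <= 8 * (2 * pi * nrm h) ^+ 2 by apply: mulr_ge0 => //; exact: sqr_ge0.
have -> : 8 * (2 * pi) ^+ 2 * expR (2 * pi) * nrm h ^+ 2 = 8 * (2 * pi * nrm h) ^+ 2 * expR (2 * pi) by ring.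
by rewrite ler_wpM2l // ler_expR ler_piMr // mulr_ge0 // ltW.
Qed.

Lemma eq_hol f g z (d : R) : 0 < d -> (forall h, nrm h <= d -> f (z + h) = g (z + h)) -> hol f z -> hol g z.
Proof. by move=> d0 e [l hl]; exists l; exact: (eq_sder d0 e hl). Qed.

(* First-order jets at x with majorants: the total majorant F is
   submultiplicative, like the value at nrm x + d of a power series with
   nonnegative coefficients. *)
Definition jet (x : C) (d : R) f l (F : R) : Prop := exists F0 F1 F2 : R,
  [/\ 0 <= F0, 0 <= F1, 0 <= F2 & F0 + F1 + F2 <= F] /\
  [/\ nrm (f x) <= F0, nrm l * d <= F1 &
    forall h, nrm h <= d -> nrm (f (x + h) - f x - h * l) <= F2 * (nrm h / d) ^+ 2].

Section Jets.
Variables (x : C) (d : R).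
Hypothesis d0 : 0 < d.

Lemma jet_cst c : jet x d (fun=> c) 0 (nrm c).
Proof.
exists (nrm c), 0, 0; split; split; rewrite ?nrm_ge0 ?nrm0 ?mul0r ?addr0 // => h _.
by rewrite subrr mulr0 subrr nrm0 mul0r.
Qed.

Lemma eq_jet f g l F : f =1 g -> jet x d f l F -> jet x d g l F.
Proof. by move/funext->. Qed.

Lemma jet_id : jet x d id 1 (nrm x + d).
Proof.
exists (nrm x), d, 0; split; split; rewrite ?nrm_ge0 ?nrm1 ?mul1r ?addr0 // ?ltW // => h _.
have -> : x + h - x - h * 1 = 0 by ring.
by rewrite nrm0 mul0r.
Qed.

Lemma jetW f l F G : F <= G -> jet x d f l F -> jet x d f l G.
Proof.
move=> FG [F0 [F1 [F2 [[h0 h1 h2 h3] H]]]]; exists F0, F1, F2; split => //; split => //.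
exact: le_trans FG.
Qed.

(** The nine products of the three parts are sorted by order, everything of order above 2 being
    absorbed at order 2 because |h| <= d. *)
Lemma jetM f g l m F G : jet x d f l F -> jet x d g m G ->
  jet x d (fun y => f y * g y) (l * g x + f x * m) (F * G).
Proof.
move=> [F0 [F1 [F2 [[a0 a1 a2 a3] [b0 b1 b2]]]]] [G0 [G1 [G2 [[c0 c1 c2 c3] [e0 e1 e2]]]]].
exists (F0 * G0), (F0 * G1 + F1 * G0), (F1 * G1 + F2 * (G0 + G1 + G2) + (F0 + F1) * G2); split; split.
- exact: mulr_ge0.
- by rewrite addr_ge0 // mulr_ge0.
- by rewrite !addr_ge0 // mulr_ge0 ?addr_ge0.
- have -> : F0 * G0 + (F0 * G1 + F1 * G0) + (F1 * G1 + F2 * (G0 + G1 + G2) + (F0 + F1) * G2) =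
    (F0 + F1 + F2) * (G0 + G1 + G2) by ring.
  by apply: ler_pM => //; rewrite !addr_ge0.
- by rewrite nrmM; apply: ler_pM; rewrite ?nrm_ge0.
- apply: (@le_trans _ _ (nrm l * d * nrm (g x) + nrm (f x) * (nrm m * d))).
    have -> : nrm l * d * nrm (g x) + nrm (f x) * (nrm m * d) = (nrm l * nrm (g x) + nrm (f x) * nrm m) * d by ring.
    by rewrite ler_pM2r // -!nrmM; exact: nrmD.
  have dp := ltW d0; rewrite addrC; apply: lerD; apply: ler_pM => //; rewrite ?nrm_ge0 // mulr_ge0 ?nrm_ge0 //.
move=> h hd; set q := nrm h / d.
have q1 : q <= 1 by rewrite /q ler_pdivrMr // mul1r.
have qp : 0 <= q by rewrite /q divr_ge0 ?nrm_ge0 // ltW.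
have hE : nrm h = q * d by rewrite /q divfK // gt_eqF.
have B := b2 h hd; have E := e2 h hd; rewrite -/q in B E.
set r := f (x + h) - f x - h * l in B; set s := g (x + h) - g x - h * m in E.
have -> : f (x + h) * g (x + h) - f x * g x - h * (l * g x + f x * m) =
  (h * l) * (h * m) + r * (g x + h * m + s) + (f x + h * l) * s by rewrite /r /s; ring.
have hl : nrm (h * l) <= F1 * q.
  by rewrite nrmM hE (_ : q * d * nrm l = nrm l * d * q) ?ler_wpM2r //; ring.
have hm : nrm (h * m) <= G1 * q.
  by rewrite nrmM hE (_ : q * d * nrm m = nrm m * d * q) ?ler_wpM2r //; ring.
have q22 : q ^+ 2 <= 1 by rewrite expr_le1.
have g3 : nrm (g x + h * m + s) <= G0 + G1 + G2.
  apply: le_trans (nrmD _ _) _; have := nrmD (g x) (h * m).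
  have : G1 * q <= G1 by rewrite ler_piMr.
  have : G2 * q ^+ 2 <= G2 by rewrite ler_piMr.
  lra.
have f3 : nrm (f x + h * l) <= F0 + F1.
  apply: le_trans (nrmD _ _) _; have : F1 * q <= F1 by rewrite ler_piMr.
  lra.
apply: le_trans (nrmD _ _) _; have := nrmD (h * l * (h * m)) (r * (g x + h * m + s)).
have t1 : nrm (h * l * (h * m)) <= F1 * q * (G1 * q) by rewrite nrmM; apply: ler_pM; rewrite ?nrm_ge0.
have t2 : nrm (r * (g x + h * m + s)) <= F2 * q ^+ 2 * (G0 + G1 + G2) by rewrite nrmM; apply: ler_pM; rewrite ?nrm_ge0.
have t3 : nrm ((f x + h * l) * s) <= (F0 + F1) * (G2 * q ^+ 2) by rewrite nrmM; apply: ler_pM; rewrite ?nrm_ge0.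
have -> : (F1 * G1 + F2 * (G0 + G1 + G2) + (F0 + F1) * G2) * q ^+ 2 =
  F1 * q * (G1 * q) + F2 * q ^+ 2 * (G0 + G1 + G2) + (F0 + F1) * (G2 * q ^+ 2) by ring.
lra.
Qed.

Lemma jetD f g l m F G : jet x d f l F -> jet x d g m G ->
  jet x d (fun y => f y + g y) (l + m) (F + G).
Proof.
move=> [F0 [F1 [F2 [[a0 a1 a2 a3] [b0 b1 b2]]]]] [G0 [G1 [G2 [[c0 c1 c2 c3] [e0 e1 e2]]]]].
exists (F0 + G0), (F1 + G1), (F2 + G2); split; split; rewrite ?addr_ge0 //.
- lra.
- by apply: le_trans (nrmD _ _) _; exact: lerD.
- apply: (@le_trans _ _ ((nrm l + nrm m) * d)); first by rewrite ler_pM2r //; exact: nrmD.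
  by rewrite mulrDl; exact: lerD.
move=> h hd; have -> : f (x + h) + g (x + h) - (f x + g x) - h * (l + m) =
  (f (x + h) - f x - h * l) + (g (x + h) - g x - h * m) by ring.
by apply: le_trans (nrmD _ _) _; rewrite mulrDl; apply: lerD; [exact: b2 | exact: e2].
Qed.

Lemma jetX n : exists l, jet x d (fun y => y ^+ n) l ((nrm x + d) ^+ n).
Proof.
elim: n => [|n [l hl]]; first by exists 0; have := jet_cst 1; rewrite nrm1.
exists (1 * x ^+ n + x * l); have := jetM jet_id hl; rewrite -exprS.
by apply: eq_jet => y; rewrite exprS.
Qed.

Lemma jet_series (u : nat -> C -> C) (F : nat -> R) (B : R) f :
  (forall i, exists l, jet x d (u i) l (F i)) -> (forall n, \sum_(i < n) F i <= B) ->
  (forall h, nrm h <= d -> cvC (fun n => \sum_(i < n) u i (x + h)) (f (x + h))) -> hol f x.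
Proof.
move=> hu hB hf; have [l hl] := choice hu.
have lF i : nrm (l i) <= F i / d.
  have [F0 [F1 [F2 [[a0 a1 a2 a3] [b0 b1 b2]]]]] := hl i.
  by rewrite ler_pdivlMr //; lra.
have [|L hL] := @sum_cvC R l (B / d).
  move=> n; apply: (@le_trans _ _ (\sum_(i < n) F i / d)); first by apply: ler_sum => i _.
  by rewrite -mulr_suml ler_pM2r ?invr_gt0.
exists L; apply: (@sder_series R u f x l L (fun i => F i / d ^+ 2) (B / d ^+ 2) d) => //.
  move=> i h hd; have [F0 [F1 [F2 [[a0 a1 a2 a3] [b0 b1 b2]]]]] := hl i.
  apply: le_trans (b2 h hd) _; rewrite exprMn exprVn.
  have -> : F i / d ^+ 2 * nrm h ^+ 2 = F i * (nrm h ^+ 2 / d ^+ 2) by ring.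
  rewrite ler_wpM2r //; first by rewrite divr_ge0 ?exprn_ge0 ?nrm_ge0 // ltW.
  lra.
by move=> n; rewrite -mulr_suml ler_pM2r // invr_gt0 exprn_gt0.
Qed.

End Jets.

Lemma disc_radius x : nrm x < 1 -> exists2 d : R, 0 < d & 0 < nrm x + d < 1.
Proof. by move=> x1; have := nrm_ge0 x; exists ((1 - nrm x) / 2); lra. Qed.

(** Series are what jets handle, so the product is written as 1 plus its successive increments
    -y^(n+1) times the n-th partial product. The majorants telescope to a product with factors 1 +
    r^(i+1), which is bounded. *)
Lemma hol_pochqq x : nrm x < 1 -> hol (fun y => poch y y) x.
Proof.
move=> x1; have [d d0 /andP[r0 r1]] := disc_radius x1; set r := nrm x + d in r0 r1.
have rg n : 0 <= r ^+ n by rewrite exprn_ge0 // ltW.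
pose F n := r ^+ n.+1 * \prod_(i < n) (1 + r ^+ i.+1).
have prodj n : exists l, jet x d (fun y => \prod_(i < n) (1 - y ^+ i * y)) l (\prod_(i < n) (1 + r ^+ i.+1)).
  elim: n => [|n [l hl]].
    exists 0; have := jet_cst x d 1; rewrite nrm1 big_ord0.
    by apply: eq_jet => y; rewrite big_ord0.
  have [m hm] := jetX x d0 n.+1; have h1 := jetD d0 (jet_cst x d 1) (jetM d0 (jet_cst x d (-1)) hm).
  rewrite nrmN nrm1 mul1r in h1.
  have := jetM d0 hl h1; set l' := (X in jet x d _ X _); rewrite big_ord_recr /= => H; exists l'.
  by apply: eq_jet H => y; rewrite big_ord_recr /= mulN1r exprSr.
pose u n (y : C) := -1 * (y ^+ n.+1 * \prod_(i < n) (1 - y ^+ i * y)).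
have hu n : exists l, jet x d (u n) l (F n).
  have [m hm] := jetX x d0 n.+1; have [l hl] := prodj n.
  have := jetM d0 (jet_cst x d (-1)) (jetM d0 hm hl); rewrite nrmN nrm1 mul1r.
  by set l' := (X in jet x d _ X _) => H; exists l'.
have tel n : \sum_(i < n) F i = \prod_(i < n) (1 + r ^+ i.+1) - 1.
  elim: n => [|n IH]; first by rewrite !big_ord0 subrr.
  by rewrite !big_ord_recr /= IH /F; ring.
have hB n : \sum_(i < n) F i <= expR ((1 - r)^-1).
  rewrite tel; apply: (@le_trans _ _ (\prod_(i < n) (1 + r ^+ i.+1))); first lra.
  apply: (@prod_ge1_bounded R (fun i => r ^+ i.+1)) => // m.
  have rE : nrm r%:C%C = r :> R by rewrite nrm_real gtr0_norm.
  have := @geom_bound R r%:C%C m; rewrite rE => /(_ r1); apply: le_trans.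
  apply: ler_sum => i _; rewrite exprS ler_piMl //; lra.
have H := jet_series d0 (f := fun y => poch y y - 1) hu hB.
have {}H : hol (fun y => poch y y - 1) x.
  apply: H => h hd; have y1 : nrm (x + h) < 1.
    by apply: le_lt_trans (nrmD _ _) _; move: r1; rewrite /r; lra.
  apply: eq_cvC (cvCB (poch_cvC (x + h) y1) (cvC_cst 1)) => n; set y := x + h.
  elim: n => [|n IH]; first by rewrite !big_ord0 subrr.
  by rewrite !big_ord_recr /= -IH /u exprSr; ring.
have [l [e [M [e0 hl]]]] := holD H (hol_cst 1 x); exists l, e, M; split => // h he.
by have := hl h he; rewrite !subrK.
Qed.

Lemma hol_eta z : 0 < complex.Im z -> hol (@dedekind_eta R) z.
Proof.
move=> hz; have h1 := hol_comp (hol_lin (24^-1) z) (hol_qexp (24^-1 * z)).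
have h2 := hol_comp (hol_qexp z) (hol_pochqq (nrm_qexp_lt1 hz)).
have y0 : 0 < complex.Im z / 2 by lra.
apply: (eq_hol y0) (holM h1 h2) => h hh /=; rewrite eta_poch ?[24^-1 * _]mulrC //.
have := Im_le h; rewrite ler_norml => /andP[h3 _].
have -> : complex.Im (z + h) = complex.Im z + complex.Im h by case: (z) (h) => [? ?] [? ?].
lra.
Qed.

(** At most n divisors, each contributing at most n^k. *)
Lemma sigma_bound k (f g : int -> int) n : (0 < n)%N ->
  (forall n, nrm ((f n)%:~R : C) <= 1) -> (forall n, nrm ((g n)%:~R : C) <= 1) ->
  nrm (sigma R k%:Z f g n) <= n%:R ^+ k.+1.
Proof.
move=> n0 hf hg; rewrite /sigma (@sum_divisors_ord R (fun t => (f (n %/ t)%N%:Z * g t%:Z)%:~R * t%:R ^ k%:Z) n n) ?n0 ?leqnn //.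
apply: le_trans (nrm_sum _ _ _) _.
apply: (@le_trans _ _ (\sum_(t < n) n%:R ^+ k)); last first.
  by rewrite sumr_const card_ord exprS mulr_natl.
apply: ler_sum => t _; case: ifP => _; last by rewrite nrm0 exprn_ge0.
rewrite intrM -[_ ^ k%:Z]/(_ ^+ k) !nrmM nrmX nrm_nat.
have h1 : nrm ((f (n %/ t.+1)%N%:Z)%:~R : C) * nrm ((g t.+1%:Z)%:~R : C) <= 1 * 1.
  by apply: ler_pM; rewrite ?nrm_ge0.
rewrite mulr1 in h1; rewrite -[X in _ <= X]mul1r; apply: ler_pM; rewrite ?mulr_ge0 ?nrm_ge0 ?exprn_ge0 //.
by rewrite lerXn2r ?nnegrE // ler_nat.
Qed.

Lemma hol_eisenstein k (f g : int -> int) z : 0 < complex.Im z ->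
  (forall n, nrm ((f n)%:~R : C) <= 1) -> (forall n, nrm ((g n)%:~R : C) <= 1) ->
  hol (eisenstein_sum k%:Z f g) z.
Proof.
move=> hz hf hg; have x1 := nrm_qexp_lt1 hz; set x := qexp z in x1.
pose E (y : C) : C := limn (fun p : nat => \sum_(1 <= n < p.+1) sigma R k%:Z f g n * y ^+ n : C^o).
suff hE : hol E x by exact: hol_comp (hol_qexp z) hE.
have [d d0 /andP[r0 r1]] := disc_radius x1; set r := nrm x + d in r0 r1.
have r01 : 0 <= r < 1 by rewrite r1 ltW.
have [b hb] := @geom_pow_bounded R k.+1 r r01.
pose u n (y : C) := sigma R k%:Z f g n.+1 * y ^+ n.+1.
have hu n : exists l, jet x d (u n) l (n.+1%:R ^+ k.+1 * r ^+ n).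
  have [m hm] := jetX x d0 n.+1; have := jetM d0 (jet_cst x d (sigma R k%:Z f g n.+1)) hm.
  set l' := (X in jet x d _ X _) => H; exists l'; apply: jetW H.
  apply: ler_pM; rewrite ?nrm_ge0 ?exprn_ge0 ?(ltW r0) //; first exact: sigma_bound.
  by rewrite -/r exprS ler_piMl ?exprn_ge0 //; lra.
apply: (jet_series d0 hu hb) => h hd.
have y1 : nrm (x + h) <= r by apply: le_trans (nrmD _ _) _; rewrite /r; lra.
have [|l hl] := @sum_cvC R (fun n => u n (x + h)) b.
  move=> n; apply: le_trans (hb n); apply: ler_sum => i _; rewrite nrmM nrmX.
  apply: ler_pM; rewrite ?nrm_ge0 ?exprn_ge0 ?nrm_ge0 //; first exact: sigma_bound.
  apply: (@le_trans _ _ (r ^+ i.+1)); first by rewrite lerXn2r ?nnegrE ?nrm_ge0 // ltW.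
  by rewrite exprS ler_piMl ?exprn_ge0 //; lra.
suff -> : E (x + h) = l by [].
by apply: cvC_lim; apply: eq_cvC hl => n; rewrite big_add1 /= big_mkord.
Qed.

End Holomorphy.

(** * Gauss sums, reciprocity and Kronecker symbols *)

Section GaussSigns.
Variable R : realType.
Local Notation C := R[i].

(** The positive square root of an odd n: all the angles lie in (0, pi), which fixes the sign, and
    [rho_sqr] gives the square. *)
Definition rho (n : nat) : R := \prod_(r < n./2) (2 * sin (pi * (2 * r.+1%:R / n%:R))).

Lemma Psin_rho n : Psin R n = 'i%C ^+ n./2 * (rho n)%:C%C.
Proof.
rewrite /Psin /rho rmorph_prod /=.
have -> : 'i%C ^+ n./2 = \prod_(r < n./2) 'i%C :> C by rewrite prodr_const card_ord.
rewrite -big_split /=; apply: eq_bigr => r _.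
have -> : 2 * r.+1%:R / n%:R = (2 * r.+1%:R / n%:R : R)%:C%C :> C.
  by rewrite !rmorphM fmorphV !rmorph_nat.
by rewrite sn_real rmorphM rmorph_nat; ring.
Qed.

Lemma rho_gt0 n : odd n -> 0 < rho n.
Proof.
move=> on; have nE := odd_half on; apply: prodr_gt0 => r _; rewrite mulr_gt0 //.
apply: sin_gt0_pi; have n0 : 0 < n%:R :> R by rewrite ltr0n; case: n on {nE r}.
have p0 := @pi_gt0 R; apply/andP; split; first by rewrite !mulr_gt0 ?invr_gt0.
rewrite gtr_pMr // ltr_pdivrMr // mul1r -natrM ltr_nat {2}nE; have := ltn_ord r; lia.
Qed.

Lemma rho_sqr n : odd n -> rho n ^+ 2 = n%:R.
Proof.
move=> on; have nE := odd_half on; have := Psin_sqr R n./2; rewrite -nE Psin_rho exprMn -exprM mulnC exprM.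
have -> : 'i%C ^+ 2 = -1 :> C by exact: sqr_i.
move/(mulfI (_ : (-1) ^+ n./2 != 0 :> C)); rewrite signr_eq0 => /(_ isT) E.
by apply: (@complexI R); rewrite rmorphXn rmorph_nat.
Qed.

Lemma rhoM n1 n2 : odd n1 -> odd n2 -> rho (n1 * n2) = rho n1 * rho n2.
Proof.
move=> o1 o2; have o : odd (n1 * n2) by rewrite oddM o1 o2.
apply/eqP; rewrite -(@eqrXn2 _ 2) // ?mulr_ge0 ?ltW ?rho_gt0 //.
by rewrite exprMn !rho_sqr // natrM.
Qed.

(** The evaluation of the Gauss sum involves the sines at 4r/n with a sign (-1)^((n-1)/2); passing
    to the sines at 2r/n costs (2/n), and the sign is (-1/n). *)
Lemma gsumE n : odd n -> gsum R n = (jac (-2) n)%:~R * Psin R n.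
Proof.
move=> on; have n0 : (0 < n)%N by case: n on.
rewrite /gsum gauss_sum_eval //; last exact: qexp_prim.
have c2 : coprimez 2 n%:Z by rewrite coprimezE /= coprime2n.
have -> : jac (-2) n = (-1) ^+ n./2 * jac 2 n by rewrite (_ : (-2 : int) = -1 * 2) // jacM // jacN1.
rewrite intrM rmorphXn /= rmorphN /= -mulrA; congr (_ * _); rewrite -Psin_jac // /sine_prod.
apply: eq_bigr => r _; rewrite qexpX !qexpz /sn.
have n0' : n%:R != 0 :> C by rewrite pnatr_eq0 -lt0n.
rewrite rmorphN /= -!pmulrn; move: (n%:R : C) (r.+1%:R : C) n0' => x y x0.
by congr (qexp _ - qexp _); field.
Qed.

Lemma half_mul n1 n2 : odd n1 -> odd n2 -> (n1 * n2)./2 = (n1./2 + n2./2 + (n1./2 * n2./2).*2)%N.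
Proof. by move=> /odd_half e1 /odd_half e2; rewrite {1}e1 {1}e2; lia. Qed.

Lemma gsum_level d D : odd d -> odd D -> coprime d D ->
  Psin R D * gsum R d / gsum R (d * D) = ((-1) ^+ (D./2 * d./2.+1) * jac 2 D)%:~R.
Proof.
move=> od oD cdD; have oN : odd (d * D) by rewrite oddM od oD.
have c2 n : odd n -> coprimez (-2) n%:Z by move=> on; rewrite coprimezE /= coprime2n.
have rM : (rho (d * D))%:C%C = (rho d)%:C%C * (rho D)%:C%C :> C by rewrite rhoM // rmorphM.
rewrite !gsumE // (@jac_mulr R) // intrM !Psin_rho rM half_mul //.
have jd := jac_unit_inv R od (c2 d od); have jD := jac_unit_inv R oD (c2 D oD).
have j0 n : odd n -> (jac (-2) n)%:~R != 0 :> C.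
  by move=> on; have [->|->] := jac_cases on (c2 n on); rewrite ?rmorphN ?oppr_eq0 /= oner_eq0.
have r0 n : odd n -> (rho n)%:C%C != 0 :> C.
  by move=> on; rewrite fmorph_eq0 gt_eqF // rho_gt0.
have i0 : 'i%C != 0 :> C by exact: neq0Ci.
have E : jac (-2) D = (-1) ^+ D./2 * jac 2 D by rewrite (_ : (-2 : int) = -1 * 2) // jacM // jacN1.
rewrite !exprD -[(_ * _).*2]mul2n exprM sqr_i.
have -> : ((-1) ^+ (D./2 * d./2.+1) * jac 2 D)%:~R = (-1) ^+ (d./2 * D./2) * (jac (-2) D)%:~R :> C.
  by rewrite E !intrM !rmorphXn /= !rmorphN /= mulrA -exprD mulnSr mulnC.
rewrite -[(jac (-2) D)%:~R in RHS]jD.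
have s2 : ((-1) ^+ (d./2 * D./2))^-1 = (-1) ^+ (d./2 * D./2) :> C by rewrite invr_sign.
rewrite -[in RHS]s2; have s0 : (-1) ^+ (d./2 * D./2) != 0 :> C by rewrite signr_eq0.
have a0 := expf_neq0 d./2 i0; have b0 := expf_neq0 D./2 i0.
move: (j0 d od) (j0 D oD) (r0 d od) (r0 D oD) s0 a0 b0.
move: ((jac (-2) d)%:~R : C) ((jac (-2) D)%:~R : C) ((rho d)%:C%C : C) ((rho D)%:C%C : C) ((-1) ^+ (d./2 * D./2) : C) ('i%C ^+ d./2 : C) ('i%C ^+ D./2 : C).
move=> x1 x2 x3 x4 x5 x6 x7 y1 y2 y3 y4 y5 y6 y7; field.
by rewrite y1 y2 y3 y4 y5 y6 y7.
Qed.

(** The Chinese remainder theorem splits the Gauss sum of n1 n2 with exactly these two symbols. Its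
    explicit value splits with a sign that comes from the powers of i, since (n1 n2 - 1)/2 exceeds
    the sum of the two halves by 2 n1./2 n2./2. *)
Lemma jac_reciprocity n1 n2 : odd n1 -> odd n2 -> coprime n1 n2 ->
  jac n1%:Z n2 * jac n2%:Z n1 = (-1) ^+ (n1./2 * n2./2).
Proof.
move=> o1 o2 c12; have o : odd (n1 * n2) by rewrite oddM o1 o2.
have p1 : (0 < n1)%N by case: n1 o1 {c12 o}. have p2 : (0 < n2)%N by case: n2 o2 {c12 o}.
have n10 : n1%:R != 0 :> C by rewrite pnatr_eq0 -lt0n.
have n20 : n2%:R != 0 :> C by rewrite pnatr_eq0 -lt0n.
have pz : (n1 * n2)%N.-primitive_root (qexp ((n1 * n2)%:R^-1 : C)) by apply: qexp_prim; rewrite muln_gt0 p1.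
have := gauss_sum_crt 1 o1 o2 c12 pz; rewrite !mul1r !qexpX.
have -> : n2%:R * (n1 * n2)%:R^-1 = n1%:R^-1 :> C by rewrite natrM invfM mulrCA divff // mulr1.
have -> : n1%:R * (n1 * n2)%:R^-1 = n2%:R^-1 :> C by rewrite natrM invfM mulrA divff // mul1r.
rewrite (gauss_sum_unit o1 (qexp_prim R p1) (_ : coprimez n2%:Z n1%:Z)); last by rewrite coprimezE /= coprime_sym.
rewrite (gauss_sum_unit o2 (qexp_prim R p2) (_ : coprimez n1%:Z n2%:Z)); last by rewrite coprimezE.
rewrite -!/(gsum _ _) => E.
have c2 n : odd n -> coprimez (-2) n%:Z by move=> on; rewrite coprimezE /= coprime2n.
have g0 n : odd n -> gsum R n != 0 by exact: gsum_neq0.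
have K : gsum R (n1 * n2) = (-1) ^+ (n1./2 * n2./2) * (gsum R n1 * gsum R n2).
  rewrite !gsumE // (@jac_mulr R) // intrM !Psin_rho rhoM // half_mul // rmorphM.
  by rewrite !exprD -[(_ * _).*2]mul2n exprM sqr_i; ring.
apply: (@intr_inj C); rewrite intrM rmorphXn /= rmorphN /=.
apply: (mulIf (mulf_neq0 (g0 n1 o1) (g0 n2 o2))); rewrite -K E; ring.
Qed.

(** * Identification with the Kronecker symbols and the constant C(d, N) *)

Lemma kronecker_prime_jac (a : int) p : prime p -> odd p -> kronecker_prime a p = jac a p.
Proof.
move=> pp op; rewrite /kronecker_prime; case: eqP => [p2|_]; first by rewrite p2 in op.
exact: legendre_jac.
Qed.

Lemma jac_prod_primes (a : int) (s : seq nat) : uniq s -> all (fun p => prime p && odd p) s ->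
  jac a (\prod_(p <- s) p)%N = \prod_(p <- s) jac a p.
Proof.
elim: s => [|p s IH] /=; first by rewrite !big_nil jaca1.
move=> /andP[ps us] /andP[/andP[pp op] al]; rewrite !big_cons.
have os : odd (\prod_(q <- s) q)%N.
  by elim: s al {IH ps us} => [|q s IHs] /=; rewrite ?big_nil // big_cons oddM => /andP[/andP[_ ->] /IHs].
have cp : coprime p (\prod_(q <- s) q)%N.
  rewrite prime_coprime //; apply: contra ps; elim: s al {IH us os} => [|q s IHs] /=.
    by rewrite big_nil dvdn1 => _ /eqP p1; rewrite p1 in pp.
  rewrite big_cons => /andP[/andP[pq _] al]; rewrite Euclid_dvdM // inE => /orP[|/IHs->//].
    by rewrite dvdn_prime2 // => ->.
  by rewrite orbT.
by rewrite (@jac_mulr R) // IH.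
Qed.

Lemma logn_squarefree n p : (0 < n)%N -> squarefree n -> p \in primes n -> logn p n = 1%N.
Proof.
move=> n0 sn pn; have := pn; rewrite -logn_gt0 => l0.
have pp : prime p by move: pn; rewrite mem_primes => /andP[].
apply/eqP; rewrite eqn_leq l0 andbT leqNgt -pfactor_dvdn //.
by apply/negP => /sn p1; rewrite p1 in pp.
Qed.

Lemma kronecker_jac (a : int) n : odd n -> squarefree n -> kronecker a n%:Z = jac a n.
Proof.
move=> on sn; have n0 : (0 < n)%N by case: n on {sn}.
have op p : p \in primes n -> prime p && odd p.
  rewrite mem_primes => /and3P[-> _ /dvdnP[m hm]] /=.
  by move: on; rewrite hm oddM => /andP[].
have nE : (\prod_(p <- primes n) p = n)%N.
  rewrite [RHS]prod_prime_decomp // prime_decompE big_map big_seq [RHS]big_seq.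
  by apply: eq_bigr => p pn; rewrite /= logn_squarefree // expn1.
rewrite /kronecker eqz_nat eqn0Ngt n0 /= mul1r -[in RHS]nE jac_prod_primes ?primes_uniq //; last first.
  by apply/allP => p /op.
rewrite big_seq [RHS]big_seq; apply: eq_bigr => p pn; rewrite logn_squarefree // expr1.
by have /andP[pp opp] := op p pn; rewrite kronecker_prime_jac.
Qed.

Lemma jac_prod_nat n (s : seq nat) (e : nat -> nat) : odd n ->
  jac (\prod_(p <- s) p ^ e p)%N%:Z n = \prod_(p <- s) jac p%:Z n ^+ e p.
Proof.
move=> on; elim: s => [|p s IH]; first by rewrite !big_nil jac1n.
rewrite !big_cons PoszM jacM // IH; congr (_ * _).
by elim: (e p) => [|m IHm]; rewrite ?expn0 ?jac1n // expnS PoszM jacM // IHm exprS.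
Qed.

Lemma kronecker_prime_recip n p : odd n -> squarefree n -> prime p ->
  kronecker_prime ((-1) ^+ n./2 * n%:Z) p = jac p%:Z n.
Proof.
move=> on sn pp; have nE := odd_half on; have [p2|p2] := eqVneq p 2%N.
  (* At p = 2 both sides depend only on n modulo 8, that is on n./2 modulo 4. *)
  rewrite p2 /kronecker_prime eqxx jac2 //.
  have s2 m : (-1) ^+ m = if odd m then -1 else 1 :> int by rewrite -signr_odd; case: (odd m).
  rewrite !s2; set m := n./2 in nE *.
  have hm : (m = (m %/ 4) * 4 + m %% 4)%N by exact: divn_eq.
  have lm : (m %% 4 < 4)%N by rewrite ltn_mod.
  rewrite nE; move: (m %/ 4)%N (m %% 4)%N hm lm => q r -> {nE sn on}.
  have q0 : odd (q * 4) = false by lia.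
  have u4 r' : odd (uphalf (q * 4 + r')) = odd (uphalf r') by clear; lia.
  rewrite u4 oddD q0 /=; case: r => [|[|[|[|//]]]] _ /=; rewrite ?mul1r ?mulN1r;
    by case: ifP => [|_]; [lia | case: ifP => //; lia].
have op : odd p by case: (even_prime pp) => // e; rewrite e eqxx in p2.
rewrite kronecker_prime_jac // jacM //.
have jX m : jac ((-1) ^+ m) p = (-1) ^+ (p./2 * m).
  by elim: m => [|m IH]; rewrite ?muln0 ?jac1n // exprS jacM // IH jacN1 // mulnS exprD.
rewrite jX; have [cpn|ncp] := boolP (coprime p n).
  have := jac_reciprocity op on cpn; have cn : coprimez n%:Z p%:Z by rewrite coprimezE /= coprime_sym.
  by move=> E; rewrite -E -mulrA -expr2 jac_sqr // mulr1.
rewrite (@jac_eq0 p%:Z n) // (@jac_eq0 n%:Z p) ?mulr0 //; rewrite coprimezE /= // coprime_sym //.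
Qed.

(** The character [chi] has n above and b below; reciprocity at each prime of b, with 2 included,
    exchanges them. For b < 0 the factor at the unit -1 is (-1/n), because the sign of the
    discriminant is (-1)^((n-1)/2). *)
Lemma chi_jac n (b : int) : odd n -> squarefree n -> chi n b = jac b n.
Proof.
move=> on sn; have n0 : (0 < n)%N by case: n on {sn}.
have nh : n.-1./2 = n./2 by rewrite {1}(odd_half on) /= doubleK.
rewrite /chi nh /kronecker abszM abszX /= exp1n mul1n.
have [->|b0] := eqVneq b 0.
  have [n1|n1] := ltnP 1 n; first by rewrite jac0n // gtn_eqF.
  have -> : n = 1%N by move: n0 n1; lia.
  by rewrite jaca1.
have ba : (0 < `|b|)%N by rewrite absz_gt0.
have -> : \prod_(p <- primes `|b|) kronecker_prime ((-1) ^+ n./2 * n%:Z) p ^+ logn p `|b| = jac `|b|%N%:Z n.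
  rewrite [in RHS](prod_prime_decomp ba) prime_decompE big_map /= (jac_prod_nat _ (fun p => logn p `|b|)) //.
  rewrite big_seq [RHS]big_seq; apply: eq_bigr => p; rewrite mem_primes => /andP[pp _].
  by rewrite kronecker_prime_recip.
have sg : ((-1) ^+ n./2 * n%:Z < 0) = odd n./2.
  by rewrite -signr_odd; case: (odd _); rewrite ?expr1 ?expr0 ?mulN1r ?mul1r; lia.
rewrite sg; have [bn|bp] := ltP b 0.
  have bE : b = -1 * `|b|%N%:Z by lia.
  rewrite [in RHS]bE jacM // jacN1 // -signr_odd /=; by case: (odd _).
have bE : b = `|b|%N%:Z by lia.
by rewrite mul1r [in RHS]bE.
Qed.

Lemma C_coefE d D : odd d -> odd D -> squarefree (d * D) ->
  C_coef R d (d * D) = ((-1) ^+ (D./2 * d./2.+1) * jac 2 D)%:~R.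
Proof.
move=> od oD sN; have dE := odd_half od; have DE := odd_half oD.
have d0 : (0 < d)%N by case: d od {sN dE}.
rewrite /C_coef /A_coef mulKn // jac2 //.
set a := d./2 in dE *; set b := D./2 in DE *.
have -> : ((d + 1) * (D - 1) %/ 4 = a.+1 * b)%N.
  have E : ((d + 1) * (D - 1) = a.+1 * b * 4)%N by rewrite dE DE subn1 /=; nia.
  by rewrite E mulnK.
(* With d = 2a + 1 and D = 2b + 1, d^2 D = (1 + 4a(a+1))(2b + 1). The second summand is a multiple
   of 4, so only i^-b remains. *)
have e1 : ((1 - (d * D * d)%N%:Z) %/ 2)%Z = - (b + (2 * (a * a.+1) * (2 * b + 1))%N)%N%:Z.
  have -> : 1 - (d * D * d)%N%:Z = - (b + (2 * (a * a.+1) * (2 * b + 1))%N)%N%:Z * 2 by rewrite dE DE; lia.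
  by rewrite mulzK.
rewrite e1 -exprnN exprD.
have aa : ('i%C : C) ^+ (2 * (a * a.+1) * (2 * b + 1)) = 1.
  rewrite -mulnA exprM sqr_i -signr_odd !oddM /=.
  by case: (odd a).
rewrite aa mulr1 invfM [in RHS]mulnC; rewrite intrM !rmorphXn /= !rmorphN /= mulrC invr_sign -mulrA; congr (_ * _).
(* The remaining quantities i^b, epsilon_D and (2/D) = (-1)^(uphalf b) depend only on b modulo 4. *)
have bE := divn_eq b 4; set q := (b %/ 4)%N in bE; have lb : (b %% 4 < 4)%N by rewrite ltn_mod.
have i4 m : ('i%C : C) ^+ (q * 4 + m) = 'i%C ^+ m by rewrite exprD mulnC exprM -[4%N]/(2 * 2)%N exprM sqr_i sqrrN expr1n expr1n mul1r.
have Dm : (D %% 4 = (b.*2.+1) %% 4)%N by rewrite DE.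
rewrite /epsilon {}Dm bE i4; move: (b %% 4)%N lb => r; have i0 : 'i%C != 0 :> C by exact: neq0Ci.
have ii : 'i%C * 'i%C = -1 :> C by rewrite -expr2 sqr_i.
have u8 m : ((-1) ^+ uphalf (q * 4 + m) = (-1) ^+ uphalf m :> C).
  by rewrite -signr_odd -[RHS]signr_odd; congr (_ ^+ nat_of_bool _); lia.
have D4 m : ((q * 4 + m).*2.+1 %% 4 = m.*2.+1 %% 4)%N by lia.
rewrite u8 D4; case: r => [|[|[|[|//]]]] _.
- by rewrite (_ : uphalf 0 = 0)%N // !expr0 /= invr1 mulr1.
- by rewrite (_ : uphalf 1 = 1)%N // !expr1 /= -invfM ii invrN1.
- by rewrite (_ : uphalf 2 = 1)%N // !expr1 sqr_i /= invr1 invrN1 mul1r.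
rewrite (_ : uphalf 3 = 2)%N // sqrrN expr1n exprS sqr_i /= -invfM.
by rewrite mulrA ii mulrN1 opprK invr1.
Qed.

End GaussSigns.

(** * The cusp form *)

Section Difference.
Variable R : realType.
Local Notation C := R[i].

Lemma admissible_wact h k (w : int -> int -> C) (a b c e : int) : a * e - b * c = 1 ->
  admissible h k w -> admissible h k (wact w a b c e).
Proof.
move=> hd hw; move: a b c e hd w hw.
have step (w w' : int -> int -> C) : (forall m n, w m n = w' m n) -> w = w'.
  by move=> E; apply/funext => m; apply/funext.
apply: (@SL2_ind (fun a b c e => forall w, admissible h k w -> admissible h k (wact w a b c e))).
- move=> w hw; have -> // : wact w 1 0 0 1 = w by apply: step => m n; rewrite /wact; congr w; ring.
- move=> a b c e hd IH w hw; have := IH _ (admissible_T 1 hw); congr (admissible h k _).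
  by apply: step => m n; rewrite wact_comp; congr (wact w _ _ _ _ _ _); ring.
- move=> a b c e hd IH w hw; have := IH _ (admissible_T (-1) hw); congr (admissible h k _).
  by apply: step => m n; rewrite wact_comp; congr (wact w _ _ _ _ _ _); ring.
move=> a b c e hd IH w hw; have := IH _ (admissible_S hw); congr (admissible h k _).
by apply: step => m n; rewrite wact_comp; congr (wact w _ _ _ _ _ _); ring.
Qed.

Variables (d D : nat).
Hypotheses (od : odd d) (oD : odd D) (d3 : ~~ (3 %| d)%N) (D3 : ~~ (3 %| D)%N).
Hypotheses (sN : squarefree (d * D)) (N4 : (4 < d * D)%N).
Local Notation k := (d * D)./2.
Local Notation wgt := (@wgt R d D).
Local Notation Lval := (Lval R d D).

Let cdD : coprime d D. Proof. exact: squarefree_coprime. Qed.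
Let oN : odd (d * D). Proof. by rewrite oddM od oD. Qed.
Let NE : k.*2.+1 = (d * D)%N. Proof. by rewrite -odd_half. Qed.
Let k2 : (2 <= k)%N. Proof. by have := NE; have := N4; move: (d * D)%N => n; lia. Qed.
Let d0 : (0 < d)%N. Proof. by case: d od. Qed.
Let D0 : (0 < D)%N. Proof. by case: D oD. Qed.
Let DR : D%:R != 0 :> C. Proof. by rewrite pnatr_eq0 -lt0n. Qed.
Let dR : d%:R != 0 :> C. Proof. by rewrite pnatr_eq0 -lt0n. Qed.
Let P0 : Psin R D != 0. Proof. by rewrite (odd_half oD); exact: Psin_neq0. Qed.

Lemma EisZ (c : C) z : 0 < complex.Im z -> Eis k k (fun m n => c * wgt m n) z = c * Eis k k wgt z.
Proof.
move=> hz; have [W hW] := adm_bnd (admissible_wgt R od oD sN N4).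
have e1 : Lsum k (fun n => c * wgt 0 n) = c * Lsum k (wgt 0).
  apply: cvC_lim; apply: eq_cvC (cvCMl c (Lsum_cvC k2 (hW 0))) => K.
  by rewrite -ssumZ; apply: eq_ssum => n; rewrite mulrA.
have [B _ hB] := Eis_tail_spec k k hz; have [H _] := hB wgt W z hW (lexx _).
have e2 : Eis_tail k k (fun m n => c * wgt m n) z = c * Eis_tail k k wgt z.
  apply: cvC_lim; apply: eq_cvC (cvCMl c H) => M.
  by rewrite mulr_sumr; apply: eq_bigr => m _; rewrite (@rowsumZ R d D).
by rewrite /Eis e1 e2; ring.
Qed.

Lemma LvalE : Lval = (d * D)%:R ^- k * lip_const R k *
  (gsum R (d * D) * - (gen_bernoulli C (d * D) (chi (d * D)) k / k%:R)).
Proof.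
have N1 : (1 < k.*2.+1)%N by move: k2; lia.
have sq : squarefree k.*2.+1 by rewrite NE.
have -> : chi (d * D) = fun b => jac b (d * D) by apply/funext => b; exact: chi_jac.
by have := @Lsum_jacE R k k k2 N1 sq; rewrite NE.
Qed.

Lemma Lval_neq0 : Lval != 0.
Proof.
have N1 : (1 < k.*2.+1)%N by move: k2; lia.
have h := @Lsum_jac_neq0 R k k k2 N1; rewrite NE in h; apply: h.
by rewrite jacN1.
Qed.

(** The limit of the quotient at a cusp divided by that of the Eisenstein series: the symbols of a
    and c cancel, and what remains of (Da/d) is (D/d), the same at all cusps. *)
Definition eis_ratio : C :=
  (jac D%:Z d)%:~R * ((-1) ^+ D./2 / (D%:R ^+ k * Psin R D)) / Lval.

Lemma eis_ratio_coef : eis_ratio * (2 * (d%:R ^- k * lip_const R k * gsum R d)) =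
  (kronecker D%:Z d%:Z)%:~R * C_coef R d (d * D) * (d%:R / (d * D)%:R) *
    ((1 - (d * D)%:R) / gen_bernoulli C (d * D) (chi (d * D)) k).
Proof.
have sd : squarefree d by apply: squarefree_dvd sN; exact: dvdn_mulr.
rewrite kronecker_jac // C_coefE // -gsum_level // /eis_ratio.
have := Lval_neq0; rewrite LvalE => L0.
(* This trades the sign for the ratio of Gauss sums of [gsum_level], so that C(d, N) appears without
   separating cases. *)
have PD : (-1) ^+ D./2 = Psin R D ^+ 2 / D%:R.
  by have := Psin_sqr R D./2; rewrite -(odd_half oD) => ->; rewrite mulfK.
(* The factor 1 - N collects the 2 of the Eisenstein series and the -k of -B_k/k. *)
have -> : 1 - (d * D)%:R = - (2 * k%:R) :> C.
  by rewrite -{1}NE -addn1 natrD -mul2n natrM; ring.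
rewrite PD.
have B0 : gen_bernoulli C (d * D) (chi (d * D)) k != 0.
  by apply: contraNneq L0 => ->; rewrite mul0r oppr0 !mulr0.
have l0 := lip_const_neq0 R d D; have g0 := gsum_neq0 R oN.
have k0 : k%:R != 0 :> C by rewrite pnatr_eq0; move: k2; lia.
have Dk : D%:R ^+ k != 0 :> C by rewrite expf_neq0.
have dk : d%:R ^+ k != 0 :> C by rewrite expf_neq0.
rewrite natrM exprMn; move: l0 g0 k0 B0 Dk dk P0 DR dR.
move: (lip_const R k) (gsum R (d * D)) (k%:R : C) (gen_bernoulli C _ _ _) (D%:R ^+ k : C) (d%:R ^+ k : C)
  (Psin R D) (D%:R : C) (d%:R : C) ((jac D%:Z d)%:~R : C) (gsum R d).
move=> x1 x2 x3 x4 x5 x6 x7 x8 x9 x10 x11 h1 h2 h3 h4 h5 h6 h7 h8 h9; field.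
by rewrite h1 h2 h3 h4 h5 h6 h7 h8 h9.
Qed.

Lemma eis_ratio_Eis z : 0 < complex.Im z ->
  eis_ratio * Eis k k wgt z = (chi D 0)%:~R +
    (kronecker D%:Z d%:Z)%:~R * C_coef R d (d * D) * (d%:R / (d * D)%:R) *
    ((1 - (d * D)%:R) / gen_bernoulli C (d * D) (chi (d * D)) k) *
    eisenstein_sum k.-1%:Z (chi D) (chi d) z.
Proof.
move=> hz; rewrite Eis_wgt // -eis_ratio_coef.
have sd : squarefree d by apply: squarefree_dvd sN; exact: dvdn_mulr.
have sD : squarefree D by apply: squarefree_dvd sN; exact: dvdn_mull.
have -> : chi D = fun b => jac b D by apply/funext => b; exact: chi_jac.
have -> : chi d = fun b => jac b d by apply/funext => b; exact: chi_jac.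
have e0 : eis_ratio * ((jac 0 D)%:~R * Lval) = (jac 0 D)%:~R.
  have [D1|D1] := ltnP 1 D; first by rewrite jac0n // mul0r mulr0.
  have DE : D = 1%N by move: D0 D1; lia.
  rewrite /eis_ratio mulrCA divfK ?Lval_neq0 // DE jac1n //.
  by rewrite (_ : 1./2 = 0)%N // /Psin big_ord0 expr1n expr0 mulr1 divr1 mulr1 mulr1.
by rewrite mulrDr e0; congr (_ + _); ring.
Qed.

Definition eta_diff (z : C) : C := @equot R d D z - eis_ratio * Eis k k wgt z.

(** Both parts have the multiplier (e/d)(a/D). As a and e are inverse to each other modulo D, it
    equals (e/dD). *)
Lemma eta_diff_Gamma0 (a b c e : int) z : 0 < complex.Im z -> a * e - b * c = 1 ->
  ((d * D)%:Z %| c)%Z ->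
  eta_diff (mob a b c e z) = (jac e (d * D))%:~R * aut c e z ^+ k * eta_diff z.
Proof.
move=> hz hd hc; have hw := admissible_wgt R od oD sN N4.
rewrite /eta_diff equot_Gamma0 // Eis_mob // wgt_Gamma0 // EisZ //.
have -> : jac e (d * D) = jac e d * jac a D.
  rewrite (@jac_mulr R) //; congr (_ * _).
  have Dc : (D%:Z %| c)%Z by apply: dvdz_trans hc; rewrite PoszM dvdz_mull.
  have ce : coprimez e D%:Z.
    have [c' hc'] := dvdzP Dc; apply/coprimezP; exists (a, - b * c') => /=.
    by rewrite -hd hc'; ring.
  have ca : coprimez a D%:Z.
    have [c' hc'] := dvdzP Dc; apply/coprimezP; exists (e, - b * c') => /=.
    by rewrite -hd hc'; ring.
  have E : jac a D * jac e D = 1.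
    rewrite -jacM // -[RHS](jac1n oD); apply: eq_jac => //.
    have -> : a * e - 1 = b * c by rewrite -hd; ring.
    by rewrite dvdz_mull.
  have S := jac_sqr oD ca; rewrite expr2 in S.
  by rewrite -[LHS]mul1r -S -mulrA E mulr1.
move: (equot d D z) (Eis k k wgt z) => x y; ring.
Qed.

Lemma eta_diff_cusp (a b c e : int) : a * e - b * c = 1 ->
  cvI (fun z => aut c e z ^- k * eta_diff (mob a b c e z)) 0.
Proof.
move=> hd; have hw := admissible_wgt R od oD sN N4.
have h1 := @equot_cusp R _ _ od oD d3 D3 _ _ _ _ hd.
have h2 := Eis_cusp (admissible_wact hd hw); rewrite wgt_cusp // in h2.
have := cvID h1 (cvIN (cvIMl eis_ratio h2)).
have -> : ((d%:Z %| c)%Z : nat)%:R * (jac (D%:Z * a) d * jac (- (d%:Z * c)) D)%:~R *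
     ((-1) ^+ D./2 / (D%:R ^+ k * Psin R D)) -
   eis_ratio * (((d%:Z %| c)%Z : nat)%:R * ((jac (- (d%:Z * c)) D)%:~R * (jac a d)%:~R) * Lval) = 0 :> C.
  rewrite /eis_ratio jacM // !intrM; have := Lval_neq0.
  move: Lval ((-1) ^+ D./2 / (D%:R ^+ k * Psin R D) : C) => L x L0.
  by apply/eqP; rewrite subr_eq0; apply/eqP; field.
apply: eq_cvI => z hz; rewrite /eta_diff Eis_mob //.
have a0 : aut c e z ^+ k != 0 by rewrite expf_neq0 // (aut_neq0 hd hz).
by rewrite mulrBr [aut c e z ^- k * (eis_ratio * _)]mulrCA mulKf.
Qed.

Lemma hol_equot z : 0 < complex.Im z -> hol (@equot R d D) z.
Proof.
move=> hz; have hI n : (0 < n)%N -> 0 < complex.Im (n%:R * z) by move=> n0; rewrite Im_natr_mul mulr_gt0 // ltr0n.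
apply: holM; first by apply: holX; apply: (hol_comp (hol_lin _ _)); apply: hol_eta; exact: hI.
apply: (@hol_comp R (fun x => dedekind_eta (d%:R * x)) (fun x => x^-1)).
  by apply: (hol_comp (hol_lin _ _)); apply: hol_eta; exact: hI.
by apply: hol_inv; apply: eta_neq0; exact: hI.
Qed.

End Difference.

(** * From integer entries back to matrices, and the level 1 case *)

Lemma det_mx22 (g : 'M[int]_2) : \det g = g 0 0 * g 1 1 - g 0 1 * g 1 0.
Proof.
rewrite (expand_det_row _ 0) !big_ord_recl big_ord0 /cofactor !det_mx11 !mxE /= addr0.
have -> : lift 0 0 = 1 :> 'I_2 by apply/val_inj.
have -> : lift 1 0 = 0 :> 'I_2 by apply/val_inj.
by rewrite expr0 expr1; ring.
Qed.

Lemma cusp_form0 (R : realType) k N psi : cusp_form k N psi (fun=> 0 : R[i]).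
Proof.
split.
- by move=> z hz; exact: derivable_cst.
- by move=> g hg z hz; rewrite mulr0.
by move=> g hg e e0; exists 0 => z _ _; rewrite /slash mulr0 normr0 lecR ltW.
Qed.

Lemma eta_quotient_level1 (R : realType) (z : R[i]) : 0 < complex.Im z ->
  dedekind_eta (1 * z) ^+ 1 / dedekind_eta (1 * z) = 1.
Proof. by move=> hz; rewrite mul1r expr1 divff // eta_neq0. Qed.

Lemma eta_quotient_cusp_form (R : realType) (d D : nat) :
  odd d -> odd D -> ~~ (3 %| d)%N -> ~~ (3 %| D)%N -> squarefree (d * D) -> (4 < d * D)%N ->
  let k := (d * D)./2 in
  cusp_form k (d * D) (chi (d * D)) (fun z : R[i] =>
    dedekind_eta (D%:R * z) ^+ (d * D) / dedekind_eta (d%:R * z) -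
    ((chi D 0)%:~R + (kronecker D%:Z d%:Z)%:~R * C_coef R d (d * D) * (d%:R / (d * D)%:R) *
      ((1 - (d * D)%:R) / gen_bernoulli R[i] (d * D) (chi (d * D)) k) *
      eisenstein_sum k.-1%:Z (chi D) (chi d) z)).
Proof.
move=> od oD d3 D3 sN N4 k; set F := fun z : R[i] => _.
have FE z : 0 < complex.Im z -> F z = @eta_diff R d D z.
  by move=> hz; rewrite /F /eta_diff eis_ratio_Eis.
have sd : squarefree d by apply: squarefree_dvd sN; exact: dvdn_mulr.
have sD : squarefree D by apply: squarefree_dvd sN; exact: dvdn_mull.
have oN : odd (d * D) by rewrite oddM od oD.
split.
- move=> z hz; have [l hl] : hol F z; last exact: sder_derivable hl.
  apply: (holD (hol_equot od oD hz)).
  have bd n : odd n -> squarefree n -> forall m, nrm ((chi n m)%:~R : R[i]) <= 1.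
    by move=> on sn m; rewrite chi_jac //; exact: jac_bound.
  have H := holM (hol_cst (-1) z) (holD (hol_cst (chi D 0)%:~R z)
    (holM (hol_cst ((kronecker D%:Z d%:Z)%:~R * C_coef R d (d * D) * (d%:R / (d * D)%:R) *
      ((1 - (d * D)%:R) / gen_bernoulli R[i] (d * D) (chi (d * D)) k)) z)
      (hol_eisenstein k.-1 hz (bd D oD sD) (bd d od sd)))).
  by apply: (eq_hol ltr01) H => h _; rewrite mulN1r.
- move=> g [gdet gN] z hz; rewrite /SL2Z /= det_mx22 in gdet.
  have hm := Im_mob_gt0 gdet hz; rewrite /moebius -/(mob _ _ _ _ _) !FE //.
  by rewrite (@chi_jac R) //; exact: eta_diff_Gamma0.
move=> g gdet e e0; rewrite /SL2Z /= det_mx22 in gdet.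
have [A hA] := @eta_diff_cusp R _ _ od oD d3 D3 sN N4 _ _ _ _ gdet e e0; exists A => z hz zA.
have := hA z hz zA; rewrite subr0 -lecR -normCE.
by have hm := Im_mob_gt0 gdet hz; rewrite /slash /moebius -/(mob _ _ _ _ _) FE.
Qed.

(** Square factors drop out of 8, -8 and -4, which leaves (2/D), since (2/d) occurs twice, and a
    power of -1 to be compared by parity. *)
Lemma C_coef_kronecker (R : realType) (d D : nat) : odd d -> odd D -> squarefree (d * D) ->
  C_coef R d (d * D) = (kronecker (-8) (d * D)%:Z * kronecker 8 d%:Z *
    kronecker (-4) d%:Z ^+ (d * D)./2)%:~R.
Proof.
move=> od oD sN; have oN : odd (d * D) by rewrite oddM od oD.
have sd : squarefree d by apply: squarefree_dvd sN; exact: dvdn_mulr.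
rewrite C_coefE // !(@kronecker_jac R) //; congr (_%:~R).
have cu n : odd n -> coprimez 2 n%:Z by move=> on; rewrite coprimezE /= coprime2n.
have j8 n : odd n -> jac 8 n = jac 2 n.
  move=> on; rewrite (_ : (8 : int) = 2 * (2 * 2)) // jacM // [jac (_ * _) _]jacM //.
  by rewrite -expr2 jac_sqr ?cu // mulr1.
have j4 n : odd n -> jac (-4) n = (-1) ^+ n./2.
  move=> on; rewrite (_ : (-4 : int) = -1 * (2 * 2)) // jacM // [jac (_ * _) _]jacM //.
  by rewrite -expr2 jac_sqr ?cu // mulr1 jacN1.
rewrite (_ : (-8 : int) = -1 * 8) // jacM // jacN1 // !j8 // j4 //.
rewrite (@jac_mulr R) //; last exact: squarefree_coprime.
have := jac_sqr od (cu d od); rewrite expr2 => E.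
rewrite -mulrA [in RHS]mulrAC; rewrite half_mul // -exprM !exprD.
have dd : (-1) ^+ (d./2 * (d./2 + D./2 + (d./2 * D./2).*2)) = (-1) ^+ (d./2 + d./2 * D./2) :> int.
  by rewrite -signr_odd -[RHS]signr_odd; congr (_ ^+ nat_of_bool _); rewrite !(oddM, oddD, odd_double); case: (odd d./2); case: (odd D./2).
rewrite dd; have dd2 : (-1) ^+ (d./2 * D./2).*2 = 1 :> int by rewrite -signr_odd odd_double.
rewrite dd2 mulr1 mulnSr !exprD.
have s2 : (-1) ^+ d./2 * (-1) ^+ d./2 = 1 :> int by rewrite -expr2 sqrr_sign.
rewrite [(D./2 * _)%N]mulnC.
transitivity ((-1) ^+ (d./2 * D./2) * (-1) ^+ D./2 * jac 2 D * (jac 2 d * jac 2 d) * ((-1) ^+ d./2 * (-1) ^+ d./2)).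
  by rewrite E s2 !mulr1.
ring.
Qed.

Theorem theorem5p1 (R : realType) (N d : nat)
    (N_gt0 : (0 < N)%N) (N_sqfree : squarefree N) (N_coprime6 : coprime N 6)
    (d_dvd_N : (d %| N)%N) :
  (exists C1 : R[i] -> R[i],
     cusp_form (N.-1)./2 N (chi N) C1 /\
     forall z : R[i], 0 < complex.Im z ->
       dedekind_eta ((N %/ d)%N%:R * z) ^+ N / dedekind_eta (d%:R * z) =
         (chi (N %/ d) 0)%:~R +
         (kronecker (N %/ d)%N%:Z d%:Z)%:~R * C_coef R d N * (d%:R / N%:R) *
           ((1 - N%:R) / gen_bernoulli R[i] N (chi N) (N.-1)./2) *
           eisenstein_sum ((N%:Z - 3) %/ 2)%Z (chi (N %/ d)) (chi d) z +
         C1 z) /\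
  C_coef R d N =
    (kronecker (-8) N%:Z * kronecker 8 d%:Z *
       kronecker (-4) d%:Z ^+ (N.-1)./2)%:~R.
Proof.
have d0 : (0 < d)%N by exact: dvdn_gt0 d_dvd_N.
have [D NE] := dvdnP d_dvd_N; rewrite mulnC in NE; subst N.
rewrite mulKn //.
have /andP[c2 c3] : coprime (d * D) 2 && coprime (d * D) 3 by rewrite -coprimeMr.
have /andP[od oD] : odd d && odd D by rewrite -oddM -coprimen2.
have /andP[d3 D3] : ~~ (3 %| d)%N && ~~ (3 %| D)%N.
  by rewrite -!prime_coprime // -coprimeMr coprime_sym.
have oN : odd (d * D) by rewrite oddM od oD.
have kE : (d * D).-1./2 = (d * D)./2 by rewrite {1}(odd_half oN) /= doubleK.
rewrite kE; split; last exact: C_coef_kronecker.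
(* The only smaller level prime to 6 is 1. There the quotient is the constant 1, and the factor 1 -
   N = 0 removes the series whatever the Bernoulli number is. *)
have [N4|N4] := ltnP 4 (d * D).
  have H := eta_quotient_cusp_form R od oD d3 D3 N_sqfree N4.
  have -> : (((d * D)%:Z - 3) %/ 2)%Z = (d * D)./2.-1%:Z.
    by move: N4 (odd_half oN); move: (d * D)%N => n; lia.
  eexists; split; first exact: H.
  by move=> z hz; rewrite /= addrC subrK.
have N1 : (d * D = 1)%N.
  move: N4 oN c3 N_gt0; move: (d * D)%N => n; case: n => [|[|[|[|[|//]]]]] //.
have /andP[/eqP d1 /eqP D1] : (d == 1)%N && (D == 1)%N by rewrite -muln_eq1 N1.
exists (fun=> 0); split; first exact: cusp_form0.
move=> z hz; rewrite d1 D1 muln1 eta_quotient_level1 // subrr mul0r mulr0 mul0r !addr0.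
by rewrite /chi /kronecker eqxx.
Qed.
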